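(* Let $(M,g)$ be a complete Riemannian $G$-manifold, let $d$ be the natural metric on the orbit space $M/G$, and let $H$ be a closed subgroup of $G$. Then $(M/G)_{\le (H)}$ is a convex subset of the path metric space $(M/G,d)$. In particular, $(M/G)_{\mathrm{reg}}$ is a convex open dense submanifold of $M/G$.
   Context: A complete Riemannian $G$-manifold is a connected complete Riemannian manifold $(M,g)$ together with a Lie group $G$ of isometries acting properly on $M$. Let $\pi:M\to M/G$ be the projection. For two orbits $\bar p,\bar q\in M/G$, $d(\bar p,\bar q)$ is the minimum of the lengths of all curves in $M$ connecting the orbits $\bar p$ and $\bar q$. The space $(M/G,d)$ is a path metric space (any two points are joined by a curve whose length equals their distance). A minimal geodesic segment in a metric space is a curve connecting two points whose length equals the distance between them. A subset $N$ of a path metric space $(X,d)$ is called convex if any minimal geodesic segment in $X$ between two points of $N$ lies in $N$. For a closed subgroup $H\subset G$, $(H)$ denotes its conjugacy class; write $(H_1)\le (H_2)$ if $H_1$ is conjugate in $G$ to a subgroup of $H_2$. The orbit type of an orbit $G.x$ is $(G_x)$, where $G_x$ is the isotropy group of $x$. $(M/G)_{\le (H)}$ is the set of orbits whose orbit type $(G_x)$ satisfies $(G_x)\le (H)$, and $(M/G)_{(H)}$ is the set of orbits of orbit type exactly $(H)$. There is a unique minimal orbit type $(K)$ (known fact), and $(M/G)_{\mathrm{reg}}:=(M/G)_{(K)}=(M/G)_{\le(K)}$. The smooth structure on $(M/G)_{(K)}=M_{(K)}/G$, where $M_{(K)}=\{x\in M: G_x\in (K)\}$, is the one for which $\pi:M_{(K)}\to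 (M/G)_{(K)}$ is a smooth fiber bundle. *)

(* Defs.v *)
From HB Require Import structures.
From mathcomp Require Import all_boot all_order all_algebra.
From mathcomp Require Import all_classical all_reals all_analysis.

Set Implicit Arguments.
Unset Strict Implicit.
Unset Printing Implicit Defensive.

Import Order.TTheory GRing.Theory Num.Theory.
Import numFieldNormedType.Exports.

Local Open Scope classical_set_scope.
Local Open Scope ring_scope.
Local Open Scope quotient_scope.

(** * Smooth maps between open subsets of normed spaces *)

(* On an open U this is the usual class C^k: f is C^0, and all its directional
   derivatives exist on U and are C^(k-1). *)
Fixpoint Ck {R : realType} {V W : normedModType R} (k : nat) (U : set V)
    (f : V -> W) : Prop :=
  (forall x, U x -> {for x, continuous f}) /\
  if k is k'.+1 then
    forall v : V, (forall x, U x -> derivable f x v) /\ Ck k' U ('D_v f)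
  else True.

Definition smooth_on {R : realType} {V W : normedModType R} (U : set V)
    (f : V -> W) : Prop :=
  forall k, Ck k U f.

(** * Smooth manifolds *)

(* Raw data of a chart: [cdom] is its domain, [cto] the coordinate map (only
   relevant on [cdom]) and [cinv] its inverse (only relevant on the image
   [cto @` cdom]). *)
Record chart (R : realType) (T : topologicalType) (n : nat) := Chart {
  cdom : set T ;
  cto : T -> 'rV[R]_n ;
  cinv : 'rV[R]_n -> T }.

Definition is_chart {R : realType} {T : topologicalType} {n : nat}
    (c : chart R T n) : Prop :=
  [/\ open (cdom c),
      open (cto c @` cdom c),
      forall x, cdom c x -> cinv c (cto c x) = x,
      forall x, cdom c x -> {for x, continuous (cto c)} &
      forall x, cdom c x -> {for cto c x, continuous (cinv c)}].

(* [A] is a smooth atlas on the open subset [S] of [T]. *)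
Definition atlas_on {R : realType} {T : topologicalType} {n : nat}
    (S : set T) (A : set (chart R T n)) : Prop :=
  [/\ open S,
      forall c, A c -> is_chart c,
      \bigcup_(c in A) cdom c = S &
      forall c c', A c -> A c' ->
        smooth_on (cto c @` (cdom c `&` cdom c')) (cto c' \o cinv c)].

(* [A] makes the open subset [S] of [T], with the topology induced by [T], an
   [n]-dimensional smooth manifold; [S] is coerced to the subspace type. *)
Definition manifold_on {R : realType} {T : topologicalType} {n : nat}
    (S : set T) (A : set (chart R T n)) : Prop :=
  [/\ hausdorff_space S, @second_countable S & atlas_on S A].

Definition prod_chart {R : realType} {T T' : topologicalType} {n n' : nat}
    (c : chart R T n) (c' : chart R T' n') : chart R (T * T')%type (n + n') :=
  {| cdom := cdom c `*` cdom c' ;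
     cto := fun p => row_mx (cto c p.1) (cto c' p.2) ;
     cinv := fun v => (cinv c (lsubmx v), cinv c' (rsubmx v)) |}.

Definition prod_atlas {R : realType} {T T' : topologicalType} {n n' : nat}
    (A : set (chart R T n)) (A' : set (chart R T' n')) :
    set (chart R (T * T')%type (n + n')) :=
  [set prod_chart c c' | c in A & c' in A'].

(* Smoothness of the restriction of [f] to the open set [W]. *)
Definition smooth_map {R : realType} {T T' : topologicalType} {n n' : nat}
    (A : set (chart R T n)) (W : set T) (A' : set (chart R T' n'))
    (f : T -> T') : Prop :=
  (forall x, W x -> {for x, continuous f}) /\
  forall c c', A c -> A' c' ->
    smooth_on (cto c @` (cdom c `&` W `&` f @^-1` cdom c'))
              (cto c' \o f \o cinv c).

(* The restriction [p @^-1` S -> S] of [p] is a smooth locally trivial fibre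
   bundle whose typical fibre F is a smooth manifold. Over U, the maps
   [x |-> (p x, phi x)] and [psi] are mutually inverse diffeomorphisms between
   [p @^-1` U] and [U * F]. *)
Definition smooth_fiber_bundle {R : realType} {E B : topologicalType}
    {n k : nat} (AE : set (chart R E n)) (AB : set (chart R B k)) (S : set B)
    (p : E -> B) : Prop :=
  smooth_map AE (p @^-1` S) AB p /\
  exists (f : nat) (F : topologicalType) (AF : set (chart R F f)),
    manifold_on [set: F] AF /\
    forall b, S b -> exists (U : set B) (phi : E -> F) (psi : B * F -> E),
      [/\ [/\ open U, U b & U `<=` S],
          smooth_map AE (p @^-1` U) AF phi,
          smooth_map (prod_atlas AB AF) (U `*` [set: F]) AE psi,
          forall x, U (p x) -> psi (p x, phi x) = x &
          forall u y, U u -> p (psi (u, y)) = u /\ phi (psi (u, y)) = y].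

(** * Riemannian metrics *)

(* [g c x] is the Gram matrix at [x] of the metric in the coordinates [c]. *)
Definition gram (R : realType) (T : topologicalType) (n : nat) :=
  chart R T n -> T -> 'M[R]_n.

Definition inner {R : realType} {n : nat} (G : 'M[R]_n) (v w : 'rV[R]_n) : R :=
  (v *m G *m w^T) 0 0.

(* g_(f x) (df_x v) (df_x w) = g_x v w, expressed in coordinates. *)
Definition preserves_metric {R : realType} {T : topologicalType} {n : nat}
    (A : set (chart R T n)) (g : gram R T n) (f : T -> T) : Prop :=
  forall c c' x v w, A c -> A c' -> cdom c x -> cdom c' (f x) ->
    let F := cto c' \o f \o cinv c in
    inner (g c' (f x)) ('D_v F (cto c x)) ('D_w F (cto c x)) =
    inner (g c x) v w.

(* For [f = idfun], [preserves_metric] is the transformation law of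
   (0,2)-tensors under changes of coordinates. *)
Definition riemannian_metric {R : realType} {T : topologicalType} {n : nat}
    (A : set (chart R T n)) (g : gram R T n) : Prop :=
  [/\ forall c x, A c -> cdom c x -> (g c x)^T = g c x,
      forall c x v, A c -> cdom c x -> v != 0 -> 0 < inner (g c x) v v,
      forall c, A c -> smooth_on (cto c @` cdom c) (g c \o cinv c) &
      preserves_metric A g idfun].

Definition C1_at {R : realType} {T : topologicalType} {n : nat}
    (A : set (chart R T n)) (gamma : R -> T) (t : R) : Prop :=
  {for t, continuous gamma} /\
  forall c, A c -> cdom c (gamma t) ->
    (\forall u \near t, derivable (cto c \o gamma) u 1) /\
    {for t, continuous (derive1 (cto c \o gamma))}.

(* On each closed piece, [gamma] extends to a curve that is C^1 near it. *)
Definition piecewise_C1 {R : realType} {T : topologicalType} {n : nat}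
    (A : set (chart R T n)) (a b : R) (gamma : R -> T) : Prop :=
  exists2 s : seq R, itv_partition a b s &
    forall i, (i < size s)%N -> exists sigma : R -> T,
      forall t, t \in `[nth a (a :: s) i, nth a s i] ->
        C1_at A sigma t /\ gamma t = sigma t.

(* Norm of the velocity; for a Riemannian metric it does not depend on the
   chart, wherever gamma is differentiable. *)
Definition speed {R : realType} {T : topologicalType} {n : nat}
    (A : set (chart R T n)) (g : gram R T n) (gamma : R -> T) (t : R) : R :=
  xget 0 [set r | exists c, [/\ A c, cdom c (gamma t) &
    let v := derive1 (cto c \o gamma) t in
    r = Num.sqrt (inner (g c (gamma t)) v v)]].

Definition curve_length {R : realType} {T : topologicalType} {n : nat}
    (A : set (chart R T n)) (g : gram R T n) (a b : R) (gamma : R -> T) : R :=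
  \int[@lebesgue_measure R]_(t in `[a, b]) speed A g gamma t.

Definition set_dist {R : realType} {T : topologicalType} {n : nat}
    (A : set (chart R T n)) (g : gram R T n) (X Y : set T) : R :=
  inf [set l | exists a b gamma,
    [/\ a <= b, piecewise_C1 A a b gamma, X (gamma a), Y (gamma b) &
        l = curve_length A g a b gamma]].

Definition riemannian_dist {R : realType} {T : topologicalType} {n : nat}
    (A : set (chart R T n)) (g : gram R T n) (x y : T) : R :=
  set_dist A g [set x] [set y].

(** * Geodesics and convexity in metric spaces *)

Definition dist_complete {R : realType} {X : Type} (d : X -> X -> R) : Prop :=
  forall u : nat -> X,
    (forall e, 0 < e -> exists N, forall i j,
      (N <= i)%N -> (N <= j)%N -> d (u i) (u j) < e) ->
    exists x, (fun i => d (u i) x) @ \oo --> (0 : R).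

Definition dist_continuous {R : realType} {X : Type} (d : X -> X -> R)
    (a b : R) (gamma : R -> X) : Prop :=
  forall t, t \in `[a, b] ->
    d (gamma s) (gamma t) @[s --> within `[a, b] (nbhs t)] --> (0 : R).

Definition dist_length {R : realType} {X : Type} (d : X -> X -> R)
    (a b : R) (gamma : R -> X) : \bar R :=
  ereal_sup [set (\sum_(i < size s)
      d (gamma (nth a (a :: s) i)) (gamma (nth a s i)))%:E |
    s in itv_partition a b].

Definition minimal_geodesic {R : realType} {X : Type} (d : X -> X -> R)
    (a b : R) (gamma : R -> X) : Prop :=
  [/\ a <= b, dist_continuous d a b gamma &
      dist_length d a b gamma = (d (gamma a) (gamma b))%:E].

Definition convex_subset {R : realType} {X : Type} (d : X -> X -> R)
    (N : set X) : Prop :=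
  forall a b gamma, minimal_geodesic d a b gamma ->
    N (gamma a) -> N (gamma b) -> forall t, t \in `[a, b] -> N (gamma t).

(** * Lie groups and proper isometric actions *)

#[short(type="preTopologicalGroupType")]
HB.structure Definition PreTopologicalGroup := {G of Group G & Topological G}.

Definition lie_group {R : realType} {G : preTopologicalGroupType} {m : nat}
    (A : set (chart R G m)) : Prop :=
  [/\ manifold_on [set: G] A,
      smooth_map (prod_atlas A A) [set: G * G] A (fun p => (p.1 * p.2)%g) &
      smooth_map A [set: G] A (fun x => x^-1%g)].

Record group_action (G : groupType) (M : Type) := GroupAction {
  act_fun :> G -> M -> M ;
  act_fun1 : forall x, act_fun 1%g x = x ;
  act_funM : forall a b x, act_fun (a * b)%g x = act_fun a (act_fun b x) }.

Definition proper_action {G : preTopologicalGroupType} {M : topologicalType}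
    (act : group_action G M) : Prop :=
  forall K : set (M * M), compact K ->
    compact ((fun p : G * M => (act p.1 p.2, p.2)) @^-1` K).

Record complete_riemannian_G_manifold (R : realType) (n m : nat)
    (M : topologicalType) (G : preTopologicalGroupType)
    (AM : set (chart R M n)) (g : gram R M n) (AG : set (chart R G m))
    (act : group_action G M) : Prop := {
  GM_nonempty : [set: M] !=set0 ;
  GM_connected : connected [set: M] ;
  GM_manifold : manifold_on [set: M] AM ;
  GM_metric : riemannian_metric AM g ;
  GM_complete : dist_complete (riemannian_dist AM g) ;
  GM_lie_group : lie_group AG ;
  GM_smooth : smooth_map (prod_atlas AG AM) [set: G * M] AM
                (fun p => act p.1 p.2) ;
  GM_isometric : forall a, preserves_metric AM g (act a) ;
  GM_proper : proper_action act }.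

Definition subgroup {G : groupType} (H : set G) : Prop :=
  [/\ H 1%g, forall x y, H x -> H y -> H (x * y)%g &
      forall x, H x -> H (x^-1)%g].

(* (H1) = (H2) *)
Definition conjugate {G : groupType} (H1 H2 : set G) : Prop :=
  exists a : G, [set (h ^ a)%g | h in H1] = H2.

(* (H1) <= (H2) *)
Definition subconjugate {G : groupType} (H1 H2 : set G) : Prop :=
  exists a : G, [set (h ^ a)%g | h in H1] `<=` H2.

Definition isotropy {G : groupType} {M : Type} (act : group_action G M)
    (x : M) : set G :=
  [set a | act a x = x].

Definition minimal_orbit_type {G : groupType} {M : Type}
    (act : group_action G M) (K : set G) : Prop :=
  (exists x, conjugate (isotropy act x) K) /\
  forall x, subconjugate (isotropy act x) K -> conjugate (isotropy act x) K.

(** * The orbit space *)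

Section OrbitSpace.
Context {G : groupType} {M : topologicalType} (act : group_action G M).

Definition orbit_rel : rel M := fun x y => `[< exists a, act a x = y >].

Fact orbit_rel_refl : reflexive orbit_rel.
Proof. by move=> x; apply/asboolP; exists 1%g; rewrite act_fun1. Qed.

Fact orbit_rel_sym : symmetric orbit_rel.
Proof.
by move=> x y; apply/asboolP/asboolP => -[a <-]; exists a^-1%g;
  rewrite -act_funM mulVg act_fun1.
Qed.

Fact orbit_rel_trans : transitive orbit_rel.
Proof.
move=> y x z /asboolP[a <-] /asboolP[b <-]; apply/asboolP.
by exists (b * a)%g; rewrite act_funM.
Qed.

Definition orbit_equiv : equiv_rel M :=
  EquivRel orbit_rel orbit_rel_refl orbit_rel_sym orbit_rel_trans.

Definition orbit_space : topologicalType :=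
  quotient_topology {eq_quot orbit_equiv}.

Definition orbit_proj (x : M) : orbit_space := \pi_({eq_quot orbit_equiv}) x.

Definition orbits_le (H : set G) : set orbit_space :=
  orbit_proj @` [set x | subconjugate (isotropy act x) H].

Definition orbits_of_type (H : set G) : set orbit_space :=
  orbit_proj @` [set x | conjugate (isotropy act x) H].

Definition orbit_dist {R : realType} {n : nat} (A : set (chart R M n))
    (g : gram R M n) (p q : orbit_space) : R :=
  set_dist A g (orbit_proj @^-1` [set p]) (orbit_proj @^-1` [set q]).

End OrbitSpace.

Arguments orbit_dist {G M} act {R n} A g p q.
Arguments orbits_le {G M} act H _.
Arguments orbits_of_type {G M} act H _.

(* Main.v *)
(* Convexity.  The Riemannian distance is non-branching: near a point, d(b, .) has a
   gradient, up to a quadratic error, along minimal segments that can be prolonged, this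
   gradient is Lipschitz, and two segments following it agree by a discrete Gronwall
   estimate.  So an isometry phi that fixes the points of a minimal segment up to x and
   does not decrease the distances from its origin q to phi(p) also fixes the part
   beyond x; for a segment minimizing the distance between two orbits this says that
   interior isotropy groups lie in those of the end points.

   Regular part.  Isotropy groups at points of maximal orbit rank near x have bounded
   index in K = G_x, so a minimal one exists, and it is unique up to conjugacy since
   interior points of a segment between two orbits have smaller type than both ends.
   Near a regular x, box coordinates (v, s) |-> exp(vP) sigma(s) transverse to the orbit
   have s constant on orbits; the coordinate s gives the charts of M/G.  For the bundle
   structure, the sections k sigma, k in K, are averaged over the compact group K (the
   invariant mean being obtained by von Neumann's averages) to a section tau fixed by K,
   and (s, aK) |-> a tau(s) is a local trivialization. *)

From HB Require Import structures.
Require Import Defs.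
From mathcomp Require Import all_boot all_order all_algebra.
From mathcomp Require Import all_classical all_reals all_analysis.
From mathcomp Require Import measurable_realfun.
From mathcomp Require Import ring lra.

Set Implicit Arguments.
Unset Strict Implicit.
Unset Printing Implicit Defensive.

Import Order.TTheory GRing.Theory Num.Theory.
Import numFieldNormedType.Exports.

Local Open Scope classical_set_scope.
Local Open Scope ring_scope.

(** No geodesic equation is solved and no curve of [M/G] is lifted. Of a minimal geodesic of [M/G]
    only one interior point and the additivity of distances at it are kept; in [M] they become a
    point x and nearest points p, q of the end orbits. Minimal segments of [M] are finite sequences
    of points with additive distances, supplied by the compactness of closed balls. The gradient of
    d(b, .) is therefore known only up to an additive error that vanishes with the mesh: its upper
    bound comes from displacing the vertices of a subdivided segment, its lower bound from the
    triangle inequality with a point q further on.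

    On the regular part the obstacle is that [G_x] is known to be compact but not to be a
    submanifold, nor to act linearly near x. Infinitesimal statements are made with the matrix of
    the orbit map in a chart of G at 1, at points where its rank r is maximal over M: equality of
    kernels and constancy of the rank along orbits take the place of the closed subgroup theorem and
    of a slice theorem. Sections can be averaged only in coordinates, and K does not act linearly
    there; hence each term of the average is twisted by the linear isotropy action. *)

Section Calculus.
Context {R : realType}.
Implicit Types n p q k : nat.

(** * Directional derivatives, C^k classes and differentials in coordinates *)

Lemma is_derive_line (V W : normedModType R) (f : V -> W) (x v : V) (t : R) :
  derivable f (x + t *: v) v ->
  is_derive t 1 (fun s => f (x + s *: v)) ('D_v f (x + t *: v)).
Proof.
have E : (fun h : R => h^-1 *: (((fun s => f (x + s *: v)) \o shift t) (h *: (1:R)) -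
    f (x + t *: v))) =
  (fun h : R => h^-1 *: ((f \o shift (x + t *: v)) (h *: v) - f (x + t *: v))).
  rewrite funeqE => h; congr (_ *: (f _ - _)).
  by rewrite /= [h%:A]mulr1 scalerDl addrCA.
by move=> df; split; rewrite /derivable /derive E.
Qed.

Lemma MVT_line (V : normedModType R) (f : V -> R) (x v : V) :
  (forall t : R, 0 <= t <= 1 -> derivable f (x + t *: v) v) ->
  exists2 t : R, 0 <= t <= 1 & f (x + v) - f x = 'D_v f (x + t *: v).
Proof.
move=> df.
have [t||t + E] := @MVT_segment R (fun s => f (x + s *: v))
    (fun s => 'D_v f (x + s *: v)) 0 1 ler01.
- rewrite in_itv /= => /andP[t0 t1]; apply: is_derive_line; apply: df.
  by rewrite !ltW.
- apply: derivable_within_continuous => t; rewrite in_itv /= => t01.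
  by have [] := is_derive_line (df t t01).
- by rewrite in_itv /= => t01; exists t => //; move: E; rewrite scale1r scale0r addr0 subr0 mulr1.
Qed.

(** Only derivability along [v] is available, so linearity of a differential cannot be used; the
    one-variable slice of [f] is composed with multiplication by [a], which covers [a = 0] too. *)
Lemma deriveZdir (V : normedModType R) (f : V -> R) (x v : V) a :
  derivable f x v -> derivable f x (a *: v) /\ 'D_(a *: v) f x = a * 'D_v f x.
Proof.
move=> df; have := @is_derive_line _ _ f x v 0; rewrite scale0r addr0 => /(_ df) D.
have D2 : is_derive (0 : R) (1 : R) ((fun s => f (x + s *: v)) \o ( *%R a)) (a * 'D_v f x).
  rewrite mulrC; apply: is_derive1_comp; first by rewrite mulr0.
  have := @is_deriveM R R (cst a) id (0 : R) (1 : R) 0 1 _ _.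
  rewrite scaler0 addr0 [a%:A]mulr1 => H; apply: H.
have E : (fun h : R => h^-1 *: ((((fun s => f (x + s *: v)) \o ( *%R a)) \o shift 0) (h *: (1:R)) -
    ((fun s => f (x + s *: v)) \o ( *%R a)) 0)) =
  (fun h : R => h^-1 *: ((f \o shift x) (h *: (a *: v)) - f x)).
  rewrite funeqE => h; congr (_ *: (f _ - f _)).
    by rewrite /= [h%:A]mulr1 addr0 scalerA mulrC addrC.
  by rewrite /= mulr0 scale0r addr0.
by case: D2; rewrite /derivable /derive E.
Qed.

Lemma rV_normP n (x : 'rV[R]_n) (e : R) : 0 <= e ->
  `|x| <= e <-> forall j, `|x 0 j| <= e.
Proof.
move=> e0; rewrite [`|x|]/Num.Def.normr/= mx_normrE; split=> [H j|H].
  by apply: le_trans H; apply: (le_bigmax _ (fun i : 'I_1 * 'I_n => `|x i.1 i.2|) (0, j)).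
by apply: bigmax_le => //= -[i j] _; rewrite ord1.
Qed.

Lemma rV_norm_coord n (x : 'rV[R]_n) j : `|x 0 j| <= `|x|.
Proof. by move: j; apply/rV_normP. Qed.

Let e_ n j : 'rV[R]_n := delta_mx 0 j.

(** Corners of a path from [z] to [y] that changes one coordinate at a time, so that an increment of
    a function splits into increments along the axes and only partial derivatives enter. *)
Definition hybrid n (y z : 'rV[R]_n) (k : nat) : 'rV[R]_n :=
  \row_j (if (j < k)%N then y 0 j else z 0 j).

Lemma hybridS n (y z : 'rV[R]_n) (j : 'I_n) (t : R) :
  hybrid y z j + t *: ((y - z) 0 j *: e_ j) =
  \row_i (if (i < j)%N then y 0 i else if i == j then z 0 j + t * (y - z) 0 j else z 0 i).
Proof.
apply/rowP => i; rewrite !mxE eqxx /=.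
case: (ltngtP i j) => [lt|lt|/val_inj ->]; last by rewrite eqxx mulr1.
- by rewrite (negbTE (_ : i != j)) ?mulr0 ?addr0 // -val_eqE /= neq_ltn lt.
- have -> : (i == j) = false by apply/negbTE; rewrite -val_eqE /= neq_ltn lt orbT.
  by rewrite !mulr0 addr0.
Qed.

Lemma telescope_hybrid n (f : 'rV[R]_n -> R) (y z : 'rV[R]_n) :
  f y - f z = \sum_(j < n) (f (hybrid y z j + (y - z) 0 j *: e_ j) - f (hybrid y z j)).
Proof.
have E (j : 'I_n) : hybrid y z j + (y - z) 0 j *: e_ j = hybrid y z j.+1.
  rewrite -[_ *: e_ j]scale1r hybridS; apply/rowP => i; rewrite !mxE mul1r.
  rewrite ltnS -val_eqE.
  by case: (ltngtP i j) => // /val_inj ->; rewrite subrKC.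
under eq_bigr do rewrite E.
rewrite -(big_mkord predT (fun j => f (hybrid y z j.+1) - f (hybrid y z j))).
rewrite telescope_sumr //; congr (f _ - f _); apply/rowP => i; rewrite !mxE //.
by rewrite ltn_ord.
Qed.

(* Strict differentiability: for a C^1 function the first-order expansion is
   uniform in both end points. *)
Lemma C1_strict_scalar n (U : set 'rV[R]_n) (f : 'rV[R]_n -> R) x (e : R) :
  open U -> Ck 1 U f -> U x -> 0 < e -> exists2 d, 0 < d &
    forall y z, `|y - x| < d -> `|z - x| < d ->
    `|f y - f z - \sum_(j < n) (y - z) 0 j * 'D_(e_ j) f x| <= e * `|y - z|.
Proof.
move=> oU [_ Cf] Ux e0.
(* The error is shared among the [n] coordinates; the successor avoids a division by zero when
   [n = 0]. *)
pose e' := e / (n.+1%:R).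
have e'0 : 0 < e' by rewrite divr_gt0.
have cD j : \forall y \near x, `|'D_(e_ j) f x - 'D_(e_ j) f y| < e'.
  have [_ [cf _]] := Cf (e_ j).
  by move/cvgrPdist_lt : (cf x Ux) => /(_ _ e'0).
have : \forall y \near x, U y /\ forall j, `|'D_(e_ j) f x - 'D_(e_ j) f y| < e'.
  apply: filterI; first exact: open_nbhs_nbhs.
  exact: filter_forall cD.
move=> /nbhs_ballP[d /= d0 dP]; exists d => // y z yd zd.
(* Each coordinate of the path lies between those of [y] and [z], so in the max norm the path does
   not leave the ball. *)
have hd (j : 'I_n) t : 0 <= t <= 1 ->
    ball x d (hybrid y z j + t *: ((y - z) 0 j *: e_ j)).
  move=> t01; rewrite hybridS -ball_normE /=.
  apply: (@le_lt_trans _ _ (Num.max `|y - x| `|z - x|)); last by rewrite gt_max yd zd.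
  set m := Num.max _ _; have m0 : 0 <= m by rewrite le_max normr_ge0.
  apply/rV_normP => [//|i].
  rewrite !mxE distrC.
  have yi : `|y 0 i - x 0 i| <= m.
    by have := rV_norm_coord (y - x) i; rewrite !mxE le_max => ->.
  have zi : `|z 0 i - x 0 i| <= m.
    by have := rV_norm_coord (z - x) i; rewrite !mxE le_max orbC => ->.
  case: ifP => // _; case: eqP => [<-|//].
  move: t01 => /andP[t0 t1].
  have -> : z 0 i + t * (y 0 i - z 0 i) - x 0 i = t * (y 0 i - x 0 i) + (1 - t) * (z 0 i - x 0 i) by ring.
  apply: (le_trans (ler_normD _ _)); rewrite !normrM (ger0_norm t0) (@ger0_norm _ (1 - t)) ?subr_ge0//.
  have -> : m = t * m + (1 - t) * m by ring.
  by apply: lerD; apply: ler_wpM2l; rewrite ?subr_ge0.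
rewrite telescope_hybrid -sumrB.
apply: (le_trans (ler_norm_sum _ _ _)).
apply: (@le_trans _ _ (\sum_(j < n) e' * `|y - z|)); last first.
  rewrite sumr_const card_ord -mulr_natl mulrA ler_wpM2r // /e' mulrA ler_pdivrMr //.
  by rewrite mulrC; apply: ler_wpM2l; [exact: ltW|rewrite ler_nat].
apply: ler_sum => j _.
have [t|t t01 ->] := @MVT_line _ f (hybrid y z j) ((y - z) 0 j *: e_ j).
  move=> t01; have /dP[/= Up _] := hd j t t01.
  by apply: (deriveZdir _ _).1; apply: (Cf (e_ j)).1.
have /dP[/= Up /(_ j) Dj] := hd j t t01.
rewrite (deriveZdir _ ((Cf (e_ j)).1 _ Up)).2 -mulrBr normrM mulrC.
apply: ler_pM => //; first by rewrite distrC ltW.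
exact: rV_norm_coord.
Qed.

Definition lincomb n (c : 'cV[R]_n) (h : 'rV[R]_n) : R := \sum_(j < n) h 0 j * c j 0.

Lemma lincomb_is_linear n (c : 'cV[R]_n) : linear (lincomb c).
Proof.
move=> a u v; rewrite /lincomb [in RHS]/GRing.scale /= mulr_sumr -big_split; apply: eq_bigr => j _.
by rewrite !mxE /=; ring.
Qed.

HB.instance Definition _ n (c : 'cV[R]_n) :=
  GRing.isLinear.Build R 'rV[R]_n R _ (lincomb c) (lincomb_is_linear c).

Lemma cvg_sumr (W : normedModType R) (T I : Type) (F : set_system T) {FF : Filter F}
    (r : seq I) (f : I -> T -> W) (l : I -> W) :
  (forall i, f i @ F --> l i) -> \sum_(i <- r) f i x @[x --> F] --> \sum_(i <- r) l i.
Proof.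
move=> H; elim: r => [|i r IH].
  by rewrite big_nil; under eq_cvg do rewrite big_nil; exact: cvg_cst.
by rewrite big_cons; under eq_cvg do rewrite big_cons; apply: cvgD.
Qed.

Lemma lincomb_continuous n (c : 'cV[R]_n) : continuous (lincomb c).
Proof.
move=> x; rewrite /lincomb; apply: (@cvg_sumr R _ _ (nbhs x) _ _ (fun j (h : 'rV[R]_n) => h 0 j * c j 0)) => j.
by apply: cvgM; [exact: coord_continuous|exact: cvg_cst].
Qed.

Lemma is_diff_expansion (V W : normedModType R) (f : V -> W) x (L : {linear V -> W}) :
  continuous L ->
  (forall e, 0 < e -> \forall h \near (0 : V), `|f (h + x) - f x - L h| <= e * `|h|) ->
  is_diff x f L.
Proof.
move=> cL H.
have E : f \o shift x = cst (f x) + L +o_ 0 id.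
  apply/eqaddoP => _/posnumP[e]; have := H e%:num [gt0 of e%:num].
  by apply: filterS => h /=; rewrite opprD addrA.
have D := diff_unique cL E.
by split=> //; apply/diff_locallyP; rewrite D.
Qed.

Lemma C1_is_diff_scalar n (U : set 'rV[R]_n) (f : 'rV[R]_n -> R) x :
  open U -> Ck 1 U f -> U x ->
  is_diff x f (lincomb (\col_j 'D_(e_ j) f x)).
Proof.
move=> oU Cf Ux; apply: is_diff_expansion; first exact: lincomb_continuous.
move=> e e0; have [d d0 H] := C1_strict_scalar oU Cf Ux e0.
apply/nbhs_ballP; exists d => //= h; rewrite -ball_normE /= sub0r normrN => hd.
have := H (h + x) x; rewrite addrK subrr normr0 => /(_ hd d0).
by congr (`|_ - _| <= _); apply: eq_bigr => j _; rewrite mxE.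
Qed.

Lemma differentiable_rV (V : normedModType R) p (F : V -> 'rV[R]_p) x :
  (forall j, differentiable (fun y => F y 0 j) x) -> differentiable F x.
Proof.
move=> dF.
have -> : F = \sum_(j < p) (fun y => F y 0 j *: e_ j).
  by rewrite funeqE => y; rewrite fct_sumE -row_sum_delta.
by apply: differentiable_sum => j; apply: differentiableZl; apply: dF.
Qed.

Lemma derive_scalarE n (f : 'rV[R]_n -> R) x v : differentiable f x ->
  'D_v f x = \sum_(j < n) v 0 j * 'D_(e_ j) f x.
Proof.
move=> df; rewrite deriveE // [in LHS](row_sum_delta v) linear_sum /=.
by apply: eq_bigr => j _; rewrite linearZ /= deriveE.
Qed.

Lemma derive_coord (V : normedModType R) p q (F : V -> 'M[R]_(p, q)) x v i j :
  derivable F x v -> 'D_v F x i j = 'D_v (fun y => F y i j) x.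
Proof. by move=> /derive_mx ->; rewrite mxE. Qed.

Lemma jacobianE n p (F : 'rV[R]_n -> 'rV[R]_p) x i j : differentiable F x ->
  jacobian F x i j = 'D_(e_ i) (fun y => F y 0 j) x.
Proof.
move=> dF; rewrite -derive_coord; last exact: diff_derivable.
by rewrite deriveEjacobian // -rowE !mxE.
Qed.

Lemma Ck_eq (V W : normedModType R) k (U : set V) (f g : V -> W) :
  open U -> (forall x, U x -> f x = g x) -> Ck k U f -> Ck k U g.
Proof.
move=> oU; elim: k f g => [|k IH] f g fg /=.
all: have nfg x : U x -> {near x, f =1 g} by
  move=> Ux; have := open_nbhs_nbhs (conj oU Ux); apply: filterS => y; exact: fg.
all: have cfg x : U x -> {for x, continuous f} -> {for x, continuous g} by
  move=> Ux cf; apply: cvg_trans (near_eq_cvg (nfg x Ux)) _; rewrite -fg.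
  by move=> [cf _]; split=> // x Ux; apply: cfg => //; exact: cf.
move=> [cf df]; split; first by move=> x Ux; apply: cfg => //; exact: cf.
move=> v; have [d1 d2] := df v; split.
  by move=> x Ux; apply: near_eq_derivable (d1 x Ux); exact: nfg.
by apply: IH d2 => x Ux; apply: near_eq_derive; exact: nfg.
Qed.

Lemma Ck_sub (V W : normedModType R) k (U U' : set V) (f : V -> W) :
  U' `<=` U -> Ck k U f -> Ck k U' f.
Proof.
move=> UU; elim: k f => [|k IH] f /= [cf df]; split=> //; try by move=> x /UU; exact: cf.
by move=> v; have [d1 d2] := df v; split; [move=> x /UU; exact: d1|exact: IH].
Qed.

(** [Ck] imposes pointwise conditions on the global functions ['D_v f], hence makes sense on
    singletons; this lets charts and neighbourhoods depend on the point. *)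
Lemma CkP (V W : normedModType R) k (U : set V) (f : V -> W) :
  (forall x, U x -> Ck k [set x] f) -> Ck k U f.
Proof.
elim: k f => [|k IH] f H.
  by split=> // x Ux; have [c _] := H x Ux; exact: c.
split; first by move=> x Ux; have [c _] := H x Ux; exact: c.
move=> v; split; first by move=> x Ux; have [_ /(_ v)[d _]] := H x Ux; exact: d.
by apply: IH => x Ux; have [_ /(_ v)[_]] := H x Ux.
Qed.

Lemma CkW (V W : normedModType R) k (U : set V) (f : V -> W) :
  Ck k.+1 U f -> Ck k U f.
Proof.
elim: k f => [|k IH] f [cf df]; split=> //.
by move=> v; have [d1 d2] := df v; split=> //; exact: IH.
Qed.

Lemma Ck_C1 (V W : normedModType R) k (U : set V) (f : V -> W) :
  Ck k.+1 U f -> Ck 1 U f.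
Proof. by elim: k => // k IH /CkW. Qed.

Lemma Ck_cst (V W : normedModType R) k (U : set V) (c : W) : Ck k U (cst c : V -> W).
Proof.
elim: k c => [|k IH] c; split=> //; try by move=> x _; exact: cst_continuous.
move=> v; split=> [x _|]; first exact: derivable_cst.
suff -> : 'D_v (cst c : V -> W) = cst 0 by exact: IH.
by rewrite funeqE => x; rewrite derive_cst.
Qed.

Lemma CkD (V W : normedModType R) k (U : set V) (f g : V -> W) : open U ->
  Ck k U f -> Ck k U g -> Ck k U (fun x => f x + g x).
Proof.
move=> oU; elim: k f g => [|k IH] f g [cf df] [cg dg]; split=> //;
  try by move=> x Ux; apply: cvgD; [exact: cf|exact: cg].
move=> v; have [d1 d2] := df v; have [d3 d4] := dg v; split.
  by move=> x Ux; apply: derivableD; [exact: d1|exact: d3].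
apply: (Ck_eq oU _ (IH _ _ d2 d4)) => x Ux.
by rewrite -deriveD //; [exact: d1|exact: d3].
Qed.

Lemma CkM (V : normedModType R) k (U : set V) (f g : V -> R) : open U ->
  Ck k U f -> Ck k U g -> Ck k U (fun x => f x * g x).
Proof.
move=> oU; elim: k f g => [|k IH] f g Cf Cg.
  by split=> // x Ux; apply: cvgM; [exact: Cf.1|exact: Cg.1].
split; first by move=> x Ux; apply: cvgM; [exact: Cf.1|exact: Cg.1].
move=> v; have [d1 d2] := Cf.2 v; have [d3 d4] := Cg.2 v; split.
  by move=> x Ux; apply: derivableM; [exact: d1|exact: d3].
apply: (Ck_eq oU _ (CkD oU (IH _ _ (CkW Cf) d4) (IH _ _ (CkW Cg) d2))) => x Ux.
by rewrite deriveM //; [exact: d1|exact: d3].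
Qed.

Lemma CkV (V : normedModType R) k (U : set V) (f : V -> R) : open U ->
  (forall x, U x -> f x != 0) -> Ck k U f -> Ck k U (fun x => (f x)^-1).
Proof.
move=> oU f0; elim: k => [|k IH] Cf.
  by split=> // x Ux; apply: cvgV; [exact: f0|exact: Cf.1].
split; first by move=> x Ux; apply: cvgV; [exact: f0|exact: Cf.1].
move=> v; have [d1 d2] := Cf.2 v; split.
  by move=> x Ux; apply: derivableV; [exact: f0|exact: d1].
have I := IH (CkW Cf).
apply: (Ck_eq oU _ (CkM oU (CkM oU (@Ck_cst V R k U (-1)) (CkM oU I I)) d2)) => x Ux.
rewrite deriveV; [|exact: f0|exact: d1].
by rewrite /cst -[_ *: _]/(_ * _) expr2 invfM mulN1r.
Qed.

Lemma Ck_sum (V W : normedModType R) k (U : set V) I (r : seq I) (P : pred I) (f : I -> V -> W) :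
  open U -> (forall i, P i -> Ck k U (f i)) -> Ck k U (fun x => \sum_(i <- r | P i) f i x).
Proof.
move=> oU H; elim: r => [|i r IH].
  by apply: (Ck_eq oU _ (Ck_cst k U 0)) => x _; rewrite big_nil.
case Pi : (P i).
  by apply: (Ck_eq oU _ (CkD oU (H i Pi) IH)) => x _; rewrite big_cons Pi.
by apply: (Ck_eq oU _ IH) => x _; rewrite big_cons Pi.
Qed.

Lemma Ck_prod (V : normedModType R) k (U : set V) I (r : seq I) (f : I -> V -> R) :
  open U -> (forall i, Ck k U (f i)) -> Ck k U (fun x => \prod_(i <- r) f i x).
Proof.
move=> oU H; elim: r => [|i r IH].
  by apply: (Ck_eq oU _ (@Ck_cst V R k U 1)) => x _; rewrite big_nil.
by apply: (Ck_eq oU _ (CkM oU (H i) IH)) => x _; rewrite big_cons.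
Qed.

Lemma cvg_mx (T : Type) (F : set_system T) (FF : Filter F) p q (f : T -> 'M[R]_(p, q)) (l : 'M[R]_(p, q)) :
  (forall i j, f x i j @[x --> F] --> l i j) -> f @ F --> l.
Proof.
move=> H; apply/cvgrPdist_le => e e0.
have : \forall x \near F, forall i, forall j, `|l i j - f x i j| <= e.
  apply: filter_forall => i; apply: filter_forall => j.
  by move/cvgrPdist_le : (H i j); apply.
apply: filterS => x Hx; rewrite /Num.Def.normr/= mx_normrE.
by apply: bigmax_le => [|[i j] _]; [exact: ltW|rewrite !mxE /=].
Qed.

Lemma Ck_mxP (V : normedModType R) k (U : set V) p q (F : V -> 'M[R]_(p, q)) : open U ->
  Ck k U F <-> forall i j, Ck k U (fun x => F x i j).
Proof.
move=> oU; elim: k F => [|k IH] F.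
  split=> [[cF _] i j|H].
    split=> // x Ux; apply: (@continuous_comp _ _ _ F (fun M : 'M[R]_(p, q) => M i j)); first exact: cF.
    exact: coord_continuous.
  by split=> // x Ux; apply: cvg_mx => i j; have [c _] := H i j; exact: c.
split=> [[cF dF] i j|H].
  split=> [x Ux|v].
    apply: (@continuous_comp _ _ _ F (fun M : 'M[R]_(p, q) => M i j)); first exact: cF.
    exact: coord_continuous.
  have [d1 d2] := dF v; split=> [x Ux|].
    by move: (d1 x Ux) => /derivable_mxP; apply.
  move/IH : d2 => /(_ i j); apply: Ck_eq => // x Ux.
  by rewrite derive_coord //; exact: d1.
have d1 v x : U x -> derivable F x v.
  by move=> Ux; apply/derivable_mxP => i j; have [_ /(_ v)[d _]] := H i j; exact: d.
split=> [x Ux|v]; first by apply: cvg_mx => i j; have [c _] := H i j; exact: c.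
split=> [x Ux|]; first exact: d1.
apply/IH => i j; have [_ /(_ v)[_]] := H i j; apply: Ck_eq => // x Ux.
by rewrite derive_coord //; exact: d1.
Qed.

Lemma Ck_coord n k (U : set 'rV[R]_n) j : Ck k U (fun x : 'rV[R]_n => x 0 j).
Proof.
case: k => [|k]; split=> //; try by move=> x _; exact: coord_continuous.
have E v x : is_derive x v (fun x : 'rV[R]_n => x 0 j) (v 0 j).
  have d : derivable (id : 'rV[R]_n -> 'rV[R]_n) x v by exact: derivable_id.
  split; first by move/derivable_mxP : d; apply.
  by rewrite -derive_coord // derive_id.
move=> v; split=> [x _|]; first by case: (E v x).
suff -> : 'D_v (fun x : 'rV[R]_n => x 0 j) = cst (v 0 j) by exact: Ck_cst.
by rewrite funeqE => x; case: (E v x).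
Qed.

Lemma C1_differentiable n p (U : set 'rV[R]_n) (F : 'rV[R]_n -> 'rV[R]_p) x :
  open U -> Ck 1 U F -> U x -> differentiable F x.
Proof.
move=> oU CF Ux; apply: differentiable_rV => j.
by have [] := C1_is_diff_scalar oU ((Ck_mxP _ _ oU).1 CF 0 j) Ux.
Qed.

Lemma C1_strict n p (U : set 'rV[R]_n) (F : 'rV[R]_n -> 'rV[R]_p) x (e : R) :
  open U -> Ck 1 U F -> U x -> 0 < e -> exists2 d, 0 < d &
    forall y z, `|y - x| < d -> `|z - x| < d ->
    `|F y - F z - (y - z) *m jacobian F x| <= e * `|y - z|.
Proof.
move=> oU CF Ux e0; have dF := C1_differentiable oU CF Ux.
have : forall j, \forall d \near 0^'+, forall y z, `|y - x| < d -> `|z - x| < d ->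
    `|(F y - F z - (y - z) *m jacobian F x) 0 j| <= e * `|y - z|.
  move=> j; have Cj := (Ck_mxP _ _ oU).1 CF 0 j.
  have [d d0 H] := C1_strict_scalar oU Cj Ux e0.
  near=> d' => y z yd zd; apply: le_trans (H y z _ _); last 2 first.
  - by apply: lt_trans yd _; near: d'; exact: nbhs_right_lt.
  - by apply: lt_trans zd _; near: d'; exact: nbhs_right_lt.
  rewrite !mxE; under [X in `|_ - X| <= _]eq_bigr do rewrite jacobianE //.
  by under [X in _ <= `|_ - X|]eq_bigr do rewrite !mxE; under eq_bigr do rewrite !mxE.
move=> /filter_forall H.
have : \forall d \near 0^'+, 0 < d /\ forall j, forall y z, `|y - x| < d -> `|z - x| < d ->
    `|(F y - F z - (y - z) *m jacobian F x) 0 j| <= e * `|y - z|.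
  by apply: filterI; [exact: nbhs_right_gt|exact: H].
move=> /filter_ex[d [d0 Hd]]; exists d => // y z yd zd.
by apply/rV_normP => [|j]; [rewrite mulr_ge0 // ltW|exact: Hd].
Unshelve. all: by end_near. Qed.

(** The chain rule writes a directional derivative of [f \o F] as a sum of products of derivatives
    of the components of [F] with partial derivatives of [f] composed with [F]; the induction on [k]
    applies to the latter. *)
Lemma Ck_comp_scalar n p k (U : set 'rV[R]_n) (U' : set 'rV[R]_p)
    (f : 'rV[R]_p -> R) (F : 'rV[R]_n -> 'rV[R]_p) :
  open U -> open U' -> (forall x, U x -> U' (F x)) ->
  Ck k U' f -> Ck k U F -> Ck k U (f \o F).
Proof.
move=> oU oU' UU'; elim: k f => [|k IH] f Cf CF.
  split=> // x Ux; apply: continuous_comp; first exact: CF.1.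
  by apply: Cf.1; exact: UU'.
have dF x : U x -> differentiable F x by move=> Ux; apply: (C1_differentiable oU (Ck_C1 CF)).
have df y : U' y -> differentiable f y.
  by move=> Uy; have [] := C1_is_diff_scalar oU' (Ck_C1 Cf) Uy.
split=> [x Ux|v].
  by apply: continuous_comp; [exact: CF.1|apply: Cf.1; exact: UU'].
have D x : U x -> differentiable (f \o F) x.
  by move=> Ux; apply: differentiable_comp; [exact: dF|apply: df; exact: UU'].
split=> [x Ux|]; first exact/diff_derivable/D.
apply: (@Ck_eq _ _ k U (fun x => \sum_(j < p) 'D_v (fun y => F y 0 j) x * (('D_(e_ j) f) \o F) x)) => //.
  move=> x Ux; rewrite [RHS]deriveE; last exact: D.
  rewrite diff_comp; [|exact: dF|by apply: df; exact: UU'].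
  rewrite /= -deriveE; last by apply: df; exact: UU'.
  rewrite derive_scalarE; last by apply: df; exact: UU'.
  apply: eq_bigr => j _; congr (_ * _).
  by rewrite -deriveE ?derive_coord //; [exact/diff_derivable/dF|exact: dF].
apply: Ck_sum => // j _; apply: CkM => //.
  by have := (Ck_mxP _ _ oU).1 CF 0 j; case=> _ /(_ v)[].
by apply: IH; [have [_ /(_ (e_ j))[]] := Cf|exact: CkW].
Qed.

Lemma Ck_comp n p q r k (U : set 'rV[R]_n) (U' : set 'rV[R]_p)
    (f : 'rV[R]_p -> 'M[R]_(q, r)) (F : 'rV[R]_n -> 'rV[R]_p) :
  open U -> open U' -> (forall x, U x -> U' (F x)) ->
  Ck k U' f -> Ck k U F -> Ck k U (f \o F).
Proof.
move=> oU oU' UU' Cf CF; apply/Ck_mxP => // i j.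
exact: (Ck_comp_scalar oU oU' UU' ((Ck_mxP _ _ oU').1 Cf i j) CF).
Qed.

End Calculus.

(** * The inverse function theorem *)

Section InverseFunction.
Context {R : realType}.

Lemma shift_continuous (V : normedModType R) (z x : V) : {for x, continuous (fun h => h + z)}.
Proof. by apply: (@cvgD _ _ _ (nbhs x) _ id (cst z) x z); [exact: cvg_id|exact: cvg_cst]. Qed.

Lemma near0_lt (V : normedModType R) (e : R) : 0 < e -> \forall h \near (0 : V), `|h| < e.
Proof.
by move=> e0; apply/nbhs_ballP; exists e => //= h; rewrite -ball_normE /= sub0r normrN.
Qed.

Lemma mulmx_bound p q (A : 'M[R]_(p, q)) :
  exists2 K, 0 < K & forall v : 'rV[R]_p, `|v *m A| <= K * `|v|.
Proof.
pose K := 1 + \sum_j \sum_i `|A i j|.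
have K0 : 0 < K by rewrite ltr_pwDl // sumr_ge0 // => j _; rewrite sumr_ge0.
exists K => // v; apply/rV_normP => [|j]; first by rewrite mulr_ge0 // ltW.
rewrite !mxE; apply: (le_trans (ler_norm_sum _ _ _)).
apply: (@le_trans _ _ ((\sum_i `|A i j|) * `|v|)).
  rewrite mulr_suml; apply: ler_sum => i _.
  by rewrite normrM mulrC ler_wpM2l // rV_norm_coord.
rewrite ler_wpM2r // /K (bigD1 j) //= addrCA lerDl addr_ge0 // sumr_ge0 // => i _.
exact: sumr_ge0.
Qed.

Lemma mulmxr_continuous p q (A : 'M[R]_(p, q)) : continuous (fun v : 'rV[R]_p => v *m A).
Proof.
move=> v; apply: (@cvg_mx R _ (nbhs v)) => i j; rewrite !mxE.
under eq_cvg do rewrite mxE.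
apply: (@cvg_sumr R R _ _ (nbhs v) _ _ (fun k (w : 'rV[R]_p) => w i k * A k j)) => k.
by apply: cvgM; [exact: coord_continuous|exact: cvg_cst].
Qed.

Lemma Ck_jacobian n p k (U : set 'rV[R]_n) (F : 'rV[R]_n -> 'rV[R]_p) :
  open U -> Ck k.+1 U F -> Ck k U (jacobian F).
Proof.
move=> oU CF; apply/Ck_mxP => // i j.
have C1 := Ck_C1 CF.
have [_ /(_ (delta_mx 0 i))[_]] := (Ck_mxP _ _ oU).1 CF 0 j.
apply: Ck_eq => // x Ux; rewrite jacobianE //; exact: (C1_differentiable oU).
Qed.

Lemma Ck_mulmx (V : normedModType R) p q r k (U : set V)
    (F : V -> 'M[R]_(p, q)) (G : V -> 'M[R]_(q, r)) : open U ->
  Ck k U F -> Ck k U G -> Ck k U (fun x => F x *m G x).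
Proof.
move=> oU /(Ck_mxP _ _ oU) CF /(Ck_mxP _ _ oU) CG; apply/Ck_mxP => // i j.
apply: (@Ck_eq _ _ _ k U (fun x => \sum_l F x i l * G x l j)) => //.
  by move=> x _; rewrite mxE.
by apply: Ck_sum => // l _; apply: CkM.
Qed.

Lemma Ck_det (V : normedModType R) p k (U : set V) (F : V -> 'M[R]_p) : open U ->
  (forall i j, Ck k U (fun x => F x i j)) -> Ck k U (fun x => \det (F x)).
Proof.
move=> oU CF; apply: Ck_sum => // s _; apply: CkM => //; first exact: Ck_cst.
by apply: Ck_prod.
Qed.

Lemma Ck_invmx (V : normedModType R) p k (U : set V) (F : V -> 'M[R]_p) : open U ->
  (forall x, U x -> F x \in unitmx) -> Ck k U F -> Ck k U (fun x => invmx (F x)).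
Proof.
move=> oU uF /(Ck_mxP _ _ oU) CF; apply/Ck_mxP => // i j.
apply: (@Ck_eq _ _ _ k U (fun x => (\det (F x))^-1 * cofactor (F x) j i)) => //.
  by move=> x Ux; rewrite /invmx uF // !mxE.
apply: CkM => //; first apply: CkV => //.
- by move=> x /uF; rewrite unitmxE unitfE.
- exact: Ck_det.
apply: CkM => //; first exact: Ck_cst.
apply: Ck_det => // i' j'.
apply: (@Ck_eq _ _ _ k U (fun x => F x (lift j i') (lift i j'))) => //.
by move=> x _; rewrite !mxE.
Qed.

Lemma compact_cball n (x : 'rV[R]_n) (r : R) : compact [set y : 'rV[R]_n | `|y - x| <= r].
Proof.
apply: bounded_closed_compact.
  exists (`|x| + r); split; first exact: num_real.
  move=> M xM y By /=; apply: ltW; apply: le_lt_trans xM.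
  by rewrite -(subrK x y) addrC; apply: (le_trans (ler_normD _ _)); rewrite lerD2l.
apply: (@preimage_closed _ _ (fun y : 'rV[R]_n => `|y - x|) [set s | s <= r]).
  by move=> y _; apply: (cvg_norm (@shift_continuous _ (- x) y)).
exact: closed_le.
Qed.

(** Existence is by minimization rather than iteration: at a minimum of [|(F y - w) J^-1|] over a
    closed ball, one Newton step stays in the ball and at least halves this quantity, which is
    therefore zero. The derivative of [G] is the inverse matrix of the Jacobian at [G z], and this
    formula raises the class of [G] by one at each step of an induction. *)
Theorem inverse_function n (U : set 'rV[R]_n) (F : 'rV[R]_n -> 'rV[R]_n) x :
  open U -> smooth_on U F -> U x -> jacobian F x \in unitmx ->
  exists (V W : set 'rV[R]_n) (G : 'rV[R]_n -> 'rV[R]_n),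
    [/\ [/\ open V, V x & V `<=` U], open W,
      forall y, V y -> W (F y) /\ G (F y) = y,
      forall z, W z -> V (G z) /\ F (G z) = z & smooth_on W G].
Proof.
move=> oU sF Ux uJ; set J := jacobian F x.
have dF y : U y -> differentiable F y by exact: (C1_differentiable oU (sF 1%N)).
have cF y : U y -> {for y, continuous F} by move=> Uy; apply: (sF 0%N).1.
have [K K0 HK] := mulmx_bound (invmx J).
have nunit : \forall y \near x, jacobian F y \in unitmx.
  have cdet : {for x, continuous (fun y => \det (jacobian F y))}.
    have /(Ck_mxP _ _ oU) H := Ck_jacobian oU (sF 1%N).
    by have [c _] := Ck_det oU H; exact: c.
  have := @cvgr_neq0 _ _ _ (nbhs x) _ _ (\det (jacobian F x)) cdet.
  have : \det (jacobian F x) != 0 by move: uJ; rewrite unitmxE unitfE.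
  move=> d0 /(_ _ d0) H; move: H; apply: filterS => y; by rewrite unitmxE unitfE.
have nU : \forall y \near x, U y /\ jacobian F y \in unitmx.
  by apply: filterI => //; exact: open_nbhs_nbhs.
(* This precision makes the Newton map [y |-> y - (F y - w) J^-1] contract by the factor 1/2. *)
have K2 : 0 < (2 * K)^-1 by rewrite invr_gt0 mulr_gt0.
have [d1 d10 H1] := C1_strict oU (sF 1%N) Ux K2.
have /nbhs_ballP[d2 /= d20 H2] := nU.
pose d := Num.min d1 d2.
have d0 : 0 < d by rewrite lt_min d10.
have dU y : `|y - x| < d -> U y /\ jacobian F y \in unitmx.
  by rewrite lt_min distrC => /andP[_ ?]; apply: H2; rewrite -ball_normE.
have contr y z : `|y - x| < d -> `|z - x| < d ->
    `|(F y - F z) *m invmx J - (y - z)| <= 2^-1 * `|y - z|.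
  rewrite !lt_min => /andP[yd _] /andP[zd _].
  have -> : (F y - F z) *m invmx J - (y - z) =
      (F y - F z - (y - z) *m J) *m invmx J by rewrite [RHS]mulmxBl mulmxK.
  apply: (le_trans (HK _)); have := H1 y z yd zd; rewrite -(ler_pM2l K0) => /le_trans; apply.
  by rewrite mulrA invfM mulrCA divff ?gt_eqF // mulr1.
have lip y z : `|y - x| < d -> `|z - x| < d -> `|y - z| <= 2 * K * `|F y - F z|.
  move=> yd zd; have := contr y z yd zd; have := HK (F y - F z).
  set P := (F y - F z) *m invmx J => h1 h2.
  have : `|y - z| <= `|P| + `|P - (y - z)|.
    by have := ler_normB P (P - (y - z)); rewrite subKr.
  by move: h1 h2; set a := `|y - z|; set b := `|F y - F z|; lra.
(* A Newton step from the ball of radius [d / 2] ends within [d / 4 + d / 4] of [x]: half of the old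
   distance, plus [K] times the distance from [w] to [F x]. *)
pose W := ball (F x) (d / (4 * K)).
have sol w : W w -> exists2 y, `|y - x| <= d / 2 & F y = w.
  rewrite /W -ball_normE /= => ww.
  pose B := [set y : 'rV[R]_n | `|y - x| <= d / 2].
  have Bd y : B y -> `|y - x| < d by rewrite /B /= => h; apply: (le_lt_trans h); lra.
  have B0 : B x by rewrite /B /= subrr normr0; lra.
  have cB : compact B by exact: compact_cball.
  pose h y := `|(F y - w) *m invmx J|.
  have [y yB ymin] : exists2 c, c \in B & forall t, t \in B -> h c <= h t.
    apply: EVT_min_rV => //; first by exists x.
    apply: continuous_in_subspaceT => y /[!inE] /Bd /dU[Uy _].
    have cg : {for y, continuous ((fun v => v *m invmx J) \o (fun y => F y - w))}.
      apply: continuous_comp; last exact: mulmxr_continuous.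
      exact: (continuousB (cF _ Uy) (@cst_continuous _ _ w y)).
    exact: (cvg_norm cg).
  rewrite inE in yB; have yd := Bd _ yB.
  pose y1 := y - (F y - w) *m invmx J.
  have y1B : B y1.
    rewrite /B /= /y1.
    have -> : y - (F y - w) *m invmx J - x =
      - ((F y - F x) *m invmx J - (y - x)) + (w - F x) *m invmx J.
      rewrite !mulmxBl; apply/rowP => i; rewrite !mxE; ring.
    apply: (le_trans (ler_normD _ _)); rewrite normrN.
    have := contr y x yd; rewrite subrr normr0 => /(_ d0) c1.
    have c2 := HK (w - F x).
    have c3 : K * `|w - F x| <= d / 4.
      rewrite distrC mulrC -ler_pdivlMr //.
      have -> : d / 4 / K = d / (4 * K) by rewrite invfM; ring.
      exact: ltW.
    by move: yB c1 c2 c3; rewrite /B /=; lra.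
  have y1d := Bd _ y1B.
  exists y => //.
  have hy : h y1 <= 2^-1 * h y.
    have -> : h y = `|y1 - y|.
      by rewrite /y1 addrAC subrr sub0r normrN.
    have -> : h y1 = `|(F y1 - F y) *m invmx J - (y1 - y)|.
      rewrite /h /y1 addrAC subrr sub0r opprK -mulmxDl; congr (`|_ *m _|).
      by rewrite subrKA.
    exact: contr.
  have y1B' : y1 \in B by rewrite inE.
  have h0 : h y = 0.
    have := ymin y1 y1B'; have : 0 <= h y by rewrite /h.
    by move: hy; lra.
  have /eqP := h0; rewrite /h normr_eq0 => /eqP /(congr1 (mulmx^~ J)).
  by rewrite mulmxKV // mul0mx => /subr0_eq.
pose V := [set y | `|y - x| < d /\ W (F y)].
have /choice[G HG] : forall w, exists y, W w -> `|y - x| <= d / 2 /\ F y = w.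
  move=> w; have [Ww|] := pselect (W w); last by move=> nW; exists 0.
  by have [y ? ?] := sol w Ww; exists y.
have GV z : W z -> V (G z) /\ F (G z) = z.
  move=> Wz; have [h1 h2] := HG z Wz; split=> //; split; last by rewrite h2.
  by apply: (le_lt_trans h1); lra.
have inj y z : `|y - x| < d -> `|z - x| < d -> F y = F z -> y = z.
  move=> yd zd E; have := lip y z yd zd; rewrite E subrr normr0 mulr0 normr_le0.
  by move/eqP/subr0_eq.
have oW : open W by exact: ball_open.
have oV : open V.
  rewrite openE => y [yd Wy]; rewrite /interior /=.
  apply: filterI; last by apply: (cF y (dU y yd).1); exact: open_nbhs_nbhs.
  have : nbhs y (ball x d).
    by apply: open_nbhs_nbhs; split; [exact: ball_open|rewrite -ball_normE /= distrC].
  by apply: filterS => z; rewrite -ball_normE /= distrC.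
have VG y : V y -> W (F y) /\ G (F y) = y.
  move=> [yd Wy]; split=> //; have [[h1 _] h2] := GV _ Wy.
  exact: inj.
have dG z : W z -> is_diff z G (mulmxr (invmx (jacobian F (G z)))).
  move=> Wz; have [[h1 h2] h3] := GV z Wz; set y := G z in h1 h2 h3 *.
  have [Uy uy] := dU y h1.
  apply: is_diff_expansion; first exact: mulmxr_continuous.
  move=> e e0; have [K' K'0 HK'] := mulmx_bound (invmx (jacobian F y)).
  (* [K'] bounds the inverse Jacobian at [y], and [2 * K] is the Lipschitz constant of [G]. *)
  have eK : 0 < e / (K' * (2 * K)) by rewrite divr_gt0 // !mulr_gt0.
  have [r r0 Hr] := C1_strict oU (sF 1%N) Uy eK.
  have nW : \forall h \near (0 : 'rV[R]_n), W (h + z).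
    by apply: (@shift_continuous _ z 0); rewrite add0r; exact: open_nbhs_nbhs.
  have nb : \forall h \near (0 : 'rV[R]_n), `|h| < r / (2 * K).
    by apply: near0_lt; rewrite divr_gt0 // mulr_gt0.
  near=> h.
  have Wh : W (h + z) by near: h.
  have [[g1 g2] g3] := GV _ Wh; set y' := G (h + z) in g1 g2 g3 *.
  have lyy : `|y' - y| <= 2 * K * `|h|.
    by apply: (le_trans (lip _ _ g1 h1)); rewrite g3 h3 addrK.
  have yr : `|y' - y| < r.
    apply: (le_lt_trans lyy); rewrite mulrC -ltr_pdivlMr ?mulr_gt0 //.
    by near: h.
  have := Hr y' y yr; rewrite subrr normr0 => /(_ r0); rewrite g3 h3 addrK => Hr'.
  have -> : y' - y - mulmxr (invmx (jacobian F y)) h =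
     - ((h - (y' - y) *m jacobian F y) *m invmx (jacobian F y)).
    by rewrite /= mulmxBl mulmxK // opprB.
  rewrite normrN; apply: (le_trans (HK' _)).
  apply: (@le_trans _ _ (K' * (e / (K' * (2 * K)) * (2 * K * `|h|)))).
    rewrite ler_pM2l //; apply: (le_trans Hr'); rewrite ler_pM2l //.
  by rewrite le_eqVlt; apply/orP; left; apply/eqP; field; rewrite !gt_eqF.
exists V, W, G; split=> //.
  split=> //; first by split; [rewrite subrr normr0|apply: ballxx; rewrite divr_gt0 // mulr_gt0].
  by move=> y [/dU[]].
elim=> [|k IH].
  by split=> // z Wz; apply: differentiable_continuous; case: (dG z Wz).
split; first by move=> z Wz; apply: differentiable_continuous; case: (dG z Wz).
move=> v; split; first by move=> z Wz; apply: diff_derivable; case: (dG z Wz).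
apply: (@Ck_eq _ _ _ k W (fun z => v *m invmx ((jacobian F \o G) z))) => //.
  by move=> z Wz; have D := dG z Wz; rewrite deriveE // diff_val.
apply: Ck_mulmx => //; first exact: Ck_cst.
apply: (@Ck_invmx _ _ k W (jacobian F \o G) oW).
  by move=> z Wz; have [[h1 _] _] := GV z Wz; exact: (dU _ h1).2.
apply: (@Ck_comp R _ _ _ _ k W V (jacobian F) G oW oV _ _ IH); first by move=> z Wz; have [h1 _] := GV z Wz.
apply: (Ck_jacobian oV); apply: (Ck_sub _ (sF k.+1)) => y Vy; exact: (dU _ Vy.1).1.
Unshelve. all: by end_near.
Qed.

End InverseFunction.

(** * Smooth maps between charted spaces: locality, composition, products *)

Section ChartCalculus.
Context {R : realType}.

Lemma chart_open_image (T : topologicalType) n (c : chart R T n) (O : set T) :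
  is_chart c -> open O -> O `<=` cdom c -> open (cto c @` O).
Proof.
move=> [oc oi K ct ci] oO sO; rewrite openE => _ [x Ox <-]; rewrite /interior.
have n1 : nbhs (cto c x) (cto c @` cdom c).
  by apply: open_nbhs_nbhs; split=> //; exists x => //; exact: sO.
have n2 : nbhs (cto c x) (cinv c @^-1` O).
  by apply: (ci x (sO _ Ox)); rewrite /= K; [exact: open_nbhs_nbhs|exact: sO].
apply: filterS2 n1 n2 => _ [y cy <-] /=; rewrite K // => Oy; by exists y.
Qed.

Definition covers (T : topologicalType) n (A : set (chart R T n)) (W : set T) : Prop :=
  forall x, W x -> exists2 c, A c & cdom c x.

Definition charts (T : topologicalType) n (A : set (chart R T n)) : Prop :=
  forall c, A c -> is_chart c.

Lemma smooth_map_local (T T' : topologicalType) n n' (A : set (chart R T n))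
    (A' : set (chart R T' n')) (W : set T) (f : T -> T') :
  (forall x, W x -> exists V, [/\ open V, V x & smooth_map A V A' f]) ->
  smooth_map A W A' f.
Proof.
move=> H; split=> [x Wx|c c' Ac Ac' k].
  by have [V [_ Vx [cf _]]] := H x Wx; exact: cf.
apply: CkP => _ [x [[cx Wx] cfx] <-]; have [V [_ Vx [_ sf]]] := H x Wx.
by apply: (Ck_sub _ (sf c c' Ac Ac' k)) => _ ->; exists x.
Qed.

Lemma smooth_map_sub (T T' : topologicalType) n n' (A : set (chart R T n))
    (A' : set (chart R T' n')) (W V : set T) (f : T -> T') :
  V `<=` W -> smooth_map A W A' f -> smooth_map A V A' f.
Proof.
move=> VW [cf sf]; split=> [x /VW|c c' Ac Ac' k]; first exact: cf.
apply: (Ck_sub _ (sf c c' Ac Ac' k)) => _ [x [[cx Vx] cfx] <-]; exists x => //.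
by split=> //; split=> //; exact: VW.
Qed.

Lemma open_preimage_on (T T' : topologicalType) (f : T -> T') (W : set T) (O : set T') :
  open W -> (forall x, W x -> {for x, continuous f}) -> open O -> open (W `&` f @^-1` O).
Proof.
move=> oW cf oO; rewrite openE => x [Wx Ox]; rewrite /interior /=.
by apply: filterI; [exact: open_nbhs_nbhs|apply: (cf x Wx); exact: open_nbhs_nbhs].
Qed.

Lemma smooth_map_eq (T T' : topologicalType) n n' (A : set (chart R T n))
    (A' : set (chart R T' n')) (W : set T) (f h : T -> T') :
  charts A -> open W -> charts A' -> (forall x, W x -> f x = h x) ->
  smooth_map A W A' f -> smooth_map A W A' h.
Proof.
move=> cA oW cA' E [cf sf]; split=> [x Wx|c c' Ac Ac' k].
  have nE : {near x, f =1 h} by apply: filterS (open_nbhs_nbhs (conj oW Wx)) => y; exact: E.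
  by apply: cvg_trans (near_eq_cvg nE) _; rewrite -E //; exact: cf.
have [oc _ Kc _ _] := cA _ Ac; have [oc' _ _ _ _] := cA' _ Ac'.
have S0 : cdom c `&` W `&` h @^-1` cdom c' = cdom c `&` W `&` f @^-1` cdom c'.
  by apply/seteqP; split=> x [[cx Wx]] /=; rewrite E.
rewrite S0; apply: Ck_eq (sf c c' Ac Ac' k).
  apply: chart_open_image; first exact: cA.
    apply: open_preimage_on => //; first exact: openI.
    by move=> x [_ Wx]; exact: cf.
  by move=> x [[]].
by move=> _ [x [[cx Wx] _] <-] /=; rewrite Kc // E.
Qed.

(** The intermediate chart depends on the point, so the class is checked on singletons by [CkP],
    each time inside an open set on which one chart of [A'] serves. *)
Lemma smooth_map_comp (T T' T'' : topologicalType) n n' n''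
    (A : set (chart R T n)) (A' : set (chart R T' n')) (A'' : set (chart R T'' n''))
    (W : set T) (W' : set T') (f : T -> T') (h : T' -> T'') :
  charts A -> charts A' -> charts A'' -> covers A' W' ->
  open W -> open W' -> (forall x, W x -> W' (f x)) ->
  smooth_map A W A' f -> smooth_map A' W' A'' h -> smooth_map A W A'' (h \o f).
Proof.
move=> cA cA' cA'' cov oW oW' WW' [cf sf] [ch sh].
have chf x : W x -> {for x, continuous (h \o f)}.
  by move=> Wx; apply: continuous_comp; [exact: cf|apply: ch; exact: WW'].
split=> // c c'' Ac Ac'' k; apply: CkP => _ [x [[cx Wx] cfx] <-].
have [c' Ac' c'fx] := cov _ (WW' _ Wx).
have [oc oi Kc _ _] := cA _ Ac; have [oc' oi' Kc' _ _] := cA' _ Ac'.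
have [oc'' _ _ _ _] := cA'' _ Ac''.
pose O := (cdom c `&` W) `&` f @^-1` cdom c' `&` (h \o f) @^-1` cdom c''.
have ocW : open (cdom c `&` W) by exact: openI.
have oO : open O.
  have -> : O = ((cdom c `&` W) `&` f @^-1` cdom c') `&` ((cdom c `&` W) `&` (h \o f) @^-1` cdom c'').
    by rewrite /O setIACA setIid setIA.
  by apply: openI; apply: open_preimage_on => // y [_ Wy]; [exact: cf|exact: chf].
pose U := cto c @` O.
have oU : open U by apply: (chart_open_image (cA _ Ac)) => // y [[[]]].
pose O' := cdom c' `&` W' `&` h @^-1` cdom c''.
have oO' : open O'.
  apply: open_preimage_on => //; first exact: openI.
  by move=> y [_ W'y]; exact: ch.
have oU' : open (cto c' @` O') by apply: (chart_open_image (cA' _ Ac')) => // y [[]].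
have Ux : U (cto c x) by exists x.
apply: (@Ck_sub R _ _ k U); first by move=> _ ->.
apply: (@Ck_eq R _ _ k U ((cto c'' \o h \o cinv c') \o (cto c' \o f \o cinv c))) => //.
  by move=> _ [y [[[cy Wy] c'fy] _] <-] /=; rewrite Kc // Kc'.
apply: (Ck_comp oU oU') (sh c' c'' Ac' Ac'' k) _.
  by move=> _ [y [[[cy Wy] c'fy] c''y] <-] /=; rewrite Kc //; exists (f y) => //; split=> //; split=> //; exact: WW'.
apply: Ck_sub (sf c c' Ac Ac' k) => _ [y [[[cy Wy] c'fy] _] <-]; by exists y.
Qed.

(** The one-chart atlas of a vector space; it puts maps between coordinate spaces and maps of
    manifolds under the same composition lemmas. *)
Definition eucl n : set (chart R 'rV[R]_n n) := [set Chart setT id id].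

Lemma charts_eucl n : charts (@eucl n).
Proof.
move=> _ ->; split; [exact: openT|by rewrite image_id; exact: openT|by []| |].
all: by move=> x _; exact: cvg_id.
Qed.

Lemma smooth_euclP n p (U : set 'rV[R]_n) (F : 'rV[R]_n -> 'rV[R]_p) :
  smooth_map (@eucl n) U (@eucl p) F <-> smooth_on U F.
Proof.
split=> [[_ /(_ _ _ erefl erefl)]|sF].
  by rewrite /= preimage_setT setIT setTI image_id.
split=> [x Ux|_ _ -> ->]; first exact: (sF 0%N).1.
by rewrite /= preimage_setT setIT setTI image_id.
Qed.

Lemma smooth_cto (T : topologicalType) n (A : set (chart R T n)) S c :
  atlas_on S A -> A c -> smooth_map A (cdom c) (@eucl n) (cto c).
Proof.
move=> [_ cA _ tA] Ac; split=> [|c1 _ Ac1 ->]; first by have [] := cA _ Ac.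
by rewrite /= preimage_setT setIT; exact: tA.
Qed.

Lemma smooth_cinv (T : topologicalType) n (A : set (chart R T n)) S c :
  atlas_on S A -> A c -> smooth_map (@eucl n) (cto c @` cdom c) A (cinv c).
Proof.
move=> [_ cA _ tA] Ac; have [oc oi K _ ci] := cA _ Ac; split=> [_ [x cx <-]|_ c1 -> Ac1].
  exact: ci.
rewrite /= setTI image_id => k; apply: (Ck_sub _ (tA _ _ Ac Ac1 k)) => _ [[x cx <-]].
by rewrite /= K // => c1x; exists x.
Qed.

Lemma smooth_cst (T T' : topologicalType) n n' (A : set (chart R T n))
    (A' : set (chart R T' n')) (W : set T) (y : T') : smooth_map A W A' (cst y).
Proof.
split=> [x _|c c' _ _ k]; first exact: cst_continuous.
exact: (@Ck_cst R _ _ k _ (cto c' y)).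
Qed.

Lemma smooth_id (T : topologicalType) n (A : set (chart R T n)) S : atlas_on S A ->
  smooth_map A S A idfun.
Proof.
move=> [_ cA _ tA]; split=> [x _|c c' Ac Ac' k]; first exact: cvg_id.
by apply: (Ck_sub _ (tA _ _ Ac Ac' k)) => _ [x [[cx _] c'x] <-]; exists x.
Qed.

Lemma row_mx_coord p n1 n2 (a : 'M[R]_(p, n1)) (b : 'M[R]_(p, n2)) i j :
  row_mx a b i j = match fintype.split j with inl j => a i j | inr j => b i j end.
Proof. by rewrite mxE. Qed.

Lemma Ck_row_mx (V : normedModType R) k (U : set V) n1 n2 (F : V -> 'rV[R]_n1)
    (G : V -> 'rV[R]_n2) : open U -> Ck k U F -> Ck k U G ->
  Ck k U (fun x => row_mx (F x) (G x)).
Proof.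
move=> oU /(Ck_mxP _ _ oU) CF /(Ck_mxP _ _ oU) CG; apply/Ck_mxP => // i j.
case E : (fintype.split j) => [j'|j'].
  by apply: Ck_eq (CF i j') => // x _; rewrite row_mx_coord E.
by apply: Ck_eq (CG i j') => // x _; rewrite row_mx_coord E.
Qed.

Lemma charts_prod (T T' : topologicalType) n n' (A : set (chart R T n))
    (A' : set (chart R T' n')) : charts A -> charts A' -> charts (prod_atlas A A').
Proof.
move=> cA cA' _ [c Ac [c' Ac' <-]].
have [oc oi K ct ci] := cA _ Ac; have [oc' oi' K' ct' ci'] := cA' _ Ac'.
split=> /=.
- have -> : cdom c `*` cdom c' = fst @^-1` cdom c `&` snd @^-1` cdom c' by [].
  by apply: openI; apply: open_comp => // x _; [exact: cvg_fst|exact: cvg_snd].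
- have -> : [set row_mx (cto c p.1) (cto c' p.2) | p in cdom c `*` cdom c'] =
      lsubmx @^-1` (cto c @` cdom c) `&` rsubmx @^-1` (cto c' @` cdom c').
    apply/seteqP; split=> [_ [[x y] /= [cx cy] <-]|v [[x cx Ex] [y cy Ey]]].
      by split=> /=; rewrite ?row_mxKl ?row_mxKr; [exists x|exists y].
    by exists (x, y) => //=; rewrite Ex Ey hsubmxK.
  apply: openI; apply: open_comp => // v _; [exact: continuous_lsubmx|exact: continuous_rsubmx].
- by move=> [x y] [/= cx cy]; rewrite row_mxKl row_mxKr K // K'.
- move=> [x y] [/= cx cy]; apply: (@cvg_mx R _ (nbhs (x, y))) => i j.
  rewrite row_mx_coord; under eq_cvg do rewrite row_mx_coord.
  case: (fintype.split j) => [j'|j'].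
    have := @coord_continuous R 1 n i j' (cto c x); apply: cvg_trans.
    apply: (@cvg_comp _ _ _ (fun p : T * T' => cto c p.1) (fun M : 'rV[R]_n => M i j') (nbhs (x, y)) (nbhs (cto c x))) => //.
    apply: (@cvg_comp _ _ _ fst (cto c) (nbhs (x, y)) (nbhs x)); [exact: cvg_fst|exact: ct].
  have := @coord_continuous R 1 n' i j' (cto c' y); apply: cvg_trans.
  apply: (@cvg_comp _ _ _ (fun p : T * T' => cto c' p.2) (fun M : 'rV[R]_n' => M i j') (nbhs (x, y)) (nbhs (cto c' y))) => //.
  apply: (@cvg_comp _ _ _ snd (cto c') (nbhs (x, y)) (nbhs y)); [exact: cvg_snd|exact: ct'].
- move=> [x y] [/= cx cy].
  have c1 : {for row_mx (cto c x) (cto c' y), continuous (cinv c \o lsubmx)}.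
    by apply: continuous_comp; [exact: continuous_lsubmx|rewrite row_mxKl; exact: ci].
  have c2 : {for row_mx (cto c x) (cto c' y), continuous (cinv c' \o rsubmx)}.
    by apply: continuous_comp; [exact: continuous_rsubmx|rewrite row_mxKr; exact: ci'].
  exact: (cvg_pair c1 c2).
Qed.

Lemma covers_prod (T T' : topologicalType) n n' (A : set (chart R T n))
    (A' : set (chart R T' n')) W W' : covers A W -> covers A' W' ->
  covers (prod_atlas A A') (W `*` W').
Proof.
move=> cA cA' [x y] [/= /cA[c Ac cx] /cA'[c' Ac' cy]].
by exists (prod_chart c c') => //; exists c => //; exists c'.
Qed.

Lemma smooth_pair (T T1 T2 : topologicalType) n n1 n2 (A : set (chart R T n))
    (A1 : set (chart R T1 n1)) (A2 : set (chart R T2 n2)) W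
    (f : T -> T1) (h : T -> T2) : charts A -> charts A1 -> charts A2 -> open W ->
  smooth_map A W A1 f -> smooth_map A W A2 h ->
  smooth_map A W (prod_atlas A1 A2) (fun x => (f x, h x)).
Proof.
move=> cA cA1 cA2 oW [cf sf] [ch sh]; split=> [x Wx|c _ Ac [c1 Ac1 [c2 Ac2 <-]] k].
  by apply: cvg_pair; [exact: cf|exact: ch].
have [oc1 _ _ _ _] := cA1 _ Ac1; have [oc2 _ _ _ _] := cA2 _ Ac2.
have [oc oi Kc _ _] := cA _ Ac.
set U := cto c @` _.
have oU : open U.
  apply: chart_open_image; [exact: cA| |by move=> x [[]]].
  have -> : cdom c `&` W `&` (fun x => (f x, h x)) @^-1` cdom (prod_chart c1 c2) =
    (cdom c `&` W `&` f @^-1` cdom c1) `&` (cdom c `&` W `&` h @^-1` cdom c2).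
    by rewrite [RHS]setIACA setIid.
  by apply: openI; apply: open_preimage_on => //; try exact: openI; move=> x [_ Wx]; [exact: cf|exact: ch].
apply: (@Ck_eq R _ _ k U (fun z => row_mx ((cto c1 \o f \o cinv c) z) ((cto c2 \o h \o cinv c) z))) => //.
apply: Ck_row_mx => //.
  by apply: Ck_sub (sf c c1 Ac Ac1 k) => _ [x [[cx Wx] [/= h1 h2]] <-]; exists x.
by apply: Ck_sub (sh c c2 Ac Ac2 k) => _ [x [[cx Wx] [/= h1 h2]] <-]; exists x.
Qed.

Lemma smooth_lsubmx n1 n2 (U : set 'rV[R]_(n1 + n2)) : smooth_on U (lsubmx : 'rV[R]_(n1 + n2) -> 'rV[R]_n1).
Proof.
move=> k; apply: (Ck_sub (subsetT U)); apply/Ck_mxP => [|i j]; first exact: openT.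
apply: (@Ck_eq R _ _ k setT (fun x : 'rV[R]_(n1 + n2) => x 0 (lshift n2 j))); [exact: openT| |exact: Ck_coord].
by move=> x _; rewrite mxE ord1.
Qed.

Lemma smooth_rsubmx n1 n2 (U : set 'rV[R]_(n1 + n2)) : smooth_on U (rsubmx : 'rV[R]_(n1 + n2) -> 'rV[R]_n2).
Proof.
move=> k; apply: (Ck_sub (subsetT U)); apply/Ck_mxP => [|i j]; first exact: openT.
apply: (@Ck_eq R _ _ k setT (fun x : 'rV[R]_(n1 + n2) => x 0 (rshift n1 j))); [exact: openT| |exact: Ck_coord].
by move=> x _; rewrite mxE ord1.
Qed.

Lemma smooth_onid n (U : set 'rV[R]_n) : smooth_on U (id : 'rV[R]_n -> 'rV[R]_n).
Proof.
move=> k; apply: (Ck_sub (subsetT U)); apply/Ck_mxP => [|i j]; first exact: openT.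
by apply: (@Ck_eq R _ _ k setT (fun x : 'rV[R]_n => x 0 j)); [exact: openT|move=> x _; rewrite ord1|exact: Ck_coord].
Qed.

Lemma smooth_affine n p (A : 'M[R]_(n, p)) (b : 'rV[R]_p) (U : set 'rV[R]_n) :
  smooth_on U (fun v => v *m A + b).
Proof.
move=> k; apply: (Ck_sub (subsetT U)).
have oT : open (setT : set 'rV[R]_n) by exact: openT.
apply: (CkD oT) (Ck_cst _ _ _).
by apply: (Ck_mulmx oT) (Ck_cst _ _ _); exact: smooth_onid.
Qed.

End ChartCalculus.

(** * Integrals of continuous functions over segments *)

Section SegmentIntegral.
Context {R : realType}.
Local Notation mu := (@lebesgue_measure R).
Implicit Types (a b c s t : R) (f phi F : R -> R).

(** Continuity is two-sided even at the end points: C^1 pieces extend beyond their segment, so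
    [speed] satisfies it, and derivatives of primitives at the end points are ordinary ones. *)
Definition continuous_on a b phi : Prop := forall t, a <= t <= b -> {for t, continuous phi}.

Lemma continuous_on_integrable a b phi : continuous_on a b phi ->
  mu.-integrable `[a, b] (EFin \o phi).
Proof.
move=> cphi; apply: continuous_compact_integrable; first exact: segment_compact.
by apply: continuous_in_subspaceT => t; rewrite inE /= in_itv /= => /cphi.
Qed.

Definition clamp a b t : R := Num.max a (Num.min t b).

Lemma clamp_in a b t : a <= b -> a <= clamp a b t <= b.
Proof. by move=> ab; rewrite /clamp le_max lexx ge_max ab ge_min lexx orbT. Qed.

Lemma clamp_id a b t : a <= t <= b -> clamp a b t = t.
Proof. by move=> /andP[at_ tb]; rewrite /clamp min_l // max_r. Qed.

Lemma clamp_continuous a b : continuous (clamp a b).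
Proof.
move=> t; apply: (@continuous_max R R (cst a) (fun s => Num.min s b)); first exact: cst_continuous.
by apply: (@continuous_min R R id (cst b)); [exact: cvg_id|exact: cst_continuous].
Qed.

Lemma zero_derive_const a b F : a <= b ->
  (forall t, a <= t <= b -> is_derive t 1 F 0) -> F a = F b.
Proof.
move=> ab dF; have [t||t _] := @MVT_segment R F (cst 0) a b ab.
- by rewrite in_itv /= => /andP[at_ tb]; apply: dF; rewrite !ltW.
- apply: derivable_within_continuous => t; rewrite in_itv /= => /dF[].
  by [].
- by rewrite /cst mul0r => /subr0_eq.
Qed.

(** The integrand is extended continuously to the line by [clamp], and the primitive starts from
    [a - 1], so that it has a two-sided derivative at [a] and [b] as well. Integrals then become
    differences of values. *)
Lemma primitive_exists a b phi : a <= b -> continuous_on a b phi ->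
  exists2 F, forall t, a <= t <= b -> is_derive t 1 F (phi t) &
    forall s t, a <= s -> s <= t -> t <= b ->
      \int[mu]_(x in `[s, t]) phi x = F t - F s.
Proof.
move=> ab cphi; pose psi := phi \o clamp a b.
have cpsi : continuous psi.
  move=> t; apply: continuous_comp; first exact: clamp_continuous.
  by apply: cphi; exact: clamp_in.
have cpsi' s t : continuous_on s t psi by move=> u _; exact: cpsi.
pose F x := \int[mu]_(t in `[a - 1, x]) psi t.
have E t : a <= t <= b -> psi t = phi t by move=> tab; rewrite /psi /= clamp_id.
exists F => [t /andP[at_ tb]|s t as_ st tb].
  have tb1 : t < b + 1 by lra.
  have at1 : a - 1 < t by lra.
  have [dF F'] := continuous_FTC1_closed tb1 (continuous_on_integrable (cpsi' (a - 1) (b + 1))) at1 (cpsi t).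
  by split; [exact: dF|rewrite -derive1E F' E // at_].
have -> : \int[mu]_(x in `[s, t]) phi x = \int[mu]_(x in `[s, t]) psi x.
  apply: eq_Rintegral => x; rewrite inE /= in_itv /= => /andP[sx xt].
  by rewrite E // (le_trans as_ sx) (le_trans xt tb).
rewrite /F (Rintegral_itvB (continuous_on_integrable (cpsi' (a - 1) t))) ?bnd_simp //; last lra.
rewrite Rintegral_itv_obnd_cbnd //.
apply: (integrableS _ _ _ (continuous_on_integrable (cpsi' s t))) => //.
by apply: subset_itvr; rewrite bnd_simp.
Qed.

Lemma integral_derive a b F phi : a <= b -> continuous_on a b phi ->
  (forall t, a <= t <= b -> is_derive t 1 F (phi t)) ->
  \int[mu]_(x in `[a, b]) phi x = F b - F a.
Proof.
move=> ab cphi dF; have [P dP ->] := primitive_exists ab cphi; rewrite ?lexx //.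
have := @zero_derive_const a b (F \- P) ab.
have H : forall t, a <= t <= b -> is_derive t 1 (F \- P) 0.
  move=> t tab; rewrite -(subrr (phi t)).
  by apply: is_deriveB; [exact: dF|exact: dP].
by move=> /(_ H) /=; lra.
Qed.

Lemma integral_shift a b c phi : a <= b -> continuous_on a b phi ->
  \int[mu]_(x in `[a + c, b + c]) phi (x - c) = \int[mu]_(x in `[a, b]) phi x.
Proof.
move=> ab cphi; have [P dP ->] := primitive_exists ab cphi; rewrite ?lexx //.
have sh t : is_derive t 1 (fun x => x - c) 1.
  have := @is_deriveB R R R id (cst c) t 1 1 0 _ _; rewrite subr0; exact.
have -> : P b - P a = (P \o (fun x => x - c)) (b + c) - (P \o (fun x => x - c)) (a + c).
  by rewrite /= !addrK.
apply: integral_derive; first by rewrite lerD2r.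
  move=> t tab; apply: (@continuous_comp _ _ _ (fun x => x - c) phi); first exact: shift_continuous.
  by apply: cphi; move: tab; lra.
move=> t tab; rewrite -[phi _]mulr1; apply: is_derive1_comp.
by apply: dP; move: tab; lra.
Qed.

Lemma integral_opp a b phi : a <= b -> continuous_on a b phi ->
  \int[mu]_(x in `[- b, - a]) phi (- x) = \int[mu]_(x in `[a, b]) phi x.
Proof.
move=> ab cphi; have [P dP ->] := primitive_exists ab cphi; rewrite ?lexx //.
have op t : is_derive t 1 (fun x : R => - x) (-1) by exact: is_deriveN.
have -> : P b - P a = - P (- - a) - - P (- - b) by rewrite !opprK addrC.
apply: (@integral_derive _ _ (fun x => - P (- x))); first by rewrite lerN2.
  move=> t tab; apply: (@continuous_comp _ _ _ (fun x => - x) phi); first exact: opp_continuous.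
  by apply: cphi; move: tab; lra.
move=> t tab; have -> : phi (- t) = - (phi (- t) * -1) by ring.
apply: is_deriveN; apply: (@is_derive1_comp _ P (fun x => - x)).
by apply: dP; move: tab; lra.
Qed.

Lemma integral_split a b c phi : a <= c -> c <= b -> continuous_on a b phi ->
  \int[mu]_(x in `[a, b]) phi x =
  \int[mu]_(x in `[a, c]) phi x + \int[mu]_(x in `[c, b]) phi x.
Proof.
move=> ac cb cphi; have ab := le_trans ac cb.
by have [P dP HP] := primitive_exists ab cphi; rewrite !HP ?lexx //; ring.
Qed.

Lemma integrable_oo_cc a b f : mu.-integrable `]a, b[ (EFin \o f) ->
  mu.-integrable `[a, b] (EFin \o f).
Proof.
move=> /integrableP[mf fi]; apply/integrableP; split.
  by apply/measurable_EFinP; apply: measurable_fun_itv_cc; apply/measurable_EFinP; exact: mf.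
by rewrite integral_itv_bndoo //; exact: measurableT_comp.
Qed.

(** At the junctions of a piecewise curve [speed] need not be that of either piece; equality on the
    open interval suffices, the two end points being negligible. *)
Lemma integral_oo_eq a b f phi : mu.-integrable `[a, b] (EFin \o phi) ->
  (forall t, a < t < b -> f t = phi t) ->
  mu.-integrable `[a, b] (EFin \o f) /\
  \int[mu]_(x in `[a, b]) f x = \int[mu]_(x in `[a, b]) phi x.
Proof.
move=> ic E.
have ip : mu.-integrable `]a, b[ (EFin \o phi).
  by apply: (integrableS _ _ _ ic) => //; exact: subset_itv_oo_cc.
have io : mu.-integrable `]a, b[ (EFin \o f).
  apply: eq_integrable ip => // t; rewrite inE /= in_itv /= => tab.
  by rewrite /= E.
split; first exact: integrable_oo_cc.
congr fine; apply: eq_integral_itv_bounded.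
- by apply/measurable_EFinP; exact: (measurable_int _ io).
- by apply/measurable_EFinP; exact: (measurable_int _ ip).
- by move=> t; rewrite in_itv /= => /E.
Qed.

Lemma integral_cat a b c f : a <= b -> b <= c ->
  mu.-integrable `[a, b] (EFin \o f) -> mu.-integrable `[b, c] (EFin \o f) ->
  mu.-integrable `[a, c] (EFin \o f) /\
  \int[mu]_(x in `[a, c]) f x =
  \int[mu]_(x in `[a, b]) f x + \int[mu]_(x in `[b, c]) f x.
Proof.
move=> ab bc i1 i2.
have i3 : mu.-integrable `]b, c] (EFin \o f).
  by apply: (integrableS _ _ _ i2) => //; apply: subset_itvr; rewrite bnd_simp.
have E : `[a, c]%classic = `[a, b] `|` `]b, c].
  by rewrite -itv_bndbnd_setU ?bnd_simp.
have i : mu.-integrable `[a, c] (EFin \o f).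
  have mf : measurable_fun `[a, c] (EFin \o f).
    by rewrite E; apply/measurable_funU => //; split; [exact: (measurable_int mu i1)|exact: (measurable_int mu i3)].
  apply/integrableP; split=> //; rewrite E ge0_integral_setU //=.
  - by apply: lte_add_pinfty; [case/integrableP : i1|case/integrableP : i3].
  - by rewrite -E; apply/measurable_EFinP; apply: measurableT_comp => //; exact/measurable_EFinP.
  - by apply/disj_setPS => t [/=]; rewrite !in_itv /= => /andP[_ h1] /andP[]; rewrite ltNge h1.
split=> //; have := Rintegral_itvB i; move=> /(_ b); rewrite !bnd_simp => /(_ ab bc).
by rewrite (Rintegral_itv_obnd_cbnd i3) => <-; ring.
Qed.

End SegmentIntegral.

(** * Velocity and speed of curves, and their independence of charts *)

Section Velocity.
Context {R : realType}.

Lemma near_eq_continuous (T U : topologicalType) (f h : T -> U) t :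
  {near t, f =1 h} -> {for t, continuous f} -> {for t, continuous h}.
Proof.
move=> E cf; rewrite /prop_for /continuous_at -(nbhs_singleton E).
exact: cvg_trans (near_eq_cvg E) cf.
Qed.

Lemma cvg_coord (T : Type) (F : set_system T) {FF : Filter F} p q
    (f : T -> 'M[R]_(p, q)) (a : 'M[R]_(p, q)) i j :
  f @ F --> a -> f x i j @[x --> F] --> a i j.
Proof.
move=> fa; exact: (@cvg_comp _ _ _ f (fun N : 'M[R]_(p, q) => N i j) F
  (nbhs a) (nbhs (a i j)) fa (@coord_continuous R p q i j a)).
Qed.

Lemma cvg_trmx (T : Type) (F : set_system T) {FF : Filter F} p q
    (f : T -> 'M[R]_(p, q)) (a : 'M[R]_(p, q)) : f @ F --> a -> (f x)^T @[x --> F] --> a^T.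
Proof.
move=> fa; apply: cvg_mx => i j; rewrite mxE; under eq_cvg do rewrite mxE.
exact: cvg_coord.
Qed.

Lemma cvg_mulmx (T : Type) (F : set_system T) {FF : Filter F} p q r
    (f : T -> 'M[R]_(p, q)) (h : T -> 'M[R]_(q, r)) (a : 'M[R]_(p, q)) (b : 'M[R]_(q, r)) :
  f @ F --> a -> h @ F --> b -> f x *m h x @[x --> F] --> a *m b.
Proof.
move=> fa hb; apply: cvg_mx => i j; rewrite mxE; under eq_cvg do rewrite mxE.
by apply: cvg_sumr => k; apply: cvgM; exact: cvg_coord.
Qed.

Lemma derive1_comp_rV n p (F : 'rV[R]_n -> 'rV[R]_p) (s : R -> 'rV[R]_n) (t : R) :
  differentiable F (s t) -> derivable s t 1 ->
  derivable (F \o s) t 1 /\ derive1 (F \o s) t = derive1 s t *m jacobian F (s t).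
Proof.
move=> dF /derivable1_diffP ds; have D := differentiable_comp ds dF.
split; first exact/derivable1_diffP.
rewrite derive1E' // diff_comp //= -derive1E' // -deriveE //.
exact: deriveEjacobian.
Qed.

Section Curves.
Context {n : nat} {M : topologicalType} {A : set (chart R M n)}.
Hypothesis atA : atlas_on setT A.

Let cA : charts A. Proof. by have [] := atA. Qed.

Lemma atlas_cover x : exists2 c, A c & cdom c x.
Proof. by have [_ _ E _] := atA; have : [set: M] x by []; rewrite -E => -[c]; exists c. Qed.

Lemma near_cdom (s : R -> M) t c : A c -> cdom c (s t) -> {for t, continuous s} ->
  \forall u \near t, cdom c (s u).
Proof. by move=> Ac ct cs; apply: cs; have [oc _ _ _ _] := cA Ac; exact: open_nbhs_nbhs. Qed.

Lemma smooth_local_differentiable (f : M -> M) c c' x : smooth_map A setT A f ->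
  A c -> A c' -> cdom c x -> cdom c' (f x) ->
  exists U, [/\ open U, U (cto c x), smooth_on U (cto c' \o f \o cinv c) &
    forall y, cdom c y -> cdom c' (f y) -> U (cto c y)].
Proof.
move=> [cf sf] Ac Ac' cx c'x; have [oc _ _ _ _] := cA Ac; have [oc' _ _ _ _] := cA Ac'.
exists (cto c @` (cdom c `&` setT `&` f @^-1` cdom c')); split.
- apply: (chart_open_image (cA Ac)); last by move=> y [[]].
  by rewrite setIT; apply: open_preimage_on => // y _; exact: cf.
- by exists x.
- exact: sf.
- by move=> y cy c'y; exists y.
Qed.

Lemma velocity_comp (f : M -> M) (s : R -> M) t c c' : smooth_map A setT A f ->
  A c -> A c' -> (\forall u \near t, cdom c (s u) /\ cdom c' (f (s u))) ->
  derivable (cto c \o s) t 1 ->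
  derivable (cto c' \o f \o s) t 1 /\
  derive1 (cto c' \o f \o s) t =
    derive1 (cto c \o s) t *m jacobian (cto c' \o f \o cinv c) (cto c (s t)).
Proof.
move=> sf Ac Ac' nD ds; have [ct c't] := nbhs_singleton nD.
have [U [oU Ut sU _]] := smooth_local_differentiable sf Ac Ac' ct c't.
have dF : differentiable (cto c' \o f \o cinv c) ((cto c \o s) t) by exact: (C1_differentiable oU (sU 1%N)).
have [d1 d2] := derive1_comp_rV dF ds.
have E : {near t, ((cto c' \o f \o cinv c) \o (cto c \o s)) =1 (cto c' \o f \o s)}.
  by apply: filterS nD => u [cu _] /=; have [_ _ K _ _] := cA Ac; rewrite K.
split; first exact: near_eq_derivable d1.
rewrite -[RHS]d2 !derive1E; apply: near_eq_derive.
by apply: filterS E => u ->.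
Qed.

(** Velocities in two charts differ by a Jacobian that varies continuously, so one chart is enough;
    with [f := idfun] this is the independence of [C1_at] from the chart. *)
Lemma C1_chart (f : M -> M) (s : R -> M) t c : smooth_map A setT A f ->
  A c -> cdom c (s t) -> {for t, continuous s} ->
  (\forall u \near t, derivable (cto c \o s) u 1) ->
  {for t, continuous (derive1 (cto c \o s))} ->
  C1_at A (f \o s) t.
Proof.
move=> sf Ac ct cs ds cds.
have cfs : {for t, continuous (f \o s)} by apply: continuous_comp => //; exact: sf.1.
split; first exact: cfs.
move=> c' Ac' c't.
have nD : \forall u \near t, cdom c (s u) /\ cdom c' (f (s u)).
  by apply: filterI; [exact: near_cdom|exact: (@near_cdom (f \o s))].
have nV : \forall u \near t, derivable (cto c' \o f \o s) u 1 /\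
  derive1 (cto c' \o f \o s) u =
    derive1 (cto c \o s) u *m jacobian (cto c' \o f \o cinv c) (cto c (s u)).
  apply: filterS2 (near_join nD) ds => u nDu dsu; exact: velocity_comp.
split; first by apply: filterS nV => u [].
have [U [oU Ut sU _]] := smooth_local_differentiable sf Ac Ac' ct c't.
have cJ : {for cto c (s t), continuous (jacobian (cto c' \o f \o cinv c))}.
  by have [cJ _] := Ck_jacobian oU (sU 1%N); exact: cJ.
have cc : {for t, continuous (cto c \o s)}.
  by apply: continuous_comp => //; have [_ _ _ ct' _] := cA Ac; exact: ct'.
apply: near_eq_continuous (cvg_mulmx cds (continuous_comp cc cJ)).
by apply: filterS nV => u [_ ->].
Qed.

Lemma C1_smooth (f : M -> M) (s : R -> M) t : smooth_map A setT A f ->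
  C1_at A s t -> C1_at A (f \o s) t.
Proof.
move=> sf [cs H]; have [c Ac ct] := atlas_cover (s t).
by have [h1 h2] := H c Ac ct; exact: (C1_chart sf Ac).
Qed.

Context {g : gram R M n}.
Hypothesis gm : riemannian_metric A g.

Lemma smooth_idT : smooth_map A setT A idfun.
Proof. exact: smooth_id atA. Qed.

(** The chart behind the value picked by [xget] is unknown, so every candidate value is shown to be
    the announced one. The case [f := idfun] is the independence of the speed from the chart. *)
Lemma speed_iso (f : M -> M) (s : R -> M) t c : smooth_map A setT A f ->
  preserves_metric A g f -> A c -> (\forall u \near t, cdom c (s u)) ->
  {for t, continuous s} ->
  derivable (cto c \o s) t 1 ->
  speed A g (f \o s) t =
    Num.sqrt (inner (g c (s t)) (derive1 (cto c \o s) t) (derive1 (cto c \o s) t)).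
Proof.
move=> sf pf Ac nc cs ds; have ct := nbhs_singleton nc.
rewrite /speed; set P := [set r | _].
have HP r : P r -> r = Num.sqrt (inner (g c (s t)) (derive1 (cto c \o s) t) (derive1 (cto c \o s) t)).
  move=> [c' [Ac' c't ->]] /=.
  have cfs : {for t, continuous (f \o s)} by apply: continuous_comp => //; exact: sf.1.
  have nD : \forall u \near t, cdom c (s u) /\ cdom c' (f (s u)).
    by apply: filterI => //; exact: (@near_cdom (f \o s)).
  have [_ E] := velocity_comp sf Ac Ac' nD ds.
  rewrite [derive1 _ t]E; congr Num.sqrt.
  have [U [oU Ut sU _]] := smooth_local_differentiable sf Ac Ac' ct c't.
  rewrite -deriveEjacobian; last exact: (C1_differentiable oU (sU 1%N)).
  exact: pf.
apply: HP; apply: xgetPex; have [c' Ac' c't] := atlas_cover (f (s t)).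
by eexists; exists c'; split; [exact: Ac'|exact: c't|reflexivity].
Qed.

Lemma speedE (s : R -> M) t c : A c -> (\forall u \near t, cdom c (s u)) ->
  {for t, continuous s} -> derivable (cto c \o s) t 1 ->
  speed A g s t =
    Num.sqrt (inner (g c (s t)) (derive1 (cto c \o s) t) (derive1 (cto c \o s) t)).
Proof. by apply: (@speed_iso idfun); [exact: smooth_idT|case: gm]. Qed.

Lemma C1_near (s : R -> M) t c : A c -> cdom c (s t) -> C1_at A s t ->
  \forall u \near t, [/\ cdom c (s u), \forall w \near u, cdom c (s w),
    {for u, continuous s} & derivable (cto c \o s) u 1].
Proof.
move=> Ac ct [cs /(_ c Ac ct)[ds _]].
apply: filterS2 (near_join (near_cdom Ac ct cs)) ds => u nu du; split=> //.
  exact: nbhs_singleton nu.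
have cc : {for u, continuous (cto c \o s)}.
  by apply: differentiable_continuous; exact/derivable1_diffP.
have [_ _ K _ ci] := cA Ac.
have E : {near u, (cinv c \o (cto c \o s)) =1 s} by apply: filterS nu => w cw /=; rewrite K.
apply: (near_eq_continuous E); apply: (continuous_comp cc).
by apply: ci; exact: nbhs_singleton nu.
Qed.

Lemma speed_continuous (s : R -> M) t : C1_at A s t -> {for t, continuous (speed A g s)}.
Proof.
move=> Cs; have [c Ac ct] := atlas_cover (s t).
have [cs /(_ c Ac ct)[ds cds]] := Cs.
have nE : \forall u \near t, speed A g s u = Num.sqrt (inner ((g c \o cinv c) (cto c (s u)))
    (derive1 (cto c \o s) u) (derive1 (cto c \o s) u)).
  apply: filterS (C1_near Ac ct Cs) => u [cu nu csu dsu]; rewrite (speedE Ac) //=.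
  by have [_ _ K _ _] := cA Ac; rewrite K.
have cc : {for t, continuous (cto c \o s)}.
  by apply: continuous_comp => //; have [_ _ _ ct' _] := cA Ac; exact: ct'.
have cg : {for cto c (s t), continuous (g c \o cinv c)}.
  by have [_ _ sg _] := gm; apply: (sg c Ac 0%N).1; exists (s t).
have ci : {for t, continuous (fun u => inner ((g c \o cinv c) (cto c (s u)))
    (derive1 (cto c \o s) u) (derive1 (cto c \o s) u))}.
  exact: (@cvg_coord _ _ _ _ _ _ _ 0 0
    (cvg_mulmx (cvg_mulmx cds (continuous_comp cc cg)) (cvg_trmx cds))).
apply: (near_eq_continuous _ (continuous_comp ci (@sqrt_continuous _ _))).
by apply: filterS nE => u ->.
Qed.

Lemma speed_ge0 (s : R -> M) t : 0 <= speed A g s t.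
Proof.
rewrite /speed; set P := [set r | _].
have [Pex|nP] := pselect (exists r, P r).
  by have [c [_ _ ->]] := xgetPex 0 Pex; exact: sqrtr_ge0.
by rewrite xgetPN // => r Pr; apply: nP; exists r.
Qed.

Lemma speed_near_eq (s s' : R -> M) t : {near t, s =1 s'} -> speed A g s t = speed A g s' t.
Proof.
move=> E; have Et := nbhs_singleton E.
have D c : derive1 (cto c \o s) t = derive1 (cto c \o s') t.
  by rewrite !derive1E; apply: near_eq_derive; apply: filterS E => u /= ->.
pose S (y : M) (V : chart R M n -> 'rV[R]_n) :=
  [set r | exists c, [/\ A c, cdom c y & r = Num.sqrt (inner (g c y) (V c) (V c))]].
rewrite -[LHS]/(xget 0 (S (s t) (fun c => derive1 (cto c \o s) t))).
rewrite -[RHS]/(xget 0 (S (s' t) (fun c => derive1 (cto c \o s') t))) Et.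
by congr (xget 0 (S _ _)); apply/funext => c; exact: D.
Qed.

End Curves.
End Velocity.

(** * Piecewise C^1 curves as chains of C^1 steps *)

Section Chains.
Context {R : realType}.
Local Notation mu := (@lebesgue_measure R).

Lemma near_comp (T U : topologicalType) (f : T -> U) (P : U -> Prop) t :
  {for t, continuous f} -> (\forall v \near f t, P v) -> \forall u \near t, P (f u).
Proof. by move=> cf; exact: cf. Qed.

Lemma derive1_affine n (f : R -> 'rV[R]_n) (e c t : R) : derivable f (e * t + c) 1 ->
  derivable (fun u => f (e * u + c)) t 1 /\
  derive1 (fun u => f (e * u + c)) t = e *: derive1 f (e * t + c).
Proof.
move=> df; have D (u : R) : is_derive u 1 (fun u : R => e * u + c) e.
  have H := @is_deriveM R R (cst e) id u 1 0 1 _ _.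
  rewrite scaler0 addr0 [e%:A]mulr1 in H.
  have := @is_deriveD R R R _ (cst c) u 1 _ 0 (H _ _) _; rewrite addr0; exact.
have dg : differentiable (fun u : R => e * u + c) t by apply/derivable1_diffP; case: (D t).
have df' : differentiable f ((fun u : R => e * u + c) t) by apply/derivable1_diffP.
have Dc := differentiable_comp dg df'.
split; first by apply/derivable1_diffP.
rewrite [LHS](derive1E' Dc) diff_comp //=.
have -> : 'd (fun u : R => e * u + c) t 1 = e *: (1 : R).
  by rewrite -deriveE // [RHS]mulr1; case: (D t).
by rewrite linearZ /= derive1E'.
Qed.

Context {n : nat} {M : topologicalType} {A : set (chart R M n)} {g : gram R M n}.
Hypothesis atA : atlas_on setT A.
Hypothesis gm : riemannian_metric A g.

(** The case [e = 1] translates the parameter, for concatenating curves, and [e = -1] reverses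
    it. *)
Lemma C1_affine (s : R -> M) (e c t : R) : e = 1 \/ e = -1 -> C1_at A s (e * t + c) ->
  C1_at A (fun u => s (e * u + c)) t /\
  speed A g (fun u => s (e * u + c)) t = speed A g s (e * t + c).
Proof.
move=> e1 Cs; have [h Ah ht] := atlas_cover atA (s (e * t + c)).
have ca (u : R) : {for u, continuous (fun u : R => e * u + c)}.
  apply: (@continuousD R R R ( *%R e) (cst c)); last exact: cst_continuous.
  exact: mulrl_continuous.
have nE := C1_near atA Ah ht Cs.
have [cs /(_ h Ah ht)[ds cds]] := Cs.
have cs' : {for t, continuous (fun u => s (e * u + c))}.
  exact: (@continuous_comp _ _ _ (fun u : R => e * u + c) s t (ca t) cs).
have nD : \forall u \near t, derivable (cto h \o s) (e * u + c) 1 by exact: (@near_comp _ _ _ (fun v => derivable (cto h \o s) v 1) t (ca t) ds).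
have D (u : R) : derivable (cto h \o s) (e * u + c) 1 ->
    derivable (cto h \o (fun u => s (e * u + c))) u 1 /\
    derive1 (cto h \o (fun u => s (e * u + c))) u = e *: derive1 (cto h \o s) (e * u + c).
  by move=> du; exact: derive1_affine.
have C : C1_at A (fun u => s (e * u + c)) t.
  apply: (C1_chart atA (smooth_idT atA) Ah ht cs').
    by apply: filterS nD => u /D[].
  apply: (@near_eq_continuous _ _ (fun u => e *: derive1 (cto h \o s) (e * u + c))).
    by apply: filterS nD => u /D[].
  apply: continuousZr.
  exact: (@continuous_comp _ _ _ (fun u : R => e * u + c) _ t (ca t) cds).
split; first exact: C.
have [_ nh1 _ d1] := nbhs_singleton nE.
have [_ nh2 _ d2] := nbhs_singleton (C1_near atA Ah (s := fun u => s (e * u + c)) ht C).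
rewrite (speedE atA gm Ah nh2 cs' d2) (speedE atA gm Ah nh1 cs d1).
have [_ ->] := D t d1; congr Num.sqrt.
by case: e1 => ->; rewrite ?scale1r // /inner scaleN1r mulNmx linearN /= mulmxN mulNmx opprK.
Qed.

Local Opaque speed C1_at.

Definition step (x y : M) (l : R) : Prop := exists a b s,
  [/\ a <= b, forall t, a <= t <= b -> C1_at A s t, s a = x, s b = y &
      l = \int[mu]_(t in `[a, b]) speed A g s t].

(** Piecewise C^1 curves without a common parameter: concatenation, reversal and images under
    isometries become inductions, with no junctions to check. [curve_chain] and [chain_curve] pass
    to actual curves and back, so the distances are unchanged. *)
Inductive chain : M -> M -> R -> Prop :=
| chain_nil x : chain x x 0
| chain_cons x y z l l' : step x y l -> chain y z l' -> chain x z (l + l').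

Lemma step_continuous a b s : (forall t, a <= t <= b -> C1_at A s t) ->
  continuous_on a b (speed A g s).
Proof. by move=> H t /H; exact: speed_continuous. Qed.

Lemma chain_step x y l : step x y l -> chain x y l.
Proof. by move=> H; rewrite -[l]addr0; apply: chain_cons H (chain_nil y). Qed.

Lemma chain_cat x y z l l' : chain x y l -> chain y z l' -> chain x z (l + l').
Proof.
move=> H; elim: H z l' => [{}x|{}x {}y w {}l l1 S _ IH] z l' C; first by rewrite add0r.
by rewrite -addrA; apply: chain_cons S _; exact: IH.
Qed.

Lemma step_rev x y l : step x y l -> step y x l.
Proof.
move=> [a [b [s [ab Cs sa sb ->]]]].
exists (- b), (- a), (fun u => s (-1 * u + 0)); split.
- by rewrite lerN2.
- move=> t tab; have Ct : C1_at A s (-1 * t + 0) by apply: Cs; move: tab; lra.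
  exact: (C1_affine (or_intror erefl) Ct).1.
- by rewrite mulN1r opprK addr0.
- by rewrite mulN1r opprK addr0.
rewrite -(integral_opp ab (step_continuous Cs)).
apply: eq_Rintegral => t; rewrite inE /= in_itv /= => tab.
have Ct : C1_at A s (-1 * t + 0) by apply: Cs; move: tab; lra.
by have [_ ->] := C1_affine (or_intror erefl) Ct; rewrite mulN1r addr0.
Qed.

Lemma chain_rev x y l : chain x y l -> chain y x l.
Proof.
elim=> [{}x|{}x {}y z l1 l2 S _ IH]; first exact: chain_nil.
by rewrite addrC; apply: chain_cat IH _; apply: chain_step; exact: step_rev.
Qed.

Lemma step_ge0 x y l : step x y l -> 0 <= l.
Proof. by move=> [a [b [s [_ _ _ _ ->]]]]; apply: Rintegral_ge0 => t _; exact: speed_ge0. Qed.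

Lemma chain_ge0 x y l : chain x y l -> 0 <= l.
Proof. by elim=> // x0 y0 z l1 l2 /step_ge0 h _; exact: addr_ge0. Qed.

Lemma piece_integral a b (gamma s : R -> M) :
  (forall t, a <= t <= b -> C1_at A s t) ->
  (forall t, a <= t <= b -> gamma t = s t) ->
  mu.-integrable `[a, b] (EFin \o speed A g gamma) /\
  \int[mu]_(t in `[a, b]) speed A g gamma t = \int[mu]_(t in `[a, b]) speed A g s t.
Proof.
move=> Cs E; apply: integral_oo_eq; first exact/continuous_on_integrable/step_continuous.
move=> t /andP[at_ tb]; apply: speed_near_eq.
have : \forall u \near t, u \in `]a, b[ by apply: near_in_itvoo; rewrite in_itv /= at_.
by apply: filterS => u; rewrite in_itv /= => /andP[au ub]; apply: E; rewrite !ltW.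
Qed.

Lemma curve_chain a b (gamma : R -> M) (s : seq R) : itv_partition a b s ->
  (forall i, (i < size s)%N -> exists sigma : R -> M,
      forall t, t \in `[nth a (a :: s) i, nth a s i] ->
        C1_at A sigma t /\ gamma t = sigma t) ->
  mu.-integrable `[a, b] (EFin \o speed A g gamma) /\
  chain (gamma a) (gamma b) (curve_length A g a b gamma).
Proof.
elim: s a => [|m s IH] a.
  move=> /itv_partition_nil -> _; rewrite /curve_length; split; last first.
    by rewrite set_itv1 Rintegral_set1; exact: chain_nil.
  have c0 : continuous_on b b (cst 0 : R -> R) by move=> t _; exact: cst_continuous.
  apply: (integral_oo_eq (continuous_on_integrable c0) _).1 => t /andP[h1 h2].
  by have := lt_trans h1 h2; rewrite ltxx.
move=> part H; have part' := itv_partition_cons part.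
have am : a <= m by case: part => /= /andP[/ltW].
have mb := itv_partition_le part'.
have [|i2 C2] := IH m part'.
  move=> i si; have [sigma Hs] := H i.+1 si; exists sigma => t.
  have -> : nth m (m :: s) i = nth a (m :: s) i by apply: set_nth_default; rewrite /= ltnS ltnW.
  have -> : nth m s i = nth a s i by exact: set_nth_default.
  exact: Hs.
have [sigma Hs] := H 0%N isT; rewrite /= in Hs.
have Cs t : a <= t <= m -> C1_at A sigma t.
  by move=> tam; apply: (Hs t _).1; rewrite in_itv.
have E t : a <= t <= m -> gamma t = sigma t.
  by move=> tam; apply: (Hs t _).2; rewrite in_itv.
have [i1 E1] := piece_integral Cs E.
have [i3 E3] := integral_cat am mb i1 i2; split; first exact: i3.
rewrite /curve_length E3; apply: chain_cons C2.
exists a, m, sigma; split; [exact: am|exact: Cs| | |exact: E1].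
  by rewrite E ?lexx.
by rewrite E ?lexx ?am.
Qed.

Lemma chain_curve x y l : chain x y l -> exists a b gamma,
  [/\ a <= b, piecewise_C1 A a b gamma, gamma a = x, gamma b = y &
      l = curve_length A g a b gamma].
Proof.
elim=> [{}x|{}x {}y z l1 l2 [a [b [s [ab Cs sa sb El1]]]] _ [a' [b' [gamma [ab' [q part pcs] ga gb El2]]]]].
  exists 0, 0, (fun=> x); split; [by []|by exists [::]|by []|by []|].
  by rewrite /curve_length set_itv1 Rintegral_set1.
(* A partition is strictly increasing, so a first piece with [a = b] must be dropped instead of
   concatenated. *)
move: ab; rewrite le_eqVlt => /orP[/eqP ab|ab].
  exists a', b', gamma; split; [exact: ab'|by exists q| |exact: gb|].
    by rewrite ga -sb -ab sa.
  rewrite El1 -ab set_itv1 Rintegral_set1 add0r; exact: El2.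
(* The first piece is translated in time so that it ends at [a'], where the remaining curve
   starts. *)
pose c := a' - b; pose s' u := s (1 * u + (- c)).
pose gam u := if u <= a' then s' u else gamma u.
have Cs' t : a + c <= t <= a' -> C1_at A s' t /\ speed A g s' t = speed A g s (t - c).
  move=> tc; have Ct : C1_at A s (1 * t + - c) by apply: Cs; move: tc; rewrite /c; lra.
  have [C S] := C1_affine (or_introl erefl) Ct.
  split; first exact: C.
  have -> : t - c = 1 * t - c by rewrite mul1r.
  exact: S.
have ac : a + c < a' by rewrite /c; lra.
have gam1 t : a + c <= t <= a' -> gam t = s' t by move=> /andP[_ ta]; rewrite /gam ta.
have gam2 t : a' <= t -> gam t = gamma t.
  rewrite le_eqVlt => /orP[/eqP <-|ta]; last by rewrite /gam leNgt ta.
  by rewrite /gam lexx /s' mul1r /c opprB subrKC sb ga.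
have pg : piecewise_C1 A (a + c) b' gam.
  clear El1 El2; exists (a' :: q).
    by case: part => p1 p2; split=> //=; rewrite ac.
  case=> [_|i si] /=.
    by exists s' => t; rewrite in_itv /= => ti; split; [exact: (Cs' t ti).1|exact: gam1].
  have [sigma Hs] := pcs i si; exists sigma => t ti.
  have ti' : t \in `[nth a' (a' :: q) i, nth a' q i].
    move: ti; rewrite (set_nth_default a' (a + c) (n := i)) /=; last by rewrite ltnS ltnW.
    by rewrite (set_nth_default a' (a + c) (s := q)).
  have [h1 h2] := Hs t ti'; split; first exact: h1.
  rewrite -h2; apply: gam2.
  move: ti'; rewrite in_itv /= => /andP[h3 _]; apply: le_trans h3.
  have iq : (i < (size q).+1)%N by rewrite ltnS ltnW.
  rewrite (set_nth_default b' a' (s := a' :: q) iq).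
  exact: (itv_partition_nth_ge iq part).
have gx : gam (a + c) = x.
  by clear El1 El2; rewrite gam1 ?lexx ?ltW // /s' mul1r addrK.
have gz : gam b' = z by clear El1 El2; rewrite gam2.
have le1 : a + c <= b' by clear El1 El2; rewrite (le_trans (ltW ac)).
have [i1 E1] := piece_integral (fun t h => (Cs' t h).1) gam1.
have [i2 C2] := curve_chain part pcs.
have [i2' E2] : mu.-integrable `[a', b'] (EFin \o speed A g gam) /\
    \int[mu]_(t in `[a', b']) speed A g gam t = \int[mu]_(t in `[a', b']) speed A g gamma t.
  apply: (integral_oo_eq i2) => t /andP[at_ _]; apply: speed_near_eq.
  have : \forall u \near t, u \in `]a', +oo[ by apply: near_in_itvoy; rewrite in_itv /= at_.
  by apply: filterS => u; rewrite in_itv /= andbT => au; apply: gam2; exact: ltW.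
have E1s : \int[mu]_(t in `[a, b]) speed A g s t = \int[mu]_(t in `[a + c, a']) speed A g s' t.
  rewrite -(integral_shift c (ltW ab) (step_continuous Cs)).
  have -> : b + c = a' by rewrite /c subrKC.
  by apply: eq_Rintegral => t; rewrite inE /= in_itv /= => /Cs'[_ ->].
exists (a + c), b', gam; split; [exact: le1|exact: pg|exact: gx|exact: gz|].
subst l1 l2; exact: (etrans (f_equal2 (fun u v : R => u + v) (etrans E1s (esym E1)) (esym E2))
  (esym (integral_cat (ltW ac) ab' i1 i2').2)).
Qed.

Lemma set_dist_chain (X Y : set M) :
  set_dist A g X Y = inf [set l | exists x y, [/\ X x, Y y & chain x y l]].
Proof.
rewrite /set_dist; congr inf; apply/seteqP; split=> l /=.
  move=> [a [b [gamma [ab [s part pcs] Xa Yb ->]]]].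
  by exists (gamma a), (gamma b); split; [exact: Xa|exact: Yb|exact: (curve_chain part pcs).2].
move=> [x [y [Xx Yy /chain_curve[a [b [gamma [ab pc ga gb ->]]]]]]].
by exists a, b, gamma; split; [exact: ab|exact: pc|rewrite ga|rewrite gb|].
Qed.

Lemma step_iso (f : M -> M) x y l : smooth_map A setT A f -> preserves_metric A g f ->
  step x y l -> step (f x) (f y) l.
Proof.
move=> sf pf [a [b [s [ab Cs sa sb ->]]]]; exists a, b, (f \o s); split; first exact: ab.
- by move=> t /Cs; exact: C1_smooth.
- by rewrite /= sa.
- by rewrite /= sb.
apply: eq_Rintegral => t; rewrite inE /= in_itv /= => /Cs Ct.
have [c Ac ct] := atlas_cover atA (s t).
have [_ nh csc d] := nbhs_singleton (C1_near atA Ac ct Ct).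
by rewrite (speed_iso atA sf pf Ac nh csc d) (speedE atA gm Ac nh csc d).
Qed.

Lemma chain_iso (f : M -> M) x y l : smooth_map A setT A f -> preserves_metric A g f ->
  chain x y l -> chain (f x) (f y) l.
Proof.
move=> sf pf; elim=> [{}x|{}x {}y z l1 l2 S _ IH]; first exact: chain_nil.
by apply: chain_cons IH; exact: step_iso.
Qed.

End Chains.

(** * Bilinear forms given by Gram matrices: bounds and the Cauchy-Schwarz inequality *)

Section InnerProduct.
Context {R : realType} {n : nat}.
Implicit Types (G E : 'M[R]_n) (u v w : 'rV[R]_n).

Lemma innerDl G u v w : inner G (u + v) w = inner G u w + inner G v w.
Proof. by rewrite /inner !mulmxDl mxE. Qed.

Lemma innerDr G u v w : inner G u (v + w) = inner G u v + inner G u w.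
Proof. by rewrite /inner linearD mulmxDr mxE. Qed.

Lemma innerZl G a u v : inner G (a *: u) v = a * inner G u v.
Proof. by rewrite /inner -!scalemxAl mxE. Qed.

Lemma innerZr G a u v : inner G u (a *: v) = a * inner G u v.
Proof. by rewrite /inner linearZ /= -scalemxAr mxE. Qed.

Lemma innerNl G u v : inner G (- u) v = - inner G u v.
Proof. by rewrite -scaleN1r innerZl mulN1r. Qed.

Lemma innerNr G u v : inner G u (- v) = - inner G u v.
Proof. by rewrite -scaleN1r innerZr mulN1r. Qed.

Lemma innerDm G E u v : inner (G + E) u v = inner G u v + inner E u v.
Proof. by rewrite /inner mulmxDr mulmxDl mxE. Qed.

Lemma innerNm G u v : inner (- G) u v = - inner G u v.
Proof. by rewrite /inner mulmxN mulNmx mxE. Qed.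

Lemma innerC G u v : G^T = G -> inner G u v = inner G v u.
Proof.
move=> sG; rewrite /inner.
have -> : u *m G *m v^T = (v *m G *m u^T)^T by rewrite !trmx_mul trmxK sG mulmxA.
by rewrite mxE.
Qed.

Lemma mx_norm_entry p q (E : 'M[R]_(p, q)) i j : `|E i j| <= `|E|.
Proof.
rewrite [`|E|]/Num.Def.normr/= mx_normrE.
exact: (le_bigmax _ (fun i : 'I_p * 'I_q => `|E i.1 i.2|) (i, j)).
Qed.

Lemma mx_norm_le p q (E : 'M[R]_(p, q)) (e : R) : 0 <= e -> (forall i j, `|E i j| <= e) -> `|E| <= e.
Proof.
move=> e0 H; rewrite [`|E|]/Num.Def.normr/= mx_normrE.
by apply: bigmax_le => //= -[i j] _.
Qed.

(** The number of terms in the double sum that defines [inner]: the price of bounding it by max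
    norms. *)
Definition dim2 : R := (n * n)%:R.

Lemma dim2_ge0 : 0 <= dim2. Proof. exact: ler0n. Qed.

Lemma inner_bound E u v : `|inner E u v| <= dim2 * `|E| * `|u| * `|v|.
Proof.
rewrite /inner mxE; apply: (le_trans (ler_norm_sum _ _ _)).
apply: (@le_trans _ _ (\sum_(j < n) \sum_(i < n) `|E| * `|u| * `|v|)).
  apply: ler_sum => j _; rewrite normrM !mxE.
  apply: (@le_trans _ _ ((\sum_(i < n) `|u| * `|E|) * `|v|)).
    apply: ler_pM => //; last exact: rV_norm_coord.
    apply: (le_trans (ler_norm_sum _ _ _)); apply: ler_sum => i _; rewrite normrM.
    by apply: ler_pM => //; [exact: rV_norm_coord|exact: mx_norm_entry].
  by rewrite mulr_suml; apply: ler_sum => i _; rewrite (mulrC `|u|).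
rewrite !sumr_const card_ord -mulrnA -mulr_natl /dim2 !mulrA //.
Qed.

Section Definite.
Variable (G : 'M[R]_n).
Hypothesis sG : G^T = G.
Hypothesis pG : forall v, v != 0 -> 0 < inner G v v.

Lemma inner_ge0 v : 0 <= inner G v v.
Proof.
have [->|/pG/ltW//] := eqVneq v 0.
by rewrite /inner !mul0mx mxE.
Qed.

Lemma inner_CS u v : (inner G u v) ^+ 2 <= inner G u u * inner G v v.
Proof.
have [->|v0] := eqVneq v 0.
  by rewrite -(scale0r (0 : 'rV[R]_n)) !innerZr !mul0r mulr0 expr0n.
have := inner_ge0 (inner G v v *: u - inner G u v *: v).
rewrite innerDl !innerDr !innerNl !innerNr !innerZl !innerZr (innerC v u sG) => H.
have Q0 := pG v0; rewrite -(ler_pM2r Q0) -subr_ge0; apply: le_trans H _.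
by rewrite le_eqVlt; apply/orP; left; apply/eqP; ring.
Qed.

Definition gnorm v : R := Num.sqrt (inner G v v).

Lemma gnorm_ge0 v : 0 <= gnorm v. Proof. exact: sqrtr_ge0. Qed.

Lemma gnorm_sqr v : gnorm v ^+ 2 = inner G v v.
Proof. by rewrite sqr_sqrtr // inner_ge0. Qed.

Lemma gnorm_CS u v : inner G u v <= gnorm u * gnorm v.
Proof.
apply: (le_trans (ler_norm _)).
rewrite -(@ler_pXn2r _ 2) ?nnegrE ?mulr_ge0 ?gnorm_ge0 // exprMn !gnorm_sqr.
by rewrite real_normK ?num_real //; exact: inner_CS.
Qed.

End Definite.
End InnerProduct.

(** * Uniform Taylor estimates, and induction along a real segment *)

Section LocalEstimates.
Context {R : realType}.

Lemma C1_lipschitz n (U : set 'rV[R]_n) (f : 'rV[R]_n -> R) x :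
  open U -> Ck 1 U f -> U x -> exists r L, [/\ 0 < r, 0 <= L &
    forall y z, `|y - x| < r -> `|z - x| < r -> `|f y - f z| <= L * `|y - z|].
Proof.
move=> oU Cf Ux; have [r r0 H] := C1_strict_scalar oU Cf Ux ltr01.
pose S := \sum_(j < n) `|'D_(delta_mx 0 j) f x|.
have S0 : 0 <= S by apply: sumr_ge0.
exists r, (1 + S); split=> //; first by rewrite addr_ge0.
move=> y z yr zr; have := H y z yr zr; set T := \sum_(j < n) _ => h.
have : `|T| <= S * `|y - z|.
  apply: (le_trans (ler_norm_sum _ _ _)); rewrite /S mulr_suml; apply: ler_sum => j _.
  by rewrite normrM mulrC ler_wpM2l // rV_norm_coord.
move=> h2; have := ler_normD (f y - f z - T) T; rewrite subrK => h3.
by apply: (le_trans h3); rewrite mulrDl; apply: lerD.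
Qed.

(** The differential of [F] at [w] applied to [h], entry by entry. Both arguments stay variable
    because the estimates have to be uniform in the base point. *)
Definition grad n p q (F : 'rV[R]_n -> 'M[R]_(p, q)) (w h : 'rV[R]_n) : 'M[R]_(p, q) :=
  \matrix_(i, j) \sum_(l < n) h 0 l * 'D_(delta_mx 0 l) (fun y => F y i j) w.

(** The mean value theorem moves the derivative to an intermediate point, and the partial
    derivatives are Lipschitz near [x]; hence a quadratic remainder with one constant for all base
    points. *)
Lemma C2_taylor n (U : set 'rV[R]_n) (f : 'rV[R]_n -> R) x :
  open U -> Ck 2 U f -> U x -> exists r K, [/\ 0 < r, 0 <= K &
    forall y h, `|y - x| < r -> `|y + h - x| < r ->
    `|f (y + h) - f y - \sum_(l < n) h 0 l * 'D_(delta_mx 0 l) f y| <= K * `|h| ^+ 2 /\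
    `|\sum_(l < n) h 0 l * 'D_(delta_mx 0 l) f y| <= K * `|h|].
Proof.
move=> oU Cf Ux; have C1 : Ck 1 U f by exact: CkW.
have /choice[rL H] : forall l, exists rL : R * R, [/\ 0 < rL.1, 0 <= rL.2 &
    forall y z, `|y - x| < rL.1 -> `|z - x| < rL.1 ->
      `|'D_(delta_mx 0 l) f y - 'D_(delta_mx 0 l) f z| <= rL.2 * `|y - z|].
  move=> l; have [_ /(_ (delta_mx 0 l))[_ Cl]] := Cf.
  by have [r [L H]] := C1_lipschitz oU Cl Ux; exists (r, L).
have /nbhs_ballP[r0 /= r00 Hr0] := open_nbhs_nbhs (conj oU Ux).
have : \forall r \near 0^'+, [/\ 0 < r, r < r0, r < 1 & forall l, r < (rL l).1].
  have h1 : \forall r \near 0^'+, forall l, r < (rL l).1.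
    by apply: filter_forall => l; apply: nbhs_right_lt; have [] := H l.
  near=> r; split; [by near: r; exact: nbhs_right_gt|near: r; exact: nbhs_right_lt|near: r; exact: nbhs_right_lt|].
  by near: r.
move=> /filter_ex[r [rp rr0 r1 rl]].
pose K := \sum_l (rL l).2 + \sum_l (`|'D_(delta_mx 0 l) f x| + (rL l).2).
have K1 : 0 <= \sum_l (rL l).2 by apply: sumr_ge0 => l _; have [] := H l.
have K2 : 0 <= \sum_l (`|'D_(delta_mx 0 l) f x| + (rL l).2).
  by apply: sumr_ge0 => l _; have [_ ? _] := H l; rewrite addr_ge0.
exists r, K; split=> //; first by rewrite addr_ge0.
move=> y h yr yhr.
have seg t : 0 <= t <= 1 -> `|y + t *: h - x| < r.
  move=> /andP[t0 t1].
  have -> : y + t *: h - x = (1 - t) *: (y - x) + t *: (y + h - x).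
    by apply/rowP => i; rewrite !mxE; ring.
  apply: (le_lt_trans (ler_normD _ _)); rewrite !normrZ (ger0_norm t0) (@ger0_norm _ (1 - t)) ?subr_ge0 //.
  have [->|t00] := eqVneq t 0; first by rewrite subr0 mul1r mul0r addr0.
  have tp : 0 < t by rewrite lt0r t00.
  have -> : r = (1 - t) * r + t * r by ring.
  by apply: ler_ltD; [apply: ler_wpM2l; [rewrite subr_ge0|exact: ltW]|rewrite ltr_pM2l].
have inU t : 0 <= t <= 1 -> U (y + t *: h).
  move=> /seg s; apply: Hr0; rewrite -ball_normE /= distrC; exact: lt_trans s rr0.
have df z : U z -> differentiable f z by move=> Uz; have [] := C1_is_diff_scalar oU C1 Uz.
split.
  have [t|t t01 ->] := @MVT_line _ _ f y h.
    by move=> /inU Ut; apply: diff_derivable; exact: df.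
  rewrite derive_scalarE; last exact/df/inU.
  rewrite -sumrB; apply: (le_trans (ler_norm_sum _ _ _)).
  apply: (@le_trans _ _ (\sum_l (rL l).2 * `|h| ^+ 2)); last first.
    by rewrite -mulr_suml ler_wpM2r // lerDl.
  apply: ler_sum => l _; rewrite -mulrBr normrM.
  have [_ L0 HL] := H l.
  have := HL (y + t *: h) y (lt_trans (seg t t01) (rl l)) (lt_trans yr (rl l)).
  rewrite addrAC subrr add0r normrZ => h2.
  rewrite expr2 mulrCA; apply: ler_pM => //; first exact: rV_norm_coord.
  apply: (le_trans h2); rewrite ler_wpM2l //.
  by move/andP: t01 => [t0 t1]; rewrite ger0_norm // ler_piMl.
apply: (le_trans (ler_norm_sum _ _ _)).
apply: (@le_trans _ _ (\sum_l (`|'D_(delta_mx 0 l) f x| + (rL l).2) * `|h|)); last first.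
  by rewrite -mulr_suml ler_wpM2r // lerDr.
apply: ler_sum => l _; rewrite normrM mulrC ler_pM //; last exact: rV_norm_coord.
have [r0l L0 HL] := H l.
have := HL y x (lt_trans yr (rl l)); rewrite subrr normr0 => /(_ r0l) h2.
rewrite -[X in `|X|](subrK ('D_(delta_mx 0 l) f x)) addrC.
apply: (le_trans (ler_normD _ _)); rewrite lerD2l; apply: (le_trans h2).
by rewrite ler_piMr // ltW // (lt_trans yr).
Unshelve. all: by end_near. Qed.

Lemma C2_taylor_mx n p q (U : set 'rV[R]_n) (F : 'rV[R]_n -> 'M[R]_(p, q)) x :
  open U -> Ck 2 U F -> U x -> exists r K, [/\ 0 < r, 0 <= K &
    forall y h, `|y - x| < r -> `|y + h - x| < r ->
    `|F (y + h) - F y - grad F y h| <= K * `|h| ^+ 2 /\ `|grad F y h| <= K * `|h|].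
Proof.
move=> oU /(Ck_mxP _ _ oU) CF Ux.
have /choice[rK H] : forall ij : 'I_p * 'I_q, exists rK : R * R, [/\ 0 < rK.1, 0 <= rK.2 &
    forall y h, `|y - x| < rK.1 -> `|y + h - x| < rK.1 ->
    let f := fun y => F y ij.1 ij.2 in
    `|f (y + h) - f y - \sum_(l < n) h 0 l * 'D_(delta_mx 0 l) f y| <= rK.2 * `|h| ^+ 2 /\
    `|\sum_(l < n) h 0 l * 'D_(delta_mx 0 l) f y| <= rK.2 * `|h|].
  by move=> ij; have [r [K HK]] := C2_taylor oU (CF ij.1 ij.2) Ux; exists (r, K).
have : \forall r \near 0^'+, 0 < r /\ forall ij, r < (rK ij).1.
  apply: filterI; first exact: nbhs_right_gt.
  have h1 ij : \forall r \near 0^'+, r < (rK ij).1 by apply: nbhs_right_lt; have [] := H ij.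
  exact: filter_forall h1.
move=> /filter_ex[r [r0 rr]].
have K0 ij : 0 <= (rK ij).2 by have [] := H ij.
pose K := \sum_ij (rK ij).2.
have KK ij : (rK ij).2 <= K by rewrite /K (bigD1 ij) //= lerDl sumr_ge0.
have Kp : 0 <= K by apply: sumr_ge0.
exists r, K; split=> // y h yr yhr; split.
  apply: mx_norm_le => [|i j]; first by rewrite mulr_ge0 // exprn_ge0.
  have [_ _ /(_ y h (lt_trans yr (rr _)) (lt_trans yhr (rr _)))[h1 _]] := H (i, j).
  by rewrite !mxE; apply: (le_trans h1); rewrite ler_wpM2r // exprn_ge0.
apply: mx_norm_le => [|i j]; first by rewrite mulr_ge0.
have [_ _ /(_ y h (lt_trans yr (rr _)) (lt_trans yhr (rr _)))[_ h1]] := H (i, j).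
by rewrite !mxE; apply: (le_trans h1); rewrite ler_wpM2r.
Qed.

(** The supremum of the times up to which [P] holds throughout satisfies [P] by the limit
    hypothesis, and cannot be smaller than [b] by the successor hypothesis. It serves to keep short
    curves inside a chart and to enlarge the radius of compact balls. *)
Lemma real_induction (a b : R) (P : R -> Prop) : a <= b -> P a ->
  (forall t, a < t -> t <= b -> (forall u, a <= u -> u < t -> P u) -> P t) ->
  (forall t, a <= t -> t < b -> (forall u, a <= u -> u <= t -> P u) ->
     exists2 e, 0 < e & forall u, t < u -> u < t + e -> P u) ->
  forall t, a <= t <= b -> P t.
Proof.
move=> ab Pa limP sucP.
pose S := [set t | a <= t <= b /\ forall u, a <= u -> u <= t -> P u].
have Sa : S a.
  split=> [|u au ua]; first by rewrite lexx.
  by have -> : u = a by apply/eqP; rewrite eq_le au ua.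
have hS : has_sup S by split; [exists a|exists b => t [/andP[]]].
pose s := sup S.
have as_ : a <= s by apply: ub_le_sup => //; exact: hS.2.
have sb : s <= b by apply: ge_sup; [exists a|move=> t [/andP[]]].
have Pu u : a <= u -> u < s -> P u.
  move=> au us; have su : 0 < s - u by rewrite subr_gt0.
  have [t [_ St] ut] := sup_adherent su hS.
  by apply: St => //; move: ut; rewrite subKr => /ltW.
have Ps : P s.
  move: as_; rewrite le_eqVlt => /orP[/eqP <- //|as_]; exact: limP.
have Ss : S s.
  split=> [|u au]; first by rewrite as_.
  by rewrite le_eqVlt => /orP[/eqP -> //|]; exact: Pu.
have -> : b = s.
  apply/eqP; rewrite eq_le sb andbT leNgt; apply/negP => sb'.
  have [e e0 He] := sucP s as_ sb' Ss.2.
  pose t := s + Num.min (e / 2) (b - s).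
  have st : s < t by rewrite ltrDl lt_min divr_gt0 // subr_gt0.
  have : S t.
    split.
      rewrite (le_trans as_ (ltW st)) /=; rewrite /t -lerBrDl ge_min lexx orbT //.
    move=> u au ut; have [us|su] := leP u s; first exact: Ss.2.
    apply: He => //; apply: (le_lt_trans ut); rewrite ltrD2l gt_min.
    by apply/orP; left; lra.
  by move=> /(ub_le_sup hS.2); rewrite leNgt st.
by move=> t /andP[at_ ts]; exact: Ss.2.
Qed.

End LocalEstimates.

(** * The Riemannian metric in a coordinate ball *)

Section LocalMetric.
Context {R : realType} {n : nat} {M : topologicalType} {A : set (chart R M n)} {g : gram R M n}.
Hypothesis atA : atlas_on setT A.
Hypothesis gm : riemannian_metric A g.
Local Notation mu := (@lebesgue_measure R).
Local Notation chain := (@chain R n M A g).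
Local Notation step := (@step R n M A g).
Local Opaque speed C1_at.

Let cA : charts A. Proof. by have [] := atA. Qed.

Definition cgram (c : chart R M n) : 'rV[R]_n -> 'M[R]_n := g c \o cinv c.

(** All that later estimates use of the metric near a point: [K] compares its norm with the
    coordinate norm in both directions, and [L] bounds its variation and the remainder of its
    first-order expansion. *)
Record gball (c : chart R M n) (p : 'rV[R]_n) (r K L : R) : Prop := {
  gb_r : 0 < r; gb_K : 0 < K; gb_L : 0 <= L;
  gb_img : forall w, `|w - p| <= r -> (cto c @` cdom c) w;
  gb_lo : forall w v, `|w - p| <= r -> `|v| <= K * gnorm (cgram c w) v;
  gb_up : forall w v, `|w - p| <= r -> gnorm (cgram c w) v <= K * `|v|;
  gb_lip : forall w w', `|w - p| <= r -> `|w' - p| <= r ->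
    `|cgram c w' - cgram c w| <= L * `|w' - w|;
  gb_tay : forall w h, `|w - p| <= r -> `|w + h - p| <= r ->
    `|cgram c (w + h) - cgram c w - grad (cgram c) w h| <= L * `|h| ^+ 2 /\
    `|grad (cgram c) w h| <= L * `|h| }.

Lemma cgram_sym c w : A c -> (cto c @` cdom c) w -> (cgram c w)^T = cgram c w.
Proof.
by move=> Ac [x cx <-]; have [s _ _ _] := gm; have [_ _ K _ _] := cA Ac; rewrite /cgram /= K //; exact: s.
Qed.

Lemma cgram_pos c w v : A c -> (cto c @` cdom c) w -> v != 0 -> 0 < inner (cgram c w) v v.
Proof.
by move=> Ac [x cx <-]; have [_ p _ _] := gm; have [_ _ K _ _] := cA Ac; rewrite /cgram /= K //; exact: p.
Qed.

Lemma inner_cont (G : 'M[R]_n) : continuous (fun v : 'rV[R]_n => inner G v v).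
Proof.
move=> v; apply: (@cvg_coord R _ (nbhs v) _ _ _ (fun v : 'rV[R]_n => v *m G *m v^T) _ 0 0).
apply: cvg_mulmx; last exact: cvg_trmx.
exact: mulmxr_continuous.
Qed.

Lemma pos_def_lower (G : 'M[R]_n) : (forall v, v != 0 -> 0 < inner G v v) ->
  exists2 m, 0 < m & forall v : 'rV[R]_n, m * `|v| ^+ 2 <= inner G v v.
Proof.
move=> pG; pose S := [set v : 'rV[R]_n | `|v| = 1].
(* The unit sphere is empty only in dimension 0, where every vector vanishes. *)
have [[v0 Sv0]|S0] := pselect (S !=set0); last first.
  exists 1 => // v; have [->|v0] := eqVneq v 0.
    by rewrite normr0 expr0n /= mulr0 /inner !mul0mx mxE.
  exfalso; apply: S0; exists (`|v|^-1 *: v); rewrite /S /= normrZ normfV normr_id.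
  by rewrite mulVf // normr_eq0.
have cS : compact S.
  apply: bounded_closed_compact.
    by exists 1; split=> [|N N1 v /= ->]; [exact: num_real|exact: ltW].
  apply: (@preimage_closed _ _ (fun v : 'rV[R]_n => `|v|) [set s | s = 1]).
    by move=> v _; exact: norm_continuous.
  exact: closed_eq.
have [v Sv vmin] : exists2 c, c \in S & forall t, t \in S -> inner G c c <= inner G t t.
  apply: EVT_min_rV => //; first by exists v0.
  by apply: continuous_subspaceT; exact: inner_cont.
rewrite inE in Sv; have vn0 : v != 0 by rewrite -normr_eq0 Sv oner_eq0.
exists (inner G v v); first exact: pG.
move=> u; have [->|u0] := eqVneq u 0.
  by rewrite normr0 expr0n /= mulr0 /inner !mul0mx mxE.
have un : 0 < `|u| by rewrite normr_gt0.
have Su : `|u|^-1 *: u \in S by rewrite inE /S /= normrZ normfV normr_id mulVf // gt_eqF.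
have := vmin _ Su; rewrite innerZl innerZr mulrA -expr2 exprVn.
by rewrite ler_pdivlMl ?exprn_gt0 // mulrC.
Qed.

Lemma gball_exists c p : A c -> (cto c @` cdom c) p -> exists r K L, gball c p r K L.
Proof.
move=> Ac ip; have [oc oi Kc _ _] := cA Ac.
have sg : smooth_on (cto c @` cdom c) (cgram c) by have [_ _ s _] := gm; exact: s.
have [r1 [L1 [r10 L10 H1]]] := C2_taylor_mx oi (sg 2%N) ip.
have /nbhs_ballP[r2 /= r20 H2] := open_nbhs_nbhs (conj oi ip).
have [m m0 Hm] := pos_def_lower (fun v => @cgram_pos c p v Ac ip).
pose D : R := @dim2 R n + 1; have D0 : 0 < D by rewrite ltr_wpDl // dim2_ge0.
pose L := 3 * L1 + 1; have L0 : 0 < L by rewrite /L; lra.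
(* The first two terms give strict inclusion in the balls of the Taylor estimate and of the chart
   image; [m / (4 * D * L)] keeps the change of the quadratic form below [m / 4] times [|v|^2], so
   that at least [m / 2] is left. *)
pose r := Num.min (Num.min (r1 / 3) (r2 / 2)) (Num.min 1 (m / (4 * D * L))).
have r0 : 0 < r by rewrite !lt_min ltr01 !divr_gt0 // !mulr_gt0.
have [ra rb rc rd] : [/\ r <= r1 / 3, r <= r2 / 2, r <= 1 & r <= m / (4 * D * L)].
  by rewrite /r !ge_min !lexx !orbT.
have img w : `|w - p| <= r -> (cto c @` cdom c) w.
  by move=> h; apply: H2; rewrite -ball_normE /= distrC; apply: (le_lt_trans h); lra.
have in1 w : `|w - p| <= r -> `|w - p| < r1 by move=> h; apply: (le_lt_trans h); lra.
have tay w h : `|w - p| <= r -> `|w + h - p| <= r ->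
    `|cgram c (w + h) - cgram c w - grad (cgram c) w h| <= L1 * `|h| ^+ 2 /\
    `|grad (cgram c) w h| <= L1 * `|h|.
  by move=> /in1 h1 /in1 h2; exact: H1.
have lip w w' : `|w - p| <= r -> `|w' - p| <= r ->
    `|cgram c w' - cgram c w| <= L * `|w' - w|.
  move=> wr w'r; pose h := w' - w; have Ew : w' = w + h by rewrite /h subrKC.
  have w'r2 : `|w + h - p| <= r by rewrite -Ew.
  have [t1 t2] := tay w h wr w'r2; rewrite {1}Ew -/h.
  have h1 : `|h| <= 2.
    have -> : h = (w' - p) - (w - p) by rewrite /h opprB addrA subrK.
    by apply: (le_trans (ler_normB _ _)); lra.
  rewrite -[X in `|X|](subrK (grad (cgram c) w h)).
  apply: (le_trans (ler_normD _ _)); apply: (le_trans (lerD t1 t2)).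
  have : L1 * `|h| ^+ 2 <= L1 * (2 * `|h|) by rewrite ler_wpM2l // expr2 ler_wpM2r.
  by rewrite /L; have := normr_ge0 h; nra.
have Qlo w v : `|w - p| <= r -> m / 2 * `|v| ^+ 2 <= inner (cgram c w) v v.
  move=> wr; have -> : cgram c w = cgram c p + (cgram c w - cgram c p) by rewrite subrKC.
  rewrite innerDm; have := inner_bound (cgram c w - cgram c p) v v.
  have pr : `|p - p| <= r by rewrite subrr normr0 ltW.
  have := lip p w pr wr => l1.
  have : @dim2 R n * `|cgram c w - cgram c p| * `|v| * `|v| <= m / 4 * `|v| ^+ 2.
    rewrite -mulrA -expr2 ler_wpM2r ?exprn_ge0 //.
    apply: (@le_trans _ _ (D * (L * (m / (4 * D * L))))).
      apply: ler_pM => //; first by rewrite /D lerDl.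
      by apply: (le_trans l1); rewrite ler_pM2l //; exact: le_trans wr rd.
    by rewrite le_eqVlt; apply/orP; left; apply/eqP; field; rewrite !gt_eqF.
  move=> h1 h2; have := Hm v; move: h1 h2; set E := inner (_ - _) v v => h1 h2.
  have : - E <= `|E| by rewrite -normrN ler_norm.
  have := exprn_ge0 2 (normr_ge0 v).
  by nra.
pose B := `|cgram c p| + L; have B0 : 0 < B by rewrite ltr_wpDl.
have Gb w : `|w - p| <= r -> `|cgram c w| <= B.
  move=> wr; have pr : `|p - p| <= r by rewrite subrr normr0 ltW.
  have -> : cgram c w = cgram c p + (cgram c w - cgram c p) by rewrite subrKC.
  apply: (le_trans (ler_normD _ _)); rewrite lerD2l.
  apply: (le_trans (lip p w pr wr)); rewrite ler_piMr ?(ltW L0) //.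
  exact: le_trans wr rc.
(* The first term serves the lower comparison of [gnorm] with the coordinate norm, the second the
   upper one. *)
pose K := Num.max (Num.sqrt (2 / m)) (Num.sqrt (D * B)).
exists r, K, L; split=> //; [|exact: ltW| | |].
- by rewrite lt_max sqrtr_gt0 divr_gt0.
- move=> w v wr; apply: (@le_trans _ _ (Num.sqrt (2 / m) * gnorm (cgram c w) v)); last first.
    by rewrite ler_wpM2r ?sqrtr_ge0 // le_max lexx.
  rewrite /gnorm -sqrtrM ?divr_ge0 ?(ltW m0) //.
  rewrite -[`|v|](ger0_norm (normr_ge0 v)) -sqrtr_sqr; apply: ler_wsqrtr.
  have := Qlo w v wr; rewrite -(ler_pM2l (_ : 0 < 2 / m)) ?divr_gt0 //.
  by have -> : 2 / m * (m / 2 * `|v| ^+ 2) = `|v| ^+ 2 by field; rewrite gt_eqF.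
- move=> w v wr; apply: (@le_trans _ _ (Num.sqrt (D * B) * `|v|)); last first.
    by rewrite ler_wpM2r // le_max lexx orbT.
  rewrite -[`|v|](ger0_norm (normr_ge0 v)) -sqrtr_sqr -sqrtrM; last by rewrite mulr_ge0 // ltW.
  apply: ler_wsqrtr; apply: (le_trans (ler_norm _)); apply: (le_trans (inner_bound _ _ _)).
  rewrite -mulrA -expr2 ler_wpM2r ?exprn_ge0 //; apply: ler_pM => //; first by rewrite /D lerDl.
  exact: Gb.
- move=> w h wr whr; have [t1 t2] := tay w h wr whr.
  have LL : L1 <= L by rewrite /L; lra.
  split; first by apply: (le_trans t1); rewrite ler_wpM2r // exprn_ge0.
  by apply: (le_trans t2); rewrite ler_wpM2r.
Qed.

Lemma derive_mono (a b : R) (F G dF dG : R -> R) : a <= b ->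
  (forall t, a <= t <= b -> is_derive t 1 F (dF t)) ->
  (forall t, a <= t <= b -> is_derive t 1 G (dG t)) ->
  (forall t, a <= t <= b -> dF t <= dG t) -> F b - F a <= G b - G a.
Proof.
move=> ab DF DG le.
have D t : a <= t <= b -> is_derive t 1 (G \- F) (dG t - dF t).
  by move=> tab; apply: is_deriveB; [exact: DG|exact: DF].
have [t||t tab] := @MVT_segment R (G \- F) (dG \- dF) a b ab.
- by rewrite in_itv /= => /andP[at_ tb]; apply: D; rewrite !ltW.
- apply: derivable_within_continuous => t; rewrite in_itv /= => /D[].
  by [].
have : 0 <= (dG t - dF t) * (b - a).
  by apply: mulr_ge0; rewrite subr_ge0 //; apply: le; rewrite in_itv in tab.
by move=> /[swap] /= <-; lra.
Qed.

Lemma is_derive_lincomb (l : 'cV[R]_n) (s : R -> 'rV[R]_n) (t : R) : derivable s t 1 ->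
  is_derive t 1 (fun u => lincomb l (s u)) (lincomb l (derive1 s t)).
Proof.
move=> /derivable1_diffP ds.
have dl : differentiable (lincomb l) (s t) by apply: linear_differentiable; exact: lincomb_continuous.
have D := differentiable_comp ds dl.
split; first exact/derivable1_diffP.
rewrite -derive1E (derive1E' D) diff_comp //= diff_lin; last exact: lincomb_continuous.
by rewrite derive1E'.
Qed.

End LocalMetric.

Lemma is_derive_mulc {R : realType} (k : R) (f : R -> R) (t df : R) :
  is_derive t 1 f df -> is_derive t 1 (fun u => k * f u) (k * df).
Proof.
move=> D; have H := @is_deriveM R R (cst k) f t 1 0 df (is_derive_cst _ _ _) D.
rewrite scaler0 addr0 in H; exact: H.
Qed.

(** * Lengths of curves inside a coordinate ball *)

Section RiemannianDistance.
Context {R : realType} {n : nat} {M : topologicalType} {A : set (chart R M n)} {g : gram R M n}.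
Hypothesis atA : atlas_on setT A.
Hypothesis gm : riemannian_metric A g.
Local Notation mu := (@lebesgue_measure R).
Local Notation chain := (@chain R n M A g).
Local Notation step := (@step R n M A g).
Local Notation cgram := (@cgram R n M g).
Local Notation gball := (@gball R n M g).
Local Opaque speed C1_at.

Let cA : charts A. Proof. by have [] := atA. Qed.

Lemma speed_chart (s : R -> M) t c : A c -> cdom c (s t) -> C1_at A s t ->
  speed A g s t = gnorm (cgram c (cto c (s t))) (derive1 (cto c \o s) t).
Proof.
move=> Ac ct Ct; have [_ nh cs d] := nbhs_singleton (C1_near atA Ac ct Ct).
have [_ _ K _ _] := cA Ac.
by rewrite (speedE atA gm Ac nh cs d) /gnorm /cgram /= K.
Qed.

(** The straight coordinate segment is the competitor: its velocity is the constant vector [w' - w],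
    and a bound for the norm of this vector along the segment bounds the length. *)
Lemma segment_step c p r K L w w' B : A c -> gball c p r K L ->
  `|w - p| <= r -> `|w' - p| <= r ->
  (forall u, `|u - p| <= r -> `|u - w| <= `|w' - w| -> gnorm (cgram c u) (w' - w) <= B) ->
  exists2 l, l <= B & step (cinv c w) (cinv c w') l.
Proof.
move=> Ac gb wr w'r HB; pose v := w' - w; pose s t := cinv c (w + t *: v).
have [oc oi Kc ct ci] := cA Ac.
have seg (t : R) : 0 <= t <= 1 -> `|w + t *: v - p| <= r.
  move=> /andP[t0 t1].
  have -> : w + t *: v - p = (1 - t) *: (w - p) + t *: (w' - p).
    by apply/rowP => i; rewrite !mxE; ring.
  apply: (le_trans (ler_normD _ _)); rewrite !normrZ (ger0_norm t0) (@ger0_norm _ (1 - t)) ?subr_ge0 //.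
  have -> : r = (1 - t) * r + t * r by ring.
  by apply: lerD; apply: ler_wpM2l; rewrite ?subr_ge0.
have sw (t : R) : 0 <= t <= 1 -> `|w + t *: v - w| <= `|w' - w|.
  by move=> /andP[t0 t1]; rewrite addrC addKr normrZ ger0_norm // ler_piMl.
have im (t : R) : 0 <= t <= 1 -> (cto c @` cdom c) (w + t *: v) by move=> /seg; exact: gb_img gb _.
have cl (t : R) : {for t, continuous (fun t : R => w + t *: v)}.
  apply: (@continuousD R _ _ (cst w) (fun t : R => t *: v)); first exact: cst_continuous.
  exact: scalel_continuous.
have nim (t : R) : 0 <= t <= 1 -> \forall u \near t, (cto c @` cdom c) (w + u *: v).
  move=> /im ti; exact: (near_comp (cl t) (open_nbhs_nbhs (conj oi ti))).
have E (t : R) : 0 <= t <= 1 -> {near t, (fun u => w + u *: v) =1 (cto c \o s)}.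
  by move=> /nim; apply: filterS => u [x cx Ex]; rewrite /s /= -Ex Kc.
have dl (t : R) : is_derive t 1 (fun u : R => w + u *: v) v.
  have := @is_derive_line R _ _ (id : 'rV[R]_n -> 'rV[R]_n) w v t (@derivable_id _ _ _ _).
  by rewrite derive_id.
have Cs (t : R) : 0 <= t <= 1 -> C1_at A s t.
  move=> t01; have [x cx Ex] := im t t01.
  have csx : cdom c (s t) by rewrite /s -Ex Kc.
  apply: (C1_chart atA (smooth_idT atA) Ac csx).
  - apply: (continuous_comp (cl t)); rewrite -Ex; exact: ci.
  - apply: filterS (near_join (E t t01)) => u Eu; apply: near_eq_derivable Eu _.
    by case: (dl u).
  - apply: (near_eq_continuous _ (@cst_continuous _ _ v t)).
    apply: filterS (near_join (E t t01)) => u Eu.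
    rewrite derive1E -(near_eq_derive _ Eu).
    by case: (dl u) => _ ->.
have sp (t : R) : 0 <= t <= 1 -> speed A g s t <= B.
  move=> t01; have [x cx Ex] := im t t01.
  have csx : cdom c (s t) by rewrite /s -Ex Kc.
  rewrite (speed_chart Ac csx (Cs t t01)) derive1E -(near_eq_derive _ (E t t01)).
  have [_ ->] := dl t; rewrite -[cto c (s t)](nbhs_singleton (E t t01)).
  exact: HB (seg t t01) (sw t t01).
have cs := step_continuous atA gm Cs.
have [F dF HF] := primitive_exists ler01 cs.
exists (F 1 - F 0); last first.
  exists 0, 1, s; split; [exact: ler01|exact: Cs| | |].
  - by rewrite /s scale0r addr0.
  - by rewrite /s scale1r /v subrKC.
  - by rewrite HF ?lexx ?ler01.
have db (t : R) : 0 <= t <= 1 -> is_derive t 1 (fun u : R => B * u) B.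
  move=> _; have H := @is_derive_mulc R B id t 1 (@is_derive_id R R t 1).
  by rewrite mulr1 in H.
have := derive_mono ler01 dF db sp; rewrite mulr1 mulr0; lra.
Qed.

Hypothesis hausM : hausdorff_space M.

(** Real induction on time: a curve must spend length to move in coordinates, hence a short one
    cannot leave the ball. The last conclusion is a calibration: a covector of dual norm at most
    [kappa] near the curve bounds its length from below. The coordinate bound itself is the case of
    the coordinate forms and their opposites. *)
Lemma step_stay c p r K L x y l : A c -> gball c p r K L -> step x y l ->
  cdom c x -> `|cto c x - p| + K * l < r ->
  [/\ cdom c y, `|cto c y - cto c x| <= K * l &
    forall (q : 'rV[R]_n) r' (lam : 'cV[R]_n) kappa, 0 <= kappa -> `|cto c x - q| + K * l <= r' ->
      (forall w v, `|w - q| <= r' -> lincomb lam v <= kappa * gnorm (cgram c w) v) ->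
      lincomb lam (cto c y - cto c x) <= kappa * l].
Proof.
move=> Ac gb [a [b [s [ab Cs sa sb El]]]] cx xr.
have [oc oi Kc ct ci] := cA Ac.
have cs := step_continuous atA gm Cs.
have [F dF HF] := primitive_exists ab cs.
have K0 := gb_K gb.
have Fm (t : R) : a <= t <= b -> 0 <= F t - F a <= l.
  move=> /andP[at_ tb]; apply/andP; split.
    by rewrite -HF ?lexx //; apply: Rintegral_ge0 => u _; exact: speed_ge0.
  have h : 0 <= F b - F t by rewrite -HF //; apply: Rintegral_ge0 => u _; exact: speed_ge0.
  have El' : l = F b - F a by rewrite El HF ?lexx.
  by rewrite El'; lra.
pose P (t : R) := cdom c (s t) /\ `|cto c (s t) - p| < r.
have bound (t : R) (lam : 'cV[R]_n) (kappa : R) : a <= t <= b -> (forall u, a <= u -> u <= t -> P u) -> 0 <= kappa ->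
    (forall u v, a <= u -> u <= t -> lincomb lam v <= kappa * gnorm (cgram c (cto c (s u))) v) ->
    lincomb lam (cto c (s t) - cto c x) <= kappa * (F t - F a).
  move=> /andP[at_ tb] HP k0 Hl.
  rewrite linearB /= mulrBr -sa.
  have D1 (u : R) : a <= u <= t -> is_derive u 1 (fun u => lincomb lam ((cto c \o s) u)) (lincomb lam (derive1 (cto c \o s) u)).
    move=> /andP[au ut]; apply: is_derive_lincomb.
    have ub : a <= u <= b by rewrite au (le_trans ut).
    by have [_ _ _] := nbhs_singleton (C1_near atA Ac (HP u au ut).1 (Cs u ub)).
  have D2 (u : R) : a <= u <= t -> is_derive u 1 (fun u => kappa * F u) (kappa * speed A g s u).
    move=> /andP[au ut]; have ub : a <= u <= b by rewrite au (le_trans ut).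
    exact: is_derive_mulc (dF u ub).
  apply: (derive_mono at_ D1 D2) => u /andP[au ut].
  have ub : a <= u <= b by rewrite au (le_trans ut).
  rewrite (speed_chart Ac (HP u au ut).1 (Cs u ub)); exact: Hl.
have nb (t : R) : a <= t <= b -> (forall u, a <= u -> u <= t -> P u) ->
    `|cto c (s t) - cto c x| <= K * (F t - F a).
  move=> tab HP; apply/rV_normP => [|j]; first by rewrite mulr_ge0 ?(ltW K0) //; case/andP: (Fm t tab).
  have lo (u : R) (v : 'rV[R]_n) : a <= u -> u <= t -> `|v 0 j| <= K * gnorm (cgram c (cto c (s u))) v.
    move=> au ut; apply: (le_trans (rV_norm_coord v j)); apply: (gb_lo gb).
    exact: ltW (HP u au ut).2.
  have lc (v : 'rV[R]_n) : lincomb (delta_mx j 0 : 'cV[R]_n) v = v 0 j.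
    rewrite /lincomb (bigD1 j) //= mxE !eqxx mulr1 big1 ?addr0 // => i ij.
    by rewrite mxE (negbTE ij) mulr0.
  have lc' (v : 'rV[R]_n) : lincomb (- delta_mx j 0 : 'cV[R]_n) v = - v 0 j.
    by rewrite -lc /lincomb -sumrN; apply: eq_bigr => i _; rewrite mxE mulrN.
  rewrite ler_norml; apply/andP; split.
    rewrite lerNl -lc'; apply: bound => //; first exact: ltW.
    by move=> u v au ut; rewrite lc'; apply: le_trans (lo u v au ut); rewrite -normrN ler_norm.
  rewrite -lc; apply: bound => //; first exact: ltW.
  by move=> u v au ut; rewrite lc; apply: le_trans (lo u v au ut); rewrite ler_norm.
(* Since [r1 < r], a limit of points of the closed ball of radius [r1] is still in the open ball of
   radius [r]. *)
pose r1 := `|cto c x - p| + K * l.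
have r1P (t : R) : a <= t <= b -> (forall u, a <= u -> u <= t -> P u) -> `|cto c (s t) - p| <= r1.
  move=> tab HP; rewrite -(subrKA (cto c x)) /r1 addrC; apply: (le_trans (ler_normD _ _)).
  rewrite lerD2l; apply: (le_trans (nb t tab HP)); rewrite ler_wpM2l ?(ltW K0) //.
  by case/andP: (Fm t tab).
have cont (t : R) : a <= t <= b -> {for t, continuous s}.
  move=> tab; have [h Ah ht] := atlas_cover atA (s t).
  by have [_ _ csx _] := nbhs_singleton (C1_near atA Ah ht (Cs t tab)).
have PP : forall t, a <= t <= b -> P t.
  apply: real_induction => //.
  - rewrite /P sa; split=> //; apply: le_lt_trans xr; rewrite lerDl mulr_ge0 ?(ltW K0) //.
    exact: step_ge0 (ex_intro _ a (ex_intro _ b (ex_intro _ s (And5 ab Cs sa sb El)))).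
  - move=> t at_ tb HP.
    have ta : a <= t <= b by rewrite (ltW at_).
    (* The image in [M] of this compact ball is closed because [M] is Hausdorff; it contains [s u]
       for [u] just before [t], hence [s t], and the curve has not left the chart. *)
    pose Kc1 := [set w : 'rV[R]_n | `|w - p| <= r1].
    have clo : closed (cinv c @` Kc1).
      apply: compact_closed => //; apply: continuous_compact; last exact: compact_cball.
      apply: continuous_in_subspaceT => w; rewrite inE => wr1.
      have [y' cy <-] := gb_img gb (ltW (le_lt_trans wr1 xr)).
      exact: ci.
    have : (cinv c @` Kc1) (s t).
      apply: (@closed_cvg _ _ (t^'-) _ s _ clo); last first.
        by apply: cvg_within_filter; exact: cont.
      near=> u.
      have ut : u < t by near: u; exact: nbhs_left_lt.
      have au : a <= u by near: u; exact: nbhs_left_ge.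
      have HPu v : a <= v -> v <= u -> P v by move=> av vu; apply: HP => //; exact: le_lt_trans ut.
      have ub : a <= u <= b by rewrite au (le_trans (ltW ut)).
      exists (cto c (s u)); first exact: r1P.
      by rewrite Kc //; exact: (HPu u au (lexx u)).1.
    move=> [w wr1 Ew]; have [y' cy Ey] := gb_img gb (ltW (le_lt_trans wr1 xr)).
    have Es : s t = y' by rewrite -Ew -Ey Kc.
    rewrite /P Es; split=> //; rewrite Ey; exact: le_lt_trans wr1 xr.
  - move=> t at_ tb HP; have ta : a <= t <= b by rewrite at_ ltW.
    have [ct1 ct2] := HP t at_ (lexx t).
    have nP : \forall u \near t, P u.
      apply: filterI; first by apply: (near_comp (cont t ta)); exact: open_nbhs_nbhs.
      have cc : {for t, continuous (cto c \o s)}.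
        by apply: continuous_comp; [exact: cont|exact: ct].
      have : \forall w \near cto c (s t), `|w - p| < r.
        have B : nbhs (cto c (s t)) (ball p r).
          by apply: open_nbhs_nbhs; split; [exact: ball_open|rewrite -ball_normE /= distrC].
        by apply: filterS B => w; rewrite -ball_normE /= distrC.
      exact: near_comp cc.
    move: nP => /nbhs_ballP[e /= e0 He]; exists e => // u tu ue.
    by apply: He; rewrite -ball_normE /= ltr_distlC; apply/andP; split; lra.
have bb : a <= b <= b by rewrite ab lexx.
have PPb u : a <= u -> u <= b -> P u by move=> au ub; apply: PP; rewrite au.
have El' : l = F b - F a by rewrite El HF ?lexx.
split; first by rewrite -sb; case: (PP b bb).
  by rewrite -sb El'; exact: nb.
move=> q r' lam kappa k0 qr Hl; rewrite -sb El'; apply: bound => // u v au ub.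
apply: Hl; have uab : a <= u <= b by rewrite au.
rewrite -(subrKA (cto c x)) addrC; apply: (le_trans (ler_normD _ _)).
apply: le_trans qr; rewrite lerD2l.
apply: (le_trans (nb u uab (fun v av vu => PPb v av (le_trans vu ub)))).
by rewrite ler_wpM2l ?(ltW K0) //; case/andP: (Fm u uab).
Unshelve. all: by end_near. Qed.

Lemma chain_stay c p r K L x y l : A c -> gball c p r K L -> chain x y l ->
  cdom c x -> `|cto c x - p| + K * l < r ->
  [/\ cdom c y, `|cto c y - cto c x| <= K * l &
    forall (q : 'rV[R]_n) r' (lam : 'cV[R]_n) kappa, 0 <= kappa -> `|cto c x - q| + K * l <= r' ->
      (forall w v, `|w - q| <= r' -> lincomb lam v <= kappa * gnorm (cgram c w) v) ->
      lincomb lam (cto c y - cto c x) <= kappa * l].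
Proof.
move=> Ac gb H; elim: H => [{}x|{}x {}y z l1 l2 S C IH] cx xr.
  split=> //; first by rewrite subrr normr0 mulr0.
  by move=> q r' lam kappa _ _ _; rewrite subrr mulr0 linear0.
have K0 := gb_K gb; have l20 := chain_ge0 C; have l10 := step_ge0 S.
have Kl1 : 0 <= K * l1 by rewrite mulr_ge0 // ltW.
have Kl2 : 0 <= K * l2 by rewrite mulr_ge0 // ltW.
have xr1 : `|cto c x - p| + K * l1 < r by apply: le_lt_trans xr; rewrite lerD2l mulrDr; lra.
have [cy yx Hy] := step_stay Ac gb S cx xr1.
have tri q : `|cto c y - q| <= `|cto c x - q| + K * l1.
  by rewrite -(subrKA (cto c x)) addrC; apply: (le_trans (ler_normD _ _)); rewrite lerD2l.
have xr2 : `|cto c y - p| + K * l2 < r by apply: le_lt_trans xr; rewrite mulrDr addrA lerD2r.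
have [cz zy Hz] := IH cy xr2.
split=> //.
  rewrite -(subrKA (cto c y)) addrC mulrDr; apply: (le_trans (ler_normD _ _)); exact: lerD.
move=> q r' lam kappa k0 qr Hl.
rewrite -(subrKA (cto c y)) addrC linearD /= mulrDr; apply: lerD.
  apply: (Hy q r') => //; apply: le_trans qr; rewrite lerD2l mulrDr; lra.
apply: (Hz q r') => //; apply: le_trans qr; rewrite mulrDr addrA lerD2r; exact: tri.
Qed.

End RiemannianDistance.

Lemma minl_le {R : realDomainType} (a b : R) : Num.min a b <= a.
Proof. by rewrite ge_min lexx. Qed.

Lemma minr_le {R : realDomainType} (a b : R) : Num.min a b <= b.
Proof. by rewrite ge_min lexx orbT. Qed.

(** * The Riemannian distance is a metric that induces the topology *)

Section Metric.
Context {R : realType} {n : nat} {M : topologicalType} {A : set (chart R M n)} {g : gram R M n}.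
Hypothesis atA : atlas_on setT A.
Hypothesis gm : riemannian_metric A g.
Hypothesis hausM : hausdorff_space M.
Hypothesis connM : connected [set: M].
Local Notation mu := (@lebesgue_measure R).
Local Notation chain := (@chain R n M A g).
Local Notation step := (@step R n M A g).
Local Notation cgram := (@cgram R n M g).
Local Notation gball := (@gball R n M g).
Local Notation d := (@riemannian_dist R M n A g).

Let cA : charts A. Proof. by have [] := atA. Qed.

(** The step on which [phi] reaches [t] is cut by the intermediate value theorem, so the lengths of
    the two parts add up exactly. *)
Lemma chain_ivt (x y : M) (l : R) (phi : M -> R) (t : R) : chain x y l -> continuous phi ->
  phi x <= t <= phi y ->
  exists z l1 l2, [/\ phi z = t, chain x z l1, chain z y l2 & l = l1 + l2].
Proof.
move=> C cphi; elim: C => [{}x|{}x {}y z l1 l2 S C IH] /andP[xt ty].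
  exists x, 0, 0; split; [|exact: chain_nil|exact: chain_nil|by rewrite addr0].
  by apply/eqP; rewrite eq_le xt ty.
have [yt|yt] := leP (phi y) t.
  have [w [l3 [l4 [E C1 C2 El]]]] := IH (introT andP (conj yt ty)).
  exists w, (l1 + l3), l4; split; [exact: E|exact: chain_cons S C1|exact: C2|].
  by rewrite El addrA.
have [a [b [s [ab Cs sa sb El]]]] := S.
have cs := step_continuous atA gm Cs.
have cf : {within `[a, b], continuous (phi \o s)}.
  apply: continuous_in_subspaceT => u; rewrite inE /= in_itv /= => /Cs[csu _].
  by apply: continuous_comp; [exact: csu|exact: cphi].
have tI : Num.min ((phi \o s) a) ((phi \o s) b) <= t <= Num.max ((phi \o s) a) ((phi \o s) b).
  by rewrite /= sa sb ge_min xt /= le_max (ltW yt) orbT.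
have [u] := @IVT R (phi \o s) a b t ab cf tI.
rewrite in_itv /= => /andP[au ub] Eu.
exists (s u), (\int[mu]_(v in `[a, u]) speed A g s v), (\int[mu]_(v in `[u, b]) speed A g s v + l2).
split; [exact: Eu| | |].
- apply: chain_step; exists a, u, s; split; [exact: au| |exact: sa|by []|by []].
  by move=> v /andP[av vu]; apply: Cs; rewrite av (le_trans vu).
- apply: (chain_cons _ C); exists u, b, s; split; [exact: ub| |by []|exact: sb|by []].
  by move=> v /andP[uv vb]; apply: Cs; rewrite vb (le_trans au).
- by rewrite El (integral_split au ub cs) addrA.
Qed.

Local Opaque speed C1_at.

Lemma near_step x (e : R) : 0 < e -> \forall y \near x, exists2 l, l < e & step x y l.
Proof.
move=> e0; have [c Ac cx] := atlas_cover atA x.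
have [oc oi Kc ct ci] := cA Ac.
have [r [K [L gb]]] := gball_exists atA gm Ac (imageP _ cx).
have K0 := gb_K gb; have r0 := gb_r gb.
have pr : 0 < Num.min r (e / K / 2) by rewrite lt_min r0 !divr_gt0.
have nb : \forall y \near x, cdom c y /\ `|cto c y - cto c x| < Num.min r (e / K / 2).
  apply: filterI; first exact: open_nbhs_nbhs.
  by have /cvgrPdistC_lt := ct x cx; apply.
apply: filterS nb => y [cy]; rewrite lt_min => /andP[yr ye].
have xx : `|cto c x - cto c x| <= r by rewrite subrr normr0 ltW.
have ub u : `|u - cto c x| <= r -> `|u - cto c x| <= `|cto c y - cto c x| ->
    gnorm (cgram c u) (cto c y - cto c x) <= e / 2.
  move=> h _; apply: (le_trans (gb_up gb _ h)).
  by rewrite mulrC -ler_pdivlMr // mulrAC; exact: ltW.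
have [l lB S] := segment_step atA gm Ac gb xx (ltW yr) ub.
exists l; first by apply: (le_lt_trans lB); lra.
by rewrite !Kc // in S.
Qed.

(** The set of points reachable from [x] is open and closed, because a point and its neighbours are
    joined by steps that can be reversed. *)
Lemma chain_exists x y : exists l, chain x y l.
Proof.
pose B := [set y | exists l, chain x y l].
suff BT : B = setT by have : B y by rewrite BT.
have nb z := near_step z ltr01.
apply: connM.
- by exists x; exists 0; exact: chain_nil.
- exists B; last by rewrite setTI.
  rewrite openE => z [l C]; apply: filterS (nb z) => w [l' _ S].
  by exists (l + l'); apply: chain_cat C (chain_step S).
- exists B; last by rewrite setTI.
  move=> z /(_ _ (nb z))[w [[l C] [l' _ S]]].
  by exists (l + l'); apply: chain_cat C (chain_step (step_rev atA gm S)).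
Qed.

Lemma distE x y : d x y = inf [set l | chain x y l].
Proof.
rewrite /riemannian_dist (set_dist_chain atA gm); congr inf; apply/seteqP; split=> l /=.
  by move=> [_ [_ [-> ->]]].
by move=> C; exists x, y.
Qed.

Lemma dist_le_chain x y l : chain x y l -> d x y <= l.
Proof.
move=> C; rewrite distE; apply: ge_inf C.
by exists 0 => l' /chain_ge0.
Qed.

Lemma dist_chain x y (r : R) : d x y < r -> exists2 l, l < r & chain x y l.
Proof.
rewrite distE => /inf_lt[|l C lr]; first exact: chain_exists.
by exists l.
Qed.

Lemma dist_ge0 x y : 0 <= d x y.
Proof.
rewrite distE; apply: lb_le_inf; first exact: chain_exists.
by move=> l /chain_ge0.
Qed.

Lemma distxx x : d x x = 0.
Proof. by apply/eqP; rewrite eq_le dist_ge0 (dist_le_chain (chain_nil x)). Qed.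

Lemma dist_le_rev x y : d x y <= d y x.
Proof.
apply/ler_addgt0Pr => e e0; have [|l lr C] := @dist_chain y x (d y x + e); first by rewrite ltrDl.
exact: le_trans (dist_le_chain (chain_rev atA gm C)) (ltW lr).
Qed.

Lemma distC x y : d x y = d y x.
Proof. by apply/eqP; rewrite eq_le !dist_le_rev. Qed.

Lemma dist_tri y x z : d x z <= d x y + d y z.
Proof.
apply/ler_addgt0Pr => e e0; have e20 : 0 < e / 2 by rewrite divr_gt0.
have [|l lr C] := @dist_chain x y (d x y + e / 2); first by rewrite ltrDl.
have [|l' lr' C'] := @dist_chain y z (d y z + e / 2); first by rewrite ltrDl.
apply: (le_trans (dist_le_chain (chain_cat C C'))); lra.
Qed.

Lemma dist_near x (e : R) : 0 < e -> \forall y \near x, d x y < e.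
Proof.
move=> e0; apply: filterS (near_step x e0) => y [l le S].
exact: le_lt_trans (dist_le_chain (chain_step S)) le.
Qed.

Lemma dist_dist_le x y y' : `|d x y - d x y'| <= d y y'.
Proof.
have h1 := dist_tri y x y'; have h2 := dist_tri y' x y; have h3 := distC y y'.
rewrite ler_norml; apply/andP; split; lra.
Qed.

Lemma dist_continuous_r x : continuous (d x).
Proof.
move=> y; apply/cvgrPdist_lt => e e0; apply: filterS (dist_near y e0) => z.
exact: le_lt_trans (dist_dist_le _ _ _).
Qed.

Lemma dist_stay c p r K L x y : A c -> gball c p r K L -> cdom c x ->
  `|cto c x - p| + K * d x y < r -> cdom c y /\ `|cto c y - cto c x| <= K * d x y.
Proof.
move=> Ac gb cx xr; have K0 := gb_K gb.
pose e0 := (r - (`|cto c x - p| + K * d x y)) / K.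
have e00 : 0 < e0 by rewrite divr_gt0 // subr_gt0.
have H (e : R) : 0 < e -> e <= e0 -> cdom c y /\ `|cto c y - cto c x| <= K * (d x y + e).
  move=> ep ee; have [|l lr C] := @dist_chain x y (d x y + e); first by rewrite ltrDl.
  have h : `|cto c x - p| + K * l < r.
    have h1 : K * l < K * (d x y + e) by rewrite ltr_pM2l.
    have h2 : K * e <= r - (`|cto c x - p| + K * d x y) by rewrite mulrC -ler_pdivlMr.
    by move: h1; rewrite mulrDr => h1; lra.
  have [cy yx _] := chain_stay atA gm hausM Ac gb C cx h.
  by split=> //; apply: (le_trans yx); rewrite ler_wpM2l ?ltW.
split; first by case: (H e0 e00 (lexx _)).
rewrite -ler_pdivrMl //; apply/ler_addgt0Pr => e ep.
have m0 : 0 < Num.min e e0 by rewrite lt_min ep.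
have [_] := H _ m0 (minr_le _ _).
rewrite ler_pdivrMl // => h; apply: (le_trans h); rewrite ler_wpM2l ?(ltW K0) // lerD2l.
exact: minl_le.
Qed.

(** The calibration estimate for chains, passed to the infimum of lengths; the strict inequalities
    leave room for chains slightly longer than the distance. *)
Lemma dist_lincomb c p r K L x y q (r' : R) (lam : 'cV[R]_n) (kappa : R) : A c ->
  gball c p r K L -> cdom c x -> `|cto c x - p| + K * d x y < r -> 0 <= kappa ->
  `|cto c x - q| + K * d x y < r' ->
  (forall w v, `|w - q| <= r' -> lincomb lam v <= kappa * gnorm (cgram c w) v) ->
  lincomb lam (cto c y - cto c x) <= kappa * d x y.
Proof.
move=> Ac gb cx xr k0 qr Hl; have K0 := gb_K gb.
pose e0 := Num.min ((r - (`|cto c x - p| + K * d x y)) / K) ((r' - (`|cto c x - q| + K * d x y)) / K).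
have e00 : 0 < e0 by rewrite lt_min !divr_gt0 // subr_gt0.
have H (e : R) : 0 < e -> e <= e0 -> lincomb lam (cto c y - cto c x) <= kappa * (d x y + e).
  move=> ep; rewrite le_min => /andP[]; rewrite !ler_pdivlMr // => ee1 ee2.
  have [|l lr C] := @dist_chain x y (d x y + e); first by rewrite ltrDl.
  have h1 : K * l < K * (d x y + e) by rewrite ltr_pM2l.
  have h : `|cto c x - p| + K * l < r by move: h1; rewrite mulrDr => h1; lra.
  have h' : `|cto c x - q| + K * l <= r' by move: h1; rewrite mulrDr => h1; lra.
  have [_ _ HH] := chain_stay atA gm hausM Ac gb C cx h.
  by apply: le_trans (HH q r' lam kappa k0 h' Hl) _; rewrite ler_wpM2l // ltW.
have [k00|k00] := eqVneq kappa 0.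
  by have := H e0 e00 (lexx _); rewrite k00 !mul0r.
have kp : 0 < kappa by rewrite lt_neqAle eq_sym k00.
rewrite -ler_pdivrMl //; apply/ler_addgt0Pr => e ep.
have m0 : 0 < Num.min e e0 by rewrite lt_min ep.
have := H _ m0 (minr_le _ _).
rewrite ler_pdivrMl // => h; apply: (le_trans h); rewrite ler_wpM2l // lerD2l.
exact: minl_le.
Qed.

(** A chain too short to leave a small coordinate ball cannot leave [U]. Together with [dist_near]
    this identifies the metric topology with the given one. *)
Lemma dist_nbhs x (U : set M) : nbhs x U -> exists2 e : R, 0 < e & forall y, d x y < e -> U y.
Proof.
move=> Ux; have [c Ac cx] := atlas_cover atA x.
have [oc oi Kc ct ci] := cA Ac.
have [r [K [L gb]]] := gball_exists atA gm Ac (imageP _ cx).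
have K0 := gb_K gb; have r0 := gb_r gb.
have : nbhs (cto c x) (cinv c @^-1` U) by apply: ci => //; rewrite Kc.
move=> /nbhs_ballP[e /= e0 He].
exists (Num.min (r / K) (e / K)); first by rewrite lt_min !divr_gt0.
move=> y; rewrite lt_min !ltr_pdivlMr // ![_ * K]mulrC => /andP[dr de].
have [|cy yx] := dist_stay Ac gb cx (y := y) (r := r); first by rewrite subrr normr0 add0r.
have : ball (cto c x) e (cto c y).
  by rewrite -ball_normE /= distrC; exact: le_lt_trans de.
by move=> /He /=; rewrite Kc.
Qed.

Lemma dist_eq0 x y : d x y = 0 -> x = y.
Proof.
move=> dxy; apply: hausM => U V Ux Vy; exists y; split; last exact: nbhs_singleton.
by have [e e0] := dist_nbhs Ux; apply; rewrite dxy.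
Qed.

Lemma dist_nonexp (f : M -> M) x y : smooth_map A setT A f -> preserves_metric A g f ->
  d (f x) (f y) <= d x y.
Proof.
move=> sf pf; apply/ler_addgt0Pr => e e0.
have [|l lr C] := @dist_chain x y (d x y + e); first by rewrite ltrDl.
exact: le_trans (dist_le_chain (chain_iso atA gm sf pf C)) (ltW lr).
Qed.

Lemma set_dist_inf (X Y : set M) : set_dist A g X Y = inf [set l | exists x y, [/\ X x, Y y & l = d x y]].
Proof.
rewrite (set_dist_chain atA gm).
set S1 := [set l | _]; set S2 := [set l | _].
have lb1 : has_lbound S1 by exists 0 => l [x [y [_ _ /chain_ge0]]].
have lb2 : has_lbound S2 by exists 0 => l [x [y [_ _ ->]]]; exact: dist_ge0.
have [[l1 Sl1]|n1] := pselect (S1 !=set0); last first.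
  have -> : S1 = set0 by apply/eqP; apply/negPn/negP => /set0P.
  have -> : S2 = set0.
    apply/eqP; apply/negPn/negP => /set0P[l [x [y [Xx Yy _]]]]; apply: n1.
    by have [l' C] := chain_exists x y; exists l', x, y.
  by [].
apply/eqP; rewrite eq_le; apply/andP; split; apply: lb_le_inf.
- by have [x [y [Xx Yy _]]] := Sl1; exists (d x y), x, y.
- move=> l [x [y [Xx Yy ->]]]; apply/ler_addgt0Pr => e e0.
  have [|l' lr C] := @dist_chain x y (d x y + e); first by rewrite ltrDl.
  by apply: le_trans (ltW lr); apply: ge_inf => //; exists x, y.
- by exists l1.
- move=> l [x [y [Xx Yy C]]]; apply: le_trans (dist_le_chain C).
  by apply: ge_inf => //; exists x, y.
Qed.

Lemma dist_between x y (t : R) : 0 <= t <= d x y -> forall e : R, 0 < e ->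
  exists z, d x z = t /\ d z y < d x y - t + e.
Proof.
move=> /andP[t0 td] e e0; have [|l lr C] := @dist_chain x y (d x y + e); first by rewrite ltrDl.
have tI : d x x <= t <= d x y by rewrite distxx t0.
have [z [l1 [l2 [E C1 C2 El]]]] := chain_ivt C (@dist_continuous_r x) tI.
exists z; split=> //; have h1 := dist_le_chain C1; have h2 := dist_le_chain C2; lra.
Qed.

End Metric.

(** * Comparison of the distance with the norm of the metric at one point *)

Section Comparison.
Context {R : realType} {n : nat} {M : topologicalType} {A : set (chart R M n)} {g : gram R M n}.
Hypothesis atA : atlas_on setT A.
Hypothesis gm : riemannian_metric A g.
Hypothesis hausM : hausdorff_space M.
Hypothesis connM : connected [set: M].
Local Notation cgram := (@cgram R n M g).
Local Notation gball := (@gball R n M g).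
Local Notation d := (@riemannian_dist R M n A g).

Let cA : charts A. Proof. by have [] := atA. Qed.

Lemma lincomb_inner (G : 'M[R]_n) u v : lincomb (G *m v^T) u = inner G u v.
Proof. by rewrite /lincomb /inner -mulmxA [RHS]mxE; apply: eq_bigr. Qed.

(** The Lipschitz bound of the metric controls the difference of the squared norms; dividing by the
    norm at [u] costs a factor [K], since [|v|] is at most [K] times that norm. *)
Lemma gnorm_near c p r K L w u v : A c -> gball c p r K L -> `|w - p| <= r -> `|u - p| <= r ->
  gnorm (cgram c u) v <= gnorm (cgram c w) v + @dim2 R n * L * K * `|u - w| * `|v|.
Proof.
move=> Ac gb wr ur; have K0 := gb_K gb; have L0 := gb_L gb.
set N := gnorm (cgram c w) v; set N' := gnorm (cgram c u) v; set D := @dim2 R n.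
have D0 : 0 <= D := @dim2_ge0 R n.
have sq w' : `|w' - p| <= r -> gnorm (cgram c w') v ^+ 2 = inner (cgram c w') v v.
  by move=> h; rewrite gnorm_sqr // => v'; exact: cgram_pos Ac (gb_img gb h).
have E : N' ^+ 2 - N ^+ 2 <= D * (L * `|u - w|) * `|v| * `|v|.
  rewrite !sq // -innerNm -innerDm; apply: (le_trans (ler_norm _)).
  apply: (le_trans (inner_bound _ _ _)); rewrite !ler_wpM2r // ler_wpM2l //.
  have h := gb_lip gb wr ur. exact: h.
have vN := gb_lo gb v ur; rewrite -/N' in vN.
have N0 : 0 <= N by exact: gnorm_ge0.
have N'0 : 0 <= N' by exact: gnorm_ge0.
have a0 : 0 <= D * L * K * `|u - w| * `|v| by rewrite !mulr_ge0 // ltW.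
have [NN|NN] := leP N' N; first by rewrite (le_trans NN) // lerDl.
have N'p : 0 < N' by exact: le_lt_trans NN.
rewrite -lerBlDl -(ler_pM2r N'p); apply: (@le_trans _ _ (N' ^+ 2 - N ^+ 2)).
  by rewrite subr_sqr; apply: ler_wpM2l; [lra|lra].
apply: (le_trans E).
have -> : D * L * K * `|u - w| * `|v| * N' = D * (L * `|u - w|) * `|v| * (K * N') by ring.
by rewrite ler_wpM2l // !mulr_ge0.
Qed.

(** The upper bound is the length of the straight segment. The lower bound is a calibration by the
    covector dual to the unit vector along [w' - w], whose norm exceeds 1 only by a multiple of the
    distance on the region that short chains can reach. *)
Lemma dist_norm c p r K L : A c -> gball c p r K L -> exists rho C : R, [/\ 0 < rho, rho <= r, 0 <= C &
  forall w w', `|w - p| <= rho -> `|w' - p| <= rho ->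
    `|d (cinv c w) (cinv c w') - gnorm (cgram c w) (w' - w)| <= C * `|w' - w| ^+ 2].
Proof.
move=> Ac gb; have K0 := gb_K gb; have L0 := gb_L gb; have r0 := gb_r gb.
have [oc oi Kc ct ci] := cA Ac.
pose C0 : R := @dim2 R n * L * K.
have C00 : 0 <= C0 by rewrite !mulr_ge0 ?dim2_ge0 // ltW.
(* Chosen so that the ball of radius [2 * (K * D) <= 4 * K ^+ 2 * rho] around a point of the
   [rho]-ball stays inside the [r]-ball, with some slack. *)
pose rho := r / (2 + 5 * K ^+ 2).
have K20 : 0 < K ^+ 2 by rewrite exprn_gt0.
have dn : 0 < 2 + 5 * K ^+ 2 by lra.
have rho0 : 0 < rho by rewrite divr_gt0.
have rhoE : rho + rho + 5 * (K ^+ 2 * rho) = r.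
  have : rho * (2 + 5 * K ^+ 2) = r by rewrite divfK // gt_eqF.
  by move=> <-; ring.
have Kr0 : 0 < K ^+ 2 * rho by rewrite mulr_gt0.
exists rho, (C0 + 2 * C0 * K ^+ 4); split=> //; first lra.
  by rewrite addr_ge0 // !mulr_ge0 ?exprn_ge0 // ltW.
move=> w w' wr w'r; set v := w' - w; set N := gnorm _ _; set D := d _ _.
have rr : rho <= r by lra.
have wr' := le_trans wr rr; have w'r' := le_trans w'r rr.
have vr : `|v| <= rho + rho.
  rewrite /v -(subrKA p); apply: (le_trans (ler_normD _ _)); rewrite [`|p - w|]distrC; lra.
have up : D <= N + C0 * `|v| ^+ 2.
  have HB u : `|u - p| <= r -> `|u - w| <= `|w' - w| -> gnorm (cgram c u) (w' - w) <= N + C0 * `|v| ^+ 2.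
    move=> ur uw; apply: (le_trans (gnorm_near _ Ac gb wr' ur)); rewrite lerD2l expr2 mulrA.
    by rewrite ler_wpM2r // ler_wpM2l.
  have [l lB S] := segment_step atA gm Ac gb wr' w'r' HB.
  exact: le_trans (dist_le_chain atA gm (chain_step S)) lB.
have Nv : `|v| <= K * N := gb_lo gb v wr'.
have [x cx Ex] := gb_img gb wr'; have [y cy Ey] := gb_img gb w'r'.
have Dx : D = d x y by rewrite /D -Ex -Ey !Kc.
have D0 : 0 <= D by exact: dist_ge0.
have HB' u : `|u - p| <= r -> `|u - w| <= `|w' - w| -> gnorm (cgram c u) (w' - w) <= K * `|v|.
  by move=> ur _; exact: (gb_up gb (w' - w) ur).
have DK : D <= K * `|v|.
  have [l lB S] := segment_step atA gm Ac gb wr' w'r' HB'.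
  exact: le_trans (dist_le_chain atA gm (chain_step S)) lB.
have lo : N <= D + 2 * C0 * K ^+ 4 * `|v| ^+ 2.
  have c1 : 0 <= 2 * C0 * K ^+ 4 * `|v| ^+ 2 by rewrite !mulr_ge0 ?exprn_ge0 // ltW.
  have [N0|N0] := eqVneq N 0; first by rewrite N0 addr_ge0.
  have Np : 0 < N by rewrite lt_neqAle eq_sym N0 gnorm_ge0.
  have [D00|Dn0] := eqVneq D 0.
    exfalso; have xy : x = y by apply: (dist_eq0 atA gm hausM connM); rewrite -Dx.
    have v0 : v = 0 by rewrite /v -Ex -Ey xy subrr.
    by move: N0; rewrite /N v0 /gnorm /inner !mul0mx mxE sqrtr0 eqxx.
  have Dp : 0 < D by rewrite lt_neqAle eq_sym Dn0.
  (* Twice the coordinate radius [K * D], to include chains slightly longer than the distance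
     [D]. *)
  pose r' := 2 * (K * D).
  have KD : K * D <= 2 * (K ^+ 2 * rho).
    apply: (@le_trans _ _ (K * (K * (rho + rho)))).
      by rewrite ler_wpM2l ?(ltW K0) // (le_trans DK) // ler_wpM2l // ltW.
    by rewrite le_eqVlt; apply/orP; left; apply/eqP; ring.
  have KDp : 0 < K * D by rewrite mulr_gt0.
  have sG := cgram_sym atA gm Ac (gb_img gb wr').
  have pG u := @cgram_pos _ _ _ _ _ atA gm c w u Ac (gb_img gb wr').
  pose kap := 1 + C0 * K * r'.
  have kap0 : 0 <= kap by rewrite addr_ge0 // !mulr_ge0 // ltW.
  have h1 : `|cto c x - p| + K * d x y < r by rewrite Ex -Dx; lra.
  have h2 : `|cto c x - w| + K * d x y < r' by rewrite Ex -Dx subrr normr0 add0r /r'; lra.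
  (* At [w] the covector has norm 1 by Cauchy-Schwarz; [gnorm_near] transports this to [u] at the
     cost of the factor [kap]. *)
  have Hl u (h : 'rV[R]_n) : `|u - w| <= r' ->
      lincomb (N^-1 *: (cgram c w *m v^T)) h <= kap * gnorm (cgram c u) h.
    move=> ur; have ur' : `|u - p| <= r.
      rewrite -(subrKA w); apply: (le_trans (ler_normD _ _)); rewrite /r' in ur; lra.
    have -> : lincomb (N^-1 *: (cgram c w *m v^T)) h = N^-1 * inner (cgram c w) h v.
      rewrite -lincomb_inner /lincomb mulr_sumr; apply: eq_bigr => i _; rewrite mxE; ring.
    rewrite ler_pdivrMl //; apply: (le_trans (gnorm_CS sG pG h v)); rewrite -/N mulrC.
    rewrite ler_wpM2l ?(ltW Np) //; apply: (le_trans (gnorm_near h Ac gb ur' wr')).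
    rewrite /kap mulrDl mul1r lerD2l -/C0 -mulrA.
    have -> : C0 * K * r' * gnorm (cgram c u) h = C0 * (r' * (K * gnorm (cgram c u) h)) by ring.
    rewrite ler_wpM2l // distrC; apply: ler_pM => //; exact: (gb_lo gb h ur').
  have := dist_lincomb atA gm hausM connM Ac gb cx h1 kap0 h2 Hl.
  have -> : lincomb (N^-1 *: (cgram c w *m v^T)) (cto c y - cto c x) = N.
    have -> : lincomb (N^-1 *: (cgram c w *m v^T)) (cto c y - cto c x) = N^-1 * inner (cgram c w) v v.
      by rewrite Ex Ey -lincomb_inner /lincomb mulr_sumr; apply: eq_bigr => i _; rewrite [X in _ * X]mxE; ring.
    by rewrite -gnorm_sqr // -/N expr2 mulKf.
  rewrite -Dx => /le_trans; apply; rewrite /kap mulrDl mul1r lerD2l.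
  have -> : C0 * K * r' * D = 2 * C0 * K ^+ 2 * D ^+ 2 by rewrite /r'; ring.
  have -> : 2 * C0 * K ^+ 4 * `|v| ^+ 2 = 2 * C0 * K ^+ 2 * (K * `|v|) ^+ 2 by ring.
  have C2 : 0 <= 2 * C0 * K ^+ 2 by rewrite mulr_ge0 ?(ltW K20) // mulr_ge0.
  by rewrite ler_wpM2l // ler_pXn2r // nnegrE // mulr_ge0 // ltW.
have c1 : 0 <= 2 * C0 * K ^+ 4 * `|v| ^+ 2 by rewrite !mulr_ge0 ?exprn_ge0 // ltW.
have c2 : 0 <= C0 * `|v| ^+ 2 by rewrite mulr_ge0 // exprn_ge0.
rewrite ler_distl mulrDl; apply/andP; split; lra.
Qed.

End Comparison.

(** * The Hopf-Rinow theorem: closed balls are compact *)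

Section HopfRinow.
Context {R : realType} {n : nat} {M : topologicalType} {A : set (chart R M n)} {g : gram R M n}.
Hypothesis atA : atlas_on setT A.
Hypothesis gm : riemannian_metric A g.
Hypothesis hausM : hausdorff_space M.
Hypothesis connM : connected [set: M].
Local Notation d := (@riemannian_dist R M n A g).
Local Notation cgram := (@cgram R n M g).
Local Notation gball := (@gball R n M g).
Local Notation dtri := (dist_tri atA gm connM).
Local Notation dC := (distC atA gm connM).
Local Notation dge0 := (dist_ge0 atA gm connM).
Local Notation dcont := (@dist_continuous_r _ _ _ _ _ atA gm connM).

Let cA : charts A. Proof. by have [] := atA. Qed.

Definition dball (x : M) (r : R) : set M := [set y | d x y <= r].

Lemma dball_closed x r : closed (dball x r).
Proof.
apply: (@preimage_closed _ _ (d x) [set s | s <= r]) => [y _|]; first exact: dcont.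
exact: closed_le.
Qed.

Lemma dball_compact_small x : exists2 e : R, 0 < e & compact (dball x e).
Proof.
have [c Ac cx] := atlas_cover atA x; have [oc oi Kc ct ci] := cA Ac.
have [r [K [L gb]]] := gball_exists atA gm Ac (imageP _ cx).
have K0 := gb_K gb; have r0 := gb_r gb.
exists (r / K / 2); first by rewrite !divr_gt0.
apply: (@subclosed_compact _ _ (cinv c @` [set w | `|w - cto c x| <= r])).
- exact: dball_closed.
- apply: continuous_compact; last exact: compact_cball.
  apply: continuous_in_subspaceT => w; rewrite inE => wr.
  have [y' cy <-] := gb_img gb wr; exact: ci.
- move=> y xy; have Kd : K * d x y <= r / 2.
    by rewrite mulrC -ler_pdivlMr // mulrAC.
  have h : `|cto c x - cto c x| + K * d x y < r by rewrite subrr normr0 add0r; lra.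
  have [cy yx] := dist_stay atA gm hausM connM Ac gb cx h.
  by exists (cto c y); [rewrite /=; lra|rewrite Kc].
Qed.

(** Every point of the larger ball is moved to a point [rho z] of the smaller one, over a distance
    at most slightly more than [t - s]. The image of the ultrafilter has a cluster point in the
    smaller, compact ball, and the original ultrafilter concentrates around it. *)
Lemma dball_push x (s t eta : R) (F : set_system M) : UltraFilter F -> 0 <= s -> s <= t ->
  compact (dball x s) -> F (dball x t) -> 0 < eta ->
  exists2 y, d x y <= s & F [set z | d y z < t - s + eta].
Proof.
move=> UF s0 st cs Ft eta0; have e20 : 0 < eta / 2 by rewrite divr_gt0.
have /choice[rho Hrho] : forall z, exists y, d x z <= t -> d x y <= s /\ d y z < t - s + eta / 2.
  move=> z; have [zt|] := pselect (d x z <= t); last by exists x.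
  have [zs|zs] := leP (d x z) s.
    by exists z => _; split=> //; rewrite (distxx atA gm connM); lra.
  have sI : 0 <= s <= d x z by rewrite s0 ltW.
  have [y [xy yz]] := dist_between atA gm connM sI e20.
  by exists y => _; split; [rewrite xy|apply: (lt_le_trans yz); lra].
have PF := @ultra_proper _ F UF.
have FD : (rho @ F) (dball x s).
  have h : F (rho @^-1` dball x s) by apply: filterS Ft => z /Hrho[].
  exact: h.
have [y [ys cy]] := cs _ _ FD.
exists y => //.
have By : nbhs y [set z | d y z < eta / 2] by exact: (dist_near atA gm y e20).
have : F (rho @^-1` [set z | d y z < eta / 2]).
  have [//|nF] := in_ultra_setVsetC (rho @^-1` [set z | d y z < eta / 2]) UF.
  have [z [nz zB]] := cy _ _ (nF : (rho @ F) (~` [set z | d y z < eta / 2])) By.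
  by exfalso; exact: nz.
move=> F1; apply: filterS (filterI Ft F1) => z [zt h]; rewrite /= in h *.
have [_ h2] := Hrho z zt; have h3 := dtri (rho z) y z; lra.
Qed.

Lemma ultra_cvg (F : set_system M) y : UltraFilter F ->
  (forall e : R, 0 < e -> F [set z | d y z < e]) -> F --> y.
Proof.
move=> UF H U Uy; have PF := @ultra_proper _ F UF.
by have [e e0 eU] := dist_nbhs atA gm hausM connM Uy; apply: filterS (H e e0) => z /eU.
Qed.

Hypothesis complete : dist_complete d.

(** Real induction on the radius. Enlarging a radius uses that small balls are compact, uniformly
    over a compact ball; completeness enters only when passing to a limit radius, where an
    ultrafilter yields a Cauchy sequence of centres. *)
Lemma dball_compact x r : compact (dball x r).
Proof.
have [r0|r0] := ltP r 0.
  have -> : dball x r = set0; last exact: compact0.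
  by apply/seteqP; split=> // y; rewrite /dball /=; have := dge0 x y; lra.
have Pright t : 0 <= t -> t < r -> (forall u, 0 <= u -> u <= t -> compact (dball x u)) ->
    exists2 e, 0 < e & forall u, t < u -> u < t + e -> compact (dball x u).
  move=> t0 tb H; have ct : compact (dball x t) by exact: H.
  (* By compactness one radius [e] works for all centres in the ball of radius [t]. *)
  have nH : \forall e \near 0^'+, dball x t `<=` [set y | compact (dball y e)].
    apply: ((compact_near_coveringP _).1 ct R 0^'+ (fun e y => compact (dball y e))) => y _.
    have [e e0 ce] := dball_compact_small y.
    have e20 : 0 < e / 2 by rewrite divr_gt0.
    exists ([set z | d y z < e / 2], [set s | s < e / 2]).
      split => /=; first exact: (dist_near atA gm y e20).
      exact: nbhs_right_lt.
    move=> [z s] [/= h1 h2]; apply: (subclosed_compact (@dball_closed z s) ce) => w.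
    rewrite /dball /= => h3; have := dtri z y w; lra.
  have [e [e0 He]] := filter_ex (filterI (nbhs_right_gt (0 : R)) nH).
  exists (e / 2); first by rewrite divr_gt0.
  move=> u tu ue; rewrite compact_ultra => F UF Fu.
  have PF := @ultra_proper _ F UF.
  have e40 : 0 < e / 4 by rewrite divr_gt0.
  have [y yt Fy] := dball_push UF t0 (ltW tu) ct Fu e40.
  have cy := He y yt; rewrite compact_ultra in cy.
  have FD : F (dball y e).
    by apply: filterS Fy => z /= h; rewrite /dball /=; lra.
  have [z [_ Fz]] := cy F UF FD.
  exists z; split=> //.
  exact: (@closed_cvg _ _ F _ id _ (@dball_closed x u)).
have Pleft t : 0 < t -> t <= r -> (forall u, 0 <= u -> u < t -> compact (dball x u)) ->
    compact (dball x t).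
  move=> t0 tb H; rewrite compact_ultra => F UF Ft.
  have PF := @ultra_proper _ F UF.
  (* The ball of radius [t - h k] (or 0) is compact; pushing the ultrafilter into it leaves an
     uncertainty of at most [2 * h k] for the centre [y k]. *)
  pose h k : R := 2^-1 ^+ k.
  have h0 k : 0 < h k by rewrite exprn_gt0 // invr_gt0.
  have /choice[y Hy] : forall k, exists y, F [set z | d y z < 2 * h k].
    move=> k; pose s := Num.max 0 (t - h k).
    have s0 : 0 <= s by rewrite le_max lexx.
    have st : s < t by rewrite gt_max t0 gtrBl h0.
    have [y _ Fy] := dball_push UF s0 (ltW st) (H s s0 st) Ft (h0 k).
    exists y; apply: filterS Fy => z /= /lt_le_trans; apply.
    have : t - h k <= s by rewrite le_max lexx orbT.
    lra.
  have cv0 : h @ \oo --> (0 : R).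
    by apply: cvg_expr; rewrite ger0_norm ?invr_ge0 // invf_lt1 // ltr1n.
  have Cy (e : R) : 0 < e -> exists N, forall i j, (N <= i)%N -> (N <= j)%N -> d (y i) (y j) < e.
    move=> e0; have e40 : 0 < e / 4 by rewrite divr_gt0.
    have := @cvgr0_norm_lt _ _ _ _ _ _ cv0 _ e40 => -[N _ HN].
    exists N => i j Ni Nj.
    have [w [wi wj]] := filter_ex (filterI (Hy i) (Hy j)).
    have := HN i Ni; have := HN j Nj; rewrite /= !gtr0_norm // => hj hi.
    have := dtri w (y i) (y j); rewrite (dC w (y j)) /= in wi wj *; lra.
  have [z cz] := complete Cy.
  have Fz : F --> z.
    apply: ultra_cvg => e e0; have e40 : 0 < e / 4 by rewrite divr_gt0.
    have n1 : \forall k \near \oo, `|h k| < e / 4 by exact: (@cvgr0_norm_lt _ _ _ _ _ _ cv0 _ e40).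
    have n2 : \forall k \near \oo, `|d (y k) z| < e / 4 by exact: (@cvgr0_norm_lt _ _ _ _ _ _ cz _ e40).
    have [k [k1 k2]] := filter_ex (filterI n1 n2).
    apply: filterS (Hy k) => w /= wk.
    rewrite gtr0_norm // in k1; rewrite (ger0_norm (dge0 (y k) z)) in k2.
    have := dtri (y k) z w; rewrite (dC z (y k)); lra.
  exists z; split=> //.
  exact: (@closed_cvg _ _ F _ id _ (@dball_closed x t)).
have P0 : compact (dball x 0).
  have -> : dball x 0 = [set x]; last exact: compact_set1.
  apply/seteqP; split=> y; rewrite /dball /=.
    move=> h; apply/esym/(dist_eq0 atA gm hausM connM)/eqP; rewrite eq_le h; exact: dge0.
  by move=> ->; rewrite (distxx atA gm connM).
by apply: (real_induction r0 P0 Pleft Pright); rewrite r0 lexx.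
Qed.

(** Approximate intermediate points lie on the sphere of radius [t] around [x], which is now
    compact; its point nearest to [y] does as well as all of them. *)
Lemma dist_between_exact x y t : 0 <= t <= d x y -> exists z, d x z = t /\ d z y = d x y - t.
Proof.
move=> tI; pose S := [set z | d x z = t].
have cS : compact S.
  apply: (subclosed_compact _ (@dball_compact x t)); last by move=> z; rewrite /S /dball /= => ->.
  apply: (@preimage_closed _ _ (d x) [set s | s = t]) => [z _|]; first exact: dcont.
  exact: closed_eq.
have S0 : S !=set0 by have [z [xz _]] := dist_between atA gm connM tI ltr01; exists z.
have ccont : {within S, continuous (d y)} by apply: continuous_subspaceT; exact: dcont.
have [z] := compact_EVT_min S0 cS ccont.
rewrite inE => Sz zmin; exists z; split=> //; apply/eqP; rewrite eq_le; apply/andP; split.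
  apply/ler_addgt0Pr => e e0; have [w [xw wy]] := dist_between atA gm connM tI e0.
  have := zmin w; rewrite inE => /(_ xw); rewrite dC [d y w]dC; lra.
have := dtri z x y; rewrite Sz; lra.
Qed.

End HopfRinow.

(** * First variation of the distance from a point *)

Section FirstVariation.
Context {R : realType} {n : nat} {M : topologicalType} {A : set (chart R M n)} {g : gram R M n}.
Hypothesis atA : atlas_on setT A.
Hypothesis gm : riemannian_metric A g.
Hypothesis hausM : hausdorff_space M.
Hypothesis connM : connected [set: M].
Local Notation d := (@riemannian_dist R M n A g).
Local Notation cgram := (@cgram R n M g).
Local Notation gball := (@gball R n M g).
Local Notation dtri := (dist_tri atA gm connM).
Local Notation dC := (distC atA gm connM).
Local Notation dge0 := (dist_ge0 atA gm connM).
Local Notation D := (@dim2 R n).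
Hypothesis complete : dist_complete d.

Let cA : charts A. Proof. by have [] := atA. Qed.

Lemma dist_subdivide (x y : M) (N : nat) : exists z : nat -> M,
  [/\ z 0%N = x, z N.+1 = y & forall i, (i <= N)%N -> d (z i) (z i.+1) = d x y / N.+1%:R].
Proof.
elim: N x y => [|N IH] x y.
  exists (fun i => if i is 0%N then x else y); split=> // i.
  by rewrite leqn0 => /eqP ->; rewrite divr1.
have N0 : 0 < N.+2%:R :> R by rewrite ltr0n.
have tI : 0 <= d x y / N.+2%:R <= d x y.
  rewrite divr_ge0 ?dge0 ?ler0n //= ler_pdivrMr // ler_peMr ?dge0 // ler1n //.
have [u [xu uy]] := dist_between_exact atA gm hausM connM complete tI.
have [z [z0 zN Hz]] := IH u y.
exists (fun i => if i is j.+1 then z j else x); split=> // -[_|i iN].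
  by rewrite z0.
rewrite Hz // uy; have N1 : N.+1%:R != 0 :> R by rewrite pnatr_eq0.
have -> : N.+2%:R = N.+1%:R + 1 :> R by rewrite -natr1.
have N2 : N.+1%:R + 1 != 0 :> R by rewrite natr1 pnatr_eq0.
by move: N.+1%:R N1 N2 => q N1 N2; field; rewrite ?N1 ?N2.
Qed.

Lemma dist_sum (z : nat -> M) (N : nat) : d (z 0%N) (z N) <= \sum_(i < N) d (z i) (z i.+1).
Proof.
elim: N => [|N IH]; first by rewrite big_ord0 (distxx atA gm connM).
rewrite big_ord_recr /=; apply: (le_trans (dtri (z N) _ _)); exact: lerD.
Qed.

Lemma linear_lincomb (l : 'rV[R]_n -> R) : (forall a u v, l (a *: u + v) = a * l u + l v) ->
  exists lam, forall v, l v = lincomb lam v.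
Proof.
move=> Hl; have l0 : l 0 = 0.
  by have := Hl (-1) 0 0; rewrite scaler0 addr0 mulN1r addNr.
exists (\col_j l (delta_mx 0 j)) => v; rewrite {1}[v]row_sum_delta /lincomb.
have lD : {morph l : u w / u + w >-> u + w} by move=> u w; have := Hl 1 u w; rewrite scale1r mul1r.
rewrite (big_morph l lD l0); apply: eq_bigr => j _.
by rewrite mxE -[_ *: _]addr0 Hl l0 addr0.
Qed.

Lemma grad_linear (F : 'rV[R]_n -> 'M[R]_n) w (a : R) (u v : 'rV[R]_n) :
  grad F w (a *: u + v) = a *: grad F w u + grad F w v.
Proof.
apply/matrixP => i j; rewrite !mxE mulr_sumr -big_split; apply: eq_bigr => l _.
by rewrite !mxE /=; ring.
Qed.

Lemma innerZm (G : 'M[R]_n) (a : R) u v : inner (a *: G) u v = a * inner G u v.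
Proof. by rewrite /inner -scalemxAr -scalemxAl mxE. Qed.

Lemma gnormZ (G : 'M[R]_n) (a : R) v : 0 <= a -> gnorm G (a *: v) = a * gnorm G v.
Proof.
move=> a0; rewrite /gnorm innerZl innerZr mulrA -expr2 sqrtrM ?sqr_ge0 //.
by rewrite sqrtr_sqr ger0_norm.
Qed.

(** Here [h] displaces the base point and [z] changes the edge vector. The middle group is linear in
    [(h, z)] and is the first variation of the energy; the last group collects the remainders, at
    least quadratic in [(h, z)] jointly. *)
Lemma energy_perturb c p r K L w h v z : A c -> gball c p r K L -> `|w - p| <= r -> `|w + h - p| <= r ->
  inner (cgram c (w + h)) (v + z) (v + z) <=
  inner (cgram c w) v v + (2 * inner (cgram c w) z v + inner (grad (cgram c) w h) v v) +
  (K ^+ 2 * `|z| ^+ 2 + 2 * (D * L) * `|h| * `|v| * `|z| + D * L * `|h| * `|z| ^+ 2 +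
   D * L * `|h| ^+ 2 * (`|v| + `|z|) ^+ 2).
Proof.
move=> Ac gb wr whr; have K0 := gb_K gb; have L0 := gb_L gb.
have [T1 T2] := gb_tay gb wr whr.
have sG := cgram_sym atA gm Ac (gb_img gb wr).
have pG u := @cgram_pos _ _ _ _ _ atA gm c w u Ac (gb_img gb wr).
set E := cgram c (w + h) - cgram c w - grad (cgram c) w h in T1.
have -> : cgram c (w + h) = cgram c w + grad (cgram c) w h + E by rewrite /E; apply/matrixP => i j; rewrite !mxE; ring.
move: E T1 => E T1.
set G := cgram c w in sG pG *; set H := grad (cgram c) w h in T2 *.
have D0 : 0 <= D := @dim2_ge0 R n.
have e1 : inner G z z <= K ^+ 2 * `|z| ^+ 2.
  rewrite -gnorm_sqr // -exprMn ler_pXn2r ?nnegrE ?gnorm_ge0 ?mulr_ge0 ?(ltW K0) //.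
  exact: (gb_up gb z wr).
have b1 u u' : inner H u u' <= D * L * `|h| * `|u| * `|u'|.
  apply: (le_trans (ler_norm _)); apply: (le_trans (inner_bound _ _ _)).
  by rewrite -[D * L * _]mulrA !ler_wpM2r // ler_wpM2l.
have b2 : inner E (v + z) (v + z) <= D * L * `|h| ^+ 2 * (`|v| + `|z|) ^+ 2.
  apply: (le_trans (ler_norm _)); apply: (le_trans (inner_bound _ _ _)).
  rewrite -mulrA -expr2 -[D * L * _]mulrA; apply: ler_pM; rewrite ?mulr_ge0 ?exprn_ge0 //.
    by rewrite ler_wpM2l.
  by rewrite ler_pXn2r ?nnegrE ?addr_ge0 // ler_normD.
have := b1 v z; have := b1 z v; have := b1 z z => h1 h2 h3.
rewrite 2!innerDm; move: (inner E _ _) b2 => X b2.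
rewrite [inner G _ _]innerDl [inner H _ _]innerDl !innerDr (innerC v z sG).
have -> : D * L * `|h| * `|z| ^+ 2 = D * L * `|h| * `|z| * `|z| by rewrite expr2 mulrA.
have -> : 2 * (D * L) * `|h| * `|v| * `|z| = D * L * `|h| * `|v| * `|z| + D * L * `|h| * `|z| * `|v| by ring.
lra.
Qed.

(** A minimal segment from [b] to [y] is cut into equal edges, and its vertex number [i] is
    displaced by the fraction [i * k] of [xi]: [b] stays fixed and [y] moves by [xi]. The total
    length of the new polygon bounds the distance. The error [e] pays for the discretization, while
    [C1] depends on neither [e], [b] nor [y]. *)
Lemma upper_support c p r K L (rho C s : R) : A c -> gball c p r K L -> 0 < rho -> rho <= r -> 0 <= C ->
  (forall w w', `|w - p| <= rho -> `|w' - p| <= rho ->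
    `|d (cinv c w) (cinv c w') - gnorm (cgram c w) (w' - w)| <= C * `|w' - w| ^+ 2) ->
  0 < s -> exists2 C1 : R, 0 <= C1 & forall b y, cdom c b -> s <= d b y -> d b y <= 2 * s ->
    `|cto c b - p| + K * d b y <= rho / 3 ->
    forall e : R, 0 < e -> exists lam, forall xi, `|xi| <= rho / 2 ->
      d b (cinv c (cto c y + xi)) <= d b y + lincomb lam xi + C1 * `|xi| ^+ 2 + e.
Proof.
move=> Ac gb rho0 rhor C0 HC s0; have K0 := gb_K gb; have L0 := gb_L gb.
have [oc oi Kc ct ci] := cA Ac.
have D0 : 0 <= D := @dim2_ge0 R n.
pose Ks := K * (2 * s); have Ks0 : 0 < Ks by rewrite !mulr_gt0.
pose C2 : R := K ^+ 2 + 2 * (D * L) * Ks + D * L * rho + D * L * (Ks + rho) ^+ 2.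
have DL0 : 0 <= D * L by rewrite mulr_ge0.
have C20 : 0 <= C2 by rewrite !addr_ge0 ?mulr_ge0 ?exprn_ge0 ?addr_ge0 // ltW.
(* [energy_perturb] contributes at most [C2 * |xi|^2 * k^2] per edge; dividing by twice the edge
   length [tau * k], with [tau >= s], gives this coefficient after summation. *)
exists (C2 / (2 * s)); first by rewrite divr_ge0 // mulr_ge0 // ltW.
move=> b y cb sl su br e e0; set tau := d b y in sl su br *.
have tau0 : 0 < tau by exact: lt_le_trans sl.
pose C4 := 2 * (C * K * Ks) + (C * K * Ks) ^+ 2.
have CKs0 : 0 <= C * K * Ks by rewrite !mulr_ge0 // ltW.
have C40 : 0 <= C4 by rewrite addr_ge0 ?exprn_ge0 // mulr_ge0.
pose C5 := C * (Ks + rho) ^+ 2.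
have C50 : 0 <= C5 by rewrite mulr_ge0 ?exprn_ge0 ?addr_ge0 // ltW.
(* The discretization error of one edge is [B * k ^+ 2], so that of the sum is [B * k], which the
   choice of [N] makes at most [e]. *)
pose B := tau * C4 / 2 + C5.
have B0 : 0 <= B by rewrite addr_ge0 // divr_ge0 // mulr_ge0 // ltW.
have BN : B / e <= (Num.bound (B / e)).+1%:R.
  have h : B / e < (Num.bound (B / e))%:R by apply: archi_boundP; rewrite divr_ge0 // ltW.
  by rewrite -natr1; lra.
move: (Num.bound _) BN => N BN.
pose k : R := N.+1%:R^-1.
have k0 : 0 < k by rewrite invr_gt0 ltr0n.
have k1 : k <= 1 by rewrite invf_le1 ?ltr0n // ler1n.
have kN : \sum_(i < N.+1) k = 1 by rewrite sumr_const card_ord -mulr_natr mulVf // pnatr_eq0.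
have kB : B * k <= e by rewrite ler_pdivrMr ?ltr0n // mulrC -ler_pdivrMr.
have [z [z0 zN Hz]] := dist_subdivide b y N; rewrite -/tau -/k in Hz.
pose w i := cto c (z i); pose v i := w i.+1 - w i.
have db i : (i <= N.+1)%N -> d b (z i) <= tau.
  move=> iN; rewrite -{1}z0; apply: (le_trans (dist_sum z i)).
  rewrite (eq_bigr (fun=> tau * k)) => [|j _]; last by rewrite Hz // -ltnS (leq_trans (ltn_ord j)).
  rewrite sumr_const card_ord -mulr_natr -mulrA ler_piMr ?(ltW tau0) //.
  by rewrite mulrC ler_pdivrMr ?ltr0n // mul1r ler_nat.
have Kd i : (i <= N.+1)%N -> K * d b (z i) <= K * tau by move=> /db; rewrite ler_pM2l.
have st i : (i <= N.+1)%N -> cdom c (z i) /\ `|w i - p| <= rho / 3.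
  move=> iN; have h : `|cto c b - p| + K * d b (z i) < r by have := Kd i iN; lra.
  have [cz zz] := dist_stay atA gm hausM connM Ac gb cb h; split=> //.
  rewrite -(subrKA (cto c b)); apply: (le_trans (ler_normD _ _)).
  rewrite addrC; apply: le_trans br; rewrite lerD2l; exact: le_trans zz (Kd i iN).
have r2 : rho / 3 <= r by lra.
have vk' i : (i <= N)%N -> `|v i| <= K * (tau * k).
  move=> iN; have [ci1 wi] := st i (leqW iN).
  have h : `|cto c (z i) - p| + K * d (z i) (z i.+1) < r.
    have kt : tau * k <= tau by rewrite ler_piMr // ltW.
    have Kt : K * (tau * k) <= K * tau by rewrite ler_pM2l.
    have := normr_ge0 (cto c b - p); rewrite Hz //; rewrite /w in wi; lra.
  have [_ zz] := dist_stay atA gm hausM connM Ac gb ci1 h.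
  by apply: (le_trans zz); rewrite Hz.
have vk i : (i <= N)%N -> `|v i| <= Ks * k.
  move=> iN; apply: (le_trans (vk' i iN)); rewrite mulrA ler_wpM2r ?(ltW k0) // ler_pM2l //.
have Gv i : (i <= N)%N -> inner (cgram c (w i)) (v i) (v i) <= tau ^+ 2 * k ^+ 2 * (1 + C4 * k).
  move=> iN; have [c1 w1] := st i (leqW iN); have [c2 w2] := st i.+1 iN.
  have := HC (w i) (w i.+1) (le_trans w1 _) (le_trans w2 _); rewrite !Kc // Hz // -/(v i).
  have rr : rho / 3 <= rho by lra.
  move=> /(_ rr rr); rewrite ler_distl => /andP[+ _].
  rewrite -gnorm_sqr => [|u]; last by apply: cgram_pos Ac (gb_img gb (le_trans w1 r2)).
  set N' := gnorm _ _ => hh; have N'0 : 0 <= N' by exact: gnorm_ge0.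
  have h1 : N' <= tau * k * (1 + C * K * Ks * k).
    have : C * `|v i| ^+ 2 <= tau * k * (C * K * Ks * k).
      have -> : tau * k * (C * K * Ks * k) = C * ((K * tau * k) * (Ks * k)) by ring.
      rewrite ler_wpM2l // expr2; apply: ler_pM => //; last exact: vk.
      by rewrite -mulrA; exact: vk'.
    by move=> h2; rewrite mulrDr mulr1; lra.
  have tk0 : 0 <= tau * k by rewrite mulr_ge0 ?ltW.
  apply: (@le_trans _ _ ((tau * k * (1 + C * K * Ks * k)) ^+ 2)).
    by rewrite ler_pXn2r // nnegrE // mulr_ge0 // addr_ge0 // mulr_ge0 // ltW.
  rewrite exprMn -[tau ^+ 2 * _]exprMn ler_wpM2l ?exprn_ge0 //.
  have -> : (1 + C * K * Ks * k) ^+ 2 = 1 + 2 * (C * K * Ks) * k + (C * K * Ks) ^+ 2 * k * k by ring.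
  have : (C * K * Ks) ^+ 2 * k * k <= (C * K * Ks) ^+ 2 * k.
    by rewrite ler_piMr // mulr_ge0 ?exprn_ge0 // ltW.
  rewrite /C4; lra.
(* The sum of the first variations of the edges: dividing the variation of the energy by twice the
   edge length [tau * k] turns it into that of the length. *)
pose ell xi := \sum_(i < N.+1) (2 * tau * k)^-1 * (2 * inner (cgram c (w i)) (k *: xi) (v i) +
  inner (grad (cgram c) (w i) ((i%:R * k) *: xi)) (v i) (v i)).
have ell_lin (a : R) u u' : ell (a *: u + u') = a * ell u + ell u'.
  rewrite /ell mulr_sumr -big_split; apply: eq_bigr => i _ /=.
  rewrite !scalerDr !scalerA ![k * a]mulrC ![_ * k * a]mulrC -!(scalerA a) innerDl innerZl.
  by rewrite grad_linear innerDm innerZm; ring.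
have [lam Hlam] := linear_lincomb ell_lin.
exists lam => xi xir; rewrite -Hlam.
pose u i := w i + (i%:R * k) *: xi.
have uE i : u i.+1 - u i = v i + k *: xi.
  rewrite /u /v -natr1 mulrDl mul1r scalerDl; apply/rowP => j; rewrite !mxE; ring.
have ik i : (i <= N.+1)%N -> 0 <= i%:R * k <= 1.
  move=> iN; rewrite mulr_ge0 ?ler0n ?(ltW k0) //= ler_pdivrMr ?ltr0n // mul1r ler_nat //.
have eta i : (i <= N.+1)%N -> `|(i%:R * k) *: xi| <= `|xi|.
  by move=> /ik/andP[h1 h2]; rewrite normrZ ger0_norm // ler_piMl.
have ur i : (i <= N.+1)%N -> `|u i - p| <= rho.
  move=> iN; have [_ h] := st i iN; have h2 := eta i iN.
  by rewrite /u addrAC; apply: (le_trans (ler_normD _ _)); lra.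
have zk : `|k *: xi| = k * `|xi| by rewrite normrZ ger0_norm // ltW.
have term i : (i <= N)%N -> d (cinv c (u i)) (cinv c (u i.+1)) <=
    (tau + B * k + C2 / (2 * s) * `|xi| ^+ 2) * k + (2 * tau * k)^-1 *
    (2 * inner (cgram c (w i)) (k *: xi) (v i) + inner (grad (cgram c) (w i) ((i%:R * k) *: xi)) (v i) (v i)).
  move=> iN; have := HC _ _ (ur i (leqW iN)) (ur i.+1 iN); rewrite ler_distl uE => /andP[_ h1].
  have ur' : `|w i + (i%:R * k) *: xi - p| <= r by exact: le_trans (ur i (leqW iN)) rhor.
  have wr' : `|w i - p| <= r by have [_ h] := st i (leqW iN); exact: le_trans h r2.
  have h2 := energy_perturb (v i) (k *: xi) Ac gb wr' ur'.
  have gE : gnorm (cgram c (u i)) (v i + k *: xi) ^+ 2 =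
      inner (cgram c (w i + (i%:R * k) *: xi)) (v i + k *: xi) (v i + k *: xi).
    by rewrite gnorm_sqr // => u'; apply: cgram_pos Ac (gb_img gb ur').
  set N' := gnorm _ _ in h1 gE; set X := 2 * inner _ _ _ + _ in h2 *.
  have h3 := Gv i iN; have h4 := eta i (leqW iN); have h5 := vk i iN.
  have xr : `|xi| <= rho by lra.
  have Q : K ^+ 2 * `|k *: xi| ^+ 2 + 2 * (D * L) * `|(i%:R * k) *: xi| * `|v i| * `|k *: xi| +
     D * L * `|(i%:R * k) *: xi| * `|k *: xi| ^+ 2 +
     D * L * `|(i%:R * k) *: xi| ^+ 2 * (`|v i| + `|k *: xi|) ^+ 2 <= C2 * `|xi| ^+ 2 * k ^+ 2.
    rewrite zk; have -> : C2 * `|xi| ^+ 2 * k ^+ 2 = K ^+ 2 * (k * `|xi|) ^+ 2 +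
      2 * (D * L) * `|xi| * (Ks * k) * (k * `|xi|) + D * L * rho * (k * `|xi|) ^+ 2 +
      D * L * `|xi| ^+ 2 * (Ks * k + k * rho) ^+ 2 by rewrite /C2; ring.
    have kx0 : 0 <= k * `|xi| by rewrite mulr_ge0 // ltW.
    have DL2 : 0 <= 2 * (D * L) by rewrite mulr_ge0.
    apply: lerD; [apply: lerD; [apply: lerD => //|]|].
    - rewrite ler_wpM2r //; apply: ler_pM; rewrite ?mulr_ge0 //.
      by rewrite ler_wpM2l.
    - rewrite ler_wpM2r ?exprn_ge0 // ler_wpM2l //; exact: le_trans h4 xr.
    - apply: ler_pM; rewrite ?mulr_ge0 ?exprn_ge0 ?addr_ge0 //.
        by rewrite ler_wpM2l // ler_pXn2r // nnegrE.
      have a1 : 0 <= Ks * k by rewrite mulr_ge0 // ltW.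
      have a2 : 0 <= k * rho by rewrite mulr_ge0 // ltW.
      rewrite ler_pXn2r ?nnegrE ?addr_ge0 //.
      by rewrite lerD // ler_pM2l.
  have h6 : C * `|v i + k *: xi| ^+ 2 <= C5 * k ^+ 2.
    rewrite /C5 -mulrA -exprMn ler_wpM2l // ler_pXn2r ?nnegrE ?mulr_ge0 ?addr_ge0 ?(ltW k0) ?(ltW Ks0) ?(ltW rho0) //.
    apply: (le_trans (ler_normD _ _)); rewrite zk mulrDl lerD // mulrC ler_pM2r //.
  have tk : 0 < tau * k by rewrite mulr_gt0.
  have h7 : N' <= (tau * k * (1 + C4 * k / 2)) + C2 * `|xi| ^+ 2 * k / (2 * tau) + (2 * tau * k)^-1 * X.
    rewrite -(ler_pM2l (_ : 0 < 2 * (tau * k))); last by rewrite mulr_gt0.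
    have -> : 2 * (tau * k) * (tau * k * (1 + C4 * k / 2) + C2 * `|xi| ^+ 2 * k / (2 * tau) + (2 * tau * k)^-1 * X) =
       tau ^+ 2 * k ^+ 2 * (1 + C4 * k) + C2 * `|xi| ^+ 2 * k ^+ 2 + X + (tau * k) ^+ 2.
      by field; rewrite !gt_eqF.
    (* Length is bounded through energy by [2 tau k N' <= N'^2 + (tau k)^2], which is sharp to first
       order because the unperturbed edge has length close to [tau * k]. *)
    have := sqr_ge0 (N' - tau * k); rewrite sqrrB.
    have -> : (N' * (tau * k)) *+ 2 = 2 * (tau * k) * N' by ring.
    by rewrite gE; lra.
  have h8 : C2 * `|xi| ^+ 2 * k / (2 * tau) <= C2 / (2 * s) * `|xi| ^+ 2 * k.
    have -> : C2 * `|xi| ^+ 2 * k / (2 * tau) = (2 * tau)^-1 * (C2 * `|xi| ^+ 2 * k) by rewrite mulrC.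
    have -> : C2 / (2 * s) * `|xi| ^+ 2 * k = (2 * s)^-1 * (C2 * `|xi| ^+ 2 * k) by ring.
    rewrite ler_wpM2r ?mulr_ge0 ?exprn_ge0 ?(ltW k0) // lef_pV2 ?posrE ?mulr_gt0 //.
    by rewrite ler_pM2l.
  apply: (le_trans h1); rewrite [leRHS](_ : _ = tau * k + (tau * k * (C4 * k / 2) + C5 * k ^+ 2) +
    C2 / (2 * s) * `|xi| ^+ 2 * k + (2 * tau * k)^-1 * X); last by rewrite /B; ring.
  by rewrite mulrDr mulr1 in h7; lra.
have u0 : cinv c (u 0%N) = b by rewrite /u mul0r scale0r addr0 /w z0 Kc.
have uN : cinv c (u N.+1) = cinv c (cto c y + xi).
  by rewrite /u /w zN /k mulfV ?pnatr_eq0 // scale1r.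
rewrite -uN -{1}u0; apply: (le_trans (dist_sum (cinv c \o u) N.+1)).
apply: (@le_trans _ _ (\sum_(i < N.+1) ((tau + B * k + C2 / (2 * s) * `|xi| ^+ 2) * k + (2 * tau * k)^-1 *
    (2 * inner (cgram c (w i)) (k *: xi) (v i) + inner (grad (cgram c) (w i) ((i%:R * k) *: xi)) (v i) (v i))))).
  by apply: ler_sum => i _; apply: term; rewrite -ltnS.
rewrite big_split /= -mulr_sumr kN mulr1 -/(ell xi); lra.
Qed.

End FirstVariation.

(** * Approximate gradients of distance functions *)

Section NonBranching.
Context {R : realType} {n : nat} {M : topologicalType} {A : set (chart R M n)} {g : gram R M n}.
Hypothesis atA : atlas_on setT A.
Hypothesis gm : riemannian_metric A g.
Hypothesis hausM : hausdorff_space M.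
Hypothesis connM : connected [set: M].
Local Notation d := (@riemannian_dist R M n A g).
Local Notation cgram := (@cgram R n M g).
Local Notation gball := (@gball R n M g).
Local Notation dtri := (dist_tri atA gm connM).
Local Notation dC := (distC atA gm connM).
Local Notation dge0 := (dist_ge0 atA gm connM).
Local Notation D := (@dim2 R n).
Hypothesis complete : dist_complete d.

Let cA : charts A. Proof. by have [] := atA. Qed.

Section Local.
Variables (c : chart R M n) (p : 'rV[R]_n) (r K L rho C : R).
Hypothesis Ac : A c.
Hypothesis gb : gball c p r K L.
Hypothesis rho0 : 0 < rho.
Hypothesis rhor : rho <= r.
Hypothesis C0 : 0 <= C.
Hypothesis HC : forall w w', `|w - p| <= rho -> `|w' - p| <= rho ->
  `|d (cinv c w) (cinv c w') - gnorm (cgram c w) (w' - w)| <= C * `|w' - w| ^+ 2.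

Let K0 : 0 < K := gb_K gb.
Let L0 : 0 <= L := gb_L gb.

(** A two-sided quadratic expansion with an additive error [e], on which [lam] may depend: no
    differentiability of the distance is claimed. *)
Definition approx_grad (f : M -> R) (w : 'rV[R]_n) (lam : 'cV[R]_n) (e Cg : R) :=
  forall xi, `|xi| <= rho / 2 ->
    `|f (cinv c (w + xi)) - f (cinv c w) - lincomb lam xi| <= Cg * `|xi| ^+ 2 + e.

(** The increment of [f] over a displacement of size [t] at [w'] is also a difference of two
    increments at [w]. The displacements have sizes [t], [t] and at most [2 * t], and [e <= t ^+ 2];
    so the errors are [Cg + 1], [Cg + 1] and [4 * Cg + 1] times [t ^+ 2], whence [6 * Cg + 3]. *)
Lemma approx_grad_lip f w w' lam lam' e Cg t v : 0 <= Cg -> 0 < t -> t <= rho / 4 -> e <= t ^+ 2 ->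
  `|w' - w| <= t -> approx_grad f w lam e Cg -> approx_grad f w' lam' e Cg ->
  `|lincomb lam' v - lincomb lam v| <= (6 * Cg + 3) * t * `|v|.
Proof.
move=> Cg0 t0 tr et ww Hw Hw'; have [->|v0] := eqVneq v 0.
  have l0 (l : 'cV[R]_n) : lincomb l 0 = 0 by exact: linear0.
  by rewrite !l0 subrr !normr0 mulr0.
have vn : 0 < `|v| by rewrite normr_gt0.
pose xi := (t / `|v|) *: v.
have xin : `|xi| = t by rewrite normrZ ger0_norm ?divfK ?gt_eqF // divr_ge0 // ltW.
have x1 : `|xi| <= rho / 2 by rewrite xin; lra.
have x2 : `|w' - w| <= rho / 2 by lra.
have x3 : `|w' - w + xi| <= rho / 2 by apply: (le_trans (ler_normD _ _)); rewrite xin; lra.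
have E : lincomb lam' v - lincomb lam v = (lincomb lam' xi - lincomb lam xi) * (`|v| / t).
  have lZ (l : 'cV[R]_n) a : lincomb l (a *: v) = a * lincomb l v by exact: linearZ.
  by rewrite /xi !lZ; field; rewrite !gt_eqF.
have h1 := Hw' xi x1; have h2 := Hw _ x2; have h3 := Hw _ x3.
rewrite addrA subrKC in h3; rewrite subrKC in h2.
have xt : `|xi| <= t by rewrite xin.
have xt2 : `|w' - w + xi| <= 2 * t by apply: (le_trans (ler_normD _ _)); rewrite xin; lra.
have sq u : `|u| <= 2 * t -> Cg * `|u| ^+ 2 + e <= (4 * Cg + 1) * t ^+ 2.
  move=> ut; have : Cg * `|u| ^+ 2 <= Cg * (2 * t) ^+ 2.
    by rewrite ler_wpM2l // ler_pXn2r ?nnegrE // mulr_ge0 // ltW.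
  by rewrite exprMn; lra.
have sq1 u : `|u| <= t -> Cg * `|u| ^+ 2 + e <= (Cg + 1) * t ^+ 2.
  move=> ut; have : Cg * `|u| ^+ 2 <= Cg * t ^+ 2 by rewrite ler_wpM2l // ler_pXn2r ?nnegrE // ltW.
  by lra.
have g1 := le_trans h1 (sq1 _ xi xt); have g2 := le_trans h2 (sq1 _ _ ww).
have g3 := le_trans h3 (sq _ _ xt2).
rewrite E normrM (@ger0_norm _ (`|v| / t)); last by rewrite divr_ge0 // ltW.
have -> : (6 * Cg + 3) * t * `|v| = ((6 * Cg + 3) * t ^+ 2) * (`|v| / t) by field; rewrite gt_eqF.
rewrite ler_wpM2r ?divr_ge0 ?(ltW t0) //.
rewrite linearD /= in g3.
move: g1 g2 g3; rewrite !ler_norml => /andP[a1 a2] /andP[b1 b2] /andP[c1 c2].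
apply/andP; split; lra.
Qed.

(** [v] is the metric dual of [lam]. As [f] grows at most like the distance, the norm of [v] exceeds
    1 at most by a multiple of [h]. A displacement [v1] of length [h] along which [f] grows by [h]
    is then nearly an equality case of Cauchy-Schwarz: expanding the square of [v1 - h *: v], the
    terms of order 2 cancel and order 3 remains. *)
Lemma velocity_exists f w lam e Cg h : 0 <= Cg -> 0 < h -> h <= 1 -> h <= rho / 2 -> e <= h ^+ 2 ->
  `|w - p| <= rho / 2 -> approx_grad f w lam e Cg ->
  (forall xi, f (cinv c (w + xi)) - f (cinv c w) <= d (cinv c w) (cinv c (w + xi))) ->
  exists v, [/\ forall u, lincomb lam u = inner (cgram c w) u v,
    gnorm (cgram c w) v <= 1 + K * (C + Cg + 1) * h &
    forall v1, `|v1| <= K * h -> `|v1| <= rho / 2 -> d (cinv c w) (cinv c (w + v1)) = h ->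
      f (cinv c (w + v1)) = f (cinv c w) + h ->
      `|v1 - h *: v| ^+ 2 <= K ^+ 2 * (2 * (C * K ^+ 2) + (C * K ^+ 2) ^+ 2 +
         2 * (Cg * K ^+ 2 + 1) + 2 * (K * (C + Cg + 1)) + (K * (C + Cg + 1)) ^+ 2) * h ^+ 3].
Proof.
move=> Cg0 h0 h1 hr eh wr Hg fl.
have wr' : `|w - p| <= rho by lra.
have wrr : `|w - p| <= r by exact: le_trans wr' rhor.
have sG := cgram_sym atA gm Ac (gb_img gb wrr).
have pG u := @cgram_pos _ _ _ _ _ atA gm c w u Ac (gb_img gb wrr).
set G := cgram c w in sG pG *.
have uG : G \in unitmx.
  rewrite -row_free_unit -kermx_eq0; apply/eqP/row_matrixP => i; rewrite row0.
  apply/eqP; apply: contraT => /pG.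
  rewrite /inner; have -> : row i (kermx G) *m G = 0 by rewrite -row_mul mulmx_ker row0.
  by rewrite mul0mx mxE ltxx.
pose v := (invmx G *m lam)^T.
have Hv u : lincomb lam u = inner G u v by rewrite -lincomb_inner /v trmxK mulKVmx.
pose a := C + Cg + 1.
have a0 : 0 <= a by rewrite !addr_ge0.
(* The expansion is tested on the displacement of coordinate size [h] along [u], where the growth of
   [f] is bounded by the distance, and the distance by the norm of the metric. *)
have Nle u : lincomb lam u <= gnorm G u + a * h * `|u|.
  have [->|u0] := eqVneq u 0.
    have -> : lincomb lam 0 = 0 by exact: linear0.
    by rewrite normr0 mulr0 addr0 gnorm_ge0.
  have un : 0 < `|u| by rewrite normr_gt0.
  pose xi := (h / `|u|) *: u.
  have xin : `|xi| = h by rewrite normrZ ger0_norm ?divfK ?gt_eqF // divr_ge0 // ltW.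
  have x1 : `|xi| <= rho / 2 by rewrite xin.
  have := Hg xi x1; rewrite ler_distl => /andP[_].
  have xr : `|w + xi - p| <= rho by rewrite addrAC; apply: (le_trans (ler_normD _ _)); lra.
  have := HC wr' xr; rewrite ler_distl => /andP[_].
  have -> : w + xi - w = xi by rewrite addrC addKr.
  rewrite -/G xin => e1 e2; have e3 := fl xi.
  have : lincomb lam xi <= gnorm G xi + a * h ^+ 2.
    move: (Hg xi x1); rewrite ler_norml xin => /andP[e4 _]; rewrite /a; lra.
  rewrite /xi gnormZ ?divr_ge0 ?(ltW h0) ?(ltW un) // linearZ /= => e4.
  have hu : 0 < h / `|u| by rewrite divr_gt0.
  rewrite -(ler_pM2l hu); apply: (le_trans e4).
  by rewrite le_eqVlt; apply/orP; left; apply/eqP; field; rewrite gt_eqF.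
have Nv : gnorm G v <= 1 + K * a * h.
  have := Nle v; rewrite Hv -gnorm_sqr // => q1.
  have q2 := gb_lo gb v wrr; rewrite -/G in q2.
  have ah0 : 0 <= a * h by rewrite mulr_ge0 // ltW.
  have q3 : gnorm G v ^+ 2 <= gnorm G v * (1 + K * a * h).
    apply: (le_trans q1); rewrite mulrDr mulr1 lerD2l.
    have -> : gnorm G v * (K * a * h) = a * h * (K * gnorm G v) by ring.
    by rewrite ler_wpM2l.
  have [N0|N0] := eqVneq (gnorm G v) 0.
    by rewrite N0 addr_ge0 // mulr_ge0 ?(ltW h0) // mulr_ge0 // ltW.
  have Np : 0 < gnorm G v by rewrite lt_neqAle eq_sym N0 gnorm_ge0.
  by rewrite expr2 ler_pM2l // in q3.
exists v; split; [exact: Hv|exact: Nv|].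
move=> v1 v1K v1r dh fh.
have xr : `|w + v1 - p| <= rho by rewrite addrAC; apply: (le_trans (ler_normD _ _)); lra.
have v12 : `|v1| ^+ 2 <= K ^+ 2 * h ^+ 2.
  by rewrite -exprMn ler_pXn2r // nnegrE // mulr_ge0 // ltW.
have q1 : gnorm G v1 <= h * (1 + C * K ^+ 2 * h).
  have := HC wr' xr; rewrite ler_distl => /andP[+ _].
  have -> : w + v1 - w = v1 by rewrite addrC addKr.
  rewrite dh -/G; have : C * `|v1| ^+ 2 <= C * (K ^+ 2 * h ^+ 2) by rewrite ler_wpM2l.
  rewrite mulrDr mulr1 (_ : h * (C * K ^+ 2 * h) = C * (K ^+ 2 * h ^+ 2)); last by ring.
  lra.
have q2 : h * (1 - (Cg * K ^+ 2 + 1) * h) <= lincomb lam v1.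
  have := Hg v1 v1r; rewrite fh ler_norml => /andP[_].
  have : Cg * `|v1| ^+ 2 <= Cg * (K ^+ 2 * h ^+ 2) by rewrite ler_wpM2l.
  rewrite (_ : h * (1 - (Cg * K ^+ 2 + 1) * h) = h - Cg * (K ^+ 2 * h ^+ 2) - h ^+ 2); last by ring.
  lra.
set b1 := C * K ^+ 2 in q1 *; set b2 := Cg * K ^+ 2 + 1 in q2 *; set b3 := K * a in Nv *.
have b10 : 0 <= b1 by rewrite mulr_ge0 // exprn_ge0 // ltW.
have b30 : 0 <= b3 by rewrite mulr_ge0 // ltW.
have q3 : `|v1 - h *: v| ^+ 2 <= K ^+ 2 * inner G (v1 - h *: v) (v1 - h *: v).
  rewrite -gnorm_sqr // -exprMn ler_pXn2r ?nnegrE ?mulr_ge0 ?gnorm_ge0 ?(ltW K0) //.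
  exact: (gb_lo gb _ wrr).
apply: (le_trans q3); rewrite -mulrA ler_wpM2l ?exprn_ge0 ?(ltW K0) //.
rewrite innerDl !innerDr !innerNl !innerNr !innerZl !innerZr (innerC v v1 sG) -Hv -!gnorm_sqr //.
have r1 : gnorm G v1 ^+ 2 <= (h * (1 + b1 * h)) ^+ 2.
  by rewrite ler_pXn2r // nnegrE ?gnorm_ge0 // mulr_ge0 ?(ltW h0) // addr_ge0 // mulr_ge0 // ltW.
have r2 : h * (h * gnorm G v ^+ 2) <= h * (h * (1 + b3 * h) ^+ 2).
  have r2' : gnorm G v ^+ 2 <= (1 + b3 * h) ^+ 2.
    by rewrite ler_pXn2r // nnegrE ?gnorm_ge0 // addr_ge0 // mulr_ge0 // ltW.
  by rewrite !ler_pM2l.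
have r3 : h * (h * (1 - b2 * h)) <= h * lincomb lam v1 by rewrite ler_pM2l.
have h3 : h ^+ 2 * h ^+ 2 <= h ^+ 3.
  have -> : h ^+ 2 * h ^+ 2 = h ^+ 3 * h by ring.
  by rewrite ler_piMr // exprn_ge0 // ltW.
have b1h : b1 ^+ 2 * (h ^+ 2 * h ^+ 2) <= b1 ^+ 2 * h ^+ 3 by rewrite ler_wpM2l // exprn_ge0.
have b3h : b3 ^+ 2 * (h ^+ 2 * h ^+ 2) <= b3 ^+ 2 * h ^+ 3 by rewrite ler_wpM2l // exprn_ge0.
move: r1 r2 r3.
have -> : (h * (1 + b1 * h)) ^+ 2 = h ^+ 2 + 2 * b1 * h ^+ 3 + b1 ^+ 2 * (h ^+ 2 * h ^+ 2) by ring.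
have -> : h * (h * (1 + b3 * h) ^+ 2) = h ^+ 2 + 2 * b3 * h ^+ 3 + b3 ^+ 2 * (h ^+ 2 * h ^+ 2) by ring.
have -> : h * (h * (1 - b2 * h)) = h ^+ 2 - b2 * h ^+ 3 by ring.
clearbody b1 b2 b3; move: (h ^+ 2 * h ^+ 2) (h ^+ 3) (h ^+ 2) b1h b3h => X4 X3 X2 b1h b3h; lra.
Qed.

(** Both the covector and the metric used to dualize it vary with the point; pairing [v - v'] with
    itself separates the two contributions [a] and [D * L * V]. *)
Lemma velocity_lip w w' lam lam' v v' a V t : `|w - p| <= r -> `|w' - p| <= r -> `|w' - w| <= t ->
  0 <= a -> 0 <= V ->
  (forall u, lincomb lam u = inner (cgram c w) u v) -> (forall u, lincomb lam' u = inner (cgram c w') u v') ->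
  (forall u, `|lincomb lam' u - lincomb lam u| <= a * t * `|u|) -> `|v'| <= V ->
  `|v - v'| <= K ^+ 2 * (a + D * L * V) * t.
Proof.
move=> wr wr' wt a0 V0 Hv Hv' Hl vV.
have t0 : 0 <= t by exact: le_trans wt.
have D0 : 0 <= D := @dim2_ge0 R n.
have DLV : 0 <= D * L * V by rewrite !mulr_ge0.
have [->|x0] := eqVneq (v - v') 0.
  by rewrite normr0 !mulr_ge0 ?exprn_ge0 ?addr_ge0 // ltW.
have pG u := @cgram_pos _ _ _ _ _ atA gm c w u Ac (gb_img gb wr).
set x := v - v' in x0 *; have xn : 0 < `|x| by rewrite normr_gt0.
have q1 : `|x| ^+ 2 <= K ^+ 2 * inner (cgram c w) x x.
  rewrite -gnorm_sqr // -exprMn ler_pXn2r ?nnegrE ?mulr_ge0 ?gnorm_ge0 ?(ltW K0) //.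
  exact: (gb_lo gb _ wr).
have q2 : inner (cgram c w) x x <= (a + D * L * V) * t * `|x|.
  have -> : inner (cgram c w) x x = (lincomb lam x - lincomb lam' x) + inner (cgram c w' - cgram c w) x v'.
    by rewrite Hv Hv' innerDm innerNm {2}/x innerDr innerNr; ring.
  have e1 := Hl x; rewrite distrC in e1.
  have lip := gb_lip gb wr wr'.
  have e2 : inner (cgram c w' - cgram c w) x v' <= D * L * V * t * `|x|.
    apply: (le_trans (ler_norm _)); apply: (le_trans (inner_bound _ _ _)).
    have -> : D * L * V * t * `|x| = D * (L * t) * `|x| * V by ring.
    apply: ler_pM; rewrite ?mulr_ge0 // ler_wpM2r // ler_wpM2l //.
    by apply: (le_trans lip); rewrite ler_wpM2l.
  have := ler_norm (lincomb lam x - lincomb lam' x); lra.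
have q3 : `|x| ^+ 2 <= K ^+ 2 * ((a + D * L * V) * t * `|x|).
  by apply: (le_trans q1); rewrite ler_wpM2l // exprn_ge0 // ltW.
by rewrite expr2 !mulrA ler_pM2r // in q3.
Qed.

End Local.

(** With the rate [B + 1] in place of [B] the forcing term [h * theta] is absorbed without a
    division by [B], which may vanish. *)
Lemma gronwall_discrete (B h theta : R) (u : nat -> R) N : 0 <= B -> 0 <= h -> 0 <= theta -> u 0%N = 0 ->
  (forall i, (i < N)%N -> u i.+1 <= (1 + B * h) * u i + h * theta) ->
  forall i, (i <= N)%N -> u i <= theta * expR ((B + 1) * h * i%:R).
Proof.
move=> B0 h0 th0 u0 Hu i iN.
have Bh : 0 <= (B + 1) * h by rewrite mulr_ge0 // addr_ge0.
have e1 j : 0 <= (1 + (B + 1) * h) ^+ j by rewrite exprn_ge0 // addr_ge0.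
have : u i <= theta * ((1 + (B + 1) * h) ^+ i - 1).
  elim: i iN => [_|i IH iN]; first by rewrite u0 expr0 subrr mulr0.
  apply: (le_trans (Hu i iN)); have {}IH := IH (ltnW iN).
  have Bh1 : 0 <= 1 + B * h by rewrite addr_ge0 // mulr_ge0.
  have := ler_wpM2l Bh1 IH.
  have ht : 0 <= h * theta * ((1 + (B + 1) * h) ^+ i - 1).
    by rewrite mulr_ge0 ?mulr_ge0 // subr_ge0 exprn_ege1 // lerDl.
  have htb : 0 <= B * h * theta by rewrite !mulr_ge0.
  rewrite exprS; set X := (1 + (B + 1) * h) ^+ i in ht *.
  lra.
move=> /le_trans; apply; rewrite ler_wpM2l //.
have : (1 + (B + 1) * h) ^+ i <= expR ((B + 1) * h * i%:R).
  by rewrite expRM_natr; apply: lerXn2r; rewrite ?nnegrE ?expR_ge0 ?addr_ge0 //; exact: expR_ge1Dx.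
lra.
Qed.

End NonBranching.

Lemma step_bounds {R : realFieldType} (x x' u h s Ks rho r : R) :
  x <= Ks -> x' <= Ks -> 0 <= u -> u <= x + x' -> 0 < h -> h <= s / 2 ->
  s <= rho / 16 -> Ks <= rho / 16 -> 0 < rho -> rho <= r ->
  [/\ x <= rho / 2 /\ x' <= rho / 2, x <= r /\ x' <= r, 0 < u + h & u + h <= rho / 4].
Proof. by move=> *; split; [split; lra|split; lra|lra|lra]. Qed.

Lemma mesh_bounds {R : realFieldType} (h s rho : R) :
  0 < s -> h <= s / 2 -> s <= 1 -> s <= rho / 16 -> [/\ h <= 1, h <= rho / 2 & h <= s].
Proof. by move=> *; split; lra. Qed.

(** * Non-branching of minimal segments and rigidity of isometries *)

Section Rigidity.
Context {R : realType} {n : nat} {M : topologicalType} {A : set (chart R M n)} {g : gram R M n}.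
Hypothesis atA : atlas_on setT A.
Hypothesis gm : riemannian_metric A g.
Hypothesis hausM : hausdorff_space M.
Hypothesis connM : connected [set: M].
Local Notation d := (@riemannian_dist R M n A g).
Local Notation cgram := (@cgram R n M g).
Local Notation gball := (@gball R n M g).
Local Notation dtri := (dist_tri atA gm connM).
Local Notation dC := (distC atA gm connM).
Local Notation dge0 := (dist_ge0 atA gm connM).
Local Notation D := (@dim2 R n).
Hypothesis complete : dist_complete d.

Let cA : charts A. Proof. by have [] := atA. Qed.

Lemma subdivide_dist (z : nat -> M) (N : nat) (h : R) :
  (forall i, (i < N)%N -> d (z i) (z i.+1) = h) -> d (z 0%N) (z N) = N%:R * h ->
  forall i, (i <= N)%N -> d (z 0%N) (z i) <= i%:R * h /\ d (z i) (z N) <= (N - i)%:R * h.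
Proof.
move=> Hz dN i iN; split.
  apply: (le_trans (dist_sum atA gm connM z i)).
  have -> : \sum_(j < i) d (z j) (z j.+1) = i%:R * h; last exact: lexx.
  rewrite (eq_bigr (fun=> h)) => [|j _]; first by rewrite sumr_const card_ord mulr_natl.
  by rewrite Hz // (leq_trans (ltn_ord j)).
have := dist_sum atA gm connM (fun j => z (i + j)%N) (N - i).
rewrite addn0 subnKC // => /le_trans; apply.
have -> : \sum_(j < N - i) d (z (i + j)%N) (z (i + j.+1)%N) = (N - i)%:R * h; last exact: lexx.
rewrite (eq_bigr (fun=> h)) => [|j _]; first by rewrite sumr_const card_ord mulr_natl.
by rewrite addnS Hz // -ltn_subRL.
Qed.

Section Branches.
Variables (c : chart R M n) (r K L rho C s : R) (o b q : M).
Hypothesis Ac : A c.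
Hypothesis co : cdom c o.
Local Notation p0 := (cto c o).
Hypothesis gb : gball c p0 r K L.
Hypothesis rho0 : 0 < rho.
Hypothesis rhor : rho <= r.
Hypothesis s0 : 0 < s.
Hypothesis sK : K * s <= rho / 16.
Hypothesis bo : d b o = s.
Hypothesis oq : d o q = s.
Hypothesis bq : d b q = 2 * s.

Let near_o y : d o y <= s -> cdom c y /\ `|cto c y - p0| <= K * s.
Proof.
move: rho0 rhor s0 sK bo oq bq => rho0' rhor' s0' sK' bo' oq' bq'.
move=> oy; have K0 := gb_K gb.
have Ky : K * d o y <= K * s by rewrite ler_pM2l.
have h : `|p0 - p0| + K * d o y < r by rewrite subrr normr0 add0r; apply: (le_lt_trans Ky); lra.
have [cy yo] := dist_stay atA gm hausM connM Ac gb co h.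
by split=> //; apply: le_trans yo Ky.
Qed.

(** The support from [b] bounds [d b] above by [lam]; the one from [q] bounds it below by [- mu],
    since [d b] is at least [2 * s] minus the distance from [q]. Comparing the two at [- xi] shows
    that [lam + mu] is of second order, at the cost [C1 + C1']; this yields the constant
    [C1 + 2 * C1'] and the three thirds of [e]. Near [o] the distance to [b] is at least [s], but to
    [q] only at least [s / 2], hence the two scales. *)
Lemma good_exists (C1 C1' : R) : 0 <= C1 -> 0 <= C1' ->
  (forall b y, cdom c b -> s <= d b y -> d b y <= 2 * s -> `|cto c b - p0| + K * d b y <= rho / 3 ->
    forall e : R, 0 < e -> exists lam, forall xi, `|xi| <= rho / 2 ->
      d b (cinv c (cto c y + xi)) <= d b y + lincomb lam xi + C1 * `|xi| ^+ 2 + e) ->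
  (forall b y, cdom c b -> s / 2 <= d b y -> d b y <= 2 * (s / 2) -> `|cto c b - p0| + K * d b y <= rho / 3 ->
    forall e : R, 0 < e -> exists lam, forall xi, `|xi| <= rho / 2 ->
      d b (cinv c (cto c y + xi)) <= d b y + lincomb lam xi + C1' * `|xi| ^+ 2 + e) ->
  forall y t, 0 <= t -> t <= s / 2 -> d b y = s + t -> d y q = s - t -> cdom c y ->
    forall e, 0 < e -> exists lam, approx_grad c rho (d b) (cto c y) lam e (C1 + 2 * C1').
Proof.
move: rho0 rhor s0 sK bo oq bq => rho0' rhor' s0' sK' bo' oq' bq'.
move=> C10 C10' U1 U2 y t t0 ts by_ yq cy e e0.
have K0 := gb_K gb; have [oc oi Kc ct ci] := cA Ac.
have [cb bs] : cdom c b /\ `|cto c b - p0| <= K * s by apply: near_o; rewrite dC bo.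
have [cq qs] : cdom c q /\ `|cto c q - p0| <= K * s by apply: near_o; rewrite oq.
have e3 : 0 < e / 3 by rewrite divr_gt0.
have Kst : K * (s + t) <= K * (2 * s) by rewrite ler_pM2l //; lra.
have Kst' : K * (s - t) <= K * s by rewrite ler_pM2l //; lra.
have h1 : s <= d b y by rewrite by_; lra.
have h2 : d b y <= 2 * s by rewrite by_; lra.
have h3 : `|cto c b - p0| + K * d b y <= rho / 3 by rewrite by_; lra.
have [lam Hlam] := U1 b y cb h1 h2 h3 _ e3.
have g1 : s / 2 <= d q y by rewrite dC yq; lra.
have g2 : d q y <= 2 * (s / 2) by rewrite dC yq; lra.
have g3 : `|cto c q - p0| + K * d q y <= rho / 3 by rewrite dC yq; lra.
have [mu Hmu] := U2 q y cq g1 g2 g3 _ e3.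
have lo xi : `|xi| <= rho / 2 -> d b y - lincomb mu xi - C1' * `|xi| ^+ 2 - e / 3 <= d b (cinv c (cto c y + xi)).
  move=> /Hmu h; have := dtri (cinv c (cto c y + xi)) b q; rewrite (dC (cinv c (cto c y + xi)) q) bq'; rewrite (dC q y) yq in h; rewrite by_; lra.
exists lam => xi xir; rewrite Kc //.
have l1 := Hlam xi xir; have l2 := lo xi xir.
have xir' : `|- xi| <= rho / 2 by rewrite normrN.
have l3 := Hlam (- xi) xir'; have l4 := lo (- xi) xir'.
have lN (l : 'cV[R]_n) : lincomb l (- xi) = - lincomb l xi by exact: linearN.
rewrite !lN !normrN in l3 l4.
have q0 : 0 <= C1' * `|xi| ^+ 2 by rewrite mulr_ge0 // exprn_ge0.
rewrite ler_norml; clear h1 h2 h3 g1 g2 g3 Kst Kst' bs qs bo' oq' bq' by_ yq; apply/andP; split; lra.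
Qed.

(** Since the distance from [b] to [q] is exactly [2 * s], the triangle inequalities leave no slack
    and all distances from [b] and to [q] along the subdivision are exact. *)
Lemma branch_sequence p (N : nat) : d o p = s / 2 -> d p q = s / 2 ->
  let h := s / 2 / N.+1%:R in
  exists y : nat -> M, [/\ y 0%N = o, y N.+1 = p &
    forall i, (i <= N.+1)%N -> [/\ cdom c (y i), `|cto c (y i) - p0| <= K * s,
      d b (y i) = s + i%:R * h, d (y i) q = s - i%:R * h & 0 <= i%:R * h <= s / 2] /\
      ((i <= N)%N -> d (y i) (y i.+1) = h /\ `|cto c (y i.+1) - cto c (y i)| <= K * h)].
Proof.
move: rho0 rhor s0 sK bo oq bq => rho0' rhor' s0' sK' bo' oq' bq'.
move=> op pq h; have K0 := gb_K gb.
have N0 : 0 < N.+1%:R :> R by rewrite ltr0n.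
have h0 : 0 < h by rewrite !divr_gt0.
have [y [y0 yN Hy]] := dist_subdivide atA gm hausM connM complete o p N.
rewrite op -/h in Hy.
have hN : N.+1%:R * h = s / 2 by rewrite mulrC divfK // gt_eqF.
have SD i : (i <= N.+1)%N -> d o (y i) <= i%:R * h /\ d (y i) p <= (N.+1 - i)%:R * h.
  move=> iN; rewrite -y0 -yN; apply: subdivide_dist => //; rewrite y0 yN hN; exact: op.
exists y; split=> // i iN; have [d1 d2] := SD i iN.
have ih : 0 <= i%:R * h <= s / 2.
  by rewrite mulr_ge0 ?ler0n ?(ltW h0) //= -hN ler_pM2r // ler_nat.
have [ih0 ihs] := andP ih.
have [cy ys] : cdom c (y i) /\ `|cto c (y i) - p0| <= K * s by apply: near_o; lra.
rewrite natrB // mulrBl hN in d2.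
have t1 := dtri o b (y i); have t2 := dtri p (y i) q; have t3 := dtri (y i) b q.
split; first by split=> //; lra.
move=> iN'; have dh := Hy i iN'; split=> //.
have hs : h <= s / 2 by rewrite -hN ler_peMl ?ler1n // ltW.
have Kh : K * h <= K * s by rewrite ler_pM2l //; lra.
have hh : `|cto c (y i) - p0| + K * d (y i) (y i.+1) < r by rewrite dh; lra.
have [_ zz] := dist_stay atA gm hausM connM Ac gb cy hh.
by rewrite dh in zz.
Qed.

End Branches.

Lemma small_bound (X Q : R) : 0 <= Q -> (forall s, 0 < s -> s <= 1 -> X <= Q * s) -> X <= 0.
Proof.
move=> Q0 H; apply/ler_addgt0Pr => e e0; rewrite add0r.
have Q1 : 0 < Q + 1 by rewrite ltr_wpDl.
pose s := Num.min 1 (e / (Q + 1)).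
have s0 : 0 < s by rewrite lt_min ltr01 divr_gt0.
have <- : (Q + 1) * (e / (Q + 1)) = e by rewrite mulrC divfK // gt_eqF.
apply: (le_trans (H s s0 (minl_le _ _))).
apply: ler_pM => //; [exact: ltW|by rewrite lerDl|exact: minr_le].
Qed.

(** Only the first half of each branch is compared: the approximate gradient of [d b] is available
    where the segment goes on for at least [s / 2], up to [q] or [q']. The threshold [delta] depends
    on [o] alone. *)
Lemma dist_nonbranching (o : M) : exists2 delta : R, 0 < delta & forall s b q p q' p',
  0 < s -> s <= delta -> d b o = s ->
  [/\ d o q = s, d b q = 2 * s, d o p = s / 2 & d p q = s / 2] ->
  [/\ d o q' = s, d b q' = 2 * s, d o p' = s / 2 & d p' q' = s / 2] -> p = p'.
Proof.
have [c Ac co] := atlas_cover atA o; have [oc oi Kc ct ci] := cA Ac.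
have [r [K [L gb]]] := gball_exists atA gm Ac (imageP _ co).
have [rho [C [rho0 rhor C0 HC]]] := dist_norm atA gm hausM connM Ac gb.
have K0 := gb_K gb; have L0 := gb_L gb.
have m0 : 0 < rho / 16 / K by rewrite !divr_gt0.
(* With [s] and [K * s] at most [rho / 16] all points and displacements used stay well inside the
   ball of [dist_norm]; [s <= 1] makes higher powers of the mesh smaller. *)
exists (Num.min 1 (Num.min (rho / 16) (rho / 16 / K))).
  by rewrite !lt_min ltr01 m0 divr_gt0.
move=> s b q p q' p' s0; rewrite !le_min => /andP[s1 /andP[sr]].
rewrite ler_pdivlMr // mulrC => sK bo [oq bq op pq] [oq' bq' op' pq'].
have s20 : 0 < s / 2 by rewrite divr_gt0.
have [C1 C10 U1] := upper_support atA gm hausM connM complete Ac gb rho0 rhor C0 HC s0.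
have [C2 C20 U2] := upper_support atA gm hausM connM complete Ac gb rho0 rhor C0 HC s20.
pose Cg := C1 + 2 * C2; have Cg0 : 0 <= Cg by rewrite addr_ge0 // mulr_ge0.
pose a := 6 * Cg + 3; have a0 : 0 <= a by rewrite addr_ge0 // mulr_ge0.
have D0 : 0 <= D := @dim2_ge0 R n.
pose C7 := K * (C + Cg + 1); have C70 : 0 <= C7 by rewrite mulr_ge0 ?(ltW K0) // addr_ge0 // addr_ge0.
pose V := K * (1 + C7); have V0 : 0 <= V by rewrite mulr_ge0 ?(ltW K0) // addr_ge0.
pose B := K ^+ 2 * (a + D * L * V).
have B0 : 0 <= B.
  by rewrite mulr_ge0 ?exprn_ge0 ?(ltW K0) // addr_ge0 // mulr_ge0 // mulr_ge0.
pose C8 := K ^+ 2 * (2 * (C * K ^+ 2) + (C * K ^+ 2) ^+ 2 +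
         2 * (Cg * K ^+ 2 + 1) + 2 * (K * (C + Cg + 1)) + (K * (C + Cg + 1)) ^+ 2).
have C80 : 0 <= C8.
  have K20 : 0 <= K ^+ 2 by rewrite exprn_ge0 // ltW.
  have x1 : 0 <= C * K ^+ 2 by rewrite mulr_ge0.
  have x2 : 0 <= Cg * K ^+ 2 by rewrite mulr_ge0.
  have x3 : 0 <= (C * K ^+ 2) ^+ 2 by rewrite exprn_ge0.
  have x4 : 0 <= (K * (C + Cg + 1)) ^+ 2 by rewrite sqr_ge0.
  rewrite /C7 in C70; rewrite mulr_ge0 //; clear V0 B0 a0; lra.
(* Both branches follow the same approximate gradient with mesh [h]. Each step misses by
   [h * sqrt (C8 * h)], and the gradients are compared up to [B * h]; Gronwall's bound then tends to
   0 with the mesh. *)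
have bound (N : nat) : let h := s / 2 / N.+1%:R in
    `|cto c p - cto c p'| <= (B * h + 2 * Num.sqrt (C8 * h)) * expR ((B + 1) * (s / 2)).
  move=> h; have N0 : 0 < N.+1%:R :> R by rewrite ltr0n.
  have h0 : 0 < h by rewrite !divr_gt0.
  have hs : h <= s / 2 by rewrite ler_pdivrMr // ler_peMr ?(ltW s20) // ler1n.
  have hN : h * N.+1%:R = s / 2 by rewrite divfK // gt_eqF.
  have [y [y0 yN Hy]] := branch_sequence Ac co gb rho0 rhor s0 sK bo oq bq N op pq.
  have [y' [y0' yN' Hy']] := branch_sequence Ac co gb rho0 rhor s0 sK bo oq' bq' N op' pq'.
  have h20 : 0 < h ^+ 2 by rewrite exprn_gt0.
  have Hg i : (i <= N.+1)%N -> exists lam, approx_grad c rho (d b) (cto c (y i)) lam (h ^+ 2) Cg.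
    move=> /Hy[[cy _ d1 d2 /andP[t0 t1]] _].
    exact: (good_exists Ac co gb rho0 rhor s0 sK bo oq bq C10 C20 U1 U2 t0 t1 d1 d2 cy h20).
  have Hg' i : (i <= N.+1)%N -> exists lam, approx_grad c rho (d b) (cto c (y' i)) lam (h ^+ 2) Cg.
    move=> /Hy'[[cy _ d1 d2 /andP[t0 t1]] _].
    exact: (good_exists Ac co gb rho0 rhor s0 sK bo oq' bq' C10 C20 U1 U2 t0 t1 d1 d2 cy h20).
  pose sg := Num.sqrt (C8 * h); have sg0 : 0 <= sg by exact: sqrtr_ge0.
  have sgE : sg ^+ 2 = C8 * h by rewrite sqr_sqrtr // mulr_ge0 // ltW.
  have [h1 hr2 hs'] := mesh_bounds s0 hs s1 sr.
  have Kh : K * h <= rho / 2.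
    by apply: (le_trans (_ : _ <= K * s)); [rewrite ler_pM2l|apply: (le_trans sK); rewrite ler_pM2l // lef_pV2 ?posrE // ler_nat].
  pose u i := `|cto c (y i) - cto c (y' i)|.
  have rec i : (i < N.+1)%N -> u i.+1 <= (1 + B * h) * u i + h * (B * h + 2 * sg).
    move=> iN; have [lam gl] := Hg i (ltnW iN); have [lam' gl'] := Hg' i (ltnW iN).
    have [[cy ys d1 _ _] /(_ iN)[d3 d4]] := Hy i (ltnW iN).
    have [[cy' ys' d1' _ _] /(_ iN)[d3' d4']] := Hy' i (ltnW iN).
    have [[cy1 _ d11 _ _] _] := Hy i.+1 iN; have [[cy1' _ d11' _ _] _] := Hy' i.+1 iN.
    have u0 : 0 <= u i by exact: normr_ge0.
    have uy : u i <= `|cto c (y i) - cto c o| + `|cto c (y' i) - cto c o|.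
      by rewrite /u -(subrKA (cto c o)) [`|cto c (y' i) - _|]distrC ler_normD.
    (* The scale for comparing the gradients at [y i] and [y' i]: at least their distance, and at
       least [h] so that the error [h ^+ 2] is within [t ^+ 2]. *)
    pose t := u i + h.
    have [[w1 w1'] [wr1 wr1'] t0 tr] := step_bounds ys ys' u0 uy h0 hs sr sK rho0 rhor.
    have ht : h ^+ 2 <= t ^+ 2 by rewrite ler_pXn2r ?nnegrE ?(ltW h0) ?(ltW t0) // lerDr.
    have wt : `|cto c (y' i) - cto c (y i)| <= t by rewrite distrC lerDl ltW.
    have e1 xi : d b (cinv c (cto c (y i) + xi)) - d b (cinv c (cto c (y i))) <=
        d (cinv c (cto c (y i))) (cinv c (cto c (y i) + xi)) by rewrite lerBlDl dtri.
    have e1' xi : d b (cinv c (cto c (y' i) + xi)) - d b (cinv c (cto c (y' i))) <=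
        d (cinv c (cto c (y' i))) (cinv c (cto c (y' i) + xi)) by rewrite lerBlDl dtri.
    have [v [Hv Nv Dv]] := velocity_exists atA gm Ac gb rhor C0 HC Cg0 h0 h1 hr2 (lexx _) w1 gl e1.
    have [v' [Hv' Nv' Dv']] := velocity_exists atA gm Ac gb rhor C0 HC Cg0 h0 h1 hr2 (lexx _) w1' gl' e1'.
    have Hl x := approx_grad_lip x Cg0 t0 tr ht wt gl gl'.
    have vV : `|v'| <= V.
      apply: (le_trans (gb_lo gb v' wr1')); rewrite ler_pM2l //; apply: (le_trans Nv').
      by rewrite lerD2l -/C7 ler_piMr.
    have vv := velocity_lip atA gm Ac gb wr1 wr1' wt a0 V0 Hv Hv' Hl vV.
    rewrite -/B in vv.
    have key (z z1 : M) (x : 'rV[R]_n) : cdom c z -> cdom c z1 -> d z z1 = h -> d b z1 = d b z + h ->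
       `|cto c z1 - cto c z| <= K * h ->
       (forall v1 : 'rV[R]_n, `|v1| <= K * h -> `|v1| <= rho / 2 ->
         d (cinv c (cto c z)) (cinv c (cto c z + v1)) = h ->
         d b (cinv c (cto c z + v1)) = d b (cinv c (cto c z)) + h -> `|v1 - h *: x| ^+ 2 <= C8 * h ^+ 3) ->
       `|cto c z1 - cto c z - h *: x| <= h * sg.
      move=> cz cz1 dzz dbz zK HH; have := HH (cto c z1 - cto c z) zK (le_trans zK Kh).
      rewrite addrC subrK !Kc // => /(_ dzz dbz) hh.
      have hs0 : 0 <= h * sg by rewrite mulr_ge0 // ltW.
      rewrite -(@ler_pXn2r _ 2) ?nnegrE // exprMn sgE.
      by apply: (le_trans hh); rewrite le_eqVlt; apply/orP; left; apply/eqP; ring.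
    have i1 : i.+1%:R * h = i%:R * h + h :> R by rewrite -natr1; ring.
    have db1 : d b (y i.+1) = d b (y i) + h by rewrite d11 d1 i1 addrA.
    have db1' : d b (y' i.+1) = d b (y' i) + h by rewrite d11' d1' i1 addrA.
    have k1 := key _ _ v cy cy1 d3 db1 d4 Dv.
    have k2 := key _ _ v' cy' cy1' d3' db1' d4' Dv'.
    have -> : u i.+1 = `|(cto c (y i) - cto c (y' i)) + (cto c (y i.+1) - cto c (y i) - h *: v) -
         (cto c (y' i.+1) - cto c (y' i) - h *: v') + h *: (v - v')|.
      by rewrite /u; congr (`|_|); apply/rowP => j; rewrite !mxE; ring.
    apply: (le_trans (ler_normD _ _)); rewrite normrZ (gtr0_norm h0).
    have hv : h * `|v - v'| <= h * (B * t) by rewrite ler_pM2l.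
    have n1 : `|(cto c (y i) - cto c (y' i)) + (cto c (y i.+1) - cto c (y i) - h *: v) -
         (cto c (y' i.+1) - cto c (y' i) - h *: v')| <= u i + h * sg + h * sg.
      apply: (le_trans (ler_normB _ _)); apply: lerD k2.
      by apply: (le_trans (ler_normD _ _)); apply: lerD k1.
    apply: (le_trans (lerD n1 hv)); rewrite /t; move: (u i) => ui.
    by rewrite le_eqVlt; apply/orP; left; apply/eqP; ring.
  have u00 : u 0%N = 0 by rewrite /u y0 y0' subrr normr0.
  have th0 : 0 <= B * h + 2 * sg by rewrite addr_ge0 // mulr_ge0 // ltW.
  have := gronwall_discrete B0 (ltW h0) th0 u00 rec (leqnn _).
  by rewrite /u yN yN' -mulrA hN.
have [cp cp'] : cdom c p /\ cdom c p'.
  have near z : d o z = s / 2 -> cdom c z.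
    move=> oz; have Kz : K * (s / 2) <= K * s by rewrite ler_pM2l //; lra.
    have hh : `|cto c o - cto c o| + K * d o z < r by rewrite subrr normr0 add0r oz; apply: (le_lt_trans Kz); lra.
    by have [] := dist_stay atA gm hausM connM Ac gb co hh.
  by split; apply: near.
suff : `|cto c p - cto c p'| <= 0.
  by rewrite normr_le0 subr_eq0 => /eqP pp; rewrite -(Kc p cp) pp Kc.
pose E := expR ((B + 1) * (s / 2)); have E0 : 0 <= E by exact: expR_ge0.
apply: (@small_bound _ ((B + 2 * Num.sqrt C8) * E)).
  by rewrite mulr_ge0 // addr_ge0 // mulr_ge0 // sqrtr_ge0.
move=> t t0 t1; have t20 : 0 < t ^+ 2 by rewrite exprn_gt0.
(* Fine enough that the mesh is at most [t ^+ 2], which makes its square root at most [t]. *)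
pose N := Num.bound (s / 2 / t ^+ 2).
have NB : s / 2 / t ^+ 2 <= N.+1%:R.
  have h : s / 2 / t ^+ 2 < N%:R by apply: archi_boundP; rewrite divr_ge0 // ltW.
  by apply: (le_trans (ltW h)); rewrite ler_nat.
have := bound N; set h := s / 2 / _ => /= /le_trans; apply.
have ht : h <= t ^+ 2 by rewrite ler_pdivrMr ?ltr0n // [leRHS]mulrC -ler_pdivrMr.
have h0 : 0 <= h by rewrite divr_ge0 ?ler0n // ltW.
rewrite -/E [leRHS]mulrAC ler_wpM2r // [leRHS]mulrDl; apply: lerD.
  by rewrite ler_wpM2l // (le_trans ht) // expr2 ler_piMr // ltW.
have e1 : Num.sqrt (C8 * h) <= Num.sqrt C8 * t.
  rewrite sqrtrM // ler_wpM2l ?sqrtr_ge0 //.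
  by rewrite -[leRHS](ger0_norm (ltW t0)) -sqrtr_sqr ler_wsqrtr.
lra.
Qed.

(* Reflecting the part beyond x of a minimal segment by phi keeps it minimal, so
   by non-branching phi fixes the largest possible piece of it. *)
Lemma fixed_beyond (phi : M -> M) (p x q : M) :
  (forall y z, d (phi y) (phi z) = d y z) -> phi x = x -> 0 < d q x ->
  d q p = d q x + d x p -> d q p <= d q (phi p) -> phi p = p.
Proof.
move=> iso fx qx0 qxp qp; pose l := d x p.
(* The first two terms alone add up to at least [l], so membership forces both alignment of [z]
   between [x] and [p] and [phi z = z]; one closed condition expresses the two equalities. *)
pose Z := [set z | d x z + d z p + d (phi z) z <= l].
have lip z : {for z, continuous (fun z => d x z + d z p + d (phi z) z)}.
  apply/cvgrPdist_lt => e e0; have e40 : 0 < e / 4 by rewrite divr_gt0.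
  apply: filterS (dist_near atA gm z e40) => y zy.
  have h1 := dist_dist_le atA gm connM x z y; have h2 := dist_dist_le atA gm connM p z y.
  have h3 := dtri (phi y) (phi z) z; have h4 := dtri y (phi y) z.
  have h5 := dtri (phi z) (phi y) y; have h6 := dtri z (phi z) y.
  rewrite !iso (dC y z) in h3 h5; rewrite (dC y z) in h4.
  move: h1 h2; rewrite (dC p z) (dC p y) !ler_norml => /andP[a1 a2] /andP[b1 b2].
  rewrite ltr_norml; apply/andP; split; lra.
have cZ : compact Z.
  apply: (subclosed_compact _ (dball_compact atA gm hausM connM complete (x := x) (r := l))).
    apply: (@preimage_closed _ _ (fun z => d x z + d z p + d (phi z) z) [set s | s <= l]) => [z _|]; first exact: lip.
    exact: closed_le.
  move=> z; rewrite /Z /dball /=; have := dge0 z p; have := dge0 (phi z) z; lra.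
have Zx : Z x by rewrite /Z /= fx !(distxx atA gm connM) add0r addr0.
have Z0 : Z !=set0 by exists x.
have dc : {within Z, continuous (d x)}.
  by apply: continuous_subspaceT; exact: (@dist_continuous_r _ _ _ _ _ atA gm connM).
have [z] := compact_EVT_max Z0 cZ dc; rewrite inE => Zz zmax.
have g1 := dge0 (phi z) z; have t1 := dtri z x p.
have fz : phi z = z.
  apply: (dist_eq0 atA gm hausM connM); apply/eqP; rewrite eq_le g1 andbT.
  by move: Zz; rewrite /Z /= /l; lra.
have xzp : d x z + d z p = l by move: Zz; rewrite /Z /= fz (distxx atA gm connM) /l in t1 *; lra.
have [zp|zp] := eqVneq (d z p) 0.
  by have <- := dist_eq0 atA gm hausM connM zp.
exfalso; have m0 : 0 < d z p by rewrite lt_neqAle eq_sym zp dge0.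
have t2 := dtri x q z; have t3 := dtri z q p.
have qz : d q z = d q x + d x z by rewrite /l in xzp; lra.
have [delta delta0 NB] := dist_nonbranching z.
(* Small enough for non-branching at [z], for a piece of length [s] from [z] towards [p], and for
   one of the same length back towards [q]. *)
pose s := Num.min delta (Num.min (d z p) (d q x)).
have s0 : 0 < s by rewrite !lt_min delta0 m0.
have sd : s <= delta by exact: minl_le.
have sm : s <= d z p by rewrite (le_trans (minr_le _ _)) // minl_le.
have sq : s <= d q x by rewrite (le_trans (minr_le _ _)) // minr_le.
have xz0 := dge0 x z.
have bI : 0 <= d q z - s <= d q z by apply/andP; split; lra.
have [b [qb bz]] := dist_between_exact atA gm hausM connM complete bI.
have QI : 0 <= s <= d z p by rewrite ltW.
have [Q [zQ Qp]] := dist_between_exact atA gm hausM connM complete QI.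
have PI : 0 <= s / 2 <= d z Q by rewrite zQ; apply/andP; split; lra.
have [P [zP PQ]] := dist_between_exact atA gm hausM connM complete PI.
(* Both [Q] and [phi Q] prolong the segment from [b] to [z] minimally: a shortcut from [b] to
   [phi Q] would bring [phi p] closer to [q] than [p] is. *)
have E1 : phi P = P.
  have hs : s - s / 2 = s / 2 by lra.
  apply: (NB s b (phi Q) (phi P) Q P s0 sd); first by rewrite bz; lra.
    have zphi y : d z (phi y) = d z y by rewrite -{1}fz iso.
    split; rewrite ?zphi ?iso //; last by rewrite PQ zQ.
    have u1 := dtri z b (phi Q); have u2 := dtri b q (phi p); have u3 := dtri (phi Q) b (phi p).
    rewrite zphi in u1; rewrite iso in u3; rewrite /l in xzp; lra.
  split; rewrite // ?PQ ?zQ //.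
  have u1 := dtri z b Q; have u2 := dtri b q p; have u3 := dtri Q b p.
  rewrite /l in xzp; lra.
have ZP : P \in Z.
  rewrite inE /Z /= E1 (distxx atA gm connM) addr0.
  have u1 := dtri z x P; have u2 := dtri Q P p; lra.
have := zmax P ZP; have u2 := dtri Q P p; have u3 := dtri P x p; rewrite /l in xzp; lra.
Qed.

End Rigidity.

(** * Separation in subspaces *)

Section Subtypes.
Context {T : topologicalType}.

Lemma hausdorff_sub (S : set T) : (forall x y : T, S x -> S y -> x <> y ->
    exists U V, [/\ open U, open V, U x, V y & U `&` V = set0]) -> hausdorff_space S.
Proof.
move=> H u v cl; apply/eqP/negPn/negP => /eqP uv.
have Su : S (set_val u) := set_valP u.
have Sv : S (set_val v) := set_valP v.
have nuv : set_val u <> set_val v by move=> /val_inj.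
have [U [V [oU oV Uu Vv UV]]] := H _ _ Su Sv nuv.
have nU : nbhs u (set_val @^-1` U) by apply: open_nbhs_nbhs; split=> //; exists U.
have nV : nbhs v (set_val @^-1` V) by apply: open_nbhs_nbhs; split=> //; exists V.
have [w [Uw Vw]] := cl _ _ nU nV.
have : (U `&` V) (set_val w) by [].
by rewrite UV.
Qed.

Lemma hausdorff_subT : hausdorff_space [set: T] -> hausdorff_space T.
Proof.
move=> H x y cl; pose u : [set: T] := SigSub (mem_set (I : [set: T] x)).
pose v : [set: T] := SigSub (mem_set (I : [set: T] y)).
suff : u = v by move=> /(congr1 set_val).
apply: H => U V [U' [[U'' oU'' <-] U''u UU]] [V' [[V'' oV'' <-] V''v VV]].
have [z [Uz Vz]] := cl U'' V'' (open_nbhs_nbhs (conj oU'' U''u)) (open_nbhs_nbhs (conj oV'' V''v)).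
exists (SigSub (mem_set (I : [set: T] z))); split; [exact: UU|exact: VV].
Qed.

End Subtypes.

(** * Conjugacy of subgroups and of isotropy groups *)

Section Subgroups.
Context {G : groupType}.
Implicit Types H : set G.
Local Open Scope group_scope.

Lemma conjugate_sub H1 H2 : conjugate H1 H2 -> subconjugate H1 H2.
Proof. by move=> [a <-]; exists a. Qed.

Lemma conjugate_refl H : conjugate H H.
Proof.
exists 1; apply/seteqP; split=> [_ [h Hh <-]|h Hh]; first by rewrite conjg1.
by exists h => //; rewrite conjg1.
Qed.

Lemma conjugate_sym H1 H2 : conjugate H1 H2 -> conjugate H2 H1.
Proof.
move=> [a <-]; exists a^-1; apply/seteqP; split=> [_ [_ [h Hh <-] <-]|h Hh].
  by rewrite conjgK.
by exists (h ^ a); [exists h|rewrite conjgK].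
Qed.

Lemma conjugate_trans H1 H2 H3 : conjugate H1 H2 -> conjugate H2 H3 -> conjugate H1 H3.
Proof.
move=> [a <-] [b <-]; exists (a * b); apply/seteqP; split=> [_ [h Hh <-]|_ [_ [h Hh <-] <-]].
  by exists (h ^ a); [exists h|rewrite conjgM].
by exists h => //; rewrite conjgM.
Qed.

Lemma subconjugate_trans H1 H2 H3 : subconjugate H1 H2 -> subconjugate H2 H3 -> subconjugate H1 H3.
Proof.
move=> [a s] [b t]; exists (a * b) => _ [h Hh <-]; apply: t.
by exists (h ^ a); [apply: s; exists h|rewrite conjgM].
Qed.

Lemma subset_subconjugate H1 H2 : H1 `<=` H2 -> subconjugate H1 H2.
Proof. by move=> s; exists 1 => _ [h Hh <-]; rewrite conjg1; exact: s. Qed.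

Lemma conjugate_isotropy {M : Type} (act : group_action G M) a x :
  conjugate (isotropy act x) (isotropy act (act a x)).
Proof.
exists a^-1; apply/seteqP; split=> [_ [h Hh <-]|h Hh]; rewrite /isotropy /=.
  by rewrite conjgE invgK -act_funM -!mulgA mulVg mulg1 act_funM Hh.
exists (h ^ a); last by rewrite conjgK.
by rewrite /isotropy /= conjgE act_funM act_funM Hh -act_funM mulVg act_fun1.
Qed.

End Subgroups.

(** * The orbit distance, and convexity *)

Section OrbitDistance.
Context {R : realType} {n m : nat} {M : topologicalType} {G : preTopologicalGroupType}
  {AM : set (chart R M n)} {g : gram R M n} {AG : set (chart R G m)} {act : group_action G M}.
Hypothesis hM : complete_riemannian_G_manifold AM g AG act.
Local Notation d := (@riemannian_dist R M n AM g).
Local Notation proj := (orbit_proj act).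

Lemma gm_atlas : atlas_on setT AM. Proof. by have [_ _ a] := GM_manifold hM. Qed.

Lemma gm_hausdorff : hausdorff_space M.
Proof. by apply: hausdorff_subT; have [h _ _] := GM_manifold hM. Qed.

Lemma gm_group_atlas : atlas_on setT AG.
Proof. by have [[_ _ a] _ _] := GM_lie_group hM. Qed.

Local Notation atA := gm_atlas.
Local Notation metA := (GM_metric hM).
Local Notation conA := (GM_connected hM).
Local Notation hauA := gm_hausdorff.
Local Notation dtri := (dist_tri atA metA conA).
Local Notation dC := (distC atA metA conA).
Local Notation dge0 := (dist_ge0 atA metA conA).
Local Notation dcont := (@dist_continuous_r _ _ _ _ _ atA metA conA).

Lemma charts_M : charts AM. Proof. by have [] := atA. Qed.
Lemma charts_G : charts AG. Proof. by have [] := gm_group_atlas. Qed.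

Lemma covers_M : covers AM setT. Proof. by move=> x _; exact: atlas_cover atA x. Qed.
Lemma covers_G : covers AG setT. Proof. by move=> x _; exact: atlas_cover gm_group_atlas x. Qed.

Lemma act_continuous2 : continuous (fun p : G * M => act p.1 p.2).
Proof. by move=> p; have [h _] := GM_smooth hM; exact: h. Qed.

Lemma act_smooth a : smooth_map AM setT AM (act a).
Proof.
have S1 := smooth_pair charts_M charts_G charts_M openT (@smooth_cst R M G n m AM AG setT a) (smooth_id atA).
have cov : covers (prod_atlas AG AM) [set: G * M].
  by move=> p _; apply: (covers_prod covers_G covers_M).
exact: (smooth_map_comp charts_M (charts_prod charts_G charts_M) charts_M cov openT openT
  (fun x _ => I) S1 (GM_smooth hM)).
Qed.

Lemma act_continuous a : continuous (act a).
Proof. by move=> x; have [h _] := act_smooth a; exact: h. Qed.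

Lemma dist_act a x y : d (act a x) (act a y) = d x y.
Proof.
have le b u v : d (act b u) (act b v) <= d u v.
  have sb := act_smooth b; have ib : preserves_metric AM g (act b) by case: hM => _ _ _ _ _ _ _ + _; apply.
  have := dist_nonexp atA metA conA u v sb ib.
  exact.
apply/eqP; rewrite eq_le le /=.
by have := le a^-1%g (act a x) (act a y); rewrite -!act_funM mulVg !act_fun1.
Qed.

Lemma proj_eqP x y : proj x = proj y <-> exists a, act a x = y.
Proof.
split=> [/eqmodP/asboolP[a ax]|[a ax]]; first by exists a.
by apply/eqmodP/asboolP; exists a.
Qed.

Lemma proj_surj (p : orbit_space act) : exists x, proj x = p.
Proof. by exists (repr p); rewrite /orbit_proj reprK. Qed.

(** By properness the pairs [(a, x)] with [act a x] in [K] form a compact set, whose image under the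
    action is the set in question. *)
Lemma orbit_compact x (K : set M) : compact K -> compact [set y | K y /\ proj y = proj x].
Proof.
move=> cK; have cX : compact (K `*` [set x]) by apply: compact_setX => //; exact: compact_set1.
have cP := GM_proper hM cX.
set P := _ @^-1` _ in cP.
have -> : [set y | K y /\ proj y = proj x] = (fun p : G * M => act p.1 p.2) @` P.
  apply/seteqP; split=> y.
    move=> [Ky /esym/proj_eqP[a ax]]; exists (a, x) => //.
    by rewrite /P /=; split=> //=; rewrite ax.
  move=> [[a z] [/= Kz zx] <-] /=; split=> //; rewrite -zx.
  by apply/esym/proj_eqP; exists a.
apply: continuous_compact => //; apply: continuous_subspaceT; exact: act_continuous2.
Qed.

Lemma nearest_in_orbit x y : exists2 y', proj y' = proj y & forall b, d x y' <= d x (act b y).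
Proof.
pose S := [set z | dball (A := AM) (g := g) x (d x y) z /\ proj z = proj y].
have cS : compact S by apply: orbit_compact; exact: (dball_compact atA metA hauA conA (GM_complete hM)).
have S0 : S !=set0 by exists y; split; rewrite // /dball /= lexx.
have dc : {within S, continuous (d x)} by apply: continuous_subspaceT; exact: dcont.
have [z] := compact_EVT_min S0 cS dc; rewrite inE => -[zy pz] zmin.
exists z => // b; have [xb|xb] := leP (d x (act b y)) (d x y).
  by apply: zmin; rewrite inE; split=> //; apply/esym/proj_eqP; exists b.
exact: le_trans zy (ltW xb).
Qed.

Lemma orbit_dist_le x y : orbit_dist act AM g (proj x) (proj y) <= d x y.
Proof.
rewrite /orbit_dist (set_dist_inf atA metA conA); apply: ge_inf; last by exists x, y.
by exists 0 => l [u [v [_ _ ->]]]; exact: dge0.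
Qed.

Lemma orbit_dist_lb x y (r : R) : (forall b, r <= d x (act b y)) -> r <= orbit_dist act AM g (proj x) (proj y).
Proof.
move=> H; rewrite /orbit_dist (set_dist_inf atA metA conA); apply: lb_le_inf; first by exists (d x y), x, y.
move=> l [u [v [/esym/proj_eqP[a <-] /esym/proj_eqP[b <-] ->]]].
have -> : d (act a x) (act b y) = d x (act (a^-1 * b)%g y).
  by rewrite -(dist_act a^-1%g) -!act_funM mulVg act_fun1.
exact: H.
Qed.

Lemma nearest_orbit_dist x p : exists2 y, proj y = p & orbit_dist act AM g (proj x) p = d x y.
Proof.
have [y0 <-] := proj_surj p; have [y yp H] := nearest_in_orbit x y0.
exists y => //; rewrite -yp; apply/eqP; rewrite eq_le orbit_dist_le /=.
rewrite yp; exact: orbit_dist_lb.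
Qed.

Lemma orbit_distC p q : orbit_dist act AM g p q = orbit_dist act AM g q p.
Proof.
have [x <-] := proj_surj p; have [y <-] := proj_surj q.
have le u v : orbit_dist act AM g (proj u) (proj v) <= orbit_dist act AM g (proj v) (proj u).
  have [w <- ->] := nearest_orbit_dist v (proj u); rewrite dC; exact: orbit_dist_le.
by apply/eqP; rewrite eq_le !le.
Qed.

Lemma isotropy_between p x q : 0 < d q x -> d q p = d q x + d x p ->
  (forall a, d q p <= d q (act a p)) -> isotropy act x `<=` isotropy act p.
Proof.
move=> qx qp H a ax; exact: (fixed_beyond atA metA hauA conA (GM_complete hM) (dist_act a) ax qx qp (H a)).
Qed.

(** Over [gamma t] a point [x] is chosen, with nearest points [p] and [q] in the two end orbits.
    Additivity at [t] makes [p, x, q] aligned and the orbit of [p] no closer to [q] than [p], so the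
    isotropy group of [x] lies in that of [p]. *)
Lemma convex_orbits_le (H : set G) : convex_subset (orbit_dist act AM g) (orbits_le act H).
Proof.
move=> a b gamma [ab _ len] Na Nb t; rewrite in_itv /= => /andP[at_ tb].
have [->//|ta] := eqVneq t a; have [->//|tb'] := eqVneq t b.
have {}at_ : a < t by rewrite lt_neqAle eq_sym ta.
have {}tb : t < b by rewrite lt_neqAle tb'.
set od := orbit_dist act AM g in len.
have split_le : od (gamma a) (gamma t) + od (gamma t) (gamma b) <= od (gamma a) (gamma b).
  (* The two-piece partition with nodes [t] and [b] is all that is used of the length of [gamma]. *)
  rewrite -lee_fin -len; apply: ereal_sup_ubound; exists [:: t; b].
    by split; rewrite /= ?at_ ?tb.
  by rewrite !big_ord_recl big_ord0 /= addr0.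
have [x Ex] := proj_surj (gamma t).
have [p pa xp] := nearest_orbit_dist x (gamma a).
have [q qb xq] := nearest_orbit_dist x (gamma b).
have [p0 Hp0 Ep0] := Na; have [q0 Hq0 Eq0] := Nb.
have iso_p : isotropy act x `<=` isotropy act p -> orbits_le act H (gamma t).
  move=> sub; exists x => //; move: Ep0; rewrite -pa => /proj_eqP[c cp].
  apply: subconjugate_trans (subset_subconjugate sub) _; rewrite -cp.
  apply: subconjugate_trans Hp0; apply: conjugate_sub; apply: conjugate_sym; exact: conjugate_isotropy.
(* If [q = x] there is no segment before [x] to be continued, but then [gamma t = gamma b]. *)
have [qx0|qx0] := eqVneq (d q x) 0.
  have E : q = x by exact: (dist_eq0 atA metA hauA conA qx0).
  by rewrite -Ex -E qb.
have E1 : od (gamma a) (gamma t) = d x p by rewrite /od -Ex orbit_distC.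
have E2 : od (gamma t) (gamma b) = d q x by rewrite /od -Ex dC.
rewrite E1 E2 in split_le.
apply: iso_p; apply: (@isotropy_between _ _ q); first by rewrite lt_neqAle eq_sym qx0 dge0.
  have t1 := dtri x q p; have := orbit_dist_le p q; rewrite pa qb -/od (dC p q) => t2.
  lra.
move=> c; have t1 := dtri x q p; have := orbit_dist_le (act c p) q.
have -> : proj (act c p) = proj p by apply/esym/proj_eqP; exists c.
rewrite pa qb -/od (dC (act c p) q) => t2; lra.
Qed.

(** Interior points of a segment from [p] to the nearest point of the orbit of [q] have isotropy
    contained in that of both ends; one is taken within [e] of [p], which later gives density. *)
Lemma lower_type p q (e : R) : 0 < e -> exists r, [/\ d p r < e,
  subconjugate (isotropy act r) (isotropy act p) & subconjugate (isotropy act r) (isotropy act q)].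
Proof.
move=> e0; have [q' q'q H] := nearest_in_orbit p q.
have /proj_eqP[b bq] := q'q.
have cq : subconjugate (isotropy act q') (isotropy act q).
  by rewrite -bq; apply: conjugate_sub; exact: conjugate_isotropy.
have [E|pq] := eqVneq (d p q') 0.
  exists p; split; first by rewrite (distxx atA metA conA).
    exact: subset_subconjugate.
  by rewrite (dist_eq0 atA metA hauA conA E).
have pq0 : 0 < d p q' by rewrite lt_neqAle eq_sym pq dge0.
pose s := Num.min (e / 2) (d p q' / 2).
have s0 : 0 < s by rewrite lt_min !divr_gt0.
have se : s <= e / 2 by exact: minl_le.
have sq : s <= d p q' / 2 by exact: minr_le.
have sI : 0 <= s <= d p q' by apply/andP; split; lra.
have [r [pr rq]] := dist_between_exact atA metA hauA conA (GM_complete hM) sI.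
have act_q b' : d p q' <= d p (act b' q').
  have q'E : q' = act b^-1%g q by rewrite -bq -act_funM mulVg act_fun1.
  by rewrite {2}q'E -act_funM; exact: H.
exists r; split; first by rewrite pr; lra.
  apply: subset_subconjugate; apply: (@isotropy_between _ _ q').
  - by rewrite (dC q' r) rq; lra.
  - by rewrite (dC q' p) (dC q' r) (dC r p) rq pr; lra.
  - move=> a; rewrite (dC q' p) -(dist_act a^-1%g q') -act_funM mulVg act_fun1 (dC _ p); exact: act_q.
apply: subconjugate_trans cq; apply: subset_subconjugate; apply: (@isotropy_between _ _ p).
- by rewrite pr.
- by rewrite rq pr; lra.
- exact: act_q.
Qed.

End OrbitDistance.

(** * Smoothness at a point, and Jacobians *)

Section LocalSmoothness.
Context {R : realType}.

(** Hiding the neighbourhood makes this stable under composition without tracking domains;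
    [smooth_at_map] returns to a given open set. *)
Definition smooth_at {T T' : topologicalType} {n n' : nat} (A : set (chart R T n))
    (A' : set (chart R T' n')) (f : T -> T') (x : T) : Prop :=
  exists W, [/\ open W, W x & smooth_map A W A' f].

Section Maps.
Context {T T' T'' : topologicalType} {n n' n'' : nat} {A : set (chart R T n)}
  {A' : set (chart R T' n')} {A'' : set (chart R T'' n'')}.
Hypothesis cA : charts A.
Hypothesis cA' : charts A'.
Hypothesis cA'' : charts A''.

Lemma smooth_at_continuous (f : T -> T') x : smooth_at A A' f x -> {for x, continuous f}.
Proof. by move=> [W [oW Wx [cf _]]]; exact: cf. Qed.

Lemma smooth_at_near (f : T -> T') x : smooth_at A A' f x -> \forall y \near x, smooth_at A A' f y.
Proof.
move=> [W [oW Wx sf]]; have nW : nbhs x W by exact: open_nbhs_nbhs.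
by apply: filterS nW => y Wy; exists W.
Qed.

Lemma smooth_at_map (f : T -> T') W : open W -> (forall x, W x -> smooth_at A A' f x) ->
  smooth_map A W A' f.
Proof.
move=> oW H; apply: smooth_map_local => x Wx; have [V [oV Vx sV]] := H x Wx.
exists V; split; [exact: oV|exact: Vx|exact: sV].
Qed.

Lemma smooth_map_at (f : T -> T') W x : open W -> smooth_map A W A' f -> W x -> smooth_at A A' f x.
Proof. by move=> oW sf Wx; exists W. Qed.

Lemma smooth_at_eq (f h : T -> T') x : {near x, f =1 h} -> smooth_at A A' f x -> smooth_at A A' h x.
Proof.
move=> E [W [oW Wx sf]].
have : nbhs x (W `&` (fun y => f y = h y)) by apply: filterI => //; exact: open_nbhs_nbhs.
rewrite nbhsE => -[V [oV Vx] VW]; exists V; split=> //.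
have sV : smooth_map A V A' f by apply: smooth_map_sub sf => y /VW[].
by apply: smooth_map_eq sV => // y /VW[].
Qed.

Lemma smooth_at_comp (f : T -> T') (h : T' -> T'') x :
  (exists2 c, A' c & cdom c (f x)) -> smooth_at A A' f x -> smooth_at A' A'' h (f x) ->
  smooth_at A A'' (h \o f) x.
Proof.
move=> [c Ac cx] [W [oW Wx sf]] [W' [oW' Wx' sh]].
have [oc _ _ _ _] := cA' Ac.
have oV : open (W `&` f @^-1` (W' `&` cdom c)).
  by apply: open_preimage_on => //; [exact: sf.1|exact: openI].
exists (W `&` f @^-1` (W' `&` cdom c)); split=> //.
apply: (@smooth_map_comp _ _ _ _ _ _ _ A A' A'' _ (W' `&` cdom c)) => //.
- by move=> y [_ cy]; exists c.
- exact: openI.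
- by move=> y [].
- by apply: smooth_map_sub sf => y [].
- by apply: smooth_map_sub sh => y [].
Qed.

Lemma smooth_at_pair (f : T -> T') (h : T -> T'') x : smooth_at A A' f x -> smooth_at A A'' h x ->
  smooth_at A (prod_atlas A' A'') (fun y => (f y, h y)) x.
Proof.
move=> [W [oW Wx sf]] [V [oV Vx sh]]; exists (W `&` V); split=> //; first exact: openI.
apply: smooth_pair => //; first exact: openI.
  by apply: smooth_map_sub sf => y [].
by apply: smooth_map_sub sh => y [].
Qed.

Lemma smooth_at_cst (y : T') x : smooth_at A A' (cst y) x.
Proof. by exists setT; split=> //; [exact: openT|exact: smooth_cst]. Qed.

Lemma smooth_at_id (S : set T) x : atlas_on S A -> S x -> smooth_at A A id x.
Proof. by move=> aS Sx; exists S; split=> //; [case: aS|exact: smooth_id]. Qed.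

Lemma smooth_at_cto (S : set T) c x : atlas_on S A -> A c -> cdom c x -> smooth_at A (@eucl R (n)) (cto c) x.
Proof.
move=> aS Ac cx; exists (cdom c); split=> //; first by have [] := cA Ac.
exact: smooth_cto aS Ac.
Qed.

Lemma smooth_at_cinv (S : set T) c w : atlas_on S A -> A c -> (cto c @` cdom c) w ->
  smooth_at (@eucl R (n)) A (cinv c) w.
Proof.
move=> aS Ac cx; exists (cto c @` cdom c); split=> //; first by have [] := cA Ac.
exact: smooth_cinv aS Ac.
Qed.

Lemma smooth_at_row n1 n2 (f : T -> 'rV[R]_n1) (h : T -> 'rV[R]_n2) x :
  smooth_at A (@eucl R (n1)) f x -> smooth_at A (@eucl R (n2)) h x ->
  smooth_at A (@eucl R (n1 + n2)%N) (fun y => row_mx (f y) (h y)) x.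
Proof.
move=> [W [oW Wx [cf sf]]] [V [oV Vx [ch sh]]]; exists (W `&` V); split=> //; first exact: openI.
split=> [y [Wy Vy]|c c' Ac -> k].
  apply: (@cvg_mx R _ (nbhs y)) => i j; rewrite row_mx_coord.
  under eq_cvg do rewrite row_mx_coord.
  case: (fintype.split j) => l; apply: cvg_coord; [exact: cf|exact: ch].
rewrite preimage_setT setIT.
have oI : open (cto c @` (cdom c `&` (W `&` V))).
  by apply: chart_open_image; [exact: cA|apply: openI; [by have [] := cA Ac|exact: openI]|move=> y []].
apply: (@Ck_row_mx R _ k _ n1 n2 (f \o cinv c) (h \o cinv c) oI).
- have := sf c (Chart setT id id) Ac erefl k; apply: Ck_sub => _ [y [cy [Wy _]] <-].
  by exists y; rewrite //= ?preimage_setT.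
- have := sh c (Chart setT id id) Ac erefl k; apply: Ck_sub => _ [y [cy [_ Vy]] <-].
  by exists y; rewrite //= ?preimage_setT.
Qed.

End Maps.

Section Euclidean.

Lemma eucl_chart n (x : 'rV[R]_n) : exists2 c, @eucl R n c & cdom c x.
Proof. by exists (Chart setT id id). Qed.

Lemma smooth_at_on n p (U : set 'rV[R]_n) (F : 'rV[R]_n -> 'rV[R]_p) x : open U -> U x ->
  smooth_on U F -> smooth_at (@eucl R (n)) (@eucl R (p)) F x.
Proof. by move=> oU Ux sF; exists U; split=> //; exact/smooth_euclP. Qed.

Lemma smooth_on_at n p (F : 'rV[R]_n -> 'rV[R]_p) x : smooth_at (@eucl R (n)) (@eucl R (p)) F x ->
  exists U, [/\ open U, U x & smooth_on U F].
Proof. by move=> [U [oU Ux /smooth_euclP sF]]; exists U. Qed.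

Lemma smooth_at_affine n p (P : 'M[R]_(n, p)) b x : smooth_at (@eucl R (n)) (@eucl R (p)) (fun v => v *m P + b) x.
Proof. by apply: (@smooth_at_on _ _ setT) => //; [exact: openT|exact: smooth_affine]. Qed.

Lemma smooth_at_mul n p (P : 'M[R]_(n, p)) x : smooth_at (@eucl R (n)) (@eucl R (p)) (fun v => v *m P) x.
Proof.
apply: smooth_at_eq (@smooth_at_affine n p P 0 x).
- exact: charts_eucl.
- exact: charts_eucl.
- by near=> v; rewrite addr0.
Unshelve. all: by end_near. Qed.

Lemma smooth_at_lsub n p x : smooth_at (@eucl R (n + p)%N) (@eucl R (n)) lsubmx x.
Proof. by apply: (@smooth_at_on _ _ setT) => //; [exact: openT|exact: smooth_lsubmx]. Qed.

Lemma smooth_at_rsub n p x : smooth_at (@eucl R (n + p)%N) (@eucl R (p)) rsubmx x.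
Proof. by apply: (@smooth_at_on _ _ setT) => //; [exact: openT|exact: smooth_rsubmx]. Qed.

Lemma atlas_eucl n : atlas_on setT (@eucl R (n)).
Proof.
split; [exact: openT|exact: charts_eucl|by apply/seteqP; split=> // x _; exists (Chart setT id id)|].
by move=> c c' -> ->; exact: smooth_onid.
Qed.

Lemma smooth_at_diff n p (F : 'rV[R]_n -> 'rV[R]_p) x : smooth_at (@eucl R (n)) (@eucl R (p)) F x ->
  differentiable F x.
Proof. by move=> /smooth_on_at[U [oU Ux sF]]; exact: C1_differentiable oU (sF 1%N) Ux. Qed.

Lemma jacobian_comp n p q (F : 'rV[R]_n -> 'rV[R]_p) (H : 'rV[R]_p -> 'rV[R]_q) x :
  differentiable F x -> differentiable H (F x) ->
  jacobian (H \o F) x = jacobian F x *m jacobian H (F x).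
Proof.
move=> dF dH; apply/row_matrixP => i; rewrite !rowE mulmxA /jacobian !mul_rV_lin1.
rewrite (diff_comp dF dH); reflexivity.
Qed.

Lemma jacobian_near_eq n p (F H : 'rV[R]_n -> 'rV[R]_p) x : {near x, F =1 H} ->
  differentiable F x -> differentiable H x -> jacobian F x = jacobian H x.
Proof.
move=> E dF dH; apply/matrixP => i j.
have E2 : 'D_(delta_mx 0 i) (fun y => F y 0 j) x = 'D_(delta_mx 0 i) (fun y => H y 0 j) x.
  by apply: near_eq_derive; apply: filterS E => y ->.
exact: etrans (etrans (jacobianE i j dF) E2) (esym (jacobianE i j dH)).
Qed.

Lemma derive_affine n p (F : 'rV[R]_n -> 'rV[R]_p) (P : 'rV[R]_p) x v :
  (forall h : R, F (h *: v + x) - F x = h *: P) -> 'D_v F x = P.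
Proof.
move=> HF; apply: cvg_lim => //; apply: cvg_near_cst.
near=> h; rewrite /= HF scalerA mulVf ?scale1r //.
near: h; exact: nbhs_dnbhs_neq.
Unshelve. all: by end_near. Qed.

Lemma jacobian_affine n p (P : 'M[R]_(n, p)) b x : jacobian (fun v => v *m P + b) x = P.
Proof.
have dF : differentiable (fun v : 'rV[R]_n => v *m P + b) x.
  by apply: smooth_at_diff; exact: smooth_at_affine.
apply/row_matrixP => i; rewrite !rowE -deriveEjacobian //.
apply: derive_affine => h; rewrite mulmxDl -scalemxAl.
by apply/rowP => j; rewrite !mxE; ring.
Qed.

Lemma jacobian_mul n p (P : 'M[R]_(n, p)) x : jacobian (fun v => v *m P) x = P.
Proof.
have dF : differentiable (fun v : 'rV[R]_n => v *m P) x.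
  by apply: smooth_at_diff; exact: smooth_at_mul.
apply/row_matrixP => i; rewrite !rowE -deriveEjacobian //.
by apply: derive_affine => h; rewrite mulmxDl -scalemxAl addrK.
Qed.

Lemma jacobian_cst n p (b : 'rV[R]_p) (x : 'rV[R]_n) : jacobian (fun=> b) x = 0.
Proof.
have dF : differentiable (fun=> b) x by exact: differentiable_cst.
apply/row_matrixP => i; rewrite !rowE -deriveEjacobian // mulmx0.
by apply: derive_affine => h; rewrite subrr scaler0.
Qed.

Lemma jacobian_id n (x : 'rV[R]_n) : jacobian id x = 1%:M.
Proof.
apply/row_matrixP => i; rewrite !rowE -deriveEjacobian //.
by apply: derive_affine => h; rewrite addrK mulmx1.
Qed.

Lemma jacobian_row_mx n n1 n2 (F : 'rV[R]_n -> 'rV[R]_n1) (H : 'rV[R]_n -> 'rV[R]_n2) x :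
  differentiable F x -> differentiable H x -> differentiable (fun y => row_mx (F y) (H y)) x ->
  jacobian (fun y => row_mx (F y) (H y)) x = row_mx (jacobian F x) (jacobian H x).
Proof.
move=> dF dH dFH; apply/matrixP => i j; rewrite jacobianE // row_mx_coord.
case: (fintype.split_ordP j) => l ->.
  by under [in LHS]eq_fun do rewrite row_mxEl; rewrite jacobianE.
by under [in LHS]eq_fun do rewrite row_mxEr; rewrite jacobianE.
Qed.

Lemma jacobian_continuous n p (F : 'rV[R]_n -> 'rV[R]_p) x :
  smooth_at (@eucl R n) (@eucl R p) F x -> {for x, continuous (jacobian F)}.
Proof.
move=> /smooth_on_at[U [oU Ux sF]]; have [c _] := Ck_jacobian oU (sF 1%N).
exact: c.
Qed.

Lemma inverse_function_at n (F : 'rV[R]_n -> 'rV[R]_n) x :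
  smooth_at (@eucl R n) (@eucl R n) F x -> jacobian F x \in unitmx ->
  exists (V W : set 'rV[R]_n) (G : 'rV[R]_n -> 'rV[R]_n),
  [/\ [/\ open V, V x & forall y, V y -> smooth_at (@eucl R n) (@eucl R n) F y], open W,
      forall y, V y -> W (F y) /\ G (F y) = y,
      forall z, W z -> V (G z) /\ F (G z) = z &
      forall z, W z -> smooth_at (@eucl R n) (@eucl R n) G z].
Proof.
move=> /smooth_on_at[U [oU Ux sF]] uJ.
have [V [W [G [[oV Vx VU] oW H1 H2 sG]]]] := inverse_function oU sF Ux uJ.
exists V, W, G; split=> //; first by split=> // y Vy; exact: smooth_at_on oU (VU y Vy) sF.
by move=> z Wz; exact: smooth_at_on oW Wz sG.
Qed.

End Euclidean.
End LocalSmoothness.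

(** * Ranks and kernels of matrices *)

Section RankLemmas.
Context {F : fieldType}.

Lemma rank_ker_mul (m n k : nat) (A : 'M[F]_(m, n)) (B : 'M[F]_(n, k)) (w : 'rV[F]_m) :
  (\rank A <= \rank (A *m B))%N -> w *m A *m B = 0 -> w *m A = 0.
Proof.
move=> rAB wAB; have sub : (kermx A <= kermx (A *m B))%MS.
  by apply/sub_kermxP; rewrite mulmxA mulmx_ker mul0mx.
have rk : (\rank (kermx (A *m B)) <= \rank (kermx A))%N by rewrite !mxrank_ker leq_sub2l.
have eqk : (kermx A == kermx (A *m B))%MS by rewrite -(geq_leqif (mxrank_leqif_eq sub)).
apply/eqP; rewrite -sub_kermx (eqmxP eqk) sub_kermx.
by rewrite mulmxA wAB.
Qed.

Lemma pinv_col_base (m n : nat) (A : 'M[F]_(m, n)) : pinvmx (col_base A) *m A = row_base A.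
Proof. by rewrite -[RHS]mul1mx -(mulVpmx (col_base_full A)) -mulmxA mulmx_base. Qed.

Lemma rank_factor (m n : nat) (A : 'M[F]_(m, n)) :
  pinvmx (col_base A) *m A *m pinvmx (row_base A) = 1%:M.
Proof.
by rewrite pinv_col_base mulmxVp // row_base_free.
Qed.

(** [P] extracts a basis of the row space of [A], and [Q] is a basis of a complement. In use [A] is
    the infinitesimal action, so [Q] gives directions transverse to the orbit. *)
Lemma complete_rows (m r k : nat) (A : 'M[F]_(m, r + k)) : \rank A = r ->
  exists (P : 'M[F]_(r, m)) (Q : 'M[F]_(k, r + k)), col_mx (P *m A) Q \in unitmx.
Proof.
move=> rA; have rC : \rank (A^C)%MS = k by rewrite mxrank_compl rA addKn.
have [P1 [Q1 H]] : exists (P : 'M[F]_(\rank A, m)) (Q : 'M[F]_(\rank (A^C)%MS, r + k)),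
    row_full (col_mx (P *m A) Q).
  exists (pinvmx (col_base A)), (row_base (A^C)%MS).
  rewrite pinv_col_base.
  rewrite -sub1mx -addsmxE (eqmxP (_ : row_base A + row_base A^C == A + A^C)%MS).
    by rewrite sub1mx; exact: addsmx_compl_full.
  by apply/eqmxP; apply: adds_eqmx; exact: eq_row_base.
move: P1 Q1 H; rewrite rA rC => P1 Q1 H; exists P1, Q1.
by rewrite -row_full_unit.
Qed.

End RankLemmas.

Lemma smooth_at_eid {R : realType} (n : nat) (x : 'rV[R]_n) : smooth_at (@eucl R n) (@eucl R n) id x.
Proof. exact: smooth_at_id (atlas_eucl n) I. Qed.

Section DeriveConst.
Context {R : realType}.

Lemma cvg_prodr (T I : Type) (F : set_system T) {FF : Filter F} (r : seq I) (f : I -> T -> R) (l : I -> R) :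
  (forall i, f i @ F --> l i) -> \prod_(i <- r) f i x @[x --> F] --> \prod_(i <- r) l i.
Proof.
move=> H; elim: r => [|i r IH].
  by rewrite big_nil; under eq_cvg do rewrite big_nil; exact: cvg_cst.
by rewrite big_cons; under eq_cvg do rewrite big_cons; apply: cvgM.
Qed.

Lemma unitmx_near (T : topologicalType) (n : nat) (F : T -> 'M[R]_n) x :
  {for x, continuous F} -> F x \in unitmx -> \forall y \near x, F y \in unitmx.
Proof.
move=> cF; rewrite unitmxE unitfE => u.
have cd : (fun y => \det (F y)) @ x --> \det (F x).
  rewrite /determinant; apply: (@cvg_sumr R R T _ (nbhs x)) => s.
  apply: cvgM; first exact: cvg_cst.
  by apply: (@cvg_prodr T _ (nbhs x)) => i; exact: cvg_coord.
have nz : \forall y \near x, \det (F y) != 0.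
  apply: (cd (fun d => d != 0)); apply: open_nbhs_nbhs; split=> //; exact: open_neq.
by apply: filterS nz => y; rewrite unitmxE unitfE.
Qed.

Lemma derive0_const (n : nat) (q : R -> 'rV[R]_n) (d t : R) :
  (forall s : R, `|s| < d -> is_derive s 1 q 0) -> `|t| < d -> q t = q 0.
Proof.
move=> H td; apply/rowP => j.
pose lam : 'cV[R]_n := delta_mx j 0.
have lE (v : 'rV[R]_n) : lincomb lam v = v 0 j.
  rewrite /lincomb (bigD1 j) //= mxE !eqxx mulr1 big1 ?addr0 // => i ij.
  by rewrite mxE (negbTE ij) mulr0.
have D (s : R) : `|s| < d -> is_derive s 1 (fun u => q u 0 j) 0.
  move=> sd; have [d1 d2] := H s sd; have := is_derive_lincomb lam d1.
  rewrite derive1E d2 lE mxE; under eq_fun do rewrite lE; exact.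
have D0 (s : R) : is_derive s 1 (cst 0 : R -> R) (0 : R) by exact: is_derive_cst.
have key (a b : R) : a <= b -> `|a| < d -> `|b| < d -> q a 0 j = q b 0 j.
  move=> ab ad bd.
  have inI (s : R) : a <= s <= b -> `|s| < d.
    move=> /andP[as_ sb]; move: ad bd; rewrite !ltr_norml => /andP[a1 a2] /andP[b1 b2].
    apply/andP; split; lra.
  have h1 := derive_mono ab (fun s h => D s (inI s h)) (fun s _ => D0 s) (fun s _ => lexx _).
  have h2 := derive_mono ab (fun s _ => D0 s) (fun s h => D s (inI s h)) (fun s _ => lexx _).
  by rewrite /= in h1 h2; lra.
have d0 : `|0 : R| < d by rewrite normr0; exact: le_lt_trans td.
have [t0|t0] := leP t 0; first exact: key.
by apply/esym; apply: key => //; exact: ltW.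
Qed.

End DeriveConst.

(** * The infinitesimal action in a chart of the group at the identity *)

Section GroupChart.
Context {R : realType} {n m : nat} {M : topologicalType} {G : preTopologicalGroupType}
  {AM : set (chart R M n)} {g : gram R M n} {AG : set (chart R G m)} {act : group_action G M}.
Hypothesis hM : complete_riemannian_G_manifold AM g AG act.
Variable e : chart R G m.
Hypothesis Ae : AG e.
Hypothesis e1 : cdom e 1%g.
Local Notation cM := (charts_M hM).
Local Notation cG := (charts_G hM).
Local Notation cE := (@charts_eucl R _).
Local Notation sat := (smooth_at).
Local Notation eu k := (@eucl R k).

(** A chart inverse recentred at the identity, not the Lie exponential: [t |-> gexp (t *: u)] is in
    general no one-parameter subgroup, and only [gexp 0 = 1] and local smoothness are used. *)
Definition gexp (u : 'rV[R]_m) : G := cinv e (u + cto e 1%g).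
Definition glog (a : G) : 'rV[R]_m := cto e a - cto e 1%g.

Lemma gexp0 : gexp 0 = 1%g.
Proof. by have [_ _ K _ _] := cG Ae; rewrite /gexp add0r K. Qed.

Lemma glog1 : glog 1%g = 0. Proof. by rewrite /glog subrr. Qed.

Lemma glogK a : cdom e a -> gexp (glog a) = a.
Proof. by have [_ _ K _ _] := cG Ae => ea; rewrite /gexp /glog subrK K. Qed.

Lemma gexp_near : \forall u \near (0 : 'rV[R]_m),
  [/\ cdom e (gexp u), glog (gexp u) = u & smooth_at (eu m) AG gexp u].
Proof.
have [oe oi K ct ci] := cG Ae.
have c1 : {for (0 : 'rV[R]_m), continuous (fun u : 'rV[R]_m => u + cto e 1%g)} by exact: shift_continuous.
have n1 : \forall u \near (0 : 'rV[R]_m), (cto e @` cdom e) (u + cto e 1%g).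
  by apply: (near_comp c1); rewrite add0r; apply: open_nbhs_nbhs; split=> //; exists 1%g.
apply: filterS n1 => u iu; have [a ea Ea] := iu.
have Eu : gexp u = a by rewrite /gexp -Ea K.
split; first by rewrite Eu.
  by rewrite Eu /glog Ea addrK.
have sh : smooth_at (eu m) (eu m) (fun u => u + cto e 1%g) u.
  have := @smooth_at_affine R m m 1%:M (cto e 1%g) u.
  by apply: smooth_at_eq; [exact: charts_eucl|exact: charts_eucl|near=> v; rewrite mulmx1].
apply: (smooth_at_comp cE cE cG (eucl_chart _) sh).
exact: (smooth_at_cinv cG (gm_group_atlas hM) Ae iu).
Unshelve. all: by end_near. Qed.

Lemma gexp_smooth0 : smooth_at (eu m) AG gexp 0.
Proof. by have [_ _] := nbhs_singleton gexp_near. Qed.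

Lemma glog_smooth a : cdom e a -> smooth_at AG (eu m) glog a.
Proof.
move=> ea; have s1 := smooth_at_cto cG (gm_group_atlas hM) Ae ea.
have sh := @smooth_at_affine R m m 1%:M (- cto e 1%g) (cto e a).
have := smooth_at_comp cG cE cE (eucl_chart _) s1 sh.
by apply: smooth_at_eq; [exact: cG|exact: charts_eucl|near=> b; rewrite /= mulmx1].
Unshelve. all: by end_near. Qed.

Section Combine.
Context {T : topologicalType} {q : nat} {A : set (chart R T q)}.
Hypothesis cA : charts A.

Lemma prod_cover (T1 T2 : topologicalType) n1 n2 (A1 : set (chart R T1 n1)) (A2 : set (chart R T2 n2)) x :
  (exists2 c, A1 c & cdom c x.1) -> (exists2 c, A2 c & cdom c x.2) ->
  exists2 c, prod_atlas A1 A2 c & cdom c x.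
Proof. by move=> [c1 A1c cx] [c2 A2c cy]; exists (prod_chart c1 c2) => //; exists c1 => //; exists c2. Qed.

Lemma coverM x : exists2 c, AM c & cdom c x.
Proof. exact: (covers_M hM I). Qed.

Lemma coverG x : exists2 c, AG c & cdom c x.
Proof. exact: (covers_G hM I). Qed.

Lemma smooth_at_act (f : T -> G) (h : T -> M) x : smooth_at A AG f x -> smooth_at A AM h x ->
  smooth_at A AM (fun t => act (f t) (h t)) x.
Proof.
move=> sf sh; have sp := smooth_at_pair cA cG cM sf sh.
apply: (smooth_at_comp (h := fun p : G * M => act p.1 p.2) cA (charts_prod cG cM) cM _ sp).
  by apply: prod_cover; [exact: coverG|exact: coverM].
by apply: (smooth_map_at openT (GM_smooth hM)).
Qed.

Lemma smooth_at_mulg (f h : T -> G) x : smooth_at A AG f x -> smooth_at A AG h x ->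
  smooth_at A AG (fun t => f t * h t)%g x.
Proof.
move=> sf sh; have sp := smooth_at_pair cA cG cG sf sh.
have [_ sm _] := GM_lie_group hM.
apply: (smooth_at_comp (h := fun p : G * G => (p.1 * p.2)%g) cA (charts_prod cG cG) cG _ sp).
  by apply: prod_cover; exact: coverG.
by apply: (smooth_map_at openT sm).
Qed.

Lemma smooth_at_invg (f : T -> G) x : smooth_at A AG f x -> smooth_at A AG (fun t => (f t)^-1)%g x.
Proof.
move=> sf; have [_ _ si] := GM_lie_group hM.
apply: (smooth_at_comp cA cG cG _ sf); first exact: coverG.
exact: (smooth_map_at openT si).
Qed.

Lemma smooth_at_chartM c (f : T -> M) x : AM c -> cdom c (f x) -> smooth_at A AM f x ->
  smooth_at A (eu n) (fun t => cto c (f t)) x.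
Proof.
move=> Ac cf sf; apply: (smooth_at_comp cA cM cE _ sf); first exact: coverM.
exact: (smooth_at_cto cM (gm_atlas hM) Ac cf).
Qed.

Lemma smooth_at_glog (f : T -> G) x : cdom e (f x) -> smooth_at A AG f x ->
  smooth_at A (eu m) (fun t => glog (f t)) x.
Proof. by move=> ef sf; apply: (smooth_at_comp cA cG cE (coverG _) sf); exact: glog_smooth. Qed.

Lemma smooth_at_gexp (f : T -> 'rV[R]_m) x : smooth_at (eu m) AG gexp (f x) -> smooth_at A (eu m) f x ->
  smooth_at A AG (fun t => gexp (f t)) x.
Proof. by move=> sg sf; apply: (smooth_at_comp cA cE cG (eucl_chart _) sf). Qed.

End Combine.

Definition orbit_map c y (u : 'rV[R]_m) : 'rV[R]_n := cto c (act (gexp u) y).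
(** The infinitesimal action at [y], acting on row vectors: its row space represents the tangent
    space of the orbit, and its left kernel the Lie algebra of the isotropy group. *)
Definition orbit_jac c y : 'M[R]_(m, n) := jacobian (orbit_map c y) 0.

Lemma orbit_map_smooth c y u : AM c -> cdom c (act (gexp u) y) -> smooth_at (eu m) AG gexp u ->
  smooth_at (eu m) (eu n) (orbit_map c y) u.
Proof.
move=> Ac cu su; apply: smooth_at_chartM; [exact: cE|exact: Ac|exact: cu|].
by apply: smooth_at_act; [exact: cE|exact: su|apply: smooth_at_cst].
Qed.

Lemma orbit_map_smooth0 c y : AM c -> cdom c y -> smooth_at (eu m) (eu n) (orbit_map c y) 0.
Proof.
by move=> Ac cy; apply: orbit_map_smooth => //; [rewrite gexp0 act_fun1|exact: gexp_smooth0].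
Qed.

Lemma continuous_cdomG (T : topologicalType) (f : T -> G) x : {for x, continuous f} -> cdom e (f x) ->
  \forall t \near x, cdom e (f t).
Proof. by move=> cf ef; have [oe _ _ _ _] := cG Ae; apply: (near_comp cf); exact: open_nbhs_nbhs. Qed.

(* Right translation by gexp u1 compares the derivative at u1 with the one at 0. *)
Lemma orbit_map_jacobian c y u1 : AM c -> cdom c (act (gexp u1) y) -> smooth_at (eu m) AG gexp u1 ->
  exists B : 'M[R]_m, jacobian (orbit_map c y) u1 = B *m orbit_jac c (act (gexp u1) y).
Proof.
move=> Ac cu su; pose h u := (gexp u * (gexp u1)^-1)%g; pose phi u := glog (h u).
have h1 : h u1 = 1%g by rewrite /h mulgV.
have sh : smooth_at (eu m) AG h u1.
  by apply: smooth_at_mulg; [exact: cE|exact: su|apply: smooth_at_cst].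
have eh : cdom e (h u1) by rewrite h1.
have sphi : smooth_at (eu m) (eu m) phi u1 by apply: smooth_at_glog; [exact: cE|exact: eh|exact: sh].
have phi1 : phi u1 = 0 by rewrite /phi h1 glog1.
have E : {near u1, orbit_map c (act (gexp u1) y) \o phi =1 orbit_map c y}.
  have nh := continuous_cdomG (smooth_at_continuous sh) eh.
  by apply: filterS nh => u eu; rewrite /orbit_map /= /phi glogK // -act_funM /h mulgVK.
have d1 := smooth_at_diff sphi.
have s2 := orbit_map_smooth0 Ac cu; rewrite -phi1 in s2; have d2 := smooth_at_diff s2.
have d3 := smooth_at_diff (orbit_map_smooth Ac cu su).
exists (jacobian phi u1); rewrite /orbit_jac -phi1 -(jacobian_comp d1 d2).
by apply/esym; apply: (jacobian_near_eq E) d3; exact: differentiable_comp.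
Qed.

(** Conjugation by [b] on the side of the group and [act b^-1] on the side of [M] factor the orbit
    map at [y] through the one at [act b y]. Used for an element and its inverse, this makes the
    rank constant along orbits. *)
Lemma orbit_jac_rank_le c c' b y : AM c -> AM c' -> cdom c y -> cdom c' (act b y) ->
  (\rank (orbit_jac c y) <= \rank (orbit_jac c' (act b y)))%N.
Proof.
move=> Ac Ac' cy cby; pose h u := (b * gexp u * b^-1)%g; pose chi u := glog (h u).
have h0 : h 0 = 1%g by rewrite /h gexp0 mulg1 mulgV.
have s0 := gexp_smooth0.
have sh : smooth_at (eu m) AG h 0.
  apply: smooth_at_mulg; [exact: cE| |by apply: smooth_at_cst].
  by apply: smooth_at_mulg; [exact: cE|apply: smooth_at_cst|exact: s0].
have eh : cdom e (h 0) by rewrite h0.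
have schi : smooth_at (eu m) (eu m) chi 0 by apply: smooth_at_glog; [exact: cE|exact: eh|exact: sh].
have chi0 : chi 0 = 0 by rewrite /chi h0 glog1.
pose H w := cto c (act b^-1%g (cinv c' w)).
have [oc' oi' K' _ _] := cM Ac'.
have by0 : act b^-1%g (act b y) = y by rewrite -act_funM mulVg act_fun1.
have sH : smooth_at (eu n) (eu n) H (cto c' (act b y)).
  apply: smooth_at_chartM; [exact: cE|exact: Ac|by rewrite K' // by0|].
  apply: smooth_at_act; [exact: cE|by apply: smooth_at_cst|].
  by apply: (smooth_at_cinv cM (gm_atlas hM) Ac'); exists (act b y).
have sO := orbit_map_smooth0 Ac' cby.
have O0 : orbit_map c' (act b y) 0 = cto c' (act b y) by rewrite /orbit_map gexp0 act_fun1.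
have E : {near (0 : 'rV[R]_m), (H \o orbit_map c' (act b y)) \o chi =1 orbit_map c y}.
  have nh := continuous_cdomG (smooth_at_continuous sh) eh.
  have cO : {for (0 : 'rV[R]_m), continuous (fun u => act (h u) (act b y))}.
    apply: smooth_at_continuous; apply: (smooth_at_act (A := eu m)) sh _; first exact: cE.
    by apply: smooth_at_cst.
  have nO : \forall u \near (0 : 'rV[R]_m), cdom c' (act (h u) (act b y)).
    by apply: (near_comp cO); apply: open_nbhs_nbhs; rewrite h0 act_fun1.
  apply: filterS (filterI nh nO) => u [eu cu].
  rewrite /H /orbit_map /= /chi glogK // K' // -!act_funM /h.
  by rewrite -!mulgA mulVg mulg1 mulKg.
have d1 := smooth_at_diff schi.
have sO' : smooth_at (eu m) (eu n) (orbit_map c' (act b y)) (chi 0) by rewrite chi0.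
have d2 := smooth_at_diff sO'.
have sH' : smooth_at (eu n) (eu n) H (orbit_map c' (act b y) (chi 0)) by rewrite chi0 O0.
have d3 := smooth_at_diff sH'; have d32 := differentiable_comp d2 d3.
have d4 := smooth_at_diff (orbit_map_smooth0 Ac cy).
rewrite /orbit_jac -(jacobian_near_eq E (differentiable_comp d1 d32) d4).
rewrite (jacobian_comp d1 d32) (jacobian_comp d2 d3) chi0.
by apply: leq_trans (mxrankM_maxr _ _) _; exact: mxrankM_maxl.
Qed.

(* A velocity killed by the infinitesimal action is the velocity of a curve in the
   stabilizer: solve only rank-many equations of orbit_map u = orbit_map 0; since
   the rank is constant along the orbit, the others follow. *)
Lemma isotropy_velocity c z w : AM c -> cdom c z -> w *m orbit_jac c z = 0 ->
  exists u : R -> 'rV[R]_m, [/\ u 0 = 0, is_derive (0 : R) 1 u w &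
    \forall t \near (0 : R), act (gexp (u t)) z = z].
Proof.
move=> Ac cz wJ; set J := orbit_jac c z in wJ; pose rho := \rank J.
pose P := pinvmx (col_base J); pose R' := pinvmx (row_base J).
have PJR : P *m J *m R' = 1%:M := rank_factor J.
pose f := orbit_map c z.
(* There are [rho] parameters for the rows of [P], on which [J] is injective, and one more for the
   time along [w]. *)
pose L (b : 'rV[R]_(rho + 1)) : 'rV[R]_m := b *m col_mx P w.
have sL b : smooth_at (eu (rho + 1)%N) (eu m) L b by exact: smooth_at_mul.
have L0 : L 0 = 0 by rewrite /L mul0mx.
have sf : smooth_at (eu m) (eu n) f (L 0) by rewrite L0; exact: orbit_map_smooth0.
have sfL := smooth_at_comp cE cE cE (eucl_chart _) (sL 0) sf.
have sfR := smooth_at_comp cE cE cE (eucl_chart _) sfL (@smooth_at_mul R _ _ R' _).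
(* The [rho] equations selected by [R'], followed by the time; inverting along the time axis solves
   these equations with initial velocity [w]. *)
pose Psi b := row_mx (f (L b) *m R') (rsubmx b).
have sPsi : smooth_at (eu (rho + 1)%N) (eu (rho + 1)%N) Psi 0.
  by apply: smooth_at_row; [exact: cE|exact: sfR|exact: smooth_at_rsub].
have rsE : (rsubmx : 'rV[R]_(rho + 1) -> 'rV[R]_1) = fun b => b *m col_mx 0 1%:M.
  by apply/funext => b; rewrite -{2}[b]hsubmxK mul_row_col mulmx0 add0r mulmx1.
have JPsi : jacobian Psi 0 = block_mx 1%:M 0 0 1%:M.
  have dR := smooth_at_diff (@smooth_at_rsub R rho 1 0).
  rewrite (jacobian_row_mx (smooth_at_diff sfR) dR (smooth_at_diff sPsi)).
  have -> : jacobian (rsubmx : 'rV[R]_(rho + 1) -> 'rV[R]_1) 0 = col_mx 0 1%:M by rewrite rsE jacobian_mul.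
  rewrite (jacobian_comp (smooth_at_diff sfL) (smooth_at_diff (@smooth_at_mul R _ _ R' _))) jacobian_mul.
  rewrite (jacobian_comp (smooth_at_diff (sL 0)) (smooth_at_diff sf)) jacobian_mul L0.
  rewrite -/(orbit_jac c z) -/J !mul_col_mx PJR wJ mul0mx.
  by rewrite block_mxEh.
have uJ : jacobian Psi 0 \in unitmx by rewrite JPsi -scalar_mx_block unitmx1.
have [V [W [Gi [[oV V0 _] oW HV HW sG]]]] := inverse_function_at sPsi uJ.
have dPsi := smooth_at_diff sPsi.
have [WP0 GP0] := HV 0 V0.
have sG0 := sG _ WP0; have dG0 := smooth_at_diff sG0.
have JG : jacobian Gi (Psi 0) = 1%:M.
  have EG : {near (0 : 'rV[R]_(rho + 1)), Gi \o Psi =1 id}.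
    have nV : nbhs (0 : 'rV[R]_(rho + 1)) V by exact: open_nbhs_nbhs.
    by apply: filterS nV => b /HV[].
  have := jacobian_near_eq EG (differentiable_comp dPsi dG0) (smooth_at_diff (smooth_at_eid _)).
  by rewrite (jacobian_comp dPsi dG0) JPsi -scalar_mx_block mul1mx jacobian_id.
pose one : 'rV[R]_(rho + 1) := row_mx 0 1%:M.
pose line (t : R) : 'rV[R]_(rho + 1) := Psi 0 + t *: one.
have line0 : line 0 = Psi 0 by rewrite /line scale0r addr0.
have dline (t : R) : is_derive t 1 line one.
  have := @is_derive_line R _ _ (id : 'rV[R]_(rho + 1) -> 'rV[R]_(rho + 1)) (Psi 0) one t (@derivable_id _ _ _ _).
  by rewrite derive_id.
have cline (t : R) : {for t, continuous line}.
  by apply: differentiable_continuous; apply/derivable1_diffP; case: (dline t).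
pose u (t : R) := L (Gi (line t)).
have nW : \forall t \near (0 : R), W (line t).
  by apply: (near_comp (cline 0)); rewrite line0; exact: open_nbhs_nbhs.
have fR (t : R) : W (line t) -> f (u t) *m R' = f 0 *m R'.
  move=> /HW[_]; rewrite {1}/Psi => /(congr1 lsubmx); rewrite row_mxKl /u => ->.
  by rewrite /line /Psi linearD /= linearZ /= !row_mxKl scaler0 addr0 L0.
have u0 : u 0 = 0 by rewrite /u line0 GP0 L0.
have du (t : R) : W (line t) -> derivable u t 1 /\ derive1 u t = one *m jacobian (L \o Gi) (line t).
  move=> Wt; have sLG := smooth_at_comp cE cE cE (eucl_chart _) (sG _ Wt) (sL _).
  have dlt : derivable line t 1 by case: (dline t).
  have [D1 D2] := derive1_comp_rV (smooth_at_diff sLG) dlt.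
  by split; [exact: D1|rewrite -[u]/((L \o Gi) \o line) D2 derive1E; case: (dline t) => _ ->].
have dw : is_derive (0 : R) 1 u w.
  have [D1 D2] := du 0 (nbhs_singleton nW); split; first exact: D1.
  rewrite -derive1E D2 line0.
  have sLG := smooth_at_diff (sL (Gi (Psi 0))).
  by rewrite (jacobian_comp dG0 sLG) JG mul1mx jacobian_mul mul_row_col mul0mx mul1mx add0r.
exists u; split; [exact: u0|exact: dw|].
have cu : {for (0 : R), continuous u}.
  by apply: differentiable_continuous; apply/derivable1_diffP; case: dw.
have nE : \forall v \near (0 : 'rV[R]_m), [/\ cdom c (act (gexp v) z), smooth_at (eu m) AG gexp v &
    P *m jacobian f v *m R' \in unitmx].
  have ns : \forall v \near (0 : 'rV[R]_m), smooth_at (eu m) AG gexp v.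
    by apply: filterS gexp_near => v [].
  have sa : smooth_at (eu m) AM (fun v => act (gexp v) z) 0.
    by apply: smooth_at_act; [exact: cE|exact: gexp_smooth0|apply: smooth_at_cst].
  have [oc _ Kc _ _] := cM Ac.
  have nc : \forall v \near (0 : 'rV[R]_m), cdom c (act (gexp v) z).
    by apply: (near_comp (smooth_at_continuous sa)); apply: open_nbhs_nbhs; rewrite gexp0 act_fun1.
  have cJ : {for (0 : 'rV[R]_m), continuous (fun v => P *m jacobian f v *m R')}.
    apply: (@cvg_mulmx R _ (nbhs (0 : 'rV[R]_m))); last exact: cvg_cst.
    apply: (@cvg_mulmx R _ (nbhs (0 : 'rV[R]_m))); first exact: cvg_cst.
    by apply: jacobian_continuous; rewrite -L0.
  have uJ0 : P *m jacobian f 0 *m R' \in unitmx by rewrite -[jacobian f 0]/J PJR unitmx1.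
  have nU := unitmx_near cJ uJ0.
  by apply: filterS (filterI nc (filterI ns nU)) => v [? [? ?]].
have nEu : \forall t \near (0 : R), W (line t) /\ [/\ cdom c (act (gexp (u t)) z),
    smooth_at (eu m) AG gexp (u t) & P *m jacobian f (u t) *m R' \in unitmx].
  apply: filterI => //; apply: (@near_comp _ _ u (fun v => [/\ cdom c (act (gexp v) z),
    smooth_at (eu m) AG gexp v & P *m jacobian f v *m R' \in unitmx]) 0 cu).
  by rewrite u0.
have dq : \forall t \near (0 : R), is_derive (t : R) (1 : R) (f \o u) 0.
  have nn : \forall t \near (0 : R), \forall s \near t, W (line s) by exact: near_join.
  apply: filterS (filterI nEu nn) => t [[Wt [ct st ut]] nWt].
  have [D1 D2] := du t Wt.
  have sfu := orbit_map_smooth Ac ct st.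
  have [F1 F2] := derive1_comp_rV (smooth_at_diff sfu) D1.
  split; first exact: F1.
  rewrite -derive1E F2.
  (* [R'] is injective on the row space of the Jacobian at [u t]: that rank is at most [rho], by
     constancy along the orbit, while the product with [P] and [R'] is still invertible. *)
  apply: (@rank_ker_mul _ _ _ _ _ R').
    apply: (@leq_trans rho).
      have [B ->] := orbit_map_jacobian Ac ct st.
      apply: leq_trans (mxrankM_maxr _ _) _.
      have := @orbit_jac_rank_le c c (gexp (u t))^-1%g (act (gexp (u t)) z) Ac Ac ct.
      by rewrite -act_funM mulVg act_fun1; apply.
    have rE := mxrank_unit ut; apply: (leq_trans (eq_leq (esym rE))).
    by rewrite -mulmxA; exact: mxrankM_maxr.
  have E : {near t, (fun s => f (u s) *m R') =1 cst (f 0 *m R')}.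
    by apply: filterS nWt => s /fR.
  have sR := smooth_at_diff (@smooth_at_mul R _ _ R' (f (u t))).
  have [G1 G2] := derive1_comp_rV (s := f \o u) sR F1.
  rewrite -F2; have -> : R' = jacobian (fun x : 'rV[R]_n => x *m R') ((f \o u) t) by rewrite jacobian_mul.
  rewrite -G2 derive1E (near_eq_derive _ E); exact: derive_cst.
have /nbhs_ballP[d /= d0 Hd] := dq.
have nd : \forall t \near (0 : R), `|t| < d by exact: near0_lt.
have [oc _ Kc _ _] := cM Ac.
apply: filterS (filterI nd nEu) => t [td [_ [ct _ _]]].
have : (f \o u) t = (f \o u) 0.
  apply: (derive0_const _ td) => s sd; apply: Hd.
  by rewrite -ball_normE /= sub0r normrN.
rewrite /= u0 /f /orbit_map gexp0 act_fun1 => Ef.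
by rewrite -(Kc _ ct) Ef Kc.
Qed.

End GroupChart.

Lemma near_norm_lt {R : realType} (T : topologicalType) (n : nat) (f : T -> 'rV[R]_n) x (rho : R) :
  {for x, continuous f} -> `|f x| < rho -> \forall y \near x, `|f y| < rho.
Proof.
move=> cf fx; have cn : (fun y => `|f y|) @ x --> `|f x| by exact: cvg_norm.
by apply: (cn (fun v => v < rho)); apply: open_nbhs_nbhs; split=> //; exact: open_lt.
Qed.

(** * Box coordinates along and across the orbits *)

Section Box.
Context {R : realType} {r k m : nat} {M : topologicalType} {G : preTopologicalGroupType}
  {AM : set (chart R M (r + k)%N)} {g : gram R M (r + k)%N} {AG : set (chart R G m)} {act : group_action G M}.
Hypothesis hM : complete_riemannian_G_manifold AM g AG act.
Variable e : chart R G m.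
Hypothesis Ae : AG e.
Hypothesis e1 : cdom e 1%g.
Local Notation cM := (charts_M hM).
Local Notation cG := (charts_G hM).
Local Notation cE := (@charts_eucl R _).
Local Notation eu k := (@eucl R k%N).
Local Notation J := (@orbit_jac R (r + k)%N m M G act e).
Local Notation omap := (@orbit_map R (r + k)%N m M G act e).
Local Notation gexp := (gexp e).
Local Notation glog := (glog e).
Local Notation ge0 := (gexp0 hM Ae e1).
Local Notation d := (@riemannian_dist R M (r + k)%N AM g).
Hypothesis rank_le : forall c y, AM c -> cdom c y -> (\rank (J c y) <= r)%N.

Section AtPoint.
Variables (x : M) (c : chart R M (r + k)%N) (P : 'M[R]_(r, m)) (sigma : 'rV[R]_k -> M).
Hypothesis Ac : AM c.
Hypothesis cx : cdom c x.
Hypothesis ssig : smooth_at (eu k) AM sigma 0.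
Hypothesis sig0 : sigma 0 = x.
Hypothesis uPQ : col_mx (P *m J c x) (jacobian (cto c \o sigma) 0) \in unitmx.

(** The first [r] coordinates move along the orbit through the directions [P], the last [k] along
    the section [sigma]. *)
Definition box_inv (b : 'rV[R]_(r + k)) : M := act (gexp (lsubmx b *m P)) (sigma (rsubmx b)).
Local Notation bi := box_inv.

Record box (rho : R) (N : set M) (bt : M -> 'rV[R]_(r + k)) : Prop := {
  bx_rho : 0 < rho;
  bx_open : open N;
  bx_bt : forall y, N y -> `|bt y| < rho /\ bi (bt y) = y;
  bx_bi : forall b : 'rV[R]_(r + k), `|b| < rho -> N (bi b) /\ bt (bi b) = b;
  bx_sbt : forall y, N y -> smooth_at AM (eu (r + k)) bt y;
  bx_sbi : forall b : 'rV[R]_(r + k), `|b| < rho -> smooth_at (eu (r + k)) AM bi b;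
  bx_N : N `<=` cdom c;
  bx_gexp : forall b : 'rV[R]_(r + k), `|b| < rho -> smooth_at (eu m) AG gexp (lsubmx b *m P);
  bx_sig : forall s, `|s| < rho -> smooth_at (eu k) AM sigma s }.

Lemma lsub0 : lsubmx (0 : 'rV[R]_(r + k)) = 0. Proof. by rewrite linear0. Qed.
Lemma rsub0 : rsubmx (0 : 'rV[R]_(r + k)) = 0. Proof. by rewrite linear0. Qed.

Lemma box_inv0 : bi 0 = x.
Proof. by rewrite /bi lsub0 rsub0 mul0mx ge0 act_fun1 sig0. Qed.

Lemma box_inv_row v s : bi (row_mx v s) = act (gexp (v *m P)) (sigma s).
Proof. by rewrite /bi row_mxKl row_mxKr. Qed.

Lemma norm_row_mxl (v : 'rV[R]_r) (s : 'rV[R]_k) rho : 0 < rho ->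
  `|row_mx v s| < rho <-> `|v| < rho /\ `|s| < rho.
Proof.
move=> rho0; split=> [H|[hv hs]].
  split; apply: le_lt_trans H; apply/rV_normP => // j.
    by rewrite -(row_mxEl v s); exact: rV_norm_coord.
  by rewrite -(row_mxEr v s); exact: rV_norm_coord.
apply: (@le_lt_trans _ _ (Num.max `|v| `|s|)); last by rewrite gt_max hv.
apply/rV_normP => [|j]; first by rewrite le_max normr_ge0.
rewrite row_mx_coord le_max; case: (fintype.split j) => l; apply/orP; [left|right]; exact: rV_norm_coord.
Qed.

Lemma smooth_box_inv b : smooth_at (eu m) AG gexp (lsubmx b *m P) -> smooth_at (eu k) AM sigma (rsubmx b) ->
  smooth_at (eu (r + k)) AM bi b.
Proof.
move=> sg ss; apply: (smooth_at_act hM); first exact: cE.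
  apply: (smooth_at_gexp hM); [exact: cE|exact: sg|].
  exact: (smooth_at_comp cE cE cE (eucl_chart _) (@smooth_at_lsub R r k b) (@smooth_at_mul R _ _ P _)).
exact: (smooth_at_comp cE cE cM (eucl_chart _) (@smooth_at_rsub R r k b) ss).
Qed.

Lemma box_exists : exists rho N bt, [/\ box rho N bt, N x & bt x = 0].
Proof.
have [oc oi Kc ct ci] := cM Ac.
have sg0 := gexp_smooth0 hM Ae e1.
have sg0' : smooth_at (eu m) AG gexp (lsubmx (0 : 'rV[R]_(r + k)) *m P) by rewrite lsub0 mul0mx.
have ss0' : smooth_at (eu k) AM sigma (rsubmx (0 : 'rV[R]_(r + k))) by rewrite rsub0.
have sb0 := smooth_box_inv sg0' ss0'.
have cb0 : cdom c (bi 0) by rewrite box_inv0.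
pose beta b := cto c (bi b).
have sbeta : smooth_at (eu (r + k)) (eu (r + k)) beta 0.
  exact: (smooth_at_chartM hM cE Ac cb0 sb0).
have Jb : jacobian beta 0 = col_mx (P *m J c x) (jacobian (cto c \o sigma) 0).
  pose iv (v : 'rV[R]_r) : 'rV[R]_(r + k) := v *m row_mx 1%:M 0.
  pose is_ (s : 'rV[R]_k) : 'rV[R]_(r + k) := s *m row_mx 0 1%:M.
  have ivE v : iv v = row_mx v 0 by rewrite /iv mul_mx_row mulmx1 mulmx0.
  have isE s : is_ s = row_mx 0 s by rewrite /is_ mul_mx_row mulmx1 mulmx0.
  have iv0 : iv 0 = 0 by rewrite /iv mul0mx.
  have is0 : is_ 0 = 0 by rewrite /is_ mul0mx.
  have db := smooth_at_diff sbeta.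
  have div := smooth_at_diff (@smooth_at_mul R _ _ (row_mx 1%:M 0 : 'M[R]_(r, r + k)) 0).
  have dis := smooth_at_diff (@smooth_at_mul R _ _ (row_mx 0 1%:M : 'M[R]_(k, r + k)) 0).
  have so := orbit_map_smooth0 hM Ae e1 Ac cx.
  have E1 : jacobian (beta \o iv) 0 = P *m J c x.
    have -> : beta \o iv = omap c x \o (fun v => v *m P).
      by apply/funext => v; rewrite /beta /= ivE box_inv_row sig0.
    have so' : smooth_at (eu m) (eu (r + k)) (omap c x) (0 *m P) by rewrite mul0mx.
    rewrite (jacobian_comp (smooth_at_diff (@smooth_at_mul R _ _ P 0)) (smooth_at_diff so')).
    by rewrite jacobian_mul mul0mx.
  have E2 : jacobian (beta \o is_) 0 = jacobian (cto c \o sigma) 0.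
    congr (jacobian _ _); apply/funext => s.
    by rewrite /beta /= isE box_inv_row mul0mx ge0 act_fun1.
  have db1 : differentiable beta (iv 0) by rewrite iv0.
  have db2 : differentiable beta (is_ 0) by rewrite is0.
  have E3 : jacobian (beta \o iv) 0 = row_mx 1%:M 0 *m jacobian beta 0.
    by rewrite (jacobian_comp div db1) jacobian_mul mul0mx.
  have E4 : jacobian (beta \o is_) 0 = row_mx 0 1%:M *m jacobian beta 0.
    by rewrite (jacobian_comp dis db2) jacobian_mul mul0mx.
  rewrite -E1 -E2 E3 E4 -mul_col_mx -block_mxEv -scalar_mx_block mul1mx //.
have uJ : jacobian beta 0 \in unitmx by rewrite Jb.
have [V [W [Gi [[oV V0 _] oW HV HW sG]]]] := inverse_function_at sbeta uJ.
have nn : \forall b \near (0 : 'rV[R]_(r + k)), [/\ V b, cdom c (bi b),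
    smooth_at (eu m) AG gexp (lsubmx b *m P) & smooth_at (eu k) AM sigma (rsubmx b)].
  have n1 : nbhs (0 : 'rV[R]_(r + k)) V by exact: open_nbhs_nbhs.
  have n2 : \forall b \near (0 : 'rV[R]_(r + k)), cdom c (bi b).
    by apply: (near_comp (smooth_at_continuous sb0)); exact: open_nbhs_nbhs.
  have sl : smooth_at (eu (r + k)) (eu m) (fun b : 'rV[R]_(r + k) => lsubmx b *m P) 0.
    exact: (smooth_at_comp cE cE cE (eucl_chart _) (@smooth_at_lsub R r k 0) (@smooth_at_mul R _ _ P _)).
  have n3 : \forall b \near (0 : 'rV[R]_(r + k)), smooth_at (eu m) AG gexp (lsubmx b *m P).
    by apply: (near_comp (smooth_at_continuous sl)); exact: smooth_at_near sg0'.
  have n4 : \forall b \near (0 : 'rV[R]_(r + k)), smooth_at (eu k) AM sigma (rsubmx b).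
    apply: (near_comp (smooth_at_continuous (@smooth_at_rsub R r k 0))); exact: smooth_at_near ss0'.
  by apply: filterS (filterI (filterI n1 n2) (filterI n3 n4)) => b [[? ?] [? ?]].
move: nn => /nbhs_ballP[rho /= rho0 Hrho].
have {}Hrho b : `|b| < rho -> [/\ V b, cdom c (bi b),
    smooth_at (eu m) AG gexp (lsubmx b *m P) & smooth_at (eu k) AM sigma (rsubmx b)].
  by move=> br; apply: Hrho; rewrite -ball_normE /= sub0r normrN.
pose N := [set y | [/\ cdom c y, W (cto c y) & `|Gi (cto c y)| < rho]].
pose bt y := Gi (cto c y).
have sbt y : N y -> smooth_at AM (eu (r + k)) bt y.
  move=> [cy Wy _].
  exact: (smooth_at_comp cM cE cE (eucl_chart _) (smooth_at_cto cM (gm_atlas hM) Ac cy) (sG _ Wy)).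
exists rho, N, bt; split.
- split=> //.
  + rewrite openE => y [cy Wy Gy].
    have sb := sbt y (And3 cy Wy Gy).
    have n1 : nbhs y (cdom c) by exact: open_nbhs_nbhs.
    have n2 : \forall z \near y, W (cto c z) by apply: (near_comp (ct y cy)); exact: open_nbhs_nbhs.
    have n3 : \forall z \near y, `|bt z| < rho := near_norm_lt (smooth_at_continuous sb) Gy.
    by apply: filterS (filterI n1 (filterI n2 n3)) => z [? [? ?]].
  + move=> y [cy Wy Gy]; split=> //; have [_ E] := HW _ Wy.
    have [_ cb _ _] := Hrho _ Gy.
    by rewrite -[LHS]Kc // [cto c (bi _)]E Kc.
  + move=> b br; have [Vb cb _ _] := Hrho b br; have [Wb Eb] := HV b Vb.
    by split; [split; [exact: cb|exact: Wb|rewrite Eb]|exact: Eb].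
  + by move=> b br; have [_ _ s1 s2] := Hrho b br; exact: smooth_box_inv.
  + by move=> y [].
  + by move=> b br; have [_ _ s1 _] := Hrho b br.
  + move=> s sr; have [|_ _ _] := Hrho (row_mx 0 s); last by rewrite row_mxKr.
    by apply/norm_row_mxl => //; rewrite normr0.
- have [W0 G0] := HV 0 V0; rewrite /beta box_inv0 in W0 G0.
  by split=> //; rewrite G0 normr0.
- by have [_ G0] := HV 0 V0; rewrite /beta box_inv0 in G0.
Qed.

Section WithBox.
Variables (rho : R) (N : set M) (bt : M -> 'rV[R]_(r + k)).
Hypothesis bx : box rho N bt.

Lemma box_row y : N y -> exists v s, [/\ bt y = row_mx v s, `|v| < rho, `|s| < rho &
  act (gexp (v *m P)) (sigma s) = y].
Proof.
move=> Ny; have [br E] := bx_bt bx Ny.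
exists (lsubmx (bt y)), (rsubmx (bt y)); rewrite hsubmxK.
have := br; rewrite -{1}[bt y]hsubmxK => /norm_row_mxl[|h1 h2]; first exact: bx_rho bx.
by split.
Qed.

(* On N the orbit directions are exactly the directions of the first r box
   coordinates, since the rank cannot exceed r; so they do not change the last k. *)
Lemma orbit_jac_box y : N y ->
  J c y *m jacobian (fun w => rsubmx (bt (cinv c w))) (cto c y) = 0.
Proof.
move=> Ny; have cy := bx_N bx Ny; have [oc oi Kc _ _] := cM Ac.
have [v [s [Eb vr sr Ey]]] := box_row Ny.
have brho := bx_rho bx.
have iy : (cto c @` cdom c) (cto c y) by exists y.
have sci := smooth_at_cinv cM (gm_atlas hM) Ac iy.
have sbt : smooth_at (eu (r + k)) (eu (r + k)) (fun w => bt (cinv c w)) (cto c y).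
  apply: (smooth_at_comp cE cM cE _ sci); first by exists c; rewrite ?Kc.
  by rewrite Kc //; exact: (bx_sbt bx Ny).
pose l w := lsubmx (bt (cinv c w)); pose h w := rsubmx (bt (cinv c w)).
have sl : smooth_at (eu (r + k)) (eu r) l (cto c y).
  exact: (smooth_at_comp cE cE cE (eucl_chart _) sbt (@smooth_at_lsub R r k _)).
have sh : smooth_at (eu (r + k)) (eu k) h (cto c y).
  exact: (smooth_at_comp cE cE cE (eucl_chart _) sbt (@smooth_at_rsub R r k _)).
have vsr : `|row_mx v s| < rho by apply/norm_row_mxl.
have sg : smooth_at (eu m) AG gexp (v *m P) by have := bx_gexp bx vsr; rewrite row_mxKl.
pose q (v' : 'rV[R]_r) := omap c (sigma s) (v' *m P).
have cy' : cdom c (act (gexp (v *m P)) (sigma s)) by rewrite Ey.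
have so := orbit_map_smooth hM Ac cy' sg.
have sq : smooth_at (eu r) (eu (r + k)) q v.
  exact: (smooth_at_comp cE cE cE (eucl_chart _) (@smooth_at_mul R _ _ P v) so).
have qv : q v = cto c y by rewrite /q /orbit_map Ey.
have [B EB] := orbit_map_jacobian hM Ae e1 Ac cy' sg.
have Jq : jacobian q v = P *m B *m J c y.
  rewrite (jacobian_comp (smooth_at_diff (@smooth_at_mul R _ _ P v)) (smooth_at_diff so)).
  rewrite EB Ey [LHS]mulmxA; congr (_ *m _ *m _); exact: jacobian_mul.
have nq : \forall v' \near v, `|v'| < rho /\ cdom c (act (gexp (v' *m P)) (sigma s)).
  apply: filterI.
    by apply: (near_norm_lt (f := id)) => //; exact: cvg_id.
  have cq : {for v, continuous (fun v' : 'rV[R]_r => act (gexp (v' *m P)) (sigma s))}.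
    apply: (smooth_at_continuous (A := eu r) (A' := AM)).
    apply: (smooth_at_act hM cE); last exact: smooth_at_cst.
    apply: (smooth_at_gexp hM cE sg); exact: smooth_at_mul.
  by apply: (near_comp cq); exact: open_nbhs_nbhs.
have El : {near v, l \o q =1 id}.
  apply: filterS nq => v' [vr' c']; rewrite /l /q /orbit_map /= Kc //.
  by rewrite -box_inv_row; have [|_ ->] := bx_bi bx (b := row_mx v' s); rewrite ?row_mxKl //; apply/norm_row_mxl.
have Eh : {near v, h \o q =1 cst s}.
  apply: filterS nq => v' [vr' c']; rewrite /h /q /orbit_map /= Kc //.
  by rewrite -box_inv_row; have [|_ ->] := bx_bi bx (b := row_mx v' s); rewrite ?row_mxKr //; apply/norm_row_mxl.
have dq := smooth_at_diff sq.
have dl : differentiable l (q v) by rewrite qv; exact: smooth_at_diff sl.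
have dh : differentiable h (q v) by rewrite qv; exact: smooth_at_diff sh.
have R1 : P *m B *m J c y *m jacobian l (cto c y) = 1%:M.
  have := jacobian_near_eq El (differentiable_comp dq dl) (smooth_at_diff (smooth_at_eid _)).
  by rewrite (jacobian_comp dq dl) jacobian_id Jq qv.
have R2 : P *m B *m J c y *m jacobian h (cto c y) = 0.
  have := jacobian_near_eq Eh (differentiable_comp dq dh) (differentiable_cst _ _).
  by rewrite (jacobian_comp dq dh) jacobian_cst Jq qv.
have rk : (\rank (J c y) <= \rank (P *m B *m J c y))%N.
  apply: leq_trans (rank_le Ac cy) _.
  by rewrite -{1}(@mxrank1 R r) -R1 mxrankM_maxl.
have sub : (P *m B *m J c y <= J c y)%MS by exact: submxMl.
have eqs : (J c y <= P *m B *m J c y)%MS by rewrite -(geq_leqif (mxrank_leqif_sup sub)).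
have /submxP[X EX] := eqs.
by rewrite {1}EX -[LHS]mulmxA -/h R2 mulmx0.
Qed.

Lemma near_box : N x -> exists2 del : R, 0 < del & forall u y, `|u| < del -> d x y < del ->
  N (act (gexp u) y) /\ smooth_at (eu m) AG gexp u.
Proof.
move=> Nx; have ca : {for (0 : 'rV[R]_m, x), continuous (fun p : 'rV[R]_m * M => act (gexp p.1) p.2)}.
  have cf : {for (0 : 'rV[R]_m, x), continuous (fun p : 'rV[R]_m * M => (gexp p.1, p.2))}.
    apply: cvg_pair; last exact: cvg_snd.
    have cg := smooth_at_continuous (gexp_smooth0 hM Ae e1).
    exact: (cvg_comp _ _ (@cvg_fst _ _ (nbhs (0 : 'rV[R]_m)) (nbhs x) _) cg).
  have ac : continuous (fun p : G * M => act p.1 p.2) by move=> p; exact: (act_continuous2 hM).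
  exact: (continuous_comp cf (ac _)).
have nN : \forall p \near (0 : 'rV[R]_m, x), N (act (gexp p.1) p.2).
  apply: (near_comp ca); apply: open_nbhs_nbhs; rewrite /= ge0 act_fun1.
  by split=> //; exact: bx_open bx.
have [[A1 A2] [/= n1 n2] sA] := nN.
have n3 : \forall u \near (0 : 'rV[R]_m), smooth_at (eu m) AG gexp u.
  exact: smooth_at_near (gexp_smooth0 hM Ae e1).
have nAs : \forall u \near (0 : 'rV[R]_m), A1 u /\ smooth_at (eu m) AG gexp u by exact: filterI.
move: nAs => /nbhs_ballP[d1 /= d10 H1].
have [d2 d20 H2] := dist_nbhs (gm_atlas hM) (GM_metric hM) (gm_hausdorff hM) (GM_connected hM) n2.
exists (Num.min d1 d2); first by rewrite lt_min d10.
move=> u y; rewrite !lt_min => /andP[u1 _] /andP[_ y2].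
have [|A1u su] := H1 u; first by rewrite -ball_normE /= sub0r normrN.
by split=> //; apply: (sA (u, y)); split=> //=; exact: H2.
Qed.

(** Along [t |-> gexp (t *: u)] applied to [y] the last coordinates have zero derivative, by
    translation to [orbit_jac_box], hence are constant. *)
Lemma rsub_box_act : N x -> exists2 del : R, 0 < del & forall u y, `|u| < del -> d x y < del ->
  [/\ N y, N (act (gexp u) y) & rsubmx (bt (act (gexp u) y)) = rsubmx (bt y)].
Proof.
move=> Nx; have [del del0 H] := near_box Nx; have [oc oi Kc _ _] := cM Ac.
exists (del / 2); first by rewrite divr_gt0.
move=> u y ud yd; have yd' : d x y < del by lra.
have Ny : N y by have := H 0 y; rewrite normr0 ge0 act_fun1 => /(_ del0 yd')[].
(* Times up to 2 are allowed so that the closed interval from 0 to 1 is interior. *)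
have tu (t : R) : `|t| < 2 -> `|t *: u| < del.
  move=> t2; rewrite normrZ.
  have [u0|u0] := eqVneq `|u| 0; first by rewrite u0 mulr0.
  have up : 0 < `|u| by rewrite lt_neqAle eq_sym u0 normr_ge0.
  have : `|t| * `|u| < 2 * `|u| by rewrite ltr_pM2r.
  lra.
have t1 : `|1 : R| < 2 by rewrite normr1 ltr1n.
have N1 : N (act (gexp u) y) by have := tu 1 t1; rewrite scale1r => /H/(_ yd')[].
split=> //.
pose q (t : R) := rsubmx (bt (act (gexp (t *: u)) y)).
have -> : rsubmx (bt (act (gexp u) y)) = q 1 by rewrite /q scale1r.
have -> : rsubmx (bt y) = q 0 by rewrite /q scale0r ge0 act_fun1.
apply: (derive0_const (d := 2)) => // t t2.
have [Nt st] := H _ _ (tu t t2) yd'.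
have ct := bx_N bx Nt.
have so := orbit_map_smooth hM Ac ct st.
set yt := act (gexp (t *: u)) y in Nt ct.
have iy : (cto c @` cdom c) (cto c yt) by exists yt.
have sci := smooth_at_cinv cM (gm_atlas hM) Ac iy.
have sbt : smooth_at (eu (r + k)) (eu (r + k)) (fun w => bt (cinv c w)) (cto c yt).
  apply: (smooth_at_comp cE cM cE _ sci); first by exists c; rewrite ?Kc.
  by rewrite Kc //; exact: (bx_sbt bx Nt).
pose h w := rsubmx (bt (cinv c w)).
have sh : smooth_at (eu (r + k)) (eu k) h (cto c yt).
  exact: (smooth_at_comp cE cE cE (eucl_chart _) sbt (@smooth_at_rsub R r k _)).
have dho : differentiable (h \o omap c y) (t *: u).
  by apply: differentiable_comp; [exact: smooth_at_diff so|exact: smooth_at_diff sh].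
have Jz : jacobian (h \o omap c y) (t *: u) = 0.
  rewrite (jacobian_comp (smooth_at_diff so) (smooth_at_diff sh)).
  have [B ->] := orbit_map_jacobian hM Ae e1 Ac ct st.
  by rewrite -mulmxA -/yt orbit_jac_box // mulmx0.
have dl : is_derive (t : R) (1 : R) (fun s : R => s *: u) u.
  have := @is_derive_line R _ _ (id : 'rV[R]_m -> 'rV[R]_m) 0 u t (@derivable_id _ _ _ _).
  by rewrite derive_id; under eq_fun do rewrite add0r.
have dlt : derivable (fun s : R => s *: u) t 1 by case: dl.
have [D1 D2] := derive1_comp_rV dho dlt.
rewrite Jz mulmx0 derive1E in D2.
have Eq : {near t, (h \o omap c y) \o (fun s : R => s *: u) =1 q}.
  have nt : \forall s \near t, `|s : R| < 2.
    apply: open_nbhs_nbhs; split=> //; exact: (open_comp (fun z _ => @norm_continuous _ _ z) (@open_lt _ 2)).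
  apply: filterS nt => s s2; have [Ns _] := H _ _ (tu s s2) yd'.
  by rewrite /h /orbit_map /= Kc //; exact: (bx_N bx Ns).
split; first exact: near_eq_derivable Eq D1.
by rewrite -(near_eq_derive _ Eq).
Qed.

End WithBox.
End AtPoint.
End Box.

Lemma rank_le_ker (F : fieldType) (m n n' : nat) (A : 'M[F]_(m, n)) (B : 'M[F]_(m, n')) :
  (forall v : 'rV_m, v *m B = 0 -> v *m A = 0) -> (\rank A <= \rank B)%N.
Proof.
move=> H; have sk : (kermx B <= kermx A)%MS.
  apply/row_subP => i; apply/sub_kermxP; apply: H.
  by apply/sub_kermxP; exact: row_sub.
have := mxrankS sk; rewrite !mxrank_ker leq_sub2lE //; exact: rank_leq_row.
Qed.

Lemma ker_eq_rank (F : fieldType) (m n : nat) (A B : 'M[F]_(m, n)) (w : 'rV[F]_m) :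
  (forall v : 'rV_m, v *m B = 0 -> v *m A = 0) -> (\rank B <= \rank A)%N -> w *m A = 0 -> w *m B = 0.
Proof.
move=> H rk wA; have sk : (kermx B <= kermx A)%MS.
  apply/row_subP => i; apply/sub_kermxP; apply: H.
  by apply/sub_kermxP; exact: row_sub.
have rk' : (\rank (kermx A) <= \rank (kermx B))%N by rewrite !mxrank_ker leq_sub2l.
have eqk : (kermx A <= kermx B)%MS by rewrite -(geq_leqif (mxrank_leqif_sup sk)).
by apply/sub_kermxP; apply: submx_trans eqk; apply/sub_kermxP.
Qed.

Lemma is_derive_smallo {R : realType} (D : R -> R) (t : R) :
  (forall eps : R, 0 < eps -> \forall s \near t, `|D s - D t| <= eps * `|s - t|) -> is_derive t (1 : R) D (0 : R).
Proof.
move=> H.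
have cv : (fun h : R => h^-1 *: (D (h *: (1 : R) + t) - D t)) @ (0 : R)^' --> (0 : R).
  apply/cvgr0Pnorm_le => eps e0.
  have st : (fun h : R => h *: (1 : R) + t) @ (0 : R) --> t.
    rewrite -{2}[t]add0r; apply: cvgD; last exact: cvg_cst.
    have E : (fun h : R => h *: (1 : R)) = id by apply/funext => h; rewrite /GRing.scale /= mulr1.
    by rewrite E; exact: cvg_id.
  have n1 : \forall h \near (0 : R), `|D (h *: (1 : R) + t) - D t| <= eps * `|h *: (1 : R) + t - t|.
    exact: st (H eps e0).
  have n2 : \forall h \near (0 : R)^', `|D (h *: (1 : R) + t) - D t| <= eps * `|h *: (1 : R) + t - t|.
    by apply: cvg_within; exact: n1.
  near=> h; have h0 : h != 0 by near: h; exact: nbhs_dnbhs_neq.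
  have : `|D (h *: (1 : R) + t) - D t| <= eps * `|h *: (1 : R) + t - t| by near: h; exact: n2.
  rewrite addrK {2}/GRing.scale /= mulr1 => Hh.
  by rewrite normrZ normfV -ler_pdivlMl ?invr_gt0 ?normr_gt0 // invrK mulrC.
split; first by apply/cvg_ex; exists 0.
exact: cvg_lim cv.
Unshelve. all: by end_near. Qed.

Lemma dist_chart_le {R : realType} {M : topologicalType} {n : nat} {A : set (chart R M n)} {gm : gram R M n}
  (atA : atlas_on setT A) (rm : riemannian_metric A gm) (hausM : hausdorff_space M) (conM : connected [set: M])
  (c : chart R M n) z : A c -> cdom c z ->
  exists2 C : R, 0 <= C & \forall z' \near z, riemannian_dist A gm z z' <= C * `|cto c z' - cto c z|.
Proof.
move=> Ac cz; have [oc oi Kc ct ci] : is_chart c by case: atA => _ H _ _; exact: H.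
have [r [K [L gb]]] := gball_exists atA rm Ac (imageP _ cz).
have [rho [C [rho0 rr C0 H]]] := dist_norm atA rm hausM conM Ac gb.
have K0 := gb_K gb; have up := gb_up gb (w := cto c z).
exists (K + C * rho); first by apply: addr_ge0; [exact: ltW|apply: mulr_ge0; rewrite // ltW].
have n1 : nbhs z (cdom c) by exact: open_nbhs_nbhs.
have cc : {for z, continuous (fun y => cto c y - cto c z)}.
  by apply: cvgB; [exact: ct|exact: cvg_cst].
have n2 : \forall y \near z, `|cto c y - cto c z| < rho.
  by apply: (near_norm_lt cc); rewrite subrr normr0.
apply: filterS (filterI n1 n2) => y [cy yr].
have h1 := H (cto c z) (cto c y); rewrite subrr normr0 in h1.
have := h1 (ltW rho0) (ltW yr); rewrite !Kc // ler_norml => /andP[_ h2].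
have h3 : gnorm (@cgram R n M gm c (cto c z)) (cto c y - cto c z) <= K * `|cto c y - cto c z|.
  by apply: up; rewrite subrr normr0 ltW // (gb_r gb).
have h4 : C * `|cto c y - cto c z| ^+ 2 <= C * rho * `|cto c y - cto c z|.
  rewrite expr2 mulrA; apply: ler_wpM2r => //; apply: ler_wpM2l => //; exact: ltW.
rewrite mulrDl; lra.
Qed.

(** * Isotropy elements near the identity *)

Section Retraction.
Context {R : realType} {r k m : nat} {M : topologicalType} {G : preTopologicalGroupType}
  {AM : set (chart R M (r + k)%N)} {g : gram R M (r + k)%N} {AG : set (chart R G m)} {act : group_action G M}.
Hypothesis hM : complete_riemannian_G_manifold AM g AG act.
Variable e : chart R G m.
Hypothesis Ae : AG e.
Hypothesis e1 : cdom e 1%g.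
Local Notation cM := (charts_M hM).
Local Notation cG := (charts_G hM).
Local Notation cE := (@charts_eucl R _).
Local Notation eu k := (@eucl R k%N).
Local Notation J := (@orbit_jac R (r + k)%N m M G act e).
Local Notation omap := (@orbit_map R (r + k)%N m M G act e).
Local Notation gexp := (gexp e).
Local Notation glog := (glog e).
Local Notation ge0 := (gexp0 hM Ae e1).
Local Notation d := (@riemannian_dist R M (r + k)%N AM g).
Hypothesis rank_le : forall c y, AM c -> cdom c y -> (\rank (J c y) <= r)%N.
Variables (x : M) (c : chart R M (r + k)%N).
Hypothesis Ac : AM c.
Hypothesis cx : cdom c x.
Hypothesis rkx : \rank (J c x) = r.

(** An affine slice in the chart realizes any prescribed matrix [Q] as the derivative of a section
    through [x]. *)
Lemma affine_section (Q : 'M[R]_(k, r + k)) : let sigma s := cinv c (s *m Q + cto c x) in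
  [/\ smooth_at (eu k) AM sigma 0, sigma 0 = x & jacobian (cto c \o sigma) 0 = Q].
Proof.
move=> sigma; have [oc oi Kc _ _] := cM Ac.
have s0 : sigma 0 = x by rewrite /sigma mul0mx add0r Kc.
have ss : smooth_at (eu k) AM sigma 0.
  apply: (smooth_at_comp cE cE cM (eucl_chart _) (@smooth_at_affine R _ _ Q (cto c x) 0)).
  by apply: (smooth_at_cinv cM (gm_atlas hM) Ac); exists x; rewrite // mul0mx add0r.
have cs0 : cdom c (sigma 0) by rewrite s0.
split=> //; have sc := smooth_at_chartM hM cE Ac cs0 ss.
rewrite -[RHS](jacobian_affine Q (cto c x) 0); apply: jacobian_near_eq.
- have cq : {for (0 : 'rV[R]_k), continuous (fun s : 'rV[R]_k => s *m Q + cto c x)}.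
    by apply: smooth_at_continuous; exact: (@smooth_at_affine R k (r + k) Q (cto c x) 0).
  have nI : \forall s \near (0 : 'rV[R]_k), (cto c @` cdom c) (s *m Q + cto c x).
    apply: (near_comp cq); apply: open_nbhs_nbhs; split; first exact: oi.
    by exists x; rewrite // mul0mx add0r.
  by apply: filterS nI => s [y cy /= E]; rewrite /sigma -E Kc.
- exact: smooth_at_diff sc.
- by apply: smooth_at_diff; exact: (@smooth_at_affine R k (r + k) Q (cto c x) 0).
Qed.

(** A small element moves [x] only along its orbit, so it is an element [gexp (v *m P)] read off the
    box coordinates times one fixing [x]. Keeping the second factor retracts a neighbourhood of 0
    smoothly onto the coordinates of the isotropy group: this is how the closed subgroup theorem is
    replaced. *)
Lemma isotropy_retraction : exists p : 'rV[R]_m -> 'rV[R]_m, p 0 = 0 /\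
  \forall u \near (0 : 'rV[R]_m), [/\ smooth_at (eu m) (eu m) p u, isotropy act x (gexp (p u)),
    smooth_at (eu m) AG gexp (p u) & isotropy act x (gexp u) -> p u = u].
Proof.
have [P [Q uPQ]] := complete_rows rkx.
have [ss s0 sJ] := affine_section Q; set sigma := fun s => _ in ss s0 sJ.
rewrite -sJ in uPQ.
have [rho [N [bt [bx Nx bx0]]]] := box_exists hM Ae e1 Ac cx ss s0 uPQ.
have [del del0 H] := rsub_box_act hM Ae e1 rank_le Ac bx Nx.
have dx : d x x < del by rewrite (distxx (gm_atlas hM) (GM_metric hM) (GM_connected hM)).
pose v u := lsubmx (bt (act (gexp u) x)).
pose h u := ((gexp (v u *m P))^-1 * gexp u)%g.
pose p u := glog (h u).
have hK u : `|u| < del -> act (h u) x = x.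
  move=> ud; have [_ Nu ru] := H u x ud dx.
  have E : bt (act (gexp u) x) = row_mx (v u) 0.
    by rewrite -[LHS]hsubmxK ru bx0 linear0.
  have [_] := bx_bt bx Nu; rewrite E box_inv_row -/(sigma 0) [sigma 0]s0 => E2.
  by rewrite /h act_funM -E2 -act_funM mulVg act_fun1.
have v0 : v 0 = 0 by rewrite /v ge0 act_fun1 bx0 linear0.
have h0 : h 0 = 1%g by rewrite /h v0 mul0mx ge0 mulVg.
have sg0 := gexp_smooth0 hM Ae e1.
have sv : smooth_at (eu m) (eu r) v 0.
  have sa : smooth_at (eu m) AM (fun u => act (gexp u) x) 0.
    by apply: (smooth_at_act hM cE sg0); exact: smooth_at_cst.
  have sb : smooth_at AM (eu (r + k)) bt (act (gexp 0) x) by rewrite ge0 act_fun1; exact: (bx_sbt bx Nx).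
  have sab := smooth_at_comp cE cM cE (coverM hM _) sa sb.
  exact: (smooth_at_comp cE cE cE (eucl_chart _) sab (@smooth_at_lsub R r k _)).
have svP : smooth_at (eu m) (eu m) (fun u => v u *m P) 0.
  exact: (smooth_at_comp cE cE cE (eucl_chart _) sv (@smooth_at_mul R _ _ P _)).
have sh : smooth_at (eu m) AG h 0.
  apply: (smooth_at_mulg hM cE _ sg0); apply: (smooth_at_invg hM cE).
  by apply: (smooth_at_gexp hM cE _ svP); rewrite v0 mul0mx.
have eh : cdom e (h 0) by rewrite h0.
have sp : smooth_at (eu m) (eu m) p 0 by apply: (smooth_at_glog hM Ae cE eh sh).
have p0 : p 0 = 0 by rewrite /p h0 glog1.
exists p; split=> //.
have n1 := smooth_at_near sp.
have n2 : \forall u \near (0 : 'rV[R]_m), `|u| < del.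
  by apply: (near_norm_lt (f := id)); [exact: cvg_id|rewrite normr0].
have n3 := continuous_cdomG hM Ae (smooth_at_continuous sh) eh.
have n4 : \forall u \near (0 : 'rV[R]_m), smooth_at (eu m) AG gexp (p u).
  by apply: (near_comp (smooth_at_continuous sp)); rewrite p0; exact: smooth_at_near sg0.
have n5 := gexp_near hM Ae e1.
apply: filterS (filterI n1 (filterI n2 (filterI n3 (filterI n4 n5)))) => u [su [ud [eu_ [spu [eg lg _]]]]].
split=> //; first by rewrite /isotropy /= /p (glogK hM Ae eu_); exact: hK.
move=> iu; rewrite /p /h /v; move: iu; rewrite /isotropy /= => ->.
by rewrite bx0 linear0 mul0mx ge0 invg1 mul1g.
Qed.

(* Elements of the isotropy group of x near 1 are joined to 1 inside it by curves, whose
   velocities are infinitesimal isotropies; if these fix z to first order, the curves fix z. *)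
Lemma isotropy_near : exists W : set G, nbhs 1%g W /\ forall z c', AM c' -> cdom c' z ->
  (forall w : 'rV[R]_m, w *m J c x = 0 -> w *m J c' z = 0) -> forall a, W a -> isotropy act x a -> act a z = z.
Proof.
have [p [p0 np]] := isotropy_retraction.
move: np => /nbhs_ballP[rho /= rho0 Hrho].
have {}Hrho u : `|u| < rho -> [/\ smooth_at (eu m) (eu m) p u, isotropy act x (gexp (p u)),
    smooth_at (eu m) AG gexp (p u) & isotropy act x (gexp u) -> p u = u].
  by move=> ur; apply: Hrho; rewrite -ball_normE /= sub0r normrN.
exists [set a | cdom e a /\ `|glog a| < rho / 2]; split.
  have [oe _ _ _ _] := cG Ae; have n1 : nbhs 1%g (cdom e) by exact: open_nbhs_nbhs.
  apply: filterI => //; apply: (near_norm_lt (f := glog)).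
    exact: smooth_at_continuous (glog_smooth hM Ae e1).
  by rewrite glog1 normr0 divr_gt0.
move=> z c' Ac' cz Hker a [ea la] xa; set u0 := glog a in la.
have tu (t : R) : `|t| < 2 -> `|t *: u0| < rho.
  move=> t2; rewrite normrZ; have [u00|u00] := eqVneq `|u0| 0; first by rewrite u00 mulr0.
  have up : 0 < `|u0| by rewrite lt_neqAle eq_sym u00 normr_ge0.
  have : `|t| * `|u0| < 2 * `|u0| by rewrite ltr_pM2r.
  lra.
pose th u := gexp (p u).
(* The displacement of [z] along a curve in the isotropy group of [x] that runs from 1 at [t = 0] to
   [a] at [t = 1]. Left translation by [th u1] reduces its derivative at any time to the
   infinitesimal action at [z], which vanishes. *)
pose D (t : R) := d z (act (th (t *: u0)) z).
have [atA gmA hauA conA] := And4 (gm_atlas hM) (GM_metric hM) (gm_hausdorff hM) (GM_connected hM).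
have key (t : R) : `|t| < 2 -> is_derive t (1 : R) D (0 : R).
  move=> t2; set u1 := t *: u0; have [su iu sgu _] := Hrho _ (tu t t2).
  pose h u := ((th u1)^-1 * th u)%g; pose Om u := glog (h u).
  have h1 : h u1 = 1%g by rewrite /h mulVg.
  have sth : smooth_at (eu m) AG th u1 by exact: (smooth_at_gexp hM cE sgu su).
  have sh : smooth_at (eu m) AG h u1.
    by apply: (smooth_at_mulg hM cE _ sth); exact: smooth_at_cst.
  have eh : cdom e (h u1) by rewrite h1.
  have sOm : smooth_at (eu m) (eu m) Om u1 by exact: (smooth_at_glog hM Ae cE eh sh).
  have Om1 : Om u1 = 0 by rewrite /Om h1 glog1.
  have neh := continuous_cdomG hM Ae (smooth_at_continuous sh) eh.
  have nrho : \forall u \near u1, `|u| < rho.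
    by apply: (near_norm_lt (f := id)); [exact: cvg_id|exact: tu].
  have sF y c2 : AM c2 -> cdom c2 y -> smooth_at (eu m) (eu (r + k)) (omap c2 y \o Om) u1 /\
      jacobian (omap c2 y \o Om) u1 = jacobian Om u1 *m J c2 y.
    move=> Ac2 cy; have so : smooth_at (eu m) (eu (r + k)) (omap c2 y) (Om u1).
      by rewrite Om1; exact: (orbit_map_smooth0 hM Ae e1 Ac2 cy).
    split; first exact: (smooth_at_comp cE cE cE (eucl_chart _) sOm so).
    by rewrite (jacobian_comp (smooth_at_diff sOm) (smooth_at_diff so)) Om1.
  have [sx Jx] := sF x c Ac cx; have [sz Jz] := sF z c' Ac' cz.
  have Jx0 : jacobian Om u1 *m J c x = 0.
    rewrite -Jx -(jacobian_cst (cto c x) u1); apply: jacobian_near_eq.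
    - apply: filterS (filterI neh nrho) => u [hu ur].
      rewrite /orbit_map /= /Om (glogK hM Ae hu) /h act_funM.
      have [_ ix _ _] := Hrho u ur; have -> : act (th u) x = x by exact: ix.
      by rewrite -{1}[x]iu -act_funM mulVg act_fun1.
    - exact: smooth_at_diff sx.
    - exact: differentiable_cst.
  have Jz0 : jacobian (omap c' z \o Om) u1 = 0.
    rewrite Jz; apply/row_matrixP => i; rewrite row_mul row0; apply: Hker.
    by rewrite -row_mul Jx0 row0.
  have [U [oU Uu1 sU]] := smooth_on_at sz.
  have [C C0 nC] := dist_chart_le atA gmA hauA conA Ac' cz.
  have nC' : \forall u \near u1, d z (act (h u) z) <= C * `|cto c' (act (h u) z) - cto c' z|.
    have sa : smooth_at (eu m) AM (fun u => act (h u) z) u1.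
      by apply: (smooth_at_act hM cE sh); exact: smooth_at_cst.
    apply: (@near_comp _ _ (fun u => act (h u) z) (fun y => d z y <= C * `|cto c' y - cto c' z|) _ (smooth_at_continuous sa)).
    by rewrite h1 act_fun1.
  apply: is_derive_smallo => eps eps0.
  (* [C] converts coordinates into distances and [|u0|] is the speed of the parameter; the 1 only
     keeps the divisor positive. *)
  have Q0 : 0 < C * `|u0| + 1 by rewrite ltr_wpDl // mulr_ge0.
  have e'0 : 0 < eps / (C * `|u0| + 1) by rewrite divr_gt0.
  have [del del0 Hdel] := C1_strict oU (sU 1%N) Uu1 e'0.
  have ns : \forall u \near u1, `|u - u1| < del.
    by apply: (near_norm_lt (f := fun u : 'rV[R]_m => u - u1)); [exact: cvgB cvg_id (cvg_cst _)|rewrite subrr normr0].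
  have cl : {for t, continuous (fun s : R => s *: u0)} by apply: cvgZr_tmp; exact: cvg_id.
  have nall : \forall s \near t, [/\ `|s *: u0 - u1| < del, cdom e (h (s *: u0)) &
     d z (act (h (s *: u0)) z) <= C * `|cto c' (act (h (s *: u0)) z) - cto c' z|].
    apply: (@near_comp _ _ (fun s : R => s *: u0) (fun u => [/\ `|u - u1| < del, cdom e (h u) &
      d z (act (h u) z) <= C * `|cto c' (act (h u) z) - cto c' z|]) _ cl).
    by apply: filterS (filterI ns (filterI neh nC')) => u [? [? ?]].
  apply: filterS nall => s [sd hs dC].
  have h2 : `|D s - D t| <= d z (act (h (s *: u0)) z).
    apply: le_trans (dist_dist_le atA gmA conA z _ _) _.
    rewrite -(dist_act hM (th u1) z) -act_funM /h mulgA mulgV mul1g.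
    by rewrite (distC atA gmA conA).
  have h3 : `|cto c' (act (h (s *: u0)) z) - cto c' z| <= eps / (C * `|u0| + 1) * (`|s - t| * `|u0|).
    have := Hdel (s *: u0) u1 sd; rewrite subrr normr0 Jz0 mulmx0 subr0 => /(_ del0).
    by rewrite /orbit_map /= Om1 ge0 act_fun1 /Om (glogK hM Ae hs) -scalerBl normrZ.
  apply: le_trans h2 _; apply: le_trans dC _.
  apply: le_trans (ler_wpM2l C0 h3) _.
  rewrite [leLHS](_ : _ = eps * `|s - t| * ((C * `|u0|) / (C * `|u0| + 1))); last by ring.
  rewrite -[leRHS]mulr1; apply: ler_wpM2l; first by rewrite mulr_ge0 // ltW.
  by rewrite ler_pdivrMr // mul1r lerDl.
have D01 : D 1 - D 0 <= (0 : R) - 0.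
  apply: (@derive_mono R 0 1 D (fun=> 0) (fun=> 0) (fun=> 0)) => //.
  move=> t /andP[t0 t1]; apply: key; rewrite ger0_norm //; lra.
have D0 : D 0 = 0 by rewrite /D scale0r /th p0 ge0 act_fun1 distxx.
have ga : gexp u0 = a by rewrite /u0 (glogK hM Ae ea).
have D1 : D 1 = d z (act a z).
  have [|_ _ _] := Hrho u0; first by have := tu 1; rewrite scale1r normr1; apply; rewrite ltr1n.
  by rewrite ga => /(_ xa) pu; rewrite /D scale1r /th pu ga.
apply/esym/(dist_eq0 atA gmA hauA conA); apply/eqP; rewrite eq_le (dist_ge0 atA gmA conA) andbT.
by move: D01; rewrite D0 D1 subrr; lra.
Qed.

(** [isotropy_velocity] realizes a vector of the kernel at [z] by a curve in the isotropy group of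
    [z]; this curve also fixes [x], so its velocity is killed at [x]. *)
Lemma kernel_sub z c' : AM c' -> cdom c' z -> isotropy act z `<=` isotropy act x ->
  forall w : 'rV[R]_m, w *m J c' z = 0 -> w *m J c x = 0.
Proof.
move=> Ac' cz sub w wJ; have [u [u0 du nu]] := isotropy_velocity hM Ae e1 Ac' cz wJ.
have so : smooth_at (eu m) (eu (r + k)) (omap c x) (u 0) by rewrite u0; exact: (orbit_map_smooth0 hM Ae e1 Ac cx).
have [D1 D2] := derive1_comp_rV (smooth_at_diff so) (ex_derive (is_derive := du)).
rewrite derive1E [in RHS]derive1E (derive_val (is_derive := du)) u0 in D2.
rewrite -[LHS]D2 -(derive_cst (cto c x) (0 : R) (1 : R)); apply: near_eq_derive.
by apply: filterS nu => t zt; rewrite /orbit_map /=; have -> : act (gexp (u t)) x = x by exact: sub.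
Qed.

(** The rank at [x] being maximal, the inclusion of kernels from [kernel_sub] is an equality, and
    [isotropy_near] applies in the other direction. What matters is that [W] does not depend on
    [z]. *)
Lemma isotropy_near_uniform : exists W : set G, nbhs 1%g W /\ forall z,
  isotropy act z `<=` isotropy act x -> W `&` isotropy act x `<=` isotropy act z.
Proof.
have [W [nW H]] := isotropy_near; exists W; split=> // z sub a [Wa xa].
have [c' Ac' cz] := coverM hM z.
apply: (H z c' Ac' cz) Wa xa => w wJ.
apply: (ker_eq_rank (kernel_sub Ac' cz sub)) wJ.
exact: leq_trans (rank_le Ac' cz) (eq_leq (esym rkx)).
Qed.

End Retraction.

(** * Compactness of isotropy groups, and minimal orbit types *)

Section OrbitTypes.
Context {R : realType} {n m : nat} {M : topologicalType} {G : preTopologicalGroupType}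
  {AM : set (chart R M n)} {g : gram R M n} {AG : set (chart R G m)} {act : group_action G M}.
Hypothesis hM : complete_riemannian_G_manifold AM g AG act.

Lemma isotropy_compact x : compact (isotropy act x).
Proof.
have cX : compact ([set x] `*` [set x]) by apply: compact_setX; exact: compact_set1.
have cP := GM_proper hM cX.
have -> : isotropy act x = fst @` ((fun p : G * M => (act p.1 p.2, p.2)) @^-1` ([set x] `*` [set x])).
  apply/seteqP; split=> [a ax|_ [[a y] [/= ay yx] <-]]; first by exists (a, x).
  by rewrite -yx in ay *; rewrite /isotropy /= ay.
apply: continuous_compact cP; apply: continuous_subspaceT => p; exact: cvg_fst.
Qed.

Lemma isotropyM x a b : isotropy act x a -> isotropy act x b -> isotropy act x (a * b)%g.
Proof. by rewrite /isotropy /= => ax bx; rewrite act_funM bx. Qed.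

Lemma isotropyV x a : isotropy act x a -> isotropy act x a^-1%g.
Proof. by rewrite /isotropy /= => ax; rewrite -{1}ax -act_funM mulVg act_fun1. Qed.

Lemma isotropy1 x : isotropy act x 1%g. Proof. exact: act_fun1. Qed.

Lemma mulg_continuous2 : continuous (fun p : G * G => (p.1 * p.2)%g).
Proof. by move=> p; have [_ [h _] _] := GM_lie_group hM; exact: h. Qed.

Lemma invg_continuous : continuous (fun a : G => a^-1%g).
Proof. by move=> a; have [_ _ [h _]] := GM_lie_group hM; exact: h. Qed.

Lemma continuous_mulg (T : topologicalType) (f h : T -> G) t : {for t, continuous f} -> {for t, continuous h} ->
  {for t, continuous (fun s => f s * h s)%g}.
Proof.
move=> cf ch; have cp : {for t, continuous (fun s => (f s, h s))} by exact: cvg_pair.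
exact: (continuous_comp cp (@mulg_continuous2 _)).
Qed.

Lemma continuous_invg (T : topologicalType) (f : T -> G) t : {for t, continuous f} ->
  {for t, continuous (fun s => (f s)^-1)%g}.
Proof. by move=> cf; exact: (continuous_comp cf (@invg_continuous _)). Qed.

Lemma continuous_lmulg (a : G) : continuous (fun b : G => a * b)%g.
Proof. by move=> b; apply: continuous_mulg; [exact: cvg_cst|exact: cvg_id]. Qed.

(** The translates of [V] by points of [K] cover [K]; the points of a finite subcover can be listed
    inside [K]. *)
Lemma compact_translates (K : set G) (V : set G) : compact K -> open V -> V 1%g ->
  exists2 s : seq G, forall b, b \in s -> K b & forall a, K a -> exists2 b, b \in s & V (b^-1 * a)%g.
Proof.
move=> /compact_near_coveringP cK oV V1.
(* Finite sequences directed by inclusion of their members: compactness as a near-covering property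
   then yields one sequence for all of [K]. *)
pose F : set_system (seq G) := [set S | exists s0 : seq G, forall s : seq G, {subset s0 <= s} -> S s].
have FF : Filter F.
  split=> [|S S' [s Hs] [s' Hs']|S S' SS' [s Hs]]; first by exists [::].
    exists (s ++ s') => t st; split; [apply: Hs|apply: Hs'] => b bs; apply: st.
      by rewrite mem_cat bs.
    by rewrite mem_cat bs orbT.
  by exists s => t st; apply: SS'; exact: Hs.
have [s Hs] : F [set s : seq G | K `<=` [set a | exists2 b, b \in s & K b /\ V (b^-1 * a)%g]].
  have := @cK _ F (fun s a => exists2 b, b \in s & K b /\ V (b^-1 * a)%g) FF; apply=> a Ka; exists ([set a' | V (a^-1 * a')%g], [set s : seq G | a \in s]).
    split; last by exists [:: a] => s; apply; rewrite mem_head.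
    by apply: (near_comp (@continuous_lmulg a^-1%g a)); apply: open_nbhs_nbhs; rewrite mulVg.
  by move=> [a' s] [/= Va as_]; exists a.
have {}Hs := Hs s (fun _ h => h).
exists [seq b <- s | `[< K b >]] => [b|a /Hs[b bs [Kb Vb]]].
  by rewrite mem_filter => /andP[/asboolP].
by exists b => //; rewrite mem_filter bs andbT; apply/asboolP.
Qed.

Lemma nbhs_divg (W : set G) : nbhs 1%g W -> exists V, [/\ open V, V 1%g & forall a b, V a -> V b -> W (a^-1 * b)%g].
Proof.
move=> nW; have cf : {for (1%g : G, 1%g : G), continuous (fun p : G * G => p.1^-1 * p.2)%g}.
  apply: continuous_mulg; last exact: cvg_snd.
  apply: continuous_invg; exact: cvg_fst.
have nn : \forall p \near (1%g : G, 1%g : G), W (p.1^-1 * p.2)%g.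
  by apply: (near_comp cf); rewrite /= invg1 mulg1.
have [[A B] [/= nA nB] AB] := nn.
have nAB : nbhs (1%g : G) (A `&` B) by apply: filterI.
have [V [oV V1] VAB] : exists2 V, open_nbhs (1%g : G) V & V `<=` A `&` B by move: nAB; rewrite nbhsE.
by exists V; split=> // a b /VAB[Aa _] /VAB[_ Bb]; exact: (AB (a, b)).
Qed.

Lemma isotropy_conjg a y : isotropy act (act a^-1%g y) = [set (h ^ a)%g | h in isotropy act y].
Proof.
apply/seteqP; split=> [h hy|_ [h hy <-]].
  exists (h ^ a^-1)%g; last by rewrite conjgKV.
  move: hy; rewrite /isotropy /= conjgE invgK !act_funM => /(congr1 (act a)).
  by rewrite -[in RHS]act_funM mulgV act_fun1.
by rewrite /isotropy /= conjgE !act_funM -(act_funM _ a a^-1%g) mulgV act_fun1 hy.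
Qed.

(** Minimality for inclusion among isotropy groups passes to conjugacy classes, because a conjugate
    of an isotropy group is the isotropy group of a translated point. *)
Lemma minimal_typeP z : (forall z', isotropy act z' `<=` isotropy act z -> isotropy act z `<=` isotropy act z') ->
  minimal_orbit_type act (isotropy act z).
Proof.
move=> H; split; first by exists z; exact: conjugate_refl.
move=> y [a sub].
have E := isotropy_conjg a y; exists a; rewrite -E; apply/seteqP; split; first by rewrite E.
by apply: H; rewrite E.
Qed.

(** [lower_type] gives a point whose type is below both; minimality makes it conjugate to each. *)
Lemma minimal_type_unique K K' : minimal_orbit_type act K -> minimal_orbit_type act K' -> conjugate K' K.
Proof.
move=> [[x cx] HK] [[x' cx'] HK'].
have [y [_ s s']] := lower_type hM x x' ltr01.
have h1 := HK y (subconjugate_trans s (conjugate_sub cx)).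
have h2 := HK' y (subconjugate_trans s' (conjugate_sub cx')).
exact: conjugate_trans (conjugate_sym h2) h1.
Qed.

End OrbitTypes.

(** * Existence of a minimal isotropy group *)

Section MinimalType.
Context {R : realType} {r k m : nat} {M : topologicalType} {G : preTopologicalGroupType}
  {AM : set (chart R M (r + k)%N)} {g : gram R M (r + k)%N} {AG : set (chart R G m)} {act : group_action G M}.
Hypothesis hM : complete_riemannian_G_manifold AM g AG act.
Variable e : chart R G m.
Hypothesis Ae : AG e.
Hypothesis e1 : cdom e 1%g.
Local Notation J := (@orbit_jac R (r + k)%N m M G act e).
Hypothesis rank_le : forall c y, AM c -> cdom c y -> (\rank (J c y) <= r)%N.

(** Representatives showing that a subgroup [L] of [K] has at least [j] left cosets in [K]. *)
Let separated (L : set G) (K : set G) j := exists f : 'I_j -> G,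
  (forall i, K (f i)) /\ forall i i', i != i' -> ~ L ((f i)^-1 * f i')%g.

(* The isotropy groups inside K = G_x all contain a fixed neighbourhood of 1 in K, so their
   indices in K are bounded; one of largest index contains no smaller isotropy group. *)
Lemma minimal_isotropy x c : AM c -> cdom c x -> \rank (J c x) = r ->
  exists2 z, isotropy act z `<=` isotropy act x &
    forall z', isotropy act z' `<=` isotropy act z -> isotropy act z `<=` isotropy act z'.
Proof.
move=> Ac cx rkx; set K := isotropy act x.
have [W [nW HW]] := isotropy_near_uniform hM Ae e1 rank_le Ac cx rkx.
have [V [oV V1 HV]] := nbhs_divg hM nW.
have [s _ Hs] := compact_translates hM (isotropy_compact hM (x := x)) oV V1.
have bound z j : isotropy act z `<=` K -> separated (isotropy act z) K j -> (j <= size s)%N.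
  move=> sub [f [fK fL]].
  have /choice[b Hb] : forall i, exists b, b \in s /\ V (b^-1 * f i)%g.
    by move=> i; have [b bs Vb] := Hs _ (fK i); exists b.
  (* Two representatives in the same translate of [V] would differ by an element of [W] in the
     isotropy group of [x], hence by one fixing [z]. So the number of translates bounds the
     index. *)
  have ib : injective b.
    move=> i i' E; apply/eqP/negPn/negP => ii'; apply: (fL i i' ii').
    apply: (HW z sub); split; last by apply: isotropyM; [exact: (isotropyV (fK i))|exact: fK].
    by have := HV _ _ (Hb i).2 (Hb i').2; rewrite E invgM invgK -!mulgA mulVKg.
  have := @uniq_leq_size _ (map b (enum 'I_j)) s; rewrite size_map size_enum_ord; apply.
    by rewrite map_inj_uniq // enum_uniq.
  by move=> _ /mapP[i _ ->]; exact: (Hb i).1.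
pose P j := `[< exists2 z, isotropy act z `<=` K & separated (isotropy act z) K j >].
have P1 : exists j, P j.
  by exists 0%N; apply/asboolP; exists x => //; exists (fun=> 1%g); split; case.
have Pb j : P j -> (j <= size s)%N by move=> /asboolP[z sub /(bound z _ sub)].
have [j /asboolP[z sub [f [fK fL]]] jmax] := ex_maxnP P1 Pb.
exists z => // z' sub' a za; apply: contrapT => nz'a.
case: j f fK fL jmax => [|j] f fK fL jmax.
  have := jmax 1%N; rewrite ltnn => H; suff // : false by [].
  apply: H; apply/asboolP; exists x => //; exists (fun=> 1%g); split=> [i|i i'].
    exact: isotropy1.
  by rewrite !ord1 eqxx.
have := jmax j.+2; rewrite ltnn => H; suff // : false by [].
apply: H; apply/asboolP; exists z'; first by move=> b /sub'/sub.
(* An element [a] that fixes [z] but not [z'] splits the coset of [f ord0]: adjoining [f ord0 * a]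
   produces one coset more modulo the isotropy group of [z'], against maximality. *)
pose f' (i : 'I_j.+2) := if unlift ord0 i is Some i' then f i' else (f ord0 * a)%g.
have ka : K a by exact: sub.
have nfa i : ~ isotropy act z' ((f i)^-1 * (f ord0 * a))%g.
  have [->|i0] := eqVneq i ord0; first by rewrite mulKg.
  move=> /sub' h; apply: (fL i ord0 i0); have := isotropyM h (isotropyV za).
  by rewrite -!mulgA mulgV mulg1.
exists f'; split=> [i|i i'].
  rewrite /f'; case: unliftP => [i' _|_]; first exact: fK.
  by apply: isotropyM => //; exact: fK.
rewrite /f'; case: unliftP => [i1 ->|->]; case: unliftP => [i2 ->|->] ii' //.
- by move=> /sub'; apply: fL; apply: contraNneq ii' => ->.
- move=> /isotropyV; rewrite invgM invgK; exact: nfa.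
Qed.

End MinimalType.

(** * Orbits near a point of minimal isotropy *)

Section NearRegular.
Context {R : realType} {r k m : nat} {M : topologicalType} {G : preTopologicalGroupType}
  {AM : set (chart R M (r + k)%N)} {g : gram R M (r + k)%N} {AG : set (chart R G m)} {act : group_action G M}.
Hypothesis hM : complete_riemannian_G_manifold AM g AG act.
Variable e : chart R G m.
Hypothesis Ae : AG e.
Hypothesis e1 : cdom e 1%g.
Local Notation cM := (charts_M hM).
Local Notation cG := (charts_G hM).
Local Notation cE := (@charts_eucl R _).
Local Notation eu k := (@eucl R k%N).
Local Notation J := (@orbit_jac R (r + k)%N m M G act e).
Local Notation gexp := (gexp e).
Local Notation glog := (glog e).
Local Notation ge0 := (gexp0 hM Ae e1).
Local Notation d := (@riemannian_dist R M (r + k)%N AM g).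
Local Notation proj := (orbit_proj act).
Local Notation atA := (gm_atlas hM).
Local Notation metA := (GM_metric hM).
Local Notation conA := (GM_connected hM).
Local Notation hauA := (gm_hausdorff hM).

Lemma near_glog (eta : R) : 0 < eta -> \forall a \near (1%g : G), cdom e a /\ `|glog a| < eta.
Proof.
move=> eta0; have [oe _ _ _ _] := cG Ae; have n1 : nbhs 1%g (cdom e) by exact: open_nbhs_nbhs.
apply: filterI => //; apply: (near_norm_lt (f := glog)).
  exact: smooth_at_continuous (glog_smooth hM Ae e1).
by rewrite glog1 normr0.
Qed.

(** By properness the pairs [(a, y)] with [y] and [act a y] in a ball around [x], and [a] outside
    [V] times the isotropy group of [x], form a compact set. On it the sum of the distances from [x]
    to [y] and to [act a y] vanishes nowhere, hence has a positive lower bound. *)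
Lemma near_isotropy x (W : set G) : nbhs 1%g W -> exists2 del : R, 0 < del &
  forall y a, d x y < del -> d x (act a y) < del -> exists2 u, W u & isotropy act x (u^-1 * a)%g.
Proof.
move=> nW; have [V [oV V1] VW] : exists2 V, open_nbhs (1%g : G) V & V `<=` W by move: nW; rewrite nbhsE.
pose B := dball (A := AM) (g := g) x 1.
have cB : compact B by exact: (dball_compact atA metA hauA conA (GM_complete hM)).
have cC := GM_proper hM (compact_setX cB cB).
pose O : set (G * M) := [set p | exists2 b, isotropy act x b & V (p.1 * b^-1)%g].
have oO : open O.
  rewrite (_ : O = \bigcup_(b in isotropy act x) [set p | V (p.1 * b^-1)%g]).
    apply: bigcup_open => b _; apply: open_comp oV => p _.
    apply: (continuous_mulg hM); [exact: cvg_fst|exact: cvg_cst].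
  by apply/seteqP; split=> [p [b xb Vb]|p [b xb Vb]]; exists b.
pose f (p : G * M) := d x p.2 + d x (act p.1 p.2).
pose C := (fun p : G * M => (act p.1 p.2, p.2)) @^-1` (B `*` B) `&` ~` O.
have cC' : compact C by rewrite /C; apply: compact_closedI => //; exact: open_closedC.
have cf : continuous f.
  move=> p; have c1 : {for p, continuous (fun p : G * M => d x p.2)}.
    by apply: (continuous_comp cvg_snd); exact: (dist_continuous_r atA metA conA).
  have c2 : {for p, continuous (fun p : G * M => d x (act p.1 p.2))}.
    have ca : {for p, continuous (fun p : G * M => act p.1 p.2)} by exact: (act_continuous2 hM).
    by apply: (continuous_comp ca); exact: (dist_continuous_r atA metA conA).
  exact: cvgD.
have [mu mu0 Hmu] : exists2 mu : R, 0 < mu & forall p, C p -> mu <= f p.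
  have [C0|/set0P C0] := eqVneq C set0; first by exists 1 => // p; rewrite C0.
  have [p Cp pmin] := compact_EVT_min C0 cC' (continuous_subspaceT cf).
  rewrite inE in Cp; exists (f p); last by move=> q Cq; apply: pmin; rewrite inE.
  have f1 := dist_ge0 atA metA conA x p.2; have f2 := dist_ge0 atA metA conA x (act p.1 p.2).
  rewrite lt_neqAle addr_ge0 // andbT eq_sym; apply/eqP => fp; case: Cp => _; apply.
  have E1 : x = p.2 by apply: (dist_eq0 atA metA hauA conA); rewrite /f in fp; lra.
  have E2 : x = act p.1 p.2 by apply: (dist_eq0 atA metA hauA conA); rewrite /f in fp; lra.
  by exists p.1; rewrite ?mulgV // /isotropy /= {1}E1 -E2.
exists (Num.min 1 (mu / 2)); first by rewrite lt_min ltr01 divr_gt0.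
move=> y a; rewrite !lt_min => /andP[y1 y2] /andP[a1 a2].
have [b xb Vb] : O (a, y).
  apply: contrapT => nO; have : mu <= f (a, y).
    by apply: Hmu; split=> //; split; rewrite /B /dball /= ltW.
  by rewrite /f /=; lra.
by exists (a * b^-1)%g; [exact: VW|rewrite invgM invgK -mulgA mulVg mulg1].
Qed.

Variable K : set G.
Hypothesis Kmin : forall z, isotropy act z `<=` K -> K `<=` isotropy act z.

Section Box.
Variables (x : M) (c : chart R M (r + k)) (P : 'M[R]_(r, m)) (sigma : 'rV[R]_k -> M)
  (rho : R) (N : set M) (bt : M -> 'rV[R]_(r + k)).
Hypothesis xK : isotropy act x = K.

(* A point w between x and a nearest point y' of an orbit has isotropy in G_x and in G_y';
   minimality of K = G_x forces K = G_w, hence K <= G_y'. *)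
Lemma nearest_fixed y : exists b, d x (act b y) <= d x y /\ K `<=` isotropy act (act b y).
Proof.
have [y' Ey' H] := nearest_in_orbit hM x y.
have /proj_eqP[b by'] : proj y = proj y' by rewrite Ey'.
exists b; rewrite by'; split; first by have := H 1%g; rewrite act_fun1.
have [E|xy] := eqVneq (d x y') 0.
  by rewrite -(dist_eq0 atA metA hauA conA E) xK.
have xy0 : 0 < d x y' by rewrite lt_neqAle eq_sym xy (dist_ge0 atA metA conA).
have sI : 0 <= d x y' / 2 <= d x y' by apply/andP; split; lra.
have [w [pr rq]] := dist_between_exact atA metA hauA conA (GM_complete hM) sI.
have dC := distC atA metA conA.
have Hb b' : d x y' <= d x (act b' y').
  by have := H (b' * b)%g; rewrite act_funM by'.
have s1 : isotropy act w `<=` isotropy act y'.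
  by apply: (isotropy_between hM (q := x)) => //; [rewrite pr; lra|rewrite rq pr; lra].
apply: subset_trans s1; apply: Kmin; rewrite -xK; apply: (isotropy_between hM (q := y')).
- by rewrite (dC y' w) rq; lra.
- by rewrite (dC y' x) (dC y' w) (dC w x) rq pr; lra.
- by move=> a; rewrite (dC y' x) -(dist_act hM a^-1%g y') -act_funM mulVg act_fun1 (dC _ x).
Qed.

Hypothesis rank_le : forall c y, AM c -> cdom c y -> (\rank (J c y) <= r)%N.
Hypothesis Ac : AM c.
Hypothesis bx : @box R r k m M G AM AG act e c P sigma rho N bt.
Hypothesis Nx : N x.
Hypothesis btx : bt x = 0.
Local Notation bi := (@box_inv R r k m M G act e P sigma).

Let sig0 : sigma 0 = x.
Proof.
have [_] := bx_bt bx Nx; rewrite btx /box_inv lsub0 rsub0 mul0mx ge0 act_fun1 //.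
Qed.

(** For [a] near 1 the point [act a x] has last box coordinates 0, so it equals [gexp (v *m P)]
    applied to [x]; the quotient fixes [x]. *)
Lemma box_decomposition (eta : R) : 0 < eta -> \forall a \near (1%g : G),
  exists2 v, `|v| < eta & K ((gexp (v *m P))^-1 * a)%g.
Proof.
move=> eta0; have [del del0 H] := rsub_box_act hM Ae e1 rank_le Ac bx Nx.
have dx : d x x < del by rewrite (distxx atA metA conA).
have sg0 := gexp_smooth0 hM Ae e1.
have sa : {for (0 : 'rV[R]_m), continuous (fun u => act (gexp u) x)}.
  apply: (smooth_at_continuous (A := eu m) (A' := AM)).
  by apply: (smooth_at_act hM cE sg0); exact: smooth_at_cst.
have sb : {for act (gexp 0) x, continuous (fun y => lsubmx (bt y))}.
  apply: (smooth_at_continuous (A := AM) (A' := eu r)).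
  have sbt : smooth_at AM (eu (r + k)) bt (act (gexp 0) x) by rewrite ge0 act_fun1; exact: (bx_sbt bx Nx).
  exact: (smooth_at_comp cM cE cE (eucl_chart _) sbt (@smooth_at_lsub R r k _)).
have nv : \forall u \near (0 : 'rV[R]_m), `|lsubmx (bt (act (gexp u) x))| < eta /\ `|u| < del.
  apply: filterI.
    apply: (near_norm_lt (f := fun u => lsubmx (bt (act (gexp u) x)))).
      exact: (continuous_comp sa sb).
    by rewrite ge0 act_fun1 btx lsub0 normr0.
  by apply: (near_norm_lt (f := id)); [exact: cvg_id|rewrite normr0].
have cl : {for 1%g, continuous glog} by exact: smooth_at_continuous (glog_smooth hM Ae e1).
have nl : \forall a \near (1%g : G), `|lsubmx (bt (act (gexp (glog a)) x))| < eta /\ `|glog a| < del.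
  by apply: (@near_comp _ _ glog (fun u => `|lsubmx (bt (act (gexp u) x))| < eta /\ `|u| < del) _ cl); rewrite glog1.
apply: filterS (filterI nl (near_glog ltr01)) => a [[vs ad] [ea _]].
rewrite (glogK hM Ae ea) in vs.
exists (lsubmx (bt (act a x))) => //.
have [_ Na ra] := H _ _ ad dx; rewrite (glogK hM Ae ea) in Na ra.
have [_] := bx_bt bx Na; rewrite /box_inv ra btx rsub0 sig0 => E.
by rewrite -xK /isotropy /= act_funM -[X in act _ X]E -act_funM mulVg act_fun1.
Qed.

(* Strict differentiability at the origin of (v, b) |-> first box coordinates of gexp(vP) bi(b). *)
Lemma orbit_injective : exists2 del : R, 0 < del & forall v y, `|v| < del -> d x y < del ->
  act (gexp (v *m P)) y = y -> v = 0.
Proof.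
pose Psi (q : 'rV[R]_(r + (r + k))) := lsubmx (bt (act (gexp (lsubmx q *m P)) (bi (rsubmx q)))).
have rho0 := bx_rho bx; have sg0 := gexp_smooth0 hM Ae e1.
have bi0 : bi 0 = x by have [_] := bx_bt bx Nx; rewrite btx.
have a0 : act (gexp (lsubmx (0 : 'rV[R]_(r + (r + k))) *m P)) (bi (rsubmx (0 : 'rV[R]_(r + (r + k))))) = x.
  by rewrite !linear0 mul0mx ge0 act_fun1.
have sbi0 : smooth_at (eu (r + k)) AM bi 0 by apply: (bx_sbi bx); rewrite normr0.
have sPsi : smooth_at (eu (r + (r + k))) (eu r) Psi 0.
  have sl : smooth_at (eu (r + (r + k))) (eu m) (fun q : 'rV[R]_(r + (r + k)) => lsubmx q *m P) 0.
    exact: (smooth_at_comp cE cE cE (eucl_chart _) (@smooth_at_lsub R r (r + k) 0) (@smooth_at_mul R _ _ P _)).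
  have sr : smooth_at (eu (r + (r + k))) AM (fun q : 'rV[R]_(r + (r + k)) => bi (rsubmx q)) 0.
    apply: (smooth_at_comp cE cE cM (eucl_chart _) (@smooth_at_rsub R r (r + k) 0)).
    by rewrite linear0.
  have sa : smooth_at (eu (r + (r + k))) AM (fun q : 'rV[R]_(r + (r + k)) => act (gexp (lsubmx q *m P)) (bi (rsubmx q))) 0.
    apply: (smooth_at_act hM cE _ sr); apply: (smooth_at_gexp hM cE _ sl).
    rewrite linear0 mul0mx; exact: sg0.
  have sb : smooth_at AM (eu (r + k)) bt (act (gexp (lsubmx (0 : 'rV[R]_(r + (r + k))) *m P)) (bi (rsubmx (0 : 'rV[R]_(r + (r + k)))))).
    by rewrite a0; exact: (bx_sbt bx Nx).
  have sab := smooth_at_comp cE cM cE (coverM hM _) sa sb.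
  exact: (smooth_at_comp cE cE cE (eucl_chart _) sab (@smooth_at_lsub R r k _)).
have [U [oU U0 sU]] := smooth_on_at sPsi.
(* With precision 1/2, equal values of [Psi] at [(v, b)] and [(0, b)] force [|v| <= |v| / 2]. *)
have half : (0 : R) < 1 / 2 by lra.
have [del del0 H] := C1_strict oU (sU 1%N) U0 half.
have Jv (v : 'rV[R]_r) : row_mx v 0 *m jacobian Psi 0 = v.
  pose iv (v : 'rV[R]_r) : 'rV[R]_(r + (r + k)) := v *m row_mx 1%:M 0.
  have ivE v' : iv v' = row_mx v' 0 by rewrite /iv mul_mx_row mulmx1 mulmx0.
  have iv0 : iv 0 = 0 by rewrite /iv mul0mx.
  have div := smooth_at_diff (@smooth_at_mul R _ _ (row_mx 1%:M 0 : 'M[R]_(r, r + (r + k))) 0).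
  have dP : differentiable Psi (iv 0) by rewrite iv0; exact: smooth_at_diff sPsi.
  have E : {near (0 : 'rV[R]_r), Psi \o iv =1 id}.
    have nr : \forall v \near (0 : 'rV[R]_r), `|v| < rho.
      by apply: (near_norm_lt (f := id)); [exact: cvg_id|rewrite normr0].
    apply: filterS nr => v' vr; rewrite /= ivE /Psi row_mxKl row_mxKr bi0 -sig0.
    have br : `|row_mx v' (0 : 'rV[R]_k)| < rho by apply/norm_row_mxl => //; rewrite normr0.
    rewrite -box_inv_row; have [_ ->] := bx_bi bx br; exact: row_mxKl.
  have := jacobian_near_eq E (differentiable_comp div dP) (smooth_at_diff (smooth_at_eid _)).
  rewrite (jacobian_comp div dP) jacobian_mul jacobian_id mul0mx => /(congr1 (mulmx v)).
  by rewrite mulmx1 mulmxA mul_mx_row mulmx1 mulmx0.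
have cb : {for x, continuous bt} by exact: smooth_at_continuous (bx_sbt bx Nx).
have nb : \forall y \near x, N y /\ `|bt y| < del.
  have n1 : nbhs x N by apply: open_nbhs_nbhs; split; [exact: bx_open bx|exact: Nx].
  by apply: filterI => //; apply: (near_norm_lt cb); rewrite btx normr0.
have [d1 d10 H1] := dist_nbhs atA metA hauA conA nb.
exists (Num.min del d1); first by rewrite lt_min del0.
move=> v y; rewrite !lt_min => /andP[vd _] /andP[_ /H1[Ny by_]] E.
have n1 : `|row_mx v (bt y) - 0| < del by rewrite subr0; apply/norm_row_mxl.
have n2 : `|row_mx (0 : 'rV[R]_r) (bt y) - 0| < del by rewrite subr0; apply/norm_row_mxl => //; rewrite normr0.
have := H _ _ n1 n2.
have [_ biy] := bx_bt bx Ny.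
have -> : Psi (row_mx v (bt y)) = Psi (row_mx 0 (bt y)).
  by rewrite /Psi !row_mxKl !row_mxKr biy mul0mx ge0 act_fun1 E.
have -> : row_mx v (bt y) - row_mx 0 (bt y) = row_mx v 0 by rewrite opp_row_mx add_row_mx subr0 subrr.
rewrite Jv subrr sub0r normrN => h.
have vn : `|row_mx v (0 : 'rV[R]_(r + k))| <= `|v|.
  apply/rV_normP => // j; rewrite row_mx_coord; case: (fintype.split j) => l; first exact: rV_norm_coord.
  by rewrite mxE normr0.
have v0 : `|v| <= 0 by lra.
by apply/eqP; rewrite -normr_eq0 eq_le v0 normr_ge0.
Qed.

(** An element [a] fixing [y] is, by [near_isotropy] and [box_decomposition], some [gexp (v *m P)]
    times two elements of [K]. These fix [y] by hypothesis, so [gexp (v *m P)] does too, and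
    [orbit_injective] gives [v = 0]. *)
Lemma fixed_isotropy : exists2 del : R, 0 < del & forall y, d x y < del -> K `<=` isotropy act y ->
  isotropy act y = K.
Proof.
have [d1 d10 H1] := orbit_injective.
have nW := box_decomposition d10.
have [d2 d20 H2] := near_isotropy x nW.
exists (Num.min d1 d2); first by rewrite lt_min d10.
move=> y; rewrite lt_min => /andP[y1 y2] sub.
apply/seteqP; split=> // a ay.
have [|u [v vd Ku] Kua] := H2 y a y2; first by have -> : act a y = y by [].
rewrite xK in Kua.
have uy : act u y = y.
  have := sub _ Kua; rewrite /isotropy /= act_funM => /(congr1 (act u)).
  by rewrite -act_funM mulgV act_fun1 => <-; exact: ay.
have vy : act (gexp (v *m P)) y = y.
  have := sub _ Ku; rewrite /isotropy /= act_funM uy => /(congr1 (act (gexp (v *m P)))).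
  by rewrite -act_funM mulgV act_fun1.
have v0 := H1 v y vd y1 vy.
move: Ku; rewrite v0 mul0mx ge0 invg1 mul1g => Ku.
have -> : a = (u * (u^-1 * a))%g by rewrite mulgA mulgV mul1g.
by rewrite -xK; apply: isotropyM; rewrite xK.
Qed.

Lemma nearest_isotropy : exists2 del : R, 0 < del & forall y, d x y < del ->
  exists b, d x (act b y) <= d x y /\ isotropy act (act b y) = K.
Proof.
have [del del0 H] := fixed_isotropy; exists del => // y yd.
have [b [le sub]] := nearest_fixed y; exists b; split=> //.
by apply: H => //; exact: le_lt_trans yd.
Qed.

(** [rsub_box_act] concerns only small group elements. After replacing [y] by a translate near [x]
    with isotropy exactly [K], any element that keeps it near [x] is a small one times an element of
    [K], and the latter has no effect. *)
Lemma rsub_box_orbit : exists2 del : R, 0 < del & forall y a, d x y < del -> d x (act a y) < del ->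
  [/\ N y, N (act a y) & rsubmx (bt (act a y)) = rsubmx (bt y)].
Proof.
have [d1 d10 H1] := nearest_isotropy.
have [d2 d20 H2] := rsub_box_act hM Ae e1 rank_le Ac bx Nx.
have [d3 d30 H3] := near_isotropy x (near_glog d20).
pose del := Num.min d1 (Num.min d2 d3).
have del0 : 0 < del by rewrite !lt_min d10 d20.
have key y' a : d x y' < del -> d x (act a y') < del -> isotropy act y' = K ->
    N (act a y') /\ rsubmx (bt (act a y')) = rsubmx (bt y').
  rewrite !lt_min => /andP[_ /andP[y2 y3]] /andP[_ /andP[_ a3]] y'K.
  have [u [eu_ ud] Ku] := H3 y' a y3 a3; rewrite xK -y'K in Ku.
  have -> : act a y' = act (gexp (glog u)) y'.
    rewrite (glogK hM Ae eu_).
    have {1}-> : a = (u * (u^-1 * a))%g by rewrite mulgA mulgV mul1g.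
    rewrite act_funM.
    by have -> : act (u^-1 * a)%g y' = y' by [].
  by have [] := H2 _ _ ud y2.
exists del => // y a yd ad.
have [b [le bK]] := H1 y (lt_le_trans yd (minl_le _ _)).
have y'd := le_lt_trans le yd.
have Ey : act b^-1%g (act b y) = y by rewrite -act_funM mulVg act_fun1.
have Ea : act (a * b^-1)%g (act b y) = act a y by rewrite act_funM Ey.
have [N1 r1] : N y /\ rsubmx (bt y) = rsubmx (bt (act b y)).
  by have := key _ b^-1%g y'd; rewrite Ey => /(_ yd bK).
have [N2 r2] : N (act a y) /\ rsubmx (bt (act a y)) = rsubmx (bt (act b y)).
  by have := key _ (a * b^-1)%g y'd; rewrite Ea => /(_ ad bK).
by split; rewrite // r1.
Qed.

End Box.
End NearRegular.

(** * Countability and separation for subspaces and images *)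

Section Countability.

Lemma second_countable_sub (T X : topologicalType) (f : T -> X) (S : set X) : @second_countable T ->
  continuous f -> (forall O, open O -> open (f @` O)) -> (forall p, S p -> exists x, f x = p) -> @second_countable S.
Proof.
move=> [B cB [oB bB]] cf of_ Sf.
exists ((fun U : set T => set_val @^-1` (f @` U)) @` B).
  by apply: card_le_trans (card_image_le _ _) cB.
split=> [_ [U BU <-]|p W]; first by exists (f @` U) => //; apply: of_; exact: oB.
move=> [V [[D oD DV] Vp VW]].
have [x fx] := Sf _ (set_valP p).
have Ox : D (f x) by rewrite fx; move: Vp; rewrite -DV.
have nx : nbhs x (f @^-1` D) by apply: cf; exact: open_nbhs_nbhs.
have [U [BU Ux] UO] := bB x _ nx.
exists (set_val @^-1` (f @` U)); first by split; [exists U|exists x].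
move=> q [y Uy fy]; apply: VW; rewrite -DV /= -fy; exact: UO.
Qed.

Lemma set_val_open (T : topologicalType) (O : set [set: T]) : open O -> open (set_val @` O).
Proof.
move=> [A oA <-]; rewrite (_ : _ @` _ = A) //.
apply/seteqP; split=> [_ [u Au <-]|y Ay]; first exact: Au.
by exists (SigSub (mem_set (I : [set: T] y))).
Qed.

Lemma set_val_continuous (T : topologicalType) (S : set T) : continuous (set_val : S -> T).
Proof. by move=> x; exact: initial_continuous. Qed.

Lemma continuous_to_sub (X T : topologicalType) (S : set T) (f : X -> S) x :
  {for x, continuous (set_val \o f)} -> {for x, continuous f}.
Proof.
move=> cf W [V [[D oD <-] Vx VW]]; have nO : nbhs (set_val (f x)) D by exact: open_nbhs_nbhs.
have nD : \forall y \near x, D (set_val (f y)) by exact: (cf D nO).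
suff : \forall y \near x, W (f y) by [].
by apply: filterS nD => y Dy; exact: VW.
Qed.

Lemma hausdorff_sep (T : topologicalType) (x y : T) : hausdorff_space T -> x <> y ->
  exists U V, [/\ open U, open V, U x, V y & U `&` V = set0].
Proof.
rewrite open_hausdorff => H /eqP/H[[U V] /= [xU yV] [oU oV /eqP UV]].
by exists U, V; split=> //; apply: set_mem.
Qed.

End Countability.

Lemma openX (T T' : topologicalType) (U : set T) (V : set T') : open U -> open V -> open (U `*` V).
Proof.
by move=> oU oV; apply: openI; apply: open_comp => // x _; [exact: cvg_fst|exact: cvg_snd].
Qed.

(** * Projections of a product manifold *)

Section ProductProjections.
Context {R : realType} {T T' : topologicalType} {n n' : nat} {A : set (chart R T n)} {A' : set (chart R T' n')}.
Variables (S : set T) (S' : set T').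
Hypothesis aA : atlas_on S A.
Hypothesis aA' : atlas_on S' A'.

Lemma smooth_at_fst p : S p.1 -> S' p.2 -> smooth_at (prod_atlas A A') A fst p.
Proof.
move=> Sp Sp'; have [oS cA _ tA] := aA; have [oS' cA' _ _] := aA'.
exists (S `*` S'); split=> //; first by apply: openX.
split=> [q _|_ d [c Ac [c' Ac' <-]] Ad]; first exact: cvg_fst.
apply/smooth_euclP; apply: smooth_at_map.
- apply: (chart_open_image (charts_prod cA cA' (ex_intro2 _ _ c Ac (ex_intro2 _ _ c' Ac' erefl)))).
    apply: openI; last by apply: open_comp (fun q _ => cvg_fst) _; have [] := cA d Ad.
    apply: openI; last exact: openX.
    by apply: openX; [have [] := cA c Ac|have [] := cA' c' Ac'].
  by move=> q [[]].
move=> _ [[x y] [[[/= cx cy] _] dx] <-]; have [oc oi Kc _ _] := cA c Ac; have [od _ _ _ _] := cA d Ad.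
have sl := @smooth_at_lsub R n n' (row_mx (cto c x) (cto c' y)).
have st : smooth_at (@eucl R n) (@eucl R n) (cto d \o cinv c) (lsubmx (row_mx (cto c x) (cto c' y))).
  rewrite row_mxKl; apply: (smooth_at_on _ _ (tA c d Ac Ad)); last by exists x.
  by apply: (chart_open_image (cA c Ac)); [exact: openI|move=> ? []].
exact: (smooth_at_comp (@charts_eucl R _) (@charts_eucl R _) (@charts_eucl R _) (eucl_chart _) sl st).
Qed.

Lemma smooth_at_snd p : S p.1 -> S' p.2 -> smooth_at (prod_atlas A A') A' snd p.
Proof.
move=> Sp Sp'; have [oS cA _ _] := aA; have [oS' cA' _ tA'] := aA'.
exists (S `*` S'); split=> //; first by apply: openX.
split=> [q _|_ d [c Ac [c' Ac' <-]] Ad]; first exact: cvg_snd.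
apply/smooth_euclP; apply: smooth_at_map.
- apply: (chart_open_image (charts_prod cA cA' (ex_intro2 _ _ c Ac (ex_intro2 _ _ c' Ac' erefl)))).
    apply: openI; last by apply: open_comp (fun q _ => cvg_snd) _; have [] := cA' d Ad.
    apply: openI; last exact: openX.
    by apply: openX; [have [] := cA c Ac|have [] := cA' c' Ac'].
  by move=> q [[]].
move=> _ [[x y] [[[/= cx cy] _] dy] <-]; have [oc oi Kc _ _] := cA' c' Ac'; have [od _ _ _ _] := cA' d Ad.
have sl := @smooth_at_rsub R n n' (row_mx (cto c x) (cto c' y)).
have st : smooth_at (@eucl R n') (@eucl R n') (cto d \o cinv c') (rsubmx (row_mx (cto c x) (cto c' y))).
  rewrite row_mxKr; apply: (smooth_at_on _ _ (tA' c' d Ac' Ad)); last by exists y.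
  by apply: (chart_open_image (cA' c' Ac')); [exact: openI|move=> ? []].
exact: (smooth_at_comp (@charts_eucl R _) (@charts_eucl R _) (@charts_eucl R _) (eucl_chart _) sl st).
Qed.

End ProductProjections.

(** * Charts of the orbit space *)

Section QuotientAtlas.
Context {R : realType} {n m k : nat} {M : topologicalType} {G : preTopologicalGroupType}
  {AM : set (chart R M n)} {g : gram R M n} {AG : set (chart R G m)} {act : group_action G M}.
Hypothesis hM : complete_riemannian_G_manifold AM g AG act.
Local Notation cM := (charts_M hM).
Local Notation cE := (@charts_eucl R _).
Local Notation eu k := (@eucl R k%N).
Local Notation d := (@riemannian_dist R M n AM g).
Local Notation proj := (orbit_proj act).
Local Notation atA := (gm_atlas hM).
Local Notation metA := (GM_metric hM).
Local Notation conA := (GM_connected hM).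
Local Notation hauA := (gm_hausdorff hM).

Lemma proj_continuous : continuous proj.
Proof. exact: pi_continuous. Qed.

Lemma proj_act a y : proj (act a y) = proj y.
Proof. by apply/esym/proj_eqP; exists a. Qed.

Lemma proj_open (O : set M) : open O -> open (proj @` O).
Proof.
move=> oO; suff oP : open (proj @^-1` (proj @` O)) by exact: oP.
rewrite (_ : _ @^-1` _ = \bigcup_(a in [set: G]) act a @^-1` O).
  by apply: bigcup_open => a _; apply: open_comp oO => y _; exact: (act_continuous hM).
apply/seteqP; split=> [y [z Oz /esym/proj_eqP[a ay]]|y [a _ Oay]].
  by exists a; rewrite //= ay.
by exists (act a y) => //; exact: proj_act.
Qed.

(* The charts of the open subset S of M/G whose coordinates pull back to smooth functions on M
   and whose inverses lift locally to smooth maps into M. *)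
Definition quot_atlas (S : set (orbit_space act)) : set (chart R (orbit_space act) k) :=
  [set q | [/\ is_chart q, cdom q `<=` S,
    forall y, cdom q (proj y) -> smooth_at AM (eu k) (fun z => cto q (proj z)) y &
    forall w, (cto q @` cdom q) w -> exists2 sigma, smooth_at (eu k) AM sigma w &
      \forall w' \near w, proj (sigma w') = cinv q w']].

Variable S : set (orbit_space act).
Hypothesis oS : open S.
Local Notation A := (quot_atlas S).

Lemma charts_quot : charts A. Proof. by move=> q []. Qed.

Lemma quot_transition q q' : A q -> A q' ->
  smooth_on (cto q @` (cdom q `&` cdom q')) (cto q' \o cinv q).
Proof.
move=> [iq _ _ Hq] [iq' _ Hq' _]; have [oq oi Kq _ ciq] := iq; have [oq' _ _ _ _] := iq'.
apply/smooth_euclP; apply: smooth_at_map.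
  by apply: (chart_open_image iq); [exact: openI|move=> ? []].
move=> _ [p [qp q'p] <-].
have [|sigma ss Hs] := Hq (cto q p); first by exists p.
have E := nbhs_singleton Hs; rewrite /= Kq // in E.
have sc : smooth_at AM (eu k) (fun z => cto q' (proj z)) (sigma (cto q p)) by apply: Hq'; rewrite E.
have scs := smooth_at_comp cE cM cE (coverM hM _) ss sc.
apply: (smooth_at_eq cE cE _ scs).
by apply: filterS Hs => w' Ew; rewrite /= Ew.
Qed.

Lemma smooth_proj : smooth_map AM (proj @^-1` S) A proj.
Proof.
split=> [y _|c q Ac [iq qS Hq _]]; first exact: proj_continuous.
have [oc _ Kc _ _] := cM Ac; have [oq _ _ _ _] := iq.
apply/smooth_euclP; apply: smooth_at_map.
  apply: (chart_open_image (cM Ac)); last by move=> ? [[]].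
  apply: openI; last by apply: open_comp oq => y _; exact: proj_continuous.
  by apply: openI => //; apply: open_comp oS => y _; exact: proj_continuous.
move=> _ [y [[cy _] qy] <-].
have iy : (cto c @` cdom c) (cto c y) by exists y.
have sci := smooth_at_cinv cM (gm_atlas hM) Ac iy.
have sq : smooth_at AM (eu k) (fun z => cto q (proj z)) (cinv c (cto c y)) by rewrite Kc //; exact: Hq.
exact: (smooth_at_comp cE cM cE (coverM hM _) sci sq).
Qed.

Lemma quot_manifold : (forall p, S p -> exists2 q, A q & cdom q p) -> manifold_on S A.
Proof.
move=> cov; split.
- apply: hausdorff_sub => p q _ _ pq.
  have [x px] := proj_surj p; have [y qy yd] := nearest_orbit_dist hM x q.
  have dne : d x y != 0.
    by apply/eqP => /(dist_eq0 atA metA hauA conA) xy; apply: pq; rewrite -px -qy xy.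
  have d0 : 0 < d x y by rewrite lt_neqAle eq_sym dne (dist_ge0 atA metA conA).
  have dcont z := dist_continuous_r atA metA conA (x := z).
  pose B z := [set z' | d z z' < d x y / 2].
  have oB z : open (B z) by apply: open_comp (@open_lt _ _) => z' _; exact: dcont.
  (* [y] is nearest to [x] in its orbit. An orbit meeting both balls of half that distance would
     bring some point of the orbit of [y] closer to [x]. *)
  exists (proj @` B x), (proj @` B y); split; [exact: proj_open|exact: proj_open| | |].
  + by exists x; rewrite // /B /= (distxx atA metA conA) divr_gt0.
  + by exists y; rewrite // /B /= (distxx atA metA conA) divr_gt0.
  apply/seteqP; split=> // _ [[z1 Bz1 <-] [z2 Bz2 /proj_eqP[a az]]].
  have h1 := orbit_dist_le hM x (act a y).
  rewrite proj_act qy yd in h1.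
  have h2 := dist_tri atA metA conA z1 x (act a y).
  have h3 : d z1 (act a y) = d z2 y by rewrite -az (dist_act hM).
  have h4 := distC atA metA conA z2 y.
  by move: Bz1 Bz2; rewrite /B /=; lra.
- have [_ sc _] := GM_manifold hM.
  apply: (second_countable_sub (f := proj \o (set_val : [set: M] -> M)) sc).
  + move=> x; apply: continuous_comp; [exact: set_val_continuous|exact: proj_continuous].
  + by move=> O oO; rewrite -image_comp; apply: proj_open; exact: set_val_open.
  + by move=> p _; have [x <-] := proj_surj p; exists (SigSub (mem_set (I : [set: M] x))).
- split=> //.
  + by move=> q [].
  + apply/seteqP; split=> [p [q [_ qS _ _] qp]|p /cov[q Aq qp]]; [exact: qS|by exists q].
  + exact: quot_transition.
Qed.

End QuotientAtlas.

(** * Charts on the regular part; its openness and density *)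

Section RegularCharts.
Context {R : realType} {r k m : nat} {M : topologicalType} {G : preTopologicalGroupType}
  {AM : set (chart R M (r + k)%N)} {g : gram R M (r + k)%N} {AG : set (chart R G m)} {act : group_action G M}.
Hypothesis hM : complete_riemannian_G_manifold AM g AG act.
Variable e : chart R G m.
Hypothesis Ae : AG e.
Hypothesis e1 : cdom e 1%g.
Local Notation cM := (charts_M hM).
Local Notation cE := (@charts_eucl R _).
Local Notation eu k := (@eucl R k%N).
Local Notation J := (@orbit_jac R (r + k)%N m M G act e).
Local Notation d := (@riemannian_dist R M (r + k)%N AM g).
Local Notation proj := (orbit_proj act).
Local Notation atA := (gm_atlas hM).
Local Notation metA := (GM_metric hM).
Local Notation conA := (GM_connected hM).
Local Notation hauA := (gm_hausdorff hM).
Variable K : set G.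
Hypothesis Kmin : forall z, isotropy act z `<=` K -> K `<=` isotropy act z.
Hypothesis rank_le : forall c y, AM c -> cdom c y -> (\rank (J c y) <= r)%N.
Local Notation reg := (orbits_of_type act K).
Local Notation A := (@quot_atlas R (r + k)%N k M G AM act reg).

Section BoxChart.
Variables (x : M) (c : chart R M (r + k)) (P : 'M[R]_(r, m)) (sigma : 'rV[R]_k -> M)
  (rho : R) (N : set M) (bt : M -> 'rV[R]_(r + k)).
Hypothesis xK : isotropy act x = K.
Hypothesis Ac : AM c.
Hypothesis bx : @box R r k m M G AM AG act e c P sigma rho N bt.
Hypothesis Nx : N x.
Hypothesis btx : bt x = 0.
Local Notation bi := (@box_inv R r k m M G act e P sigma).

(** The transverse box coordinate descends to orbits, with [proj \o sigma] as inverse. The bound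
    [eps] on the coordinates will keep the chart where a section has good isotropy groups. *)
Lemma box_quot_chart (eps : R) : 0 < eps -> exists q, [/\ A q, cdom q (proj x), cto q (proj x) = 0,
  forall p, cdom q p -> `|cto q p| < eps & cinv q = proj \o sigma].
Proof.
move=> eps0.
have [d1 d10 H1] := nearest_isotropy hM Ae e1 Kmin xK rank_le Ac bx Nx btx.
have [d2 d20 H2] := rsub_box_orbit hM Ae e1 Kmin xK rank_le Ac bx Nx btx.
pose del := Num.min d1 d2.
have del0 : 0 < del by rewrite lt_min d10.
(* Close enough to [x] for the last coordinates to be constant on orbits and for every orbit to
   contain a point of isotropy [K]. *)
pose N' := [set y | [/\ N y, d x y < del & `|bt y| < eps]].
have nN' y : N' y -> \forall z \near y, N' z.
  move=> [Ny yd yb]; have n1 : nbhs y N by apply: open_nbhs_nbhs; split=> //; exact: bx_open bx.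
  have n2 : \forall z \near y, d x z < del.
    apply: (@near_comp _ _ (d x) (fun v => v < del) _ (@dist_continuous_r _ _ _ _ _ atA metA conA x y)).
    by apply: open_nbhs_nbhs; split=> //; exact: open_lt.
  have n3 : \forall z \near y, `|bt z| < eps := near_norm_lt (smooth_at_continuous (bx_sbt bx Ny)) yb.
  by apply: filterS (filterI n1 (filterI n2 n3)) => z [? [? ?]].
have oN' : open N' by rewrite openE => y /nN'.
have N'x : N' x by split; rewrite // ?btx ?normr0 // (distxx atA metA conA).
(* Any representative in [N'] gives the same value, by [rsub_box_orbit]; the default 0 is taken only
   outside the domain. *)
pose ct p := xget 0 [set s | exists y, [/\ N' y, proj y = p & s = rsubmx (bt y)]].
have ctE y : N' y -> ct (proj y) = rsubmx (bt y).
  move=> N'y; rewrite /ct; case: xgetP => [s _ [z [N'z /esym/proj_eqP[a az] ->]]|/(_ (rsubmx (bt y)))].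
    have [_ yd _] := N'y; have [_ zd _] := N'z.
    have [|_ _ <-] := H2 y a (lt_le_trans yd (minr_le _ _)); last by rewrite az.
    by rewrite az; exact: lt_le_trans zd (minr_le _ _).
  by case; exists y.
have rs y : N' y -> `|rsubmx (bt y)| < rho /\ `|rsubmx (bt y)| < eps.
  move=> [Ny _ yb]; have [br _] := bx_bt bx Ny; move: br yb; rewrite -{1 2}[bt y]hsubmxK.
  move=> /norm_row_mxl[|_ h1]; first exact: bx_rho bx.
  by move=> /norm_row_mxl[|_ h2].
have projE y : N' y -> proj (sigma (rsubmx (bt y))) = proj y.
  by move=> [Ny _ _]; have [_ E] := bx_bt bx Ny; rewrite -{2}E /box_inv proj_act.
pose q : chart R (orbit_space act) k := Chart (proj @` N') ct (proj \o sigma).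
have oq : open (cdom q) by exact: (proj_open hM).
have Kq p : cdom q p -> cinv q (cto q p) = p.
  by move=> [y N'y <-]; rewrite /= ctE //; exact: projE.
have iq : is_chart q.
  split=> //.
  - rewrite openE => _ [_ [y N'y <-] <-] /=; rewrite ctE //.
    have [Ny _ _] := N'y; have [br E] := bx_bt bx Ny.
    have sb := bx_sbi bx br.
    pose ln (s : 'rV[R]_k) := row_mx (lsubmx (bt y)) s.
    have cl : {for rsubmx (bt y), continuous ln}.
      apply: (@smooth_at_continuous _ _ _ _ _ (eu k) (eu (r + k))).
      apply: (smooth_at_row cE); first exact: smooth_at_cst.
      exact: smooth_at_eid.
    have El : ln (rsubmx (bt y)) = bt y by rewrite /ln hsubmxK.
    have cb : {for ln (rsubmx (bt y)), continuous bi} by rewrite El; exact: smooth_at_continuous sb.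
    have n1 : \forall s \near rsubmx (bt y), N' (bi (ln s)).
      by apply: (near_comp (continuous_comp cl cb)); rewrite /= El E; exact: nN'.
    have n2 : \forall s \near rsubmx (bt y), `|ln s| < rho by apply: (near_norm_lt cl); rewrite El.
    apply: filterS (filterI n1 n2) => s [Ns sr].
    exists (proj (bi (ln s))); first by exists (bi (ln s)).
    by rewrite ctE //; have [_ ->] := bx_bi bx sr; rewrite /ln row_mxKr.
  - move=> _ [y N'y <-] O; rewrite /= ctE // => nO.
    have [Ny _ _] := N'y.
    have sr := smooth_at_comp cM cE cE (eucl_chart _) (bx_sbt bx Ny) (@smooth_at_rsub R r k _).
    have n1 : \forall z \near y, O (rsubmx (bt z)) by exact: (smooth_at_continuous sr nO).
    have : nbhs y (N' `&` [set z | O (rsubmx (bt z))]) by apply: filterI => //; exact: nN'.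
    rewrite nbhsE => -[V [oV Vy] VN].
    have nV : nbhs (proj y) (proj @` V) by apply: open_nbhs_nbhs; split; [exact: (proj_open hM)|exists y].
    suff : \forall p \near proj y, O (ct p) by [].
    by apply: filterS nV => _ [z /VN[N'z Oz] <-]; rewrite ctE.
  - move=> _ [y N'y <-]; rewrite /= ctE //; have [sr _] := rs y N'y.
    have cs := smooth_at_continuous (bx_sig bx sr).
    by apply: (continuous_comp cs); exact: proj_continuous.
exists q; split=> //.
- split=> //.
  + move=> _ [y [_ yd _] <-]; have [b [_ bK]] := H1 y (lt_le_trans yd (minl_le _ _)).
    exists (act b y); last exact: (proj_act).
    by rewrite /= bK; exact: conjugate_refl.
  + move=> y [y1 N'y1 /esym/proj_eqP[b by1]]; have [Ny1 _ _] := N'y1.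
    have sa : smooth_at AM AM (fun z => act b z) y.
      by apply: (smooth_at_act hM cM); [exact: smooth_at_cst|exact: (smooth_at_id (gm_atlas hM) I)].
    have sb : smooth_at AM (eu (r + k)) bt (act b y) by rewrite by1; exact: (bx_sbt bx Ny1).
    have sr := smooth_at_comp cM cM cE (coverM hM _) sa (smooth_at_comp cM cE cE (eucl_chart _) sb (@smooth_at_rsub R r k _)).
    apply: (smooth_at_eq cM cE _ sr).
    have nb : \forall z \near y, N' (act b z).
      by apply: (near_comp (smooth_at_continuous sa)); rewrite by1; exact: nN'.
    by apply: filterS nb => z N'z; rewrite /= -(proj_act b z) ctE.
  + move=> _ [_ [y N'y <-] <-]; exists sigma; last by near=> w'.
    by rewrite /= ctE //; have [sr _] := rs y N'y; exact: (bx_sig bx sr).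
- by exists x.
- by rewrite /= ctE // btx rsub0.
- by move=> _ [y N'y <-]; rewrite /= ctE //; have [] := rs y N'y.
Unshelve. all: by end_near.
Qed.

End BoxChart.

Lemma regular_representative p : reg p -> exists2 x, proj x = p & isotropy act x = K.
Proof.
move=> [y [a ya] yp]; exists (act a^-1%g y); first by rewrite (proj_act).
by rewrite isotropy_conjg.
Qed.

Variables (z : M) (cz : chart R M (r + k)%N).
Hypothesis Acz : AM cz.
Hypothesis czz : cdom cz z.
Hypothesis rkz : \rank (J cz z) = r.
Hypothesis zK : isotropy act z = K.

(** Points with the same isotropy group have the same kernel of the infinitesimal action, hence the
    same rank as [z]. *)
Lemma regular_rank x c : AM c -> cdom c x -> isotropy act x = K -> \rank (J c x) = r.
Proof.
move=> Ac cx xK; apply/eqP; rewrite eqn_leq rank_le //=.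
apply: (leq_trans (eq_leq (esym rkz))); apply: rank_le_ker => v.
by apply: (kernel_sub hM Ae e1 Acz czz Ac cx); rewrite xK zK.
Qed.

Lemma regular_box x : isotropy act x = K -> exists c P sigma rho N bt,
  [/\ AM c, @box R r k m M G AM AG act e c P sigma rho N bt, N x & bt x = 0].
Proof.
move=> xK; have [c Ac cx] := coverM hM x.
have rkx := regular_rank Ac cx xK.
have [P [Q uPQ]] := complete_rows rkx.
have [ss s0 sJ] := affine_section hM Ac cx Q; rewrite -sJ in uPQ.
have [rho [N [bt [bx Nx bx0]]]] := box_exists hM Ae e1 Ac cx ss s0 uPQ.
by exists c, P, (fun s => cinv c (s *m Q + cto c x)), rho, N, bt; split.
Qed.

Lemma regular_chart p : reg p -> exists2 q, A q & cdom q p.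
Proof.
move=> /regular_representative[x <- xK].
have [c [P [sigma [rho [N [bt [Ac bx Nx bx0]]]]]]] := regular_box xK.
have [q [Aq qx _ _ _]] := box_quot_chart xK Ac bx Nx bx0 ltr01.
by exists q.
Qed.

Lemma regular_open : open reg.
Proof.
rewrite openE => p /regular_chart[q [[oq _ _ _ _] qS _ _] qp].
have nq : nbhs p (cdom q) by exact: open_nbhs_nbhs.
exact: filterS nq.
Qed.

Lemma regular_le : reg = orbits_le act K.
Proof.
have [_ H] : minimal_orbit_type act K.
  by rewrite -zK; apply: minimal_typeP => z' s; rewrite zK in s *; exact: Kmin.
apply/seteqP; split=> _ [y Ky <-]; exists y => //; first exact: conjugate_sub.
exact: H.
Qed.

Lemma regular_dense : dense reg.
Proof.
move=> O [p Op] oO; have [y yp] := proj_surj p.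
have nO : nbhs y (proj @^-1` O).
  by apply: (@proj_continuous M G act y); apply: open_nbhs_nbhs; rewrite yp.
have [eps eps0 HO] := dist_nbhs atA metA hauA conA nO.
have [w [yw _ wK]] := lower_type hM y z eps0.
exists (proj w); split; first exact: HO.
by rewrite regular_le; exists w; rewrite //= -zK.
Qed.

Lemma regular_manifold : manifold_on reg A.
Proof. by apply: (quot_manifold hM) => //; [exact: regular_open|exact: regular_chart]. Qed.

End RegularCharts.

(** * The invariant mean on a compact group *)

Section InvariantMean.
Context {R : realType} {n m : nat} {M : topologicalType} {G : preTopologicalGroupType}
  {AM : set (chart R M n)} {g : gram R M n} {AG : set (chart R G m)} {act : group_action G M}.
Hypothesis hM : complete_riemannian_G_manifold AM g AG act.
Variable K : set G.
Hypothesis cK : compact K.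
Hypothesis sK : subgroup K.

Let K1 : K 1%g. Proof. by case: sK. Qed.
Let KM a b : K a -> K b -> K (a * b)%g. Proof. by case: sK => _ + _; apply. Qed.
Let KV a : K a -> K a^-1%g. Proof. by case: sK => _ _; apply. Qed.

(** Functions live on [G], but only their restrictions to [K] matter; continuity is therefore
    relative to [K]. *)
Definition cont (phi : G -> R) := forall a, K a -> phi @ within K (nbhs a) --> phi a.

Definition wf (A : seq G) := (0 < size A)%N /\ forall b, b \in A -> K b.

Definition avg (A : seq G) (phi : G -> R) (a : G) : R := (size A)%:R^-1 * \sum_(b <- A) phi (b * a)%g.

(** Von Neumann's characterization: the mean is the constant that averages of left translates
    approach uniformly on [K]. *)
Definition is_mean (phi : G -> R) (c : R) := forall eps : R, 0 < eps ->
  exists A, wf A /\ forall a, K a -> `|avg A phi a - c| <= eps.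

Lemma near_within (T : topologicalType) (D : set T) (f : T -> G) (P : G -> Prop) t : {for t, continuous f} ->
  (forall s, D s -> K (f s)) -> (\forall a \near within K (nbhs (f t)), P a) -> \forall s \near within D (nbhs t), P (f s).
Proof.
move=> cf Df nP; have nP' : \forall a \near f t, K a -> P a by [].
have n1 : \forall s \near t, K (f s) -> P (f s) by exact: (near_comp cf nP').
by apply: filterS n1 => s Hs Ds; apply: Hs; exact: Df.
Qed.

Lemma cont_lmul b phi : K b -> cont phi -> cont (fun a => phi (b * a)%g).
Proof.
move=> Kb cp a Ka O nO; have nP : \forall a' \near within K (nbhs (b * a)%g), O (phi a') by exact: (cp _ (KM Kb Ka)).
apply: (near_within (f := fun a => (b * a)%g) _ _ nP); last by move=> s Ks; exact: KM.
exact: (continuous_lmulg hM).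
Qed.

Lemma cont_inv phi : cont phi -> cont (fun a => phi a^-1%g).
Proof.
move=> cp a Ka O nO; have nP : \forall a' \near within K (nbhs a^-1%g), O (phi a') by exact: (cp _ (KV Ka)).
apply: (near_within (f := fun a => a^-1%g) _ _ nP); last by move=> s Ks; exact: KV.
exact: (invg_continuous hM).
Qed.

Lemma cont_avg A phi : wf A -> cont phi -> cont (avg A phi).
Proof.
move=> [_ AK] cp a Ka; apply: cvgM; first exact: cvg_cst.
elim: A AK => [|b A IH] AK.
  by under eq_cvg do rewrite big_nil; rewrite big_nil; exact: cvg_cst.
under eq_cvg do rewrite big_cons; rewrite big_cons; apply: cvgD; last first.
  by apply: IH => c cA; apply: AK; rewrite in_cons cA orbT.
by apply: (cont_lmul (AK b (mem_head _ _)) cp).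
Qed.

Lemma sumr_cst (T : Type) (s : seq T) (c : R) : \sum_(b <- s) c = (size s)%:R * c.
Proof. by rewrite big_const_seq count_predT iter_addr_0 mulr_natl. Qed.

Lemma avgE A phi a c : wf A -> avg A phi a - c = (size A)%:R^-1 * \sum_(b <- A) (phi (b * a)%g - c).
Proof.
move=> [s0 _]; rewrite sumrB mulrBr; congr (_ - _).
rewrite sumr_cst mulrA mulVf ?mul1r //.
by rewrite pnatr_eq0 -lt0n.
Qed.

Lemma avg_ge A phi lo : wf A -> (forall a, K a -> lo <= phi a) -> forall a, K a -> lo <= avg A phi a.
Proof.
move=> wA H a Ka; rewrite -subr_ge0 (avgE _ _ _ wA); apply: mulr_ge0; first by rewrite invr_ge0.
rewrite big_seq; apply: sumr_ge0 => b bA; rewrite subr_ge0; apply: H; apply: KM => //; exact: wA.2.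
Qed.

Lemma avg_le A phi hi : wf A -> (forall a, K a -> phi a <= hi) -> forall a, K a -> avg A phi a <= hi.
Proof.
move=> wA H a Ka; rewrite -subr_le0 (avgE _ _ _ wA); apply: mulr_ge0_le0; first by rewrite invr_ge0.
rewrite big_seq; apply: sumr_le0 => b bA; rewrite subr_le0; apply: H; apply: KM => //; exact: wA.2.
Qed.

Lemma avg_near A phi c eps : wf A -> (forall a, K a -> `|phi a - c| <= eps) ->
  forall a, K a -> `|avg A phi a - c| <= eps.
Proof.
move=> wA H a Ka; rewrite ler_distl; apply/andP; split.
  by apply: avg_ge => // b Kb; have := H b Kb; rewrite ler_distl => /andP[].
by apply: avg_le => // b Kb; have := H b Kb; rewrite ler_distl => /andP[].
Qed.

Lemma avg_avg A B phi a : avg B (avg A phi) a = avg [seq (c * b)%g | c <- A, b <- B] phi a.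
Proof.
rewrite /avg size_allpairs natrM invfM big_allpairs_dep exchange_big /= -mulr_sumr mulrCA !mulrA.
congr (_ * _); apply: eq_bigr => b _; apply: eq_bigr => c _; by rewrite mulgA.
Qed.

Lemma wf_allpairs A B : wf A -> wf B -> wf [seq (c * b)%g | c <- A, b <- B].
Proof.
move=> [sA AK] [sB BK]; split; first by rewrite size_allpairs muln_gt0 sA.
by move=> _ /allpairsP[[c b] [/= cA bB ->]]; apply: KM; [exact: AK|exact: BK].
Qed.

(** The modulus is for right translation, which commutes with averages of left translates; so all
    averages of [phi] share it. *)
Lemma cont_modulus phi (eps : R) : cont phi -> 0 < eps -> exists V, [/\ open V, V 1%g &
  forall a v, K a -> K (a * v)%g -> V v -> `|phi (a * v)%g - phi a| <= eps].
Proof.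
move=> cp e0; have e2 : 0 < eps / 2 by rewrite divr_gt0.
have nW : \forall v \near (1%g : G), K `<=` [set a | K (a * v)%g -> `|phi (a * v)%g - phi a| <= eps].
  have H : near_covering_within K by apply/near_covering_withinP/compact_near_coveringP.
  apply: (H G (nbhs (1%g : G)) (fun v a => K (a * v)%g -> `|phi (a * v)%g - phi a| <= eps) _) => a Ka.
  have nP : \forall a' \near a, K a' -> `|phi a' - phi a| < eps / 2.
    have nPw : \forall a' \near within K (nbhs a), `|phi a' - phi a| < eps / 2.
      by have /cvgrPdistC_lt := cp a Ka; apply.
    exact: nPw.
  have cm : {for (a, 1%g : G), continuous (fun p : G * G => p.1 * p.2)%g} by exact: (mulg_continuous2 hM).
  have n1 : \forall p \near (a, 1%g : G), K (p.1 * p.2)%g -> `|phi (p.1 * p.2)%g - phi a| < eps / 2.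
    by apply: (@near_comp _ _ (fun p : G * G => p.1 * p.2)%g (fun a' => K a' -> `|phi a' - phi a| < eps / 2) _ cm); rewrite mulg1.
  have n2 : \forall p \near (a, 1%g : G), K p.1 -> `|phi p.1 - phi a| < eps / 2.
    by apply: (@near_comp _ _ fst (fun a' => K a' -> `|phi a' - phi a| < eps / 2) (a, 1%g : G) cvg_fst).
  apply: filterS (filterI n1 n2) => -[a' v] /= [h1 h2] Ka' Kav.
  have := ler_normB (phi (a' * v)%g - phi a) (phi a' - phi a).
  rewrite opprB addrA subrK => h3; apply: le_trans h3 _.
  by have := h1 Kav; have := h2 Ka'; lra.
have nW' : nbhs (1%g : G) (fun v => K `<=` [set a | K (a * v)%g -> `|phi (a * v)%g - phi a| <= eps]) by exact: nW.
move: nW'; rewrite nbhsE => -[V [oV V1] VW]; exists V; split=> // a v Ka Kav Vv.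
exact: (VW v Vv a Ka Kav).
Qed.

Lemma sum_le_one (T : eqType) (s : seq T) (f : T -> R) b0 C C' : b0 \in s -> (forall b, b \in s -> f b <= C) ->
  f b0 <= C' -> \sum_(b <- s) f b <= ((size s)%:R - 1) * C + C'.
Proof.
move=> b0s H H0; rewrite (big_rem b0) //= addrC; apply: lerD => //.
have sE : size s = (size (rem b0 s)).+1 by rewrite size_rem // prednK //; case: s b0s {H}.
rewrite sE -natr1 addrK; elim: (rem b0 s) (fun b (h : b \in rem b0 s) => H b (mem_rem h)) => [|b t IH] Ht.
  by rewrite big_nil mul0r.
rewrite big_cons /= -natr1 mulrDl mul1r addrC; apply: lerD; last by apply: Ht; rewrite mem_head.
by apply: IH => c ct; apply: Ht; rewrite in_cons ct orbT.
Qed.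

Lemma cont_min f : cont f -> exists2 a, K a & forall b, K b -> f a <= f b.
Proof.
move=> cf; have wf_ : {within K, continuous f} by apply/subspace_continuousP.
have [a] := compact_EVT_min (ex_intro _ _ K1) cK wf_; rewrite inE => Ka H; exists a => // b Kb.
by apply: H; rewrite inE.
Qed.

(* Averaging once more over translates b_j = x0 c_j^-1, where x0 minimizes f and K is covered by
   the c_j V, puts at least one of the N averaged values within eps of the minimum. *)
Lemma osc_contraction phi (eps : R) : cont phi -> 0 < eps -> exists2 N : R, 1 <= N &
  forall A lo hi, wf A -> (forall a, K a -> lo <= avg A phi a <= hi) ->
  exists A' lo' hi', [/\ wf A', forall a, K a -> lo' <= avg A' phi a <= hi' &
    N * (hi' - lo') <= (N - 1) * (hi - lo) + eps].
Proof.
move=> cp e0; have [V [oV V1 HV]] := cont_modulus cp e0.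
have [s sK' Hs] := compact_translates hM cK oV V1.
have s0 : (0 < size s)%N by have [b] := Hs _ K1; case: s {sK' Hs}.
have s1 : 1 <= (size s)%:R :> R by rewrite ler1n.
exists (size s)%:R => // A lo hi wA HA; set f := avg A phi.
have cf := cont_avg wA cp; have [x0 Kx0 x0min] := cont_min cf.
have fmod a v : K a -> K (a * v)%g -> V v -> f (a * v)%g <= f a + eps.
  move=> Ka Kav Vv; rewrite -lerBlDl /f; rewrite (avgE _ _ _ wA).
  have S : \sum_(b <- A) (phi (b * (a * v))%g - avg A phi a) <= (size A)%:R * eps.
    rewrite sumrB sumr_cst {1}/avg mulrA mulfV; last first.
      by rewrite pnatr_eq0 -lt0n; exact: wA.1.
    rewrite mul1r -sumrB -sumr_cst.
    rewrite big_seq [X in _ <= X]big_seq; apply: ler_sum => b bA; have Kb := wA.2 b bA.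
    have := HV (b * a)%g v (KM Kb Ka); rewrite -mulgA => /(_ (KM Kb Kav) Vv).
    by rewrite ler_norml => /andP[].
  rewrite ler_pdivrMl ?ltr0n ?wA.1 //.
pose B := [seq (x0 * c^-1)%g | c <- s].
have wB : wf B.
  by split; [rewrite size_map|move=> _ /mapP[c cs ->]; apply: KM => //; apply: KV; exact: sK'].
have sz : (size B)%:R = (size s)%:R :> R by rewrite size_map.
exists [seq (c * b)%g | c <- A, b <- B], (f x0), (((size s)%:R - 1) / (size s)%:R * hi + (f x0 + eps) / (size s)%:R).
have Nz : (size s)%:R != 0 :> R by rewrite pnatr_eq0 -lt0n.
split; first exact: wf_allpairs.
  move=> a Ka; rewrite -avg_avg -/f; apply/andP; split; first by apply: avg_ge.
  have [c cs Vc] := Hs a Ka.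
  have := @sum_le_one _ B (fun b => f (b * a)%g) (x0 * c^-1)%g hi (f x0 + eps).
  rewrite sz => H; rewrite {1}/avg sz -ler_pdivlMl ?invr_gt0 ?ltr0n // invrK mulrDr.
  rewrite [leRHS](_ : _ = ((size s)%:R - 1) * hi + (f x0 + eps)); last by field.
  apply: H; first exact: map_f.
    move=> b bB; have Kba := KM (wB.2 b bB) Ka.
    by have /andP[] := HA _ Kba.
  rewrite -mulgA; apply: fmod => //; rewrite mulgA; apply: KM => //; apply: KM => //; apply: KV; exact: sK'.
have lo_le : lo <= f x0 by have /andP[] := HA _ Kx0.
have E : (size s)%:R * (((size s)%:R - 1) / (size s)%:R * hi + (f x0 + eps) / (size s)%:R - f x0) =
  ((size s)%:R - 1) * (hi - f x0) + eps by field.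
rewrite E lerD2r; apply: ler_wpM2l; lra.
Qed.

(** Since [N] is independent of the average considered, the infimum of the oscillations satisfies
    [N * inf <= (N - 1) * inf + eps / 2]. *)
Lemma osc_small phi (eps : R) : cont phi -> 0 < eps -> exists A lo hi,
  [/\ wf A, forall a, K a -> lo <= avg A phi a <= hi & hi - lo <= eps].
Proof.
move=> cp e0.
pose S := [set o : R | exists A lo hi, [/\ wf A, forall a, K a -> lo <= avg A phi a <= hi & o = hi - lo]].
have S0 : S !=set0.
  have [x xK xmin] := cont_min cp.
  have cN : cont (fun a => - phi a) by move=> a Ka; apply: cvgN; exact: cp.
  have [y yK ymax] := cont_min cN.
  have w1 : wf [:: 1%g] by split=> // b; rewrite inE => /eqP ->.
  exists (phi y - phi x), [:: 1%g], (phi x), (phi y); split=> // a Ka.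
  rewrite /avg big_seq1 mul1g invr1 mul1r xmin //=.
  by have := ymax a Ka; rewrite lerN2.
have Slb : lbound S 0 by move=> _ [A [lo [hi [_ H ->]]]]; have /andP[h1 h2] := H _ K1; lra.
have iS : has_inf S by split; [exact: S0|exists 0].
have e2 : 0 < eps / 2 by rewrite divr_gt0.
have [N N1 H] := osc_contraction cp e2.
have infle : inf S <= eps / 2.
  have key o : S o -> N * inf S <= (N - 1) * o + eps / 2.
    move=> [A [lo [hi [wA HA ->]]]]; have [A' [lo' [hi' [wA' HA' le]]]] := H A lo hi wA HA.
    apply: le_trans le; apply: ler_wpM2l; first lra.
    by apply: ge_inf; [exists 0|exists A', lo', hi'].
  have [N1'|N1'] := eqVneq N 1.
    by have [x Sx] := S0; have := key x Sx; rewrite N1' subrr mul0r mul1r add0r.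
  have N1s : 0 < N - 1 by rewrite subr_gt0 lt_neqAle eq_sym N1'.
  have : (N * inf S - eps / 2) / (N - 1) <= inf S.
    apply: lb_le_inf => // o So; rewrite ler_pdivrMr // mulrC; have := key o So; lra.
  rewrite ler_pdivrMr //; lra.
have [_ [A [lo [hi [wA HA ->]]]] oe] := inf_adherent e2 iS.
exists A, lo, hi; split=> //; lra.
Qed.

(* The two-sided average over A and B^-1 lies above lo and below hi. *)
Lemma avg_cross phi A B lo hi : wf A -> wf B -> (forall a, K a -> lo <= avg A phi a) ->
  (forall a, K a -> avg B (fun b => phi b^-1%g) a <= hi) -> lo <= hi.
Proof.
move=> wA wB HA HB.
have h1 := avg_ge wB (fun a Ka => HA _ (KV Ka)) K1.
have h2 := avg_le wA (fun a Ka => HB _ (KV Ka)) K1.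
apply: le_trans h1 _; apply: le_trans h2; rewrite /avg le_eqVlt; apply/orP; left; apply/eqP.
rewrite -!mulr_sumr mulrCA; congr (_ * (_ * _)); rewrite exchange_big /=.
by apply: eq_bigr => b _; apply: eq_bigr => c _; rewrite !mulg1 invgM invgK.
Qed.

(** Two left averages are compared through one right average that is nearly constant: left averages
    of [phi] composed with the inverse are right averages of [phi], and the two kinds commute. *)
Lemma avg_lo_hi phi A A' lo hi : cont phi -> wf A -> wf A' -> (forall a, K a -> lo <= avg A phi a) ->
  (forall a, K a -> avg A' phi a <= hi) -> lo <= hi.
Proof.
move=> cp wA wA' HA HA'; apply/ler_addgt0Pr => eps e0.
have ci := cont_inv cp; have [B [lo3 [hi3 [wB HB le]]]] := osc_small ci e0.
have h1 : lo <= hi3 by apply: (avg_cross wA wB HA) => a /HB/andP[].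
have h2 : - hi <= - lo3.
  apply: (@avg_cross (fun a => - phi a) A' B) => // a Ka.
    by rewrite /avg sumrN mulrN lerN2; exact: HA'.
  by rewrite /avg sumrN mulrN lerN2; have /andP[] := HB a Ka.
lra.
Qed.

(** The mean is the supremum of all uniform lower bounds of averages; an average of small
    oscillation pins it down because lower bounds never exceed upper bounds, even of different
    averages. *)
Lemma mean_exists phi : cont phi -> exists c, is_mean phi c.
Proof.
move=> cp; pose S := [set lo : R | exists2 A, wf A & forall a, K a -> lo <= avg A phi a].
have [A0 [lo0 [hi0 [wA0 H0 _]]]] := osc_small cp ltr01.
have S0 : S !=set0 by exists lo0, A0 => // a /H0/andP[].
exists (sup S) => eps e0; have [A [lo [hi [wA HA le]]]] := osc_small cp e0.
exists A; split=> // a Ka.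
have Sub o : S o -> o <= hi by move=> [A' wA' HA']; apply: (avg_lo_hi cp wA' wA HA') => b /HA/andP[].
have h1 : lo <= sup S.
  by apply: ub_le_sup; [exists hi => o /Sub|exists A => // b /HA/andP[]].
have h2 : sup S <= hi by apply: ge_sup.
have /andP[h3 h4] := HA a Ka; rewrite ler_norml; apply/andP; split; lra.
Qed.

Lemma mean_unique phi c c' : cont phi -> is_mean phi c -> is_mean phi c' -> c = c'.
Proof.
have key c1 c2 : cont phi -> is_mean phi c1 -> is_mean phi c2 -> c1 <= c2.
  move=> cp m1 m2; apply/ler_addgt0Pr => eps e0; have e2 : 0 < eps / 2 by rewrite divr_gt0.
  have [A [wA HA]] := m1 _ e2; have [B [wB HB]] := m2 _ e2.
  have : c1 - eps / 2 <= c2 + eps / 2.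
    apply: (avg_lo_hi cp wA wB) => a Ka; first by have := HA a Ka; rewrite ler_distl => /andP[].
    by have := HB a Ka; rewrite ler_distl => /andP[].
  lra.
by move=> cp m1 m2; apply/eqP; rewrite eq_le !key.
Qed.

Lemma is_mean_refine phi A c : wf A -> is_mean (avg A phi) c -> is_mean phi c.
Proof.
move=> wA H eps e0; have [B [wB HB]] := H _ e0; exists [seq (a * b)%g | a <- A, b <- B].
by split; [exact: wf_allpairs|move=> a Ka; rewrite -avg_avg; exact: HB].
Qed.

(** The averages for the two functions must be made common: [A] serves [phi], then [B] serves the
    [A]-average of the other function, and averaging by [B] does not spoil what [A] achieved. *)
Lemma is_meanD phi psi c c' : cont phi -> cont psi -> is_mean phi c -> is_mean psi c' ->
  is_mean (fun a => phi a + psi a) (c + c').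
Proof.
move=> cp cq m1 m2 eps e0; have e2 : 0 < eps / 2 by rewrite divr_gt0.
have [A [wA HA]] := m1 _ e2; have cqA := cont_avg wA cq.
have [c2 m3] := mean_exists cqA.
have E := mean_unique cq m2 (is_mean_refine wA m3); rewrite -E in m3.
have [B [wB HB]] := m3 _ e2; exists [seq (a * b)%g | a <- A, b <- B].
split; first exact: wf_allpairs.
move=> a Ka; have h1 := avg_near wB HA Ka; have h2 := HB a Ka.
have -> : avg [seq (a * b)%g | a <- A, b <- B] (fun a => phi a + psi a) a =
    avg B (avg A phi) a + avg B (avg A psi) a by rewrite !avg_avg /avg big_split mulrDr.
rewrite opprD addrACA; apply: le_trans (ler_normD _ _) _; lra.
Qed.

Lemma is_meanZ phi c k : is_mean phi c -> is_mean (fun a => k * phi a) (k * c).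
Proof.
move=> m1 eps e0; have k0 : 0 < `|k| + 1 by rewrite ltr_wpDl.
have e2 : 0 < eps / (`|k| + 1) by rewrite divr_gt0.
have [A [wA HA]] := m1 _ e2; exists A; split=> // a Ka.
have -> : avg A (fun a => k * phi a) a = k * avg A phi a by rewrite /avg -mulr_sumr mulrCA.
rewrite -mulrBr normrM; apply: le_trans (ler_wpM2l (normr_ge0 _) (HA a Ka)) _.
rewrite mulrCA -[leRHS]mulr1; apply: ler_wpM2l; first exact: ltW.
by rewrite ler_pdivrMr // mul1r lerDl.
Qed.

Lemma is_mean_cst phi c : (forall a, K a -> phi a = c) -> is_mean phi c.
Proof.
move=> H eps e0; exists [:: 1%g]; split; first by split=> // b; rewrite inE => /eqP ->.
by move=> a Ka; rewrite /avg big_seq1 mul1g invr1 mul1r H // subrr normr0 ltW.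
Qed.

Lemma is_mean_bound phi c C : is_mean phi c -> (forall a, K a -> `|phi a| <= C) -> `|c| <= C.
Proof.
move=> m1 H; apply/ler_addgt0Pr => eps e0; have [A [wA HA]] := m1 _ e0.
have h1 := HA _ K1; have h2 : `|avg A phi 1%g - 0| <= C by apply: avg_near => // a Ka; rewrite subr0; exact: H.
rewrite subr0 in h2; have := ler_normB (avg A phi 1%g) (avg A phi 1%g - c).
rewrite opprB addrC subrK; lra.
Qed.

Lemma is_mean_rmul phi c b : K b -> is_mean phi c -> is_mean (fun a => phi (a * b)%g) c.
Proof.
move=> Kb m1 eps e0; have [A [wA HA]] := m1 _ e0; exists A; split=> // a Ka.
have := HA _ (KM Ka Kb); rewrite /avg.
by under eq_bigr do rewrite mulgA.
Qed.

Definition mean (phi : G -> R) : R := xget 0 [set c | is_mean phi c].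

Lemma meanP phi : cont phi -> is_mean phi (mean phi).
Proof. by move=> /mean_exists[c m1]; rewrite /mean; case: xgetP => [c' -> //|/(_ c)]. Qed.

Lemma meanE phi c : cont phi -> is_mean phi c -> mean phi = c.
Proof. by move=> cp; apply: mean_unique => //; exact: meanP. Qed.

Lemma cont_eq phi psi : (forall a, K a -> phi a = psi a) -> cont phi -> cont psi.
Proof.
move=> E cp a Ka; rewrite -E //; apply: cvg_trans (cp a Ka); apply: near_eq_cvg.
by rewrite near_withinE; near=> b => Kb; rewrite E.
Unshelve. all: by end_near. Qed.

Lemma mean_eq phi psi : cont phi -> (forall a, K a -> phi a = psi a) -> mean phi = mean psi.
Proof.
move=> cp E; apply/esym/meanE; first exact: (cont_eq E).
move=> eps e0; have [A [wA HA]] := meanP cp e0; exists A; split=> // a Ka.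
have -> : avg A psi a = avg A phi a.
  rewrite /avg; congr (_ * _); rewrite big_seq [RHS]big_seq; apply: eq_bigr => b bA.
  by rewrite E //; apply: KM => //; exact: wA.2.
exact: HA.
Qed.

Lemma meanD phi psi : cont phi -> cont psi -> mean (fun a => phi a + psi a) = mean phi + mean psi.
Proof.
move=> cp cq; apply: meanE; first by move=> a Ka; apply: cvgD; [exact: cp|exact: cq].
by apply: is_meanD => //; exact: meanP.
Qed.

Lemma meanZ phi k : cont phi -> mean (fun a => k * phi a) = k * mean phi.
Proof.
move=> cp; apply: meanE; first by move=> a Ka; apply: cvgM; [exact: cvg_cst|exact: cp].
by apply: is_meanZ; exact: meanP.
Qed.

Lemma mean_bound phi C : cont phi -> (forall a, K a -> `|phi a| <= C) -> `|mean phi| <= C.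
Proof. by move=> cp; apply: is_mean_bound; exact: meanP. Qed.

Lemma cont_rmul b phi : K b -> cont phi -> cont (fun a => phi (a * b)%g).
Proof.
move=> Kb cp a Ka O nO; have nP : \forall a' \near within K (nbhs (a * b)%g), O (phi a') by exact: (cp _ (KM Ka Kb)).
apply: (near_within (f := fun a => (a * b)%g) _ _ nP); last by move=> s Ks; exact: KM.
by apply: (continuous_mulg hM); [exact: cvg_id|exact: cvg_cst].
Qed.

Lemma mean_rmul phi b : K b -> cont phi -> mean (fun a => phi (a * b)%g) = mean phi.
Proof.
move=> Kb cp; apply: meanE; first exact: cont_rmul.
by apply: is_mean_rmul => //; exact: meanP.
Qed.

End InvariantMean.

Lemma is_derive_expansion {R : realType} (V : normedModType R) (f : V -> R) (x v : V) (df : R) :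
  (forall eps : R, 0 < eps -> \forall h \near (0 : R), `|f (h *: v + x) - f x - h * df| <= eps * `|h|) ->
  is_derive x v f df.
Proof.
move=> H.
have cv : (fun h : R => h^-1 *: (f (h *: v + x) - f x)) @ (0 : R)^' --> df.
  apply/cvgrPdist_le => eps e0.
  have n2 : \forall h \near (0 : R)^', `|f (h *: v + x) - f x - h * df| <= eps * `|h|.
    by apply: cvg_within; exact: H.
  near=> h; have h0 : h != 0 by near: h; exact: nbhs_dnbhs_neq.
  have : `|f (h *: v + x) - f x - h * df| <= eps * `|h| by near: h; exact: n2.
  move=> Hh; have -> : df - h^-1 *: (f (h *: v + x) - f x) = - (h^-1 * (f (h *: v + x) - f x - h * df)).
    by rewrite /GRing.scale /=; field.
  by rewrite normrN normrM normfV ler_pdivrMl ?normr_gt0 // (mulrC `|h|).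
split; first by apply/cvg_ex; exists df.
exact: cvg_lim cv.
Unshelve. all: by end_near. Qed.

Lemma smooth_on_derive {R : realType} (V W : normedModType R) (U : set V) (f : V -> W) v :
  smooth_on U f -> smooth_on U ('D_v f).
Proof. by move=> sf j; have [_ /(_ v)[]] := sf j.+1. Qed.

Lemma continuous_pair (T X Y : topologicalType) (f : T -> X) (h : T -> Y) t : {for t, continuous f} ->
  {for t, continuous h} -> {for t, continuous (fun s => (f s, h s))}.
Proof. by move=> cf ch; exact: cvg_pair. Qed.

(** * Smoothness of means of families *)

Section SmoothFamilies.
Context {R : realType} {n m q : nat} {M : topologicalType} {G : preTopologicalGroupType}
  {AM : set (chart R M n)} {g : gram R M n} {AG : set (chart R G m)} {act : group_action G M}.
Hypothesis hM : complete_riemannian_G_manifold AM g AG act.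
Variable K : set G.
Hypothesis cK : compact K.
Hypothesis sK : subgroup K.
Variable U : set 'rV[R]_q.
Hypothesis oU : open U.
Local Notation cont := (@cont R G K).
Local Notation mean := (@mean R G K).

(** Continuity is joint in both variables, so that compactness of [K] makes the dependence on [b]
    uniform in the group variable. *)
Definition fam_cont (F : G -> 'rV[R]_q -> R) := forall a b, K a -> U b ->
  (fun p : G * 'rV[R]_q => F p.1 p.2) @ within [set p | K p.1] (nbhs (a, b)) --> F a b.

(* C^j in the second variable, with jointly continuous partial derivatives. *)
Fixpoint fam_Ck j (F : G -> 'rV[R]_q -> R) : Prop :=
  fam_cont F /\ if j is j'.+1 then forall v : 'rV[R]_q,
    (forall a b, K a -> U b -> derivable (F a) b v) /\ fam_Ck j' (fun a => 'D_v (F a)) else True.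

Lemma fam_slice F b : fam_cont F -> U b -> cont (fun a => F a b).
Proof.
move=> cF Ub a Ka O nO; have n1 : \forall p \near (a, b), K p.1 -> O (F p.1 p.2) by exact: (cF a b Ka Ub O nO).
have cp : {for a, continuous (fun a : G => (a, b))} by apply: continuous_pair; [exact: cvg_id|exact: cvg_cst].
by have n2 : \forall a' \near a, K a' -> O (F a' b) by exact: (near_comp cp n1).
Qed.

Lemma fam_near F b (eps : R) : fam_cont F -> U b -> 0 < eps ->
  \forall b' \near b, K `<=` [set a | `|F a b' - F a b| < eps].
Proof.
move=> cF Ub e0; have e2 : 0 < eps / 2 by rewrite divr_gt0.
have H : near_covering_within K by apply/near_covering_withinP/compact_near_coveringP.
apply: (H 'rV[R]_q (nbhs b) (fun b' a => `|F a b' - F a b| < eps) _) => a Ka.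
have n1 : \forall p \near (a, b), K p.1 -> `|F p.1 p.2 - F a b| < eps / 2.
  have nw : \forall p \near within [set p : G * 'rV[R]_q | K p.1] (nbhs (a, b)), `|F p.1 p.2 - F a b| < eps / 2.
    by have /cvgrPdistC_lt := cF a b Ka Ub; apply.
  exact: nw.
have n2 : \forall p \near (a, b), K p.1 -> `|F p.1 b - F a b| < eps / 2.
  have cp : {for (a, b), continuous (fun p : G * 'rV[R]_q => (p.1, b))}.
    by apply: continuous_pair; [exact: cvg_fst|exact: cvg_cst].
  exact: (near_comp cp n1).
apply: filterS (filterI n1 n2) => -[a' b'] /= [h1 h2] Ka'.
have := ler_normB (F a' b' - F a b) (F a' b - F a b).
rewrite opprB addrA subrK => h3; apply: le_lt_trans h3 _.
by have := h1 Ka'; have := h2 Ka'; lra.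
Qed.

Definition fam_mean (F : G -> 'rV[R]_q -> R) (b : 'rV[R]_q) := mean (fun a => F a b).

Lemma contB phi psi : cont phi -> cont psi -> cont (fun a => phi a - psi a).
Proof. by move=> cp cq a Ka; apply: cvgB; [exact: cp|exact: cq]. Qed.

Lemma meanB phi psi : cont phi -> cont psi -> mean (fun a => phi a - psi a) = mean phi - mean psi.
Proof.
move=> cp cq; have cN : cont (fun a => -1 * psi a).
  by move=> a Ka; apply: cvgM; [exact: cvg_cst|exact: cq].
have E : mean (fun a => phi a - psi a) = mean (fun a => phi a + -1 * psi a).
  apply: (mean_eq hM cK sK); first exact: contB.
  by move=> a Ka; rewrite mulN1r.
by rewrite E (meanD hM cK sK cp cN) (meanZ hM cK sK _ cq) mulN1r.
Qed.

Lemma fam_mean_continuous F b : fam_cont F -> U b -> {for b, continuous (fam_mean F)}.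
Proof.
move=> cF Ub; apply: (proj2 (@cvgrPdistC_le R R 'rV[R]_q (nbhs b) _ _ _)) => eps e0.
have nn := fam_near cF Ub e0; have nU : nbhs b U by exact: open_nbhs_nbhs.
apply: filterS (filterI nn nU) => b' [H Ub'].
have c1 := fam_slice cF Ub; have c2 := fam_slice cF Ub'.
rewrite /fam_mean -(meanB c2 c1); apply: (mean_bound hM cK sK); first exact: contB.
by move=> a Ka; apply: ltW; exact: H.
Qed.

(** Differentiation under the mean: the mean value theorem turns the difference quotient of each
    [F a] into a derivative at a nearby point, close to the one at [b] uniformly over [K]. *)
Lemma fam_mean_derive F v b : fam_cont F -> (forall a b, K a -> U b -> derivable (F a) b v) ->
  fam_cont (fun a => 'D_v (F a)) -> U b -> is_derive b v (fam_mean F) (fam_mean (fun a => 'D_v (F a)) b).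
Proof.
move=> cF dF cD Ub; apply: is_derive_expansion => eps e0.
have nn := fam_near cD Ub e0; have nU : nbhs b U by exact: open_nbhs_nbhs.
have nUn : \forall b' \near b, U b' /\ K `<=` [set a | `|'D_v (F a) b' - 'D_v (F a) b| < eps].
  exact: filterI.
move: nUn => /nbhs_ballP[rho /= rho0 Hrho].
have {}Hrho w : `|w| < rho -> U (b + w) /\ K `<=` [set a | `|'D_v (F a) (b + w) - 'D_v (F a) b| < eps].
  by move=> wr; apply: Hrho; rewrite -ball_normE /= opprD addrA subrr sub0r normrN.
have cl : {for (0 : R), continuous (fun h : R => h *: v)} by apply: cvgZr_tmp; exact: cvg_id.
have nh : \forall h \near (0 : R), `|h *: v| < rho by apply: (near_norm_lt cl); rewrite scale0r normr0.
apply: filterS nh => h hr.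
have tr (t : R) : 0 <= t <= 1 -> `|t *: (h *: v)| < rho.
  move=> /andP[t0 t1]; rewrite normrZ ger0_norm //; apply: le_lt_trans hr.
  by rewrite ler_piMl.
have Uh : U (h *: v + b) by have [] := Hrho _ hr; rewrite addrC.
have c1 := fam_slice cF Ub; have c2 := fam_slice cF Uh; have c3 := fam_slice cD Ub.
have c4 : cont (fun a => h * 'D_v (F a) b) by move=> a Ka; apply: cvgM; [exact: cvg_cst|exact: c3].
rewrite /fam_mean -(meanB c2 c1) -(meanZ hM cK sK h c3) -(meanB (contB c2 c1) c4).
apply: (mean_bound hM cK sK); first exact: contB (contB c2 c1) c4.
move=> a Ka.
have dl (t : R) : 0 <= t <= 1 -> derivable (F a) (b + t *: (h *: v)) v.
  by move=> t01; apply: dF => //; have [] := Hrho _ (tr t t01).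
have [t t01 E] := MVT_line (fun t t01 => (deriveZdir h (dl t t01)).1).
rewrite (addrC (h *: v)) E (deriveZdir h (dl t t01)).2 -mulrBr normrM mulrC.
apply: ler_wpM2r => //; apply: ltW; have [_ H] := Hrho _ (tr t t01); exact: H.
Qed.

Lemma fam_mean_Ck j F : fam_Ck j F -> Ck j U (fam_mean F).
Proof.
elim: j F => [|j IH] F [cF dF]; split=> //; try by move=> b Ub; exact: fam_mean_continuous.
move=> v; have [d1 d2] := dF v; have cD : fam_cont (fun a => 'D_v (F a)) by case: j d2 {IH dF} => [|j] [].
have D b : U b -> is_derive b v (fam_mean F) (fam_mean (fun a => 'D_v (F a)) b).
  by move=> Ub; exact: fam_mean_derive.
split; first by move=> b /D[].
by apply: Ck_eq (IH _ d2) => // b /D[_ ->].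
Qed.

Lemma fam_contD F F' : fam_cont F -> fam_cont F' -> fam_cont (fun a b => F a b + F' a b).
Proof. by move=> cF cF' a b Ka Ub; apply: cvgD; [exact: cF|exact: cF']. Qed.

Lemma fam_contZ phi F : cont phi -> fam_cont F -> fam_cont (fun a b => phi a * F a b).
Proof.
move=> cp cF a b Ka Ub; apply: cvgM; last exact: cF.
move=> O nO; have n1 : \forall a' \near a, K a' -> O (phi a') by exact: (cp a Ka O nO).
have n2 : \forall p \near (a, b), K p.1 -> O (phi p.1).
  by apply: (@near_comp _ _ fst (fun a' => K a' -> O (phi a')) (a, b) cvg_fst).
exact: n2.
Qed.

Lemma fam_cont_eq F F' : (forall a b, K a -> U b -> F a b = F' a b) -> fam_cont F -> fam_cont F'.
Proof.
move=> E cF a b Ka Ub; rewrite -E //; apply: cvg_trans (cF a b Ka Ub); apply: near_eq_cvg.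
have nU : \forall p \near (a, b), U p.2.
  by apply: (@near_comp _ _ snd U (a, b) cvg_snd); exact: open_nbhs_nbhs.
have nE : \forall p \near (a, b), K p.1 -> F p.1 p.2 = F' p.1 p.2.
  by apply: filterS nU => p Up Kp; exact: E.
exact: nE.
Qed.

Lemma fam_Ck_eq j F F' : (forall a b, K a -> U b -> F a b = F' a b) -> fam_Ck j F -> fam_Ck j F'.
Proof.
elim: j F F' => [|j IH] F F' E [cF dF]; split=> //; try exact: (fam_cont_eq E).
have nE a b : K a -> U b -> {near b, F a =1 F' a}.
  move=> Ka Ub; have nU : nbhs b U by exact: open_nbhs_nbhs.
  by apply: filterS nU => b' Ub'; exact: E.
move=> v; have [d1 d2] := dF v; split=> [a b Ka Ub|].
  by apply: near_eq_derivable (d1 a b Ka Ub); exact: nE.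
by apply: IH d2 => a b Ka Ub; apply: near_eq_derive; exact: nE.
Qed.

Lemma fam_CkD j F F' : fam_Ck j F -> fam_Ck j F' -> fam_Ck j (fun a b => F a b + F' a b).
Proof.
elim: j F F' => [|j IH] F F' [cF dF] [cF' dF']; split=> //; try exact: fam_contD.
move=> v; have [d1 d2] := dF v; have [e1 e2] := dF' v; split=> [a b Ka Ub|].
  by apply: derivableD; [exact: d1|exact: e1].
apply: fam_Ck_eq (IH _ _ d2 e2) => a b Ka Ub; rewrite -deriveD //; [exact: d1|exact: e1].
Qed.

Lemma fam_CkZ j phi F : cont phi -> fam_Ck j F -> fam_Ck j (fun a b => phi a * F a b).
Proof.
move=> cp; elim: j F => [|j IH] F [cF dF]; split=> //; try exact: fam_contZ.
move=> v; have [d1 d2] := dF v; split=> [a b Ka Ub|].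
  exact: (@derivableZ _ _ _ (F a) (phi a) b v (d1 a b Ka Ub)).
apply: fam_Ck_eq (IH _ d2) => a b Ka Ub.
exact: (esym (@deriveZ _ _ _ (F a) (phi a) b v (d1 a b Ka Ub))).
Qed.

Lemma fam_Ck_sum j (I : Type) (s : seq I) (F : I -> G -> 'rV[R]_q -> R) : (forall i, fam_Ck j (F i)) ->
  fam_Ck j (fun a b => \sum_(i <- s) F i a b).
Proof.
move=> H; elim: s => [|i s IH].
  have c0 : forall j (F0 : G -> 'rV[R]_q -> R), (forall a b, F0 a b = 0) -> fam_Ck j F0.
    elim=> [|j' IH] F0 F00; split=> //; try by
      move=> a b _ _; rewrite F00; under eq_cvg do rewrite F00; exact: cvg_cst.
    have E a : F0 a = cst 0 by apply/funext => b; rewrite F00.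
    move=> v; split=> [a b _ _|]; first by rewrite E; exact: derivable_cst.
    by apply: IH => a b; rewrite E derive_cst.
  by apply: c0 => a b; rewrite big_nil.
by apply: fam_Ck_eq (fam_CkD (H i) IH) => a b _ _; rewrite big_cons.
Qed.

Lemma mean_sum (I : Type) (s : seq I) (phi : I -> G -> R) : (forall i, cont (phi i)) ->
  cont (fun a => \sum_(i <- s) phi i a) /\ mean (fun a => \sum_(i <- s) phi i a) = \sum_(i <- s) mean (phi i).
Proof.
move=> H; elim: s => [|i s [c1 E1]].
  have c0 : cont (fun a => \sum_(i <- [::]) phi i a).
    by move=> a Ka; rewrite big_nil; under eq_cvg do rewrite big_nil; exact: cvg_cst.
  split=> //; rewrite big_nil; apply: (meanE hM cK sK c0).
  by apply: (is_mean_cst sK) => a Ka; rewrite big_nil.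
have c2 : cont (fun a => phi i a + \sum_(j <- s) phi j a) by move=> a Ka; apply: cvgD; [exact: H|exact: c1].
have E a : phi i a + \sum_(j <- s) phi j a = \sum_(j <- i :: s) phi j a by rewrite big_cons.
split; first by apply: (cont_eq _ c2) => a Ka; rewrite E.
rewrite -(mean_eq hM cK sK c2 (fun a _ => E a)) (meanD hM cK sK (H i) c1) E1 big_cons //.
Qed.

(** Joint smoothness, with the group variable read in a chart of [G]: [K] itself has no charts, so
    its points are surrounded by points of [G]. *)
Let locally_smooth (F : G -> 'rV[R]_q -> R) := forall a b, K a -> U b -> exists c, [/\ AG c, cdom c a &
  exists W, [/\ open W, W (row_mx (cto c a) b) &
    smooth_on W (fun w : 'rV[R]_(m + q) => F (cinv c (lsubmx w)) (rsubmx w))]].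

Lemma smooth_family_cont F : locally_smooth F -> fam_cont F.
Proof.
move=> H a b Ka Ub; have [c [Ac ca [W [oW Ww sW]]]] := H a b Ka Ub; have [oc _ Kc ct _] := charts_G hM Ac.
apply: cvg_within_filter.
have cf : {for (a, b), continuous (fun p : G * 'rV[R]_q => row_mx (cto c p.1) p.2)}.
  have c1 : {for (a, b), continuous (fun p : G * 'rV[R]_q => cto c p.1)}.
    by apply: (@continuous_comp _ _ _ fst (cto c) (a, b)); [exact: cvg_fst|exact: ct].
  have c2 : {for (a, b), continuous (fun p : G * 'rV[R]_q => p.2)} by exact: cvg_snd.
  apply: (@cvg_mx R _ (nbhs (a, b))) => i l; rewrite row_mx_coord; under eq_cvg do rewrite row_mx_coord.
  by case: (fintype.split l) => l'; apply: cvg_coord; [exact: c1|exact: c2].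
have [cW _] := sW 0%N; have cc := continuous_comp cf (cW _ Ww).
have nc : \forall p \near (a, b), cdom c p.1.
  by apply: (@near_comp _ _ fst (cdom c) (a, b) cvg_fst); exact: open_nbhs_nbhs.
have E : F a b = F (cinv c (lsubmx (row_mx (cto c a) b))) (rsubmx (row_mx (cto c a) b)).
  by rewrite row_mxKl row_mxKr Kc.
rewrite E; apply: cvg_trans cc; apply: near_eq_cvg.
by apply: filterS nc => p cp; rewrite /= row_mxKl row_mxKr Kc.
Qed.

(* In a chart of G, partial derivatives in b are derivatives in the directions (0, v). *)
Lemma smooth_family F : locally_smooth F -> forall j, fam_Ck j F.
Proof.
move=> H j; elim: j F H => [|j IH] F H; first by split=> //; exact: smooth_family_cont.
split; first exact: smooth_family_cont.
move=> v.
have key c (w : 'rV[R]_(m + q)) : (fun h : R => h^-1 *: (((fun w : 'rV[R]_(m + q) => F (cinv c (lsubmx w)) (rsubmx w)) \o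
      shift w) (h *: row_mx 0 v) - F (cinv c (lsubmx w)) (rsubmx w))) =
    (fun h : R => h^-1 *: ((F (cinv c (lsubmx w)) \o shift (rsubmx w)) (h *: v) - F (cinv c (lsubmx w)) (rsubmx w))).
  apply/funext => h; rewrite /= !linearD /= !linearZ /= row_mxKl row_mxKr scaler0 add0r //.
split=> [a b Ka Ub|].
  have [c [Ac ca [W [oW Ww sW]]]] := H a b Ka Ub; have [_ _ Kc _ _] := charts_G hM Ac.
  have [_ /(_ (row_mx 0 v))[/(_ _ Ww) d1 _]] := sW 1%N.
  by move: d1; rewrite /derivable key row_mxKl row_mxKr Kc.
apply: IH => a b Ka Ub; have [c [Ac ca [W [oW Ww sW]]]] := H a b Ka Ub; exists c; split=> //.
exists W; split=> //.
have -> : (fun w : 'rV[R]_(m + q) => 'D_v (F (cinv c (lsubmx w))) (rsubmx w)) =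
    'D_(row_mx 0 v) (fun w : 'rV[R]_(m + q) => F (cinv c (lsubmx w)) (rsubmx w)).
  by apply/funext => w; rewrite /derive key.
exact: smooth_on_derive.
Qed.

End SmoothFamilies.

Lemma lblock1_unit (F : fieldType) (r k : nat) (Y : 'M[F]_(k, r)) : block_mx 1%:M 0 Y 1%:M \in unitmx.
Proof. by rewrite unitmxE det_lblock !det1 mulr1 unitr1. Qed.

Lemma delta_mulE (F : fieldType) (p q : nat) (B : 'M[F]_(p, q)) i l : ((delta_mx 0 i : 'rV[F]_p) *m B) 0 l = B i l.
Proof. by rewrite -rowE mxE. Qed.

(** * A section fixed by the isotropy group *)

Section FixedSection.
Context {R : realType} {r k m : nat} {M : topologicalType} {G : preTopologicalGroupType}
  {AM : set (chart R M (r + k)%N)} {g : gram R M (r + k)%N} {AG : set (chart R G m)} {act : group_action G M}.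
Hypothesis hM : complete_riemannian_G_manifold AM g AG act.
Variable e : chart R G m.
Hypothesis Ae : AG e.
Hypothesis e1 : cdom e 1%g.
Local Notation cM := (charts_M hM).
Local Notation cG := (charts_G hM).
Local Notation cE := (@charts_eucl R _).
Local Notation eu k := (@eucl R k%N).
Local Notation J := (@orbit_jac R (r + k)%N m M G act e).
Local Notation omap := (@orbit_map R (r + k)%N m M G act e).
Local Notation gexp := (gexp e).
Local Notation ge0 := (gexp0 hM Ae e1).
Local Notation d := (@riemannian_dist R M (r + k)%N AM g).
Local Notation atA := (gm_atlas hM).
Local Notation metA := (GM_metric hM).
Local Notation conA := (GM_connected hM).
Local Notation hauA := (gm_hausdorff hM).
Variable K : set G.
Hypothesis Kmin : forall z, isotropy act z `<=` K -> K `<=` isotropy act z.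
Hypothesis rank_le : forall c y, AM c -> cdom c y -> (\rank (J c y) <= r)%N.
Variables (x : M) (c : chart R M (r + k)) (P : 'M[R]_(r, m)) (sigma : 'rV[R]_k -> M)
  (rho : R) (N : set M) (bt : M -> 'rV[R]_(r + k)).
Hypothesis xK : isotropy act x = K.
Hypothesis Ac : AM c.
Hypothesis bx : @box R r k m M G AM AG act e c P sigma rho N bt.
Hypothesis Nx : N x.
Hypothesis btx : bt x = 0.
Local Notation bi := (@box_inv R r k m M G act e P sigma).

Let cK : compact K. Proof. by rewrite -xK; exact: (isotropy_compact hM). Qed.

Lemma isotropy_subgroup : subgroup K.
Proof.
rewrite -xK; split; first exact: isotropy1.
  by move=> a b; exact: isotropyM.
by move=> a; exact: isotropyV.
Qed.
Let sK := isotropy_subgroup.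
Let K1 : K 1%g. Proof. by case: sK. Qed.
Let KM a b : K a -> K b -> K (a * b)%g. Proof. by case: sK => _ + _; apply. Qed.
Let KV a : K a -> K a^-1%g. Proof. by case: sK => _ _; apply. Qed.

Lemma dist_fixed a y : K a -> d x (act a y) = d x y.
Proof. by rewrite -xK => ax; rewrite -{1}[x]ax (dist_act hM). Qed.

(** As [K] preserves the last [k] box coordinates near [x], this is the only nontrivial part of its
    action in the box. *)
Definition orbit_coord (a : G) (b : 'rV[R]_(r + k)) : 'rV[R]_r := lsubmx (bt (act a (bi b))).
Local Notation T := orbit_coord.

Lemma orbit_coord_smooth a b : `|b| < rho -> N (act a (bi b)) -> smooth_at (eu (r + k)) (eu r) (T a) b.
Proof.
move=> br Nab; have sa : smooth_at (eu (r + k)) AM (fun b => act a (bi b)) b.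
  by apply: (smooth_at_act hM cE _ (bx_sbi bx br)); exact: smooth_at_cst.
have sab := smooth_at_comp cE cM cE (coverM hM _) sa (bx_sbt bx Nab).
exact: (smooth_at_comp cE cE cE (eucl_chart _) sab (@smooth_at_lsub R r k _)).
Qed.

Section Averaging.
Variable U : set 'rV[R]_(r + k).
Hypothesis oU : open U.
Hypothesis U0 : U 0.
Hypothesis HU : forall a b, K a -> U b -> `|b| < rho /\ bt (act a (bi b)) = row_mx (T a b) (rsubmx b).
Hypothesis HN : forall a b, K a -> U b -> N (act a (bi b)).
Local Notation fam_Ck := (@fam_Ck R (r + k) G K U).

Let F (i : 'I_r) a b : R := T a b 0 i.
Let iota : 'M[R]_(r, r + k) := row_mx 1%:M 0.
(** The linear isotropy action on the orbit directions at [x]; with row vectors it reverses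
    products. *)
Let A a : 'M[R]_r := iota *m jacobian (T a) 0.
Let H (j : 'I_r) a b : R := \sum_l A a^-1%g l j * F l a b.
(** Bochner's linearization: the mean over [a] of [T a b] twisted by [A a^-1]. It intertwines the
    action of [K] in the box with the linear action [A], and keeps the identity derivative along the
    orbit. *)
Let Phi b : 'rV[R]_r := \row_j fam_mean K (H j) b.

Let bi0 : bi 0 = x. Proof. by have [_] := bx_bt bx Nx; rewrite btx. Qed.

Let T0 a : K a -> T a 0 = 0.
Proof. by rewrite -xK /orbit_coord bi0 => ->; rewrite btx linear0. Qed.

Let Tcomp a a' b : K a' -> U b -> T (a * a')%g b = T a (row_mx (T a' b) (rsubmx b)).
Proof.
move=> Ka' Ub; have [_ E] := HU Ka' Ub; have [_ E2] := bx_bt bx (HN Ka' Ub).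
by rewrite -E /orbit_coord act_funM E2.
Qed.

Let dT a : K a -> differentiable (T a) 0.
Proof.
move=> Ka; apply: smooth_at_diff; apply: orbit_coord_smooth; last exact: HN.
by have [] := HU Ka U0.
Qed.

Let FCk i j : fam_Ck j (F i).
Proof.
apply: (smooth_family hM) => a b Ka Ub; have [c' Ac' ca] := coverG hM a; exists c'; split=> //.
have [br E] := HU Ka Ub; have [oc _ Kc _ _] := cG Ac'.
have sl : smooth_at (eu (m + (r + k))) AG (fun w => cinv c' (lsubmx w)) (row_mx (cto c' a) b).
  apply: (smooth_at_comp cE cE cG (eucl_chart _) (@smooth_at_lsub R m (r + k) _)).
  by rewrite row_mxKl; apply: (smooth_at_cinv cG (gm_group_atlas hM) Ac'); exists a.
have sr : smooth_at (eu (m + (r + k))) AM (fun w => bi (rsubmx w)) (row_mx (cto c' a) b).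
  apply: (smooth_at_comp cE cE cM (eucl_chart _) (@smooth_at_rsub R m (r + k) _)).
  by rewrite row_mxKr; exact: (bx_sbi bx br).
have sa := smooth_at_act hM cE sl sr.
have sb : smooth_at AM (eu (r + k)) bt (act (cinv c' (lsubmx (row_mx (cto c' a) b))) (bi (rsubmx (row_mx (cto c' a) b)))).
  by rewrite row_mxKl row_mxKr Kc //; exact: (bx_sbt bx (HN Ka Ub)).
have sab := smooth_at_comp cE cM cE (coverM hM _) sa sb.
have sT := smooth_at_comp cE cE cE (eucl_chart _) sab (@smooth_at_lsub R r k _).
have [W [oW Ww sW]] := smooth_on_at sT; exists W; split=> // l.
exact: (proj1 (Ck_mxP _ _ oW) (sW l) 0 i).
Qed.

Let AE a i l : K a -> A a i l = 'D_(delta_mx 0 i *m iota) (F l a) 0.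
Proof.
move=> Ka; have dTa := dT Ka.
rewrite -[RHS](derive_coord 0 l (diff_derivable (v := delta_mx 0 i *m iota) dTa)) deriveEjacobian //.
by rewrite -mulmxA -/(A a) delta_mulE.
Qed.

Let Acont i l : cont K (fun a => A a i l).
Proof.
have [_ /(_ (delta_mx 0 i *m iota))[_ [cD _]]] := FCk l 1.
by apply: (cont_eq _ (fam_slice cD U0)) => a Ka; rewrite AE.
Qed.

Let iv (v : 'rV[R]_r) : 'rV[R]_(r + k) := v *m iota.
Let ivE v : iv v = row_mx v 0. Proof. by rewrite /iv mul_mx_row mulmx1 mulmx0. Qed.
Let iv0 : iv 0 = 0. Proof. by rewrite /iv mul0mx. Qed.

Let AJ a : K a -> jacobian (T a \o iv) 0 = A a.
Proof.
move=> Ka; have dTa : differentiable (T a) (iv 0) by rewrite /iv mul0mx; exact: dT.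
by rewrite (jacobian_comp (smooth_at_diff (@smooth_at_mul R _ _ iota 0)) dTa) jacobian_mul /iv mul0mx.
Qed.

Let nU : \forall v \near (0 : 'rV[R]_r), U (iv v).
Proof.
have ci := smooth_at_continuous (@smooth_at_mul R _ _ iota 0).
by apply: (near_comp ci); rewrite mul0mx; exact: open_nbhs_nbhs.
Qed.

Let A1 : A 1%g = 1%:M.
Proof.
rewrite -AJ // -(jacobian_id (0 : 'rV[R]_r)); apply: jacobian_near_eq.
- apply: filterS nU => v Uv; have [vr _] := HU K1 Uv.
  by rewrite /orbit_coord /= act_fun1; have [_ ->] := bx_bi bx vr; rewrite ivE row_mxKl.
- apply: differentiable_comp; first exact: smooth_at_diff (@smooth_at_mul R _ _ iota 0).
  by rewrite iv0; exact: dT.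
- exact: smooth_at_diff (smooth_at_eid _).
Qed.

(* The chain rule for T (a a') = T a \o T a' along the orbit of x. *)
Let AM_ a a' : K a -> K a' -> A (a * a')%g = A a' *m A a.
Proof.
move=> Ka Ka'; have Kaa := KM Ka Ka'; rewrite -(AJ Kaa) -(AJ Ka') -(AJ Ka).
have d0 : differentiable iv 0 by exact: smooth_at_diff (@smooth_at_mul R _ _ iota 0).
have d1 b : K b -> differentiable (T b \o iv) 0.
  by move=> Kb; apply: differentiable_comp => //; rewrite iv0; exact: dT.
have E0 : (T a' \o iv) 0 = 0 by rewrite /= iv0 T0.
have d2 : differentiable (T a \o iv) ((T a' \o iv) 0) by rewrite E0; exact: d1.
rewrite -[X in _ *m jacobian _ X]E0 -(jacobian_comp (d1 _ Ka') d2); apply: jacobian_near_eq.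
- by apply: filterS nU => v Uv; rewrite /= Tcomp // ivE row_mxKr -ivE -/(iv (T a' (iv v))) ivE.
- exact: d1.
- exact: (differentiable_comp (d1 _ Ka') d2).
Qed.

Let AinvC i l : cont K (fun a => A a^-1%g i l).
Proof. exact: (cont_inv hM sK (@Acont i l)). Qed.

Let HCk j l : fam_Ck l (H j).
Proof. exact: (fam_Ck_sum oU (index_enum _) (fun i => fam_CkZ oU (@AinvC i j) (FCk i l))). Qed.

Let HE j a b : H j a b = (T a b *m A a^-1%g) 0 j.
Proof. by rewrite mxE; apply: eq_bigr => l _; rewrite mulrC. Qed.

Let PhiCk l : Ck l U Phi.
Proof.
apply/Ck_mxP => // i j; apply: Ck_eq (fam_mean_Ck hM cK sK oU (HCk j l)) => // b Ub.
by rewrite mxE.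
Qed.

Let Hslice j b : U b -> cont K (fun a => H j a b).
Proof. by move=> Ub; have [cH _] := HCk j 0; exact: fam_slice cH Ub. Qed.

Let Phi0 : Phi 0 = 0.
Proof.
apply/rowP => j; rewrite !mxE; apply: (meanE hM cK sK (@Hslice j 0 U0)).
by apply: (is_mean_cst sK) => a Ka; rewrite HE T0 // mul0mx mxE.
Qed.

(** Substituting [a * a0] for [a], which the mean allows, and splitting [a^-1] as [a0 * (a * a0)^-1]
    brings out the factor [A a0]. *)
Let Phi_equivariant a0 b : K a0 -> U b -> U (row_mx (T a0 b) (rsubmx b)) ->
  Phi (row_mx (T a0 b) (rsubmx b)) = Phi b *m A a0.
Proof.
move=> Ka0 Ub Ub'; apply/rowP => j; rewrite mxE [RHS]mxE.
pose phi (i : 'I_r) a := A a0 i j * H i a b.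
have cphi i : cont K (phi i) by move=> a Ka; apply: cvgM; [exact: cvg_cst|exact: Hslice].
have [cs Es] := mean_sum hM cK sK (index_enum 'I_r) cphi.
rewrite -[RHS](_ : \sum_i mean K (phi i) = _); last first.
  apply: eq_bigr => i _; rewrite (meanZ hM cK sK _ (@Hslice i b Ub)) mulrC.
  by congr (_ * _); rewrite mxE.
rewrite -Es -(mean_rmul hM cK sK Ka0 cs); apply: (mean_eq hM cK sK (@Hslice j _ Ub')) => a Ka.
rewrite HE -Tcomp //.
have -> : (a^-1 = a0 * (a * a0)^-1)%g by rewrite invgM mulgA mulgV mul1g.
rewrite AM_ //; last by apply: KV; exact: KM.
rewrite mulmxA mxE; apply: eq_bigr => i _; rewrite /phi mulrC HE //.
Qed.

(** Differentiating under the mean, each term contributes [A a *m A a^-1], which is the identity. *)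
Let JPhi : iota *m jacobian Phi 0 = 1%:M.
Proof.
have dPhi : differentiable Phi 0 := C1_differentiable oU (PhiCk 1) U0.
apply/matrixP => i j; set u : 'rV[R]_(r + k) := delta_mx 0 i *m iota.
have -> : (iota *m jacobian Phi 0) i j = 'D_u (fun b => Phi b 0 j) 0.
  rewrite -(derive_coord 0 j (diff_derivable (v := u) dPhi)) deriveEjacobian //.
  by rewrite /u -mulmxA delta_mulE.
have [cH /(_ u)[dH [cD _]]] := HCk j 1.
have [_ D] := fam_mean_derive hM cK sK oU cH dH cD U0.
have -> : (fun b => Phi b 0 j) = fam_mean K (H j) by apply/funext => b; rewrite mxE.
rewrite D; apply: (meanE hM cK sK (fam_slice cD U0)); apply: (is_mean_cst sK) => a Ka.
have -> : H j a = (fun b => (T a b *m A a^-1%g) 0 j) by apply/funext => b; rewrite HE.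
have dTa := dT Ka.
have dm := smooth_at_diff (@smooth_at_mul R _ _ (A a^-1%g) (T a 0)).
have dc : differentiable (fun b => T a b *m A a^-1%g) 0 by exact: (differentiable_comp dTa dm).
rewrite -(derive_coord 0 j (diff_derivable (v := u) dc)) deriveEjacobian //.
rewrite (jacobian_comp dTa dm) jacobian_mul mulmxA /u -[_ *m jacobian (T a) 0]mulmxA -/(A a).
by rewrite -mulmxA -(AM_ (KV Ka) Ka) mulVg A1 delta_mulE.
Qed.

(** Pairing [Phi] with the unchanged last coordinates gives a local diffeomorphism [E]. By
    equivariance the zero set of [Phi] is stable under [K], and [E] takes one value on each
    [K]-orbit in it. *)
Lemma averaged_chart : exists E : 'rV[R]_(r + k) -> 'rV[R]_(r + k),
  [/\ smooth_at (eu (r + k)) (eu (r + k)) E 0, jacobian E 0 \in unitmx,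
    forall b, rsubmx (E b) = rsubmx b, E 0 = 0 &
    forall a b, K a -> U b -> U (bt (act a (bi b))) -> lsubmx (E b) = 0 -> E (bt (act a (bi b))) = E b].
Proof.
have sPhi : smooth_at (eu (r + k)) (eu r) Phi 0 by exact: smooth_at_on oU U0 PhiCk.
have sr := @smooth_at_rsub R r k 0.
pose E b := row_mx (Phi b) (rsubmx b).
have sE : smooth_at (eu (r + k)) (eu (r + k)) E 0 by exact: (smooth_at_row cE sPhi sr).
exists E; split=> //.
- rewrite (jacobian_row_mx (smooth_at_diff sPhi) (smooth_at_diff sr) (smooth_at_diff sE)).
  have rsE : (rsubmx : 'rV[R]_(r + k) -> 'rV[R]_k) = fun b => b *m col_mx 0 1%:M.
    by apply/funext => b; rewrite -{2}[b]hsubmxK mul_row_col mulmx0 add0r mulmx1.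
  have -> : jacobian (rsubmx : 'rV[R]_(r + k) -> 'rV[R]_k) 0 = col_mx 0 1%:M by rewrite rsE jacobian_mul.
  have uE : usubmx (jacobian Phi 0) = 1%:M.
    by rewrite -JPhi -{2}[jacobian Phi 0]vsubmxK mul_row_col mul1mx mul0mx addr0.
  by rewrite -[jacobian Phi 0]vsubmxK uE -block_mxEh lblock1_unit.
- by move=> b; rewrite row_mxKr.
- by rewrite /E Phi0 rsub0 row_mx0.
- move=> a b Ka Ub; have [_ ->] := HU Ka Ub => Ub'; rewrite row_mxKl => Pb.
  by rewrite /E row_mxKr Phi_equivariant // Pb mul0mx.
Qed.

End Averaging.

(** [tau s] is the point where [E] equals [(0, s)]. The last conclusion is what [box_exists] needs
    to build new box coordinates on [tau]. *)
Lemma fixed_section : exists tau : 'rV[R]_k -> M, [/\ smooth_at (eu k) AM tau 0, tau 0 = x,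
  \forall s \near (0 : 'rV[R]_k), isotropy act (tau s) = K &
  col_mx (P *m J c x) (jacobian (cto c \o tau) 0) \in unitmx].
Proof.
have rho0 := bx_rho bx; have bi0 : bi 0 = x by have [_] := bx_bt bx Nx; rewrite btx.
have [d1 d10 H1] := rsub_box_orbit hM Ae e1 Kmin xK rank_le Ac bx Nx btx.
have [d2 d20 H2] := fixed_isotropy hM Ae e1 xK rank_le Ac bx Nx btx.
have sbi0 : smooth_at (eu (r + k)) AM bi 0 by apply: (bx_sbi bx); rewrite normr0.
have cd : {for (0 : 'rV[R]_(r + k)), continuous (fun b => d x (bi b))}.
  have cx := @dist_continuous_r _ _ _ _ _ atA metA conA x (bi 0).
  exact: (continuous_comp (smooth_at_continuous sbi0) cx).
have nd (eps : R) : 0 < eps -> \forall b \near (0 : 'rV[R]_(r + k)), d x (bi b) < eps.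
  move=> eps0; apply: (@near_comp _ _ (fun b => d x (bi b)) (fun v => v < eps) _ cd).
  by rewrite bi0 (distxx atA metA conA); apply: open_nbhs_nbhs; split=> //; exact: open_lt.
have n0 : \forall b \near (0 : 'rV[R]_(r + k)), `|b| < rho.
  by apply: (near_norm_lt (f := id)); [exact: cvg_id|rewrite normr0].
have nU : nbhs (0 : 'rV[R]_(r + k)) (fun b => `|b| < rho /\ d x (bi b) < d1).
  by apply: filterI => //; exact: nd.
have [U [oU U0] UH] : exists2 U, open_nbhs (0 : 'rV[R]_(r + k)) U & U `<=` (fun b => `|b| < rho /\ d x (bi b) < d1).
  by move: nU; rewrite nbhsE.
have HN a b : K a -> U b -> N (act a (bi b)) /\ rsubmx (bt (act a (bi b))) = rsubmx b.
  move=> Ka /UH[br bd]; have [|_ Na ->] := H1 (bi b) a bd; first by rewrite dist_fixed.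
  by split=> //; have [_ ->] := bx_bi bx br.
have [E [sE uE Er E0 Eq]] : exists E : 'rV[R]_(r + k) -> 'rV[R]_(r + k),
    [/\ smooth_at (eu (r + k)) (eu (r + k)) E 0, jacobian E 0 \in unitmx,
    forall b, rsubmx (E b) = rsubmx b, E 0 = 0 &
    forall a b, K a -> U b -> U (bt (act a (bi b))) -> lsubmx (E b) = 0 -> E (bt (act a (bi b))) = E b].
  apply: (@averaged_chart U oU U0) => a b Ka Ub; last by have [] := HN a b Ka Ub.
  split; first by have [] := UH _ Ub.
  by rewrite -[LHS]hsubmxK; have [_ ->] := HN a b Ka Ub.
have [V [W [Gi [[oV V0 _] oW HV HW sG]]]] := inverse_function_at sE uE.
have [W0 G0] := HV 0 V0; rewrite E0 in W0 G0.
pose gam (s : 'rV[R]_k) := Gi (row_mx 0 s).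
have r0 : row_mx 0 0 = 0 :> 'rV[R]_(r + k) by exact: row_mx0.
have sis : smooth_at (eu k) (eu (r + k)) (fun s => row_mx 0 s) 0.
  by apply: (smooth_at_row cE); [exact: smooth_at_cst|exact: smooth_at_eid].
have sgam : smooth_at (eu k) (eu (r + k)) gam 0.
  by apply: (smooth_at_comp cE cE cE (eucl_chart _) sis); rewrite r0; exact: sG.
have gam0 : gam 0 = 0 by rewrite /gam r0.
pose tau s := bi (gam s).
have stau : smooth_at (eu k) AM tau 0.
  by apply: (smooth_at_comp cE cE cM (eucl_chart _) sgam); rewrite gam0.
have tau0 : tau 0 = x by rewrite /tau gam0.
have ngam : \forall s \near (0 : 'rV[R]_k), W (row_mx 0 s).
  by apply: (near_comp (smooth_at_continuous sis)); rewrite r0; exact: open_nbhs_nbhs.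
have cb : {for x, continuous bt} by exact: smooth_at_continuous (bx_sbt bx Nx).
have nUV : \forall y \near x, U (bt y) /\ V (bt y).
  by apply: (@near_comp _ _ bt (fun b => U b /\ V b) x cb); rewrite btx; apply: filterI; exact: open_nbhs_nbhs.
have [d3 d30 H3] := dist_nbhs atA metA hauA conA nUV.
have nall : \forall s \near (0 : 'rV[R]_k), [/\ W (row_mx 0 s), U (gam s), d x (tau s) < d3 & d x (tau s) < d2].
  have nb : \forall b \near (0 : 'rV[R]_(r + k)), [/\ U b, d x (bi b) < d3 & d x (bi b) < d2].
    have nU' : nbhs (0 : 'rV[R]_(r + k)) U by exact: open_nbhs_nbhs.
    by apply: filterS (filterI nU' (filterI (nd _ d30) (nd _ d20))) => b [? [? ?]].
  have ng : \forall s \near (0 : 'rV[R]_k), [/\ U (gam s), d x (tau s) < d3 & d x (tau s) < d2].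
    apply: (@near_comp _ _ gam (fun b => [/\ U b, d x (bi b) < d3 & d x (bi b) < d2]) _ (smooth_at_continuous sgam)).
    by rewrite gam0.
  by apply: filterS (filterI ngam ng) => s [? [? ? ?]].
exists tau; split=> //.
  apply: filterS nall => s [Ws Us t3 t2]; apply: H2 => // a Ka.
  have [Vg Eg] := HW _ Ws.
  have [Ub Vb] : U (bt (act a (tau s))) /\ V (bt (act a (tau s))) by apply: H3; rewrite dist_fixed.
  (* [E] does not distinguish [tau s] from its translates by [K] and is injective near 0, so these
     coincide; [fixed_isotropy] has already reduced the claim to this inclusion. *)
  have EE : E (bt (act a (tau s))) = E (gam s) by apply: Eq => //; rewrite Eg row_mxKl.
  have [_ G1] := HV _ Vb; have [_ G2] := HV _ Vg.
  have {}EE : bt (act a (tau s)) = gam s by rewrite -G1 EE G2.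
  have [Na _] := HN a _ Ka Us; have [_ B] := bx_bt bx Na.
  by rewrite /isotropy /= -{1}B EE.
have cx := bx_N bx Nx; have [oc _ Kc _ _] := cM Ac.
have iy : (cto c @` cdom c) (cto c x) by exists x.
have sci := smooth_at_cinv cM (gm_atlas hM) Ac iy.
have sB : smooth_at (eu (r + k)) (eu (r + k)) (bt \o cinv c) (cto c x).
  apply: (smooth_at_comp cE cM cE _ sci); first by exists c; rewrite ?Kc.
  by rewrite Kc //; exact: (bx_sbt bx Nx).
set JB := jacobian (bt \o cinv c) (cto c x).
have so := orbit_map_smooth0 hM Ae e1 Ac cx.
have o0 : omap c x 0 = cto c x by rewrite /orbit_map ge0 act_fun1.
have so' : smooth_at (eu m) (eu (r + k)) (omap c x) (0 *m P) by rewrite mul0mx.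
have sop := smooth_at_comp cE cE cE (eucl_chart _) (@smooth_at_mul R _ _ P 0) so'.
have dB1 : differentiable (bt \o cinv c) ((omap c x \o (fun v => v *m P)) 0).
  by rewrite /= mul0mx o0; exact: smooth_at_diff sB.
have ctau0 : cdom c (tau 0) by rewrite tau0.
have sct := smooth_at_chartM hM cE Ac ctau0 stau.
have dB2 : differentiable (bt \o cinv c) ((cto c \o tau) 0) by rewrite /= tau0; exact: smooth_at_diff sB.
have P1 : P *m J c x *m JB = row_mx 1%:M 0.
  have <- : jacobian (omap c x \o (fun v => v *m P)) 0 = P *m J c x.
    rewrite (jacobian_comp (smooth_at_diff (@smooth_at_mul R _ _ P 0)) (smooth_at_diff so')).
    by rewrite jacobian_mul mul0mx.
  have -> : JB = jacobian (bt \o cinv c) ((omap c x \o (fun v => v *m P)) 0) by rewrite /= mul0mx o0.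
  rewrite -(jacobian_comp (smooth_at_diff sop) dB1) -(jacobian_mul (row_mx 1%:M 0) (0 : 'rV[R]_r)).
  apply: jacobian_near_eq.
  - have nv : \forall v \near (0 : 'rV[R]_r), `|v| < rho.
      by apply: (near_norm_lt (f := id)); [exact: cvg_id|rewrite normr0].
    have sig0 : sigma 0 = x by rewrite -bi0 /box_inv lsub0 rsub0 mul0mx ge0 act_fun1.
    apply: filterS nv => v vr; have br : `|row_mx v (0 : 'rV[R]_k)| < rho by apply/norm_row_mxl => //; rewrite normr0.
    have [Nb Eb] := bx_bi bx br.
    rewrite box_inv_row sig0 in Nb Eb.
    by rewrite /orbit_map /= Kc; [rewrite Eb mul_mx_row mulmx1 mulmx0|exact: (bx_N bx Nb)].
  - exact: (differentiable_comp (smooth_at_diff sop) dB1).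
  - exact: smooth_at_diff (@smooth_at_mul R _ _ _ 0).
have P2 : jacobian (cto c \o tau) 0 *m JB = jacobian gam 0.
  have -> : JB = jacobian (bt \o cinv c) ((cto c \o tau) 0) by rewrite /= tau0.
  rewrite -(jacobian_comp (smooth_at_diff sct) dB2); apply: jacobian_near_eq.
  - apply: filterS nall => s [_ Us _ _]; have [br _] := UH _ Us; have [Nb Eb] := bx_bi bx br.
    by rewrite /= Kc; [exact: Eb|exact: (bx_N bx Nb)].
  - by apply: differentiable_comp => //; exact: smooth_at_diff sct.
  - exact: smooth_at_diff sgam.
have P3 : rsubmx (jacobian gam 0) = 1%:M.
  have srg : smooth_at (eu (r + k)) (eu k) rsubmx (gam 0) by exact: smooth_at_rsub.
  rewrite -(jacobian_id (0 : 'rV[R]_k)).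
  have <- : jacobian (rsubmx \o gam) 0 = jacobian id 0.
    apply: jacobian_near_eq.
    - by apply: filterS ngam => s Ws; have [_ Eg] := HW _ Ws; rewrite /= -Er Eg row_mxKr.
    - by apply: differentiable_comp; [exact: smooth_at_diff sgam|exact: smooth_at_diff srg].
    - exact: smooth_at_diff (smooth_at_eid _).
  rewrite (jacobian_comp (smooth_at_diff sgam) (smooth_at_diff srg)).
  have rsE : (rsubmx : 'rV[R]_(r + k) -> 'rV[R]_k) = fun b => b *m col_mx 0 1%:M.
    by apply/funext => b; rewrite -{2}[b]hsubmxK mul_row_col mulmx0 add0r mulmx1.
  rewrite rsE jacobian_mul -{2}[jacobian gam 0]hsubmxK mul_row_col mulmx0 add0r mulmx1 //.
(* In the old box coordinates the matrix is block triangular with identity diagonal blocks, [tau]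
   having last coordinates [s]. *)
have : col_mx (P *m J c x) (jacobian (cto c \o tau) 0) *m JB \in unitmx.
  by rewrite mul_col_mx P1 P2 -[jacobian gam 0]hsubmxK P3 -block_mxEv lblock1_unit.
by rewrite unitmx_mul => /andP[].
Qed.

End FixedSection.

(** * The orbit projection as a smooth fibre bundle *)

Section Bundle.
Context {R : realType} {r k m : nat} {M : topologicalType} {G : preTopologicalGroupType}
  {AM : set (chart R M (r + k)%N)} {g : gram R M (r + k)%N} {AG : set (chart R G m)} {act : group_action G M}.
Hypothesis hM : complete_riemannian_G_manifold AM g AG act.
Variable e : chart R G m.
Hypothesis Ae : AG e.
Hypothesis e1 : cdom e 1%g.
Local Notation cM := (charts_M hM).
Local Notation cG := (charts_G hM).
Local Notation cE := (@charts_eucl R _).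
Local Notation eu k := (@eucl R k%N).
Local Notation J := (@orbit_jac R (r + k)%N m M G act e).
Local Notation gexp := (gexp e).
Local Notation ge0 := (gexp0 hM Ae e1).
Local Notation d := (@riemannian_dist R M (r + k)%N AM g).
Local Notation proj := (orbit_proj act).
Local Notation atA := (gm_atlas hM).
Local Notation metA := (GM_metric hM).
Local Notation conA := (GM_connected hM).
Local Notation hauA := (gm_hausdorff hM).
Variable K : set G.
Hypothesis Kmin : forall z, isotropy act z `<=` K -> K `<=` isotropy act z.
Hypothesis rank_le : forall c y, AM c -> cdom c y -> (\rank (J c y) <= r)%N.
Local Notation reg := (orbits_of_type act K).
Local Notation A := (@quot_atlas R (r + k)%N k M G AM act reg).
Variables (z : M) (cz : chart R M (r + k)%N).
Hypothesis Acz : AM cz.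
Hypothesis czz : cdom cz z.
Hypothesis rkz : \rank (J cz z) = r.
Hypothesis zK : isotropy act z = K.

(** The typical fibre G/K is realized as the orbit of [z], with the topology induced by [M]. *)
Definition orbit_set : set M := [set y | proj y = proj z].
Local Notation F := (set_type orbit_set).

Definition orbit_point (a : G) : F := SigSub (mem_set (proj_act a z : orbit_set (act a z))).

Lemma orbit_pointE a : set_val (orbit_point a) = act a z. Proof. by []. Qed.

Lemma orbit_lift (f : F) : exists a, set_val f = act a z.
Proof. by have /esym/proj_eqP[a <-] : proj (set_val f) = proj z := set_valP f; exists a. Qed.

(** Coordinates are restrictions of smooth functions on [M], and inverses lift to smooth maps into
    [G]; the first makes maps into the orbit smooth, the second maps out of it. *)
Definition orbit_atlas : set (chart R F r) := [set q | [/\ is_chart q,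
  forall f, cdom q f -> exists2 h : M -> 'rV[R]_r, smooth_at AM (eu r) h (set_val f) &
    forall f', cto q f' = h (set_val f') &
  forall w, (cto q @` cdom q) w -> exists2 lam : 'rV[R]_r -> G, smooth_at (eu r) AG lam w &
    \forall w' \near w, set_val (cinv q w') = act (lam w') z]].
Local Notation AF := orbit_atlas.

Lemma charts_orbit : charts AF. Proof. by move=> q []. Qed.

Lemma orbit_transition q q' : AF q -> AF q' -> smooth_on (cto q @` (cdom q `&` cdom q')) (cto q' \o cinv q).
Proof.
move=> [iq _ Hq] [iq' Hq' _]; have [oq oi Kq _ _] := iq; have [oq' _ _ _ _] := iq'.
apply/smooth_euclP; apply: smooth_at_map.
  by apply: (chart_open_image iq); [exact: openI|move=> ? []].
move=> _ [f [qf q'f] <-].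
have [|lam sl Hl] := Hq (cto q f); first by exists f.
have El := nbhs_singleton Hl; rewrite /= Kq // in El.
have [h sh Eh] := Hq' f q'f.
have sa := smooth_at_act hM cE sl (@smooth_at_cst R _ _ _ _ (eu r) AM z (cto q f)).
rewrite El in sh.
have sc := smooth_at_comp cE cM cE (coverM hM _) sa sh.
apply: (smooth_at_eq cE cE _ sc).
by apply: filterS Hl => w' Ew; rewrite /= Eh Ew.
Qed.

(** A box at [z], translated by an element taking [z] to the given point; its first [r] coordinates
    serve as chart. *)
Lemma orbit_chart f : exists2 q, AF q & cdom q f.
Proof.
have [c [P [sigma [rho [N [bt [Ac bx Nz btz]]]]]]] := regular_box hM Ae e1 rank_le Acz czz rkz zK zK.
have [del del0 H] := rsub_box_orbit hM Ae e1 Kmin zK rank_le Ac bx Nz btz.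
have dz : d z z < del by rewrite (distxx atA metA conA).
have rho0 := bx_rho bx.
have sig0 : sigma 0 = z.
  by have [_] := bx_bt bx Nz; rewrite btz /box_inv lsub0 rsub0 mul0mx ge0 act_fun1.
have [a fa] := orbit_lift f.
pose N' := [set y | N y /\ d z y < del].
have nN' y : N' y -> \forall y' \near y, N' y'.
  move=> [Ny yd]; have n1 : nbhs y N by apply: open_nbhs_nbhs; split=> //; exact: bx_open bx.
  apply: filterI => //.
  apply: (@near_comp _ _ (d z) (fun v => v < del) _ (@dist_continuous_r _ _ _ _ _ atA metA conA z y)).
  by apply: open_nbhs_nbhs; split=> //; exact: open_lt.
have N'z : N' z by [].
pose pull (f : F) := act a^-1%g (set_val f).
have cpull f' : {for f', continuous pull}.
  apply: (@continuous_comp _ _ _ set_val (act a^-1%g) f'); first exact: set_val_continuous.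
  exact: (act_continuous hM).
(* Within the box the orbit of [z] is the part with last coordinates 0, since these are constant on
   orbits near [z]. *)
have N'E f' : N' (pull f') -> [/\ `|row_mx (lsubmx (bt (pull f'))) (0 : 'rV[R]_k)| < rho,
    bt (pull f') = row_mx (lsubmx (bt (pull f'))) 0 &
    act (gexp (lsubmx (bt (pull f')) *m P)) z = pull f'].
  move=> [Ny yd]; have [b fb] := orbit_lift f'.
  have Eb : act (a^-1 * b)%g z = pull f' by rewrite /pull fb act_funM.
  have [|_ _ rb] := H z (a^-1 * b)%g dz; first by rewrite Eb.
  rewrite Eb btz rsub0 in rb.
  have E : bt (pull f') = row_mx (lsubmx (bt (pull f'))) 0 by rewrite -{1}[LHS]hsubmxK rb.
  have [br Ebi] := bx_bt bx Ny; rewrite E box_inv_row sig0 in Ebi.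
  by rewrite -E; split.
pose q : chart R F r := Chart [set f' | N' (pull f')] (fun f' => lsubmx (bt (pull f')))
  (fun v => orbit_point (a * gexp (v *m P))%g).
have sgP v : `|row_mx v (0 : 'rV[R]_k)| < rho -> smooth_at (eu r) AG (fun v => a * gexp (v *m P))%g v.
  move=> vr; apply: (smooth_at_mulg hM cE); first exact: smooth_at_cst.
  apply: (smooth_at_gexp hM cE); last exact: smooth_at_mul.
  by have := bx_gexp bx vr; rewrite row_mxKl.
have Kq f' : cdom q f' -> cinv q (cto q f') = f'.
  move=> /N'E[_ _ E]; apply: val_inj.
  rewrite [LHS](_ : _ = act (a * gexp (lsubmx (bt (pull f')) *m P))%g z) //.
  by rewrite act_funM E /pull -act_funM mulgV act_fun1.
have szv v : `|row_mx v (0 : 'rV[R]_k)| < rho -> smooth_at (eu r) AM (fun v => act (a * gexp (v *m P))%g z) v.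
  by move=> vr; apply: (smooth_at_act hM cE (sgP v vr)); exact: smooth_at_cst.
have lE f' : cdom q f' -> smooth_at AM (eu r) (fun y => lsubmx (bt (act a^-1%g y))) (set_val f').
  move=> [Ny _].
  have sa : smooth_at AM AM (fun y => act a^-1%g y) (set_val f').
    by apply: (smooth_at_act hM cM); [exact: smooth_at_cst|exact: (smooth_at_id (gm_atlas hM) I)].
  have sab := smooth_at_comp cM cM cE (coverM hM _) sa (bx_sbt bx Ny).
  exact: (smooth_at_comp cM cE cE (eucl_chart _) sab (@smooth_at_lsub R r k _)).
exists q; last by rewrite /q /= /pull fa -act_funM mulVg act_fun1.
split.
- split; [| |exact: Kq| |].
  + rewrite openE => f' /= N'f; have nN := nN' _ N'f.
    exact: (near_comp (cpull f') nN).
  + rewrite openE => _ [f' /= N'f <-]; have [vr E Ez] := N'E f' N'f.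
    have cv := smooth_at_continuous (szv _ vr).
    have crow : {for lsubmx (bt (pull f')), continuous (fun v => row_mx v (0 : 'rV[R]_k))}.
      apply: (@smooth_at_continuous _ _ _ _ _ (eu r) (eu (r + k))).
      by apply: (smooth_at_row cE); [exact: smooth_at_eid|exact: smooth_at_cst].
    have n1 := near_norm_lt crow vr.
    have ac : continuous (act a^-1%g) by move=> y; exact: (act_continuous hM).
    have cv' := continuous_comp cv (ac _).
    have n2 : \forall v \near lsubmx (bt (pull f')), N' (act a^-1%g (act (a * gexp (v *m P))%g z)).
      apply: (near_comp cv'); rewrite /= act_funM Ez -act_funM mulVg act_fun1; exact: nN'.
    apply: filterS (filterI n1 n2) => v [vr' N'v]; exists (orbit_point (a * gexp (v *m P))%g) => //.
    have [_ Ev] := bx_bi bx vr'; rewrite box_inv_row sig0 in Ev.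
    by rewrite /= /pull orbit_pointE -act_funM mulKg Ev row_mxKl.
  + move=> f' qf'; have ch := smooth_at_continuous (lE f' qf').
    exact: (continuous_comp (@set_val_continuous _ _ f') ch).
  + move=> f' /N'E[vr _ _]; apply: continuous_to_sub.
    exact: smooth_at_continuous (szv _ vr).
- by move=> f' qf'; exists (fun y => lsubmx (bt (act a^-1%g y))) => //; exact: lE.
- move=> _ [f' /N'E[vr _ _] <-]; exists (fun v => a * gexp (v *m P))%g; first exact: sgP.
  by near=> v.
Unshelve. all: by end_near. Qed.

Lemma orbit_manifold : manifold_on [set: F] AF.
Proof.
split.
- apply: hausdorff_sub => f f' _ _ ff'.
  have ne : set_val f <> set_val f' by move=> /val_inj.
  have [U [V [oU oV Uf Vf UV]]] := hausdorff_sep hauA ne.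
  exists (set_val @^-1` U), (set_val @^-1` V); split=> //.
  + by apply: open_comp oU => x _; exact: set_val_continuous.
  + by apply: open_comp oV => x _; exact: set_val_continuous.
  + by rewrite -preimage_setI UV preimage_set0.
- have [_ sc _] := GM_manifold hM.
  have sF : @second_countable F.
    apply: (second_countable_sub (f := (set_val : [set: M] -> M)) sc).
    + exact: set_val_continuous.
    + by move=> O; exact: set_val_open.
    + by move=> y _; exists (SigSub (mem_set (I : [set: M] y))).
  apply: (second_countable_sub (f := id) sF).
  + by move=> x; exact: cvg_id.
  + by move=> O oO; rewrite image_id.
  + by move=> f _; exists f.
- split; [exact: openT|exact: charts_orbit| |exact: orbit_transition].
  by apply/seteqP; split=> // f _; have [q] := orbit_chart f; exists q.
Qed.

Lemma smooth_to_orbit (phi : M -> F) W : open W -> (forall y, W y -> smooth_at AM AM (set_val \o phi) y) ->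
  smooth_map AM W AF phi.
Proof.
move=> oW H; have cphi y : W y -> {for y, continuous phi}.
  by move=> Wy; apply: continuous_to_sub; exact: smooth_at_continuous (H y Wy).
split=> // c q Ac [[oq _ _ _ _] Hq _]; have [oc _ Kc _ _] := cM Ac.
apply/smooth_euclP; apply: smooth_at_map.
  apply: (chart_open_image (cM Ac)); last by move=> ? [[]].
  rewrite -setIA; apply: openI => //; apply: open_preimage_on => //.
move=> _ [y [[cy Wy] qy] <-]; have [h sh Eh] := Hq _ qy.
have iy : (cto c @` cdom c) (cto c y) by exists y.
have sci := smooth_at_cinv cM (gm_atlas hM) Ac iy.
have sp : smooth_at AM AM (set_val \o phi) (cinv c (cto c y)) by rewrite Kc //; exact: H.
have sh' : smooth_at AM (eu r) h ((set_val \o phi) (cinv c (cto c y))) by rewrite Kc.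
have s1 := smooth_at_comp cE cM cM (coverM hM _) sci sp.
have s2 := smooth_at_comp cE cM cE (coverM hM _) s1 sh'.
apply: (smooth_at_eq cE cE _ s2).
by near=> w; rewrite /= Eh.
Unshelve. all: by end_near. Qed.

(** The trivialization matches [act a (tau s)] with the pair of the orbit of coordinate [s] and the
    point [act a z]. *)
Lemma local_triviality p : reg p -> exists (U : set (orbit_space act)) (phi : M -> F) (psi : orbit_space act * F -> M),
  [/\ [/\ open U, U p & U `<=` reg],
      smooth_map AM (proj @^-1` U) AF phi,
      smooth_map (prod_atlas A AF) (U `*` [set: F]) AM psi,
      forall x, U (proj x) -> psi (proj x, phi x) = x &
      forall u y, U u -> proj (psi (u, y)) = u /\ phi (psi (u, y)) = y].
Proof.
move=> /regular_representative[x <- xK].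
have [c [P [sigma [rho0 [N0 [bt0 [Ac bx0 N0x bt0x]]]]]]] := regular_box hM Ae e1 rank_le Acz czz rkz zK xK.
have cx := bx_N bx0 N0x.
have [tau [stau tau0 ntau utau]] := fixed_section hM Ae e1 Kmin rank_le xK Ac bx0 N0x bt0x.
have [rho [N [bt [bx Nx btx]]]] := box_exists hM Ae e1 Ac cx stau tau0 utau.
have rho0' := bx_rho bx.
move: ntau => /nbhs_ballP[eps0 /= eps00 Heps].
have {}Heps s : `|s| < eps0 -> isotropy act (tau s) = K.
  by move=> sr; apply: Heps; rewrite -ball_normE /= sub0r normrN.
pose eps := Num.min eps0 rho.
have eps_gt0 : 0 < eps by rewrite lt_min eps00.
have [q [Aq qx _ qeps qinv]] := box_quot_chart hM Ae e1 Kmin rank_le xK Ac bx Nx btx eps_gt0.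
have [iq qreg Hqs Hql] := Aq; have [oq oiq Kq ctq ciq] := iq.
have tauK s : `|s| < eps -> isotropy act (tau s) = K.
  by move=> se; apply: Heps; exact: lt_le_trans se (minl_le _ _).
have taus s : `|s| < eps -> smooth_at (eu k) AM tau s.
  by move=> se; apply: (bx_sig bx); exact: lt_le_trans se (minr_le _ _).
have ptau u : cdom q u -> proj (tau (cto q u)) = u by move=> /Kq; rewrite qinv.
pose liftF (f : F) : G := xget 1%g [set a | set_val f = act a z].
have liftE f : set_val f = act (liftF f) z.
  by rewrite /liftF; case: xgetP => [a _ //|/(_ _)]; have [a fa] := orbit_lift f; move=> /(_ a).
pose liftM y : G := xget 1%g [set a | act a (tau (cto q (proj y))) = y].
have liftME y : cdom q (proj y) -> act (liftM y) (tau (cto q (proj y))) = y.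
  move=> qy; rewrite /liftM; case: xgetP => [a _ //|].
  by have /proj_eqP[a ay] := ptau _ qy; move=> /(_ a).
(* All [tau s] and [z] have isotropy group [K], so two group elements agree on one of these points
   iff they agree on the other. Hence [phi] and [psi] do not depend on the choices made by
   [xget]. *)
have same s a b : `|s| < eps -> act a (tau s) = act b (tau s) <-> act a z = act b z.
  move=> se; have iE w : isotropy act w = K -> (act a w = act b w <-> K (b^-1 * a)%g).
    move=> wK; rewrite -wK /isotropy /= act_funM; split=> [->|h].
      by rewrite -act_funM mulVg act_fun1.
    by rewrite -{2}h -act_funM mulgV act_fun1.
  by rewrite (iE _ (tauK s se)) (iE _ zK).
pose phi y : F := orbit_point (liftM y).
pose psi (uf : orbit_space act * F) : M := act (liftF uf.2) (tau (cto q uf.1)).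
have phiE y a : cdom q (proj y) -> act a (tau (cto q (proj y))) = y -> set_val (phi y) = act a z.
  move=> qy ay; rewrite orbit_pointE; apply/(same _ _ _ (qeps _ qy)).
  by rewrite liftME // ay.
have psiE u f a : cdom q u -> set_val f = act a z -> psi (u, f) = act a (tau (cto q u)).
  by move=> qu fa; apply/(same _ _ _ (qeps _ qu)); rewrite -fa liftE.
have atA' := regular_manifold hM Ae e1 Kmin rank_le Acz czz rkz zK.
have [_ _ atQ] := atA'; have [_ _ atF] := orbit_manifold.
have oU : open (proj @^-1` cdom q) by apply: open_comp oq => y _; exact: proj_continuous.
exists (cdom q), phi, psi; split=> //.
- apply: smooth_to_orbit => // y qy.
  pose a := liftM y; pose s0 := cto q (proj y).
  have ay : act a (tau s0) = y := liftME y qy.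
  have se := qeps _ qy.
  have br : `|row_mx (0 : 'rV[R]_r) s0| < rho.
    by apply/norm_row_mxl => //; rewrite normr0; split=> //; exact: lt_le_trans se (minr_le _ _).
  have [Nt bt0'] := bx_bi bx br; rewrite box_inv_row mul0mx ge0 act_fun1 in Nt bt0'.
  have aVy : act a^-1%g y = tau s0 by rewrite -ay -act_funM mulVg act_fun1.
  have sa : smooth_at AM AM (fun y => act a^-1%g y) y.
    by apply: (smooth_at_act hM cM); [exact: smooth_at_cst|exact: (smooth_at_id (gm_atlas hM) I)].
  have sb : smooth_at AM (eu (r + k)) bt (act a^-1%g y) by rewrite aVy; exact: (bx_sbt bx Nt).
  have sab := smooth_at_comp cM cM cE (coverM hM _) sa sb.
  have sl := smooth_at_comp cM cE cE (eucl_chart _) sab (@smooth_at_lsub R r k _).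
  have slP := smooth_at_comp cM cE cE (eucl_chart _) sl (@smooth_at_mul R _ _ P _).
  have sr := smooth_at_comp cM cE cE (eucl_chart _) sab (@smooth_at_rsub R r k _).
  have l0 : lsubmx (bt (act a^-1%g y)) *m P = 0 by rewrite aVy bt0' row_mxKl mul0mx.
  have sg : smooth_at AM AG (fun y' => gexp (lsubmx (bt (act a^-1%g y')) *m P)) y.
    apply: (smooth_at_gexp hM cM _ slP); rewrite [X in smooth_at _ _ _ X](_ : _ = 0) //.
    exact: (gexp_smooth0 hM Ae e1).
  (* The chosen lift [liftM] need not be continuous. Near [y] it is replaced by the smooth lift
     [a * gexp (v *m P)], with [v] the first box coordinates of the point pulled back by [a]; it
     gives the same [phi]. *)
  have sphi : smooth_at AM AM (fun y' => act (a * gexp (lsubmx (bt (act a^-1%g y')) *m P))%g z) y.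
    apply: (smooth_at_act hM cM); last exact: smooth_at_cst.
    by apply: (smooth_at_mulg hM cM _ sg); exact: smooth_at_cst.
  apply: (smooth_at_eq cM cM _ sphi).
  have n1 : \forall y' \near y, N (act a^-1%g y').
    apply: (near_comp (smooth_at_continuous sa)); rewrite aVy; apply: open_nbhs_nbhs.
    by split; [exact: bx_open bx|exact: Nt].
  have n2 : \forall y' \near y, (cto q @` cdom q) (rsubmx (bt (act a^-1%g y'))).
    apply: (near_comp (smooth_at_continuous sr)); rewrite /= aVy bt0' row_mxKr.
    by apply: open_nbhs_nbhs; split=> //; exists (proj y).
  have n3 : \forall y' \near y, cdom q (proj y').
    by apply: (near_comp (@proj_continuous M G act y)); exact: open_nbhs_nbhs.
  apply: filterS (filterI n1 (filterI n2 n3)) => y' [Ny' [[u qu Eu] qy']].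
  have [_ E] := bx_bt bx Ny'; rewrite /box_inv -Eu in E.
  have Epu : proj y' = u.
    by rewrite -[LHS](proj_act a^-1%g) -E proj_act ptau.
  apply/esym; apply: phiE => //.
  by rewrite act_funM Epu E -act_funM mulgV act_fun1.
- apply: smooth_at_map; first by apply: openX => //; exact: openT.
  move=> [u f] [/= qu _]; have [qF AFq qFf] := orbit_chart f.
  have [iF _ HlF] := AFq; have [oF _ KF ctF _] := iF.
  have [|lam slam Elam] := HlF (cto qF f); first by exists f.
  have Su : reg u by exact: qreg.
  have cP := charts_prod (@charts_quot R (r + k) k M G AM act reg) charts_orbit.
  have s1 := smooth_at_fst atQ atF (p := (u, f)) Su I.
  have s2 := smooth_at_snd atQ atF (p := (u, f)) Su I.
  have cov1 : exists2 c, A c & cdom c ((u, f) : orbit_space act * F).1 by exists q.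
  have cov2 : exists2 c, AF c & cdom c ((u, f) : orbit_space act * F).2 by exists qF.
  have t1 := smooth_at_comp cP (@charts_quot R (r + k) k M G AM act reg) cE cov1 s1
    (smooth_at_cto (@charts_quot R (r + k) k M G AM act reg) atQ Aq qu).
  have t2 := smooth_at_comp cP charts_orbit cE cov2 s2 (smooth_at_cto charts_orbit atF AFq qFf).
  have u1 := smooth_at_comp cP cE cM (eucl_chart _) t1 (taus _ (qeps _ qu)).
  have u2 := smooth_at_comp cP cE cG (eucl_chart _) t2 slam.
  apply: (smooth_at_eq cP cM _ (smooth_at_act hM cP u2 u1)).
  have n1 : \forall uf \near (u, f), cdom q uf.1.
    by apply: (@near_comp _ _ fst (cdom q) (u, f) cvg_fst); exact: open_nbhs_nbhs.
  have n2 : \forall uf \near (u, f), cdom qF uf.2 /\ set_val (cinv qF (cto qF uf.2)) = act (lam (cto qF uf.2)) z.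
    apply: (@near_comp _ _ snd (fun f' => cdom qF f' /\ set_val (cinv qF (cto qF f')) = act (lam (cto qF f')) z) (u, f) cvg_snd).
    apply: filterI; first exact: open_nbhs_nbhs.
    exact: (@near_comp _ _ (cto qF) (fun w => set_val (cinv qF w) = act (lam w) z) f (ctF f qFf) Elam).
  apply: filterS (filterI n1 n2) => -[u' f'] /= [qu' [qf' Ef']].
  by apply/esym; apply: psiE => //; rewrite -Ef' KF.
- move=> y qy; rewrite (psiE _ _ (liftM y) qy) //; exact: liftME.
- move=> u f qu; have E : proj (psi (u, f)) = u by rewrite /psi proj_act ptau.
  split=> //; apply: val_inj.
  rewrite [LHS](phiE _ (liftF f)) ?E //; first by rewrite [RHS]liftE.
Qed.

Lemma regular_bundle : smooth_fiber_bundle AM A reg proj.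
Proof.
split.
  by apply: (smooth_proj hM); exact: (regular_open hM Ae e1 Kmin rank_le Acz czz rkz zK).
by exists r, (F : topologicalType), AF; split; [exact: orbit_manifold|exact: local_triviality].
Qed.

End Bundle.

(** * The maximal orbit rank, and the conclusion *)

Lemma max_orbit_rank {R : realType} {n m : nat} {M : topologicalType} {G : preTopologicalGroupType}
  {AM : set (chart R M n)} {g : gram R M n} {AG : set (chart R G m)} {act : group_action G M}
  (hM : complete_riemannian_G_manifold AM g AG act) (e : chart R G m) :
  exists r k, [/\ n = (r + k)%N,
    forall c y, AM c -> cdom c y -> (\rank (@orbit_jac R n m M G act e c y) <= r)%N &
    exists c y, [/\ AM c, cdom c y & \rank (@orbit_jac R n m M G act e c y) = r]].
Proof.
pose P j := `[< exists c y, [/\ AM c, cdom c y & \rank (@orbit_jac R n m M G act e c y) = j] >].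
have P0 : exists j, P j.
  have [y _] := GM_nonempty hM; have [c Ac cy] := coverM hM y.
  by exists (\rank (@orbit_jac R n m M G act e c y)); apply/asboolP; exists c, y.
have Pn j : P j -> (j <= n)%N by move=> /asboolP[c [y [_ _ <-]]]; exact: rank_leq_col.
have [r /asboolP[c [y [Ac cy rE]]] rmax] := ex_maxnP P0 Pn.
exists r, (n - r)%N; split; last by exists c, y.
  by rewrite subnKC // -rE rank_leq_col.
by move=> c' y' Ac' cy'; apply: rmax; apply/asboolP; exists c', y'.
Qed.

Lemma principal_orbits {R : realType} {r k m : nat} {M : topologicalType} {G : preTopologicalGroupType}
  {AM : set (chart R M (r + k)%N)} {g : gram R M (r + k)%N} {AG : set (chart R G m)} {act : group_action G M}
  (hM : complete_riemannian_G_manifold AM g AG act) (e : chart R G m) x c : AG e -> cdom e 1%g ->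
  (forall c y, AM c -> cdom c y -> (\rank (@orbit_jac R (r + k)%N m M G act e c y) <= r)%N) ->
  AM c -> cdom c x -> \rank (@orbit_jac R (r + k)%N m M G act e c x) = r ->
  exists K : set G, [/\ minimal_orbit_type act K,
    orbits_of_type act K = orbits_le act K,
    open (orbits_of_type act K), dense (orbits_of_type act K) &
    exists A : set (chart R (orbit_space act) k), manifold_on (orbits_of_type act K) A /\
      smooth_fiber_bundle AM A (orbits_of_type act K) (orbit_proj act)].
Proof.
move=> Ae e1 rank_le Ac cx rkx.
have [z zx zmin] := minimal_isotropy hM Ae e1 rank_le Ac cx rkx.
have [cz Acz czz] := coverM hM z.
(* The rank stays maximal at [z]: its isotropy group is smaller than that of [x], so the kernel of
   the infinitesimal action is not larger. *)
have rkz : \rank (@orbit_jac R (r + k)%N m M G act e cz z) = r.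
  apply/eqP; rewrite eqn_leq rank_le //=; apply: (leq_trans (eq_leq (esym rkx))).
  by apply: rank_le_ker => v; exact: (kernel_sub hM Ae e1 Ac cx Acz czz zx).
exists (isotropy act z); split.
- exact: minimal_typeP.
- exact: (regular_le zmin erefl).
- exact: (regular_open hM Ae e1 zmin rank_le Acz czz rkz erefl).
- exact: (regular_dense hM zmin erefl).
- exists (@quot_atlas R (r + k)%N k M G AM act (orbits_of_type act (isotropy act z))); split.
    exact: (regular_manifold hM Ae e1 zmin rank_le Acz czz rkz erefl).
  exact: (regular_bundle hM Ae e1 zmin rank_le Acz czz rkz erefl).
Qed.

Theorem proposition3p4 (R : realType) (n m : nat) (M : topologicalType)
    (G : preTopologicalGroupType) (AM : set (chart R M n)) (g : gram R M n)
    (AG : set (chart R G m)) (act : group_action G M)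
    (hM : complete_riemannian_G_manifold AM g AG act) :
  (forall H : set G, subgroup H -> closed H ->
     convex_subset (orbit_dist act AM g) (orbits_le act H)) /\
  (exists K : set G,
     [/\ minimal_orbit_type act K,
         forall K' : set G, minimal_orbit_type act K' -> conjugate K' K &
         let reg := orbits_of_type act K in
         [/\ convex_subset (orbit_dist act AM g) reg,
             open reg,
             dense reg &
             exists (k : nat) (A : set (chart R (orbit_space act) k)),
               manifold_on reg A /\
               smooth_fiber_bundle AM A reg (orbit_proj act)]]).
Proof.
split=> [H _ _|]; first exact: (convex_orbits_le hM).
have [e Ae e1] := coverG hM 1%g.
have [r [k [nE rank_le [c [x [Ac cx rkx]]]]]] := max_orbit_rank hM e.
(* Writing the dimension as [r + k] makes rows split by type into orbit and transverse
   coordinates. *)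
subst n.
have [K [Kmin regE oreg dreg [A [mA bA]]]] := principal_orbits hM Ae e1 rank_le Ac cx rkx.
exists K; split=> //.
  by move=> K' /(minimal_type_unique hM Kmin).
split=> //; first by rewrite regE; exact: (convex_orbits_le hM).
by exists k, A.
Qed.
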